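(* Let $0<r_1<r_2<1$, $D=\{(x,y)\in\mathbb{R}^2: r_1^2<x^2+y^2<r_2^2\}$, $\omega>0$, and define $\alpha(x,y)=\frac{(1+x^2+y^2)^2}{4}$, $\beta(x,y)=2\omega\frac{1-x^2-y^2}{1+x^2+y^2}$, and $J:\mathbb{R}^2\to\mathbb{R}^2$ the linear map with $J\mathbf{e}_x=\mathbf{e}_y$, $J\mathbf{e}_y=-\mathbf{e}_x$. Suppose $\mathbf{U}_0\in C^{1+\vartheta}(\overline{D})$ for some $\vartheta\in(0,1)$, $\nabla\cdot\mathbf{U}_0=0$ in $D$ and $\mathbf{U}_0\cdot\mathbf{n}=0$ on $\partial D$, where $\mathbf{n}$ is the outward unit normal. Let $T>0$. Then there exists a solution $(\mathbf{U},P)$ of \[\mathbf{U}_t+(\alpha\mathbf{U}\cdot\nabla)\mathbf{U}+\frac{|\mathbf{U}|^2}{2}\nabla\alpha+\beta J\mathbf{U}=-\nabla P,\qquad \nabla\cdot\mathbf{U}=0\quad\text{in } D\times[0,T],\] with $\mathbf{U}\cdot\mathbf{n}=0$ on $\partial D$ and $\mathbf{U}|_{t=0}=\mathbf{U}_0$, such that $\mathbf{U}$, $P$ and all their derivatives appearing in these equations belong to $C(\overline{D}\times[0,T])$. Such a solution is unique up to an arbitrary function of $t$ which may be added to $P$.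
   Context: $C^{1+\vartheta}(\overline{D})$ denotes functions whose first derivatives exist and are Hölder continuous with exponent $\vartheta$ on $\overline{D}$. $\mathbf{U}=(U,V)$ is vector-valued, $P$ scalar. *)

(* Defs.v *)
From Stdlib Require Import Reals Lra.
Open Scope R_scope.

Definition field2 := R -> R -> R.
Definition field3 := R -> R -> R -> R.

Definition inD (r1 r2 x y : R) : Prop := r1^2 < x^2 + y^2 < r2^2.
Definition inDbar (r1 r2 x y : R) : Prop := r1^2 <= x^2 + y^2 <= r2^2.
Definition onBdD (r1 r2 x y : R) : Prop := x^2 + y^2 = r1^2 \/ x^2 + y^2 = r2^2.

Definition normal_x (r1 r2 x y : R) : R := if Req_EM_T (x^2 + y^2) (r2^2) then x / r2 else - x / r1.
Definition normal_y (r1 r2 x y : R) : R := if Req_EM_T (x^2 + y^2) (r2^2) then y / r2 else - y / r1.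

Definition alpha (x y : R) : R := (1 + x^2 + y^2)^2 / 4.
(* components of grad alpha (computed: d/dx (1+x^2+y^2)^2/4 = x (1+x^2+y^2)) *)
Definition alpha_x (x y : R) : R := x * (1 + x^2 + y^2).
Definition alpha_y (x y : R) : R := y * (1 + x^2 + y^2).
Definition beta (omega x y : R) : R := 2 * omega * (1 - x^2 - y^2) / (1 + x^2 + y^2).
(* J e_x = e_y, J e_y = - e_x, hence J (U,V) = (-V, U). *)
Definition J_x (U V : R) : R := - V.
Definition J_y (U V : R) : R := U.

Definition cont_on2 (S : R -> R -> Prop) (f : field2) : Prop :=
  forall x y, S x y -> forall eps, 0 < eps -> exists delta, 0 < delta /\
    forall x' y', S x' y' -> Rabs (x' - x) < delta -> Rabs (y' - y) < delta ->
      Rabs (f x' y' - f x y) < eps.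

Definition cont_on3 (S : R -> R -> R -> Prop) (f : field3) : Prop :=
  forall x y t, S x y t -> forall eps, 0 < eps -> exists delta, 0 < delta /\
    forall x' y' t', S x' y' t' -> Rabs (x' - x) < delta -> Rabs (y' - y) < delta ->
      Rabs (t' - t) < delta -> Rabs (f x' y' t' - f x y t) < eps.

Definition holder_on2 (S : R -> R -> Prop) (th : R) (f : field2) : Prop :=
  exists C, forall x y x' y', S x y -> S x' y' ->
    Rabs (f x' y' - f x y) <= C * Rpower (sqrt ((x' - x)^2 + (y' - y)^2)) th.

Definition C1theta (r1 r2 th : R) (f : field2) : Prop :=
  cont_on2 (inDbar r1 r2) f /\
  exists fx fy : field2,
    holder_on2 (inDbar r1 r2) th fx /\ holder_on2 (inDbar r1 r2) th fy /\
    forall x y, inD r1 r2 x y ->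
      derivable_pt_lim (fun s => f s y) x (fx x y) /\
      derivable_pt_lim (fun s => f x s) y (fy x y).

Definition cylbar (r1 r2 T : R) (x y t : R) : Prop := inDbar r1 r2 x y /\ 0 <= t <= T.

(* Classical solution on D x [0,T]: U=(U,V), P and all derivatives occurring in the
   equations are continuous on closure(D) x [0,T] (derivatives taken in D x (0,T) /
   D x [0,T] and continuously extended). *)
Definition is_solution (r1 r2 omega T : R) (U0 V0 : field2) (U V P : field3) : Prop :=
  cont_on3 (cylbar r1 r2 T) U /\ cont_on3 (cylbar r1 r2 T) V /\ cont_on3 (cylbar r1 r2 T) P /\
  exists Ux Uy Ut Vx Vy Vt Px Py : field3,
    cont_on3 (cylbar r1 r2 T) Ux /\ cont_on3 (cylbar r1 r2 T) Uy /\ cont_on3 (cylbar r1 r2 T) Ut /\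
    cont_on3 (cylbar r1 r2 T) Vx /\ cont_on3 (cylbar r1 r2 T) Vy /\ cont_on3 (cylbar r1 r2 T) Vt /\
    cont_on3 (cylbar r1 r2 T) Px /\ cont_on3 (cylbar r1 r2 T) Py /\
    (forall x y t, inD r1 r2 x y -> 0 <= t <= T ->
       derivable_pt_lim (fun s => U s y t) x (Ux x y t) /\
       derivable_pt_lim (fun s => U x s t) y (Uy x y t) /\
       derivable_pt_lim (fun s => V s y t) x (Vx x y t) /\
       derivable_pt_lim (fun s => V x s t) y (Vy x y t) /\
       derivable_pt_lim (fun s => P s y t) x (Px x y t) /\
       derivable_pt_lim (fun s => P x s t) y (Py x y t)) /\
    (forall x y t, inD r1 r2 x y -> 0 < t < T ->
       derivable_pt_lim (fun s => U x y s) t (Ut x y t) /\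
       derivable_pt_lim (fun s => V x y s) t (Vt x y t)) /\
    (forall x y t, inD r1 r2 x y -> 0 <= t <= T ->
       let u := U x y t in let v := V x y t in
       Ut x y t + alpha x y * (u * Ux x y t + v * Uy x y t)
         + (u^2 + v^2) / 2 * alpha_x x y + beta omega x y * J_x u v = - Px x y t /\
       Vt x y t + alpha x y * (u * Vx x y t + v * Vy x y t)
         + (u^2 + v^2) / 2 * alpha_y x y + beta omega x y * J_y u v = - Py x y t /\
       Ux x y t + Vy x y t = 0) /\
    (forall x y t, onBdD r1 r2 x y -> 0 <= t <= T ->
       U x y t * normal_x r1 r2 x y + V x y t * normal_y r1 r2 x y = 0) /\
    (forall x y, inDbar r1 r2 x y -> U x y 0 = U0 x y /\ V x y 0 = V0 x y).

(* Main.v *)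
(** In the coordinates [x + i y = r1 exp (a + i b)] the annulus becomes the strip [0 <= a <= ln (r2 / r1)],
    periodic in [b].  For the covariant components [A = x U + y V], [B = x V - y U] and the Bernoulli
    function [Q = P + alpha |U|^2 / 2] the system reads [A_t = q B - Q_a], [B_t = - q A - Q_b],
    [A_a + B_b = 0], with [q = kappa (B_a - A_b) + beta] and [kappa = alpha / r^2], so that the potential
    vorticity [q] is transported by the flow [kappa (A, B)].

    The velocity is recovered from [q] and the circulation around the inner circle by a Poisson problem
    on the strip.  Maximum principle arguments for second differences in doubled variables bound the
    second derivatives of its solution by the Hoelder constant of the right-hand side, which yields
    solvability (by mollification) and, letting the exponent tend to zero, a bound that depends on the
    Hoelder constant only logarithmically.

    For existence, [q] is transported by small alternating shears in [a] and [b]; by the logarithmic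
    bound its Hoelder constant stays bounded on [[0, T]], and a subsequence converges to a weak solution.
    The Helmholtz decomposition of [q (B, - A)] defines [Q], and an energy identity for the defect of the
    time-integrated momentum equation shows that the defect vanishes.

    For uniqueness, the energy of the difference of two solutions satisfies a Gronwall inequality. *)

Require Import Defs.
From Stdlib Require Import Reals ZArith Lra Lia ClassicalEpsilon Cantor.
From Coquelicot Require Import Coquelicot.
Open Scope R_scope.

(** The Schauder bound controls second derivatives only in the sup norm, by a multiple of [H / th]
    with [H] the Hoelder constant in [b] alone. The logarithm comes from the explicit [1 / th]: by
    interpolation with the sup norm, exponent [th * t] has a constant of order [H] to the power [t].
    The choice [t = 1 / (1 + ln (1 + H))] keeps that power bounded and costs the factor
    [1 + ln (1 + H)].

    Shears replace the flow of an ODE because their inverses come from the intermediate value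
    theorem and their changes of variables are one-dimensional. One shear alone compresses the
    measure; in the pair the compressions cancel to first order since [A_a + B_b = 0]. With velocity
    gradients below [C * (1 + ln (1 + H))], each step multiplies [1 + ln (1 + H)] by at most
    [1 + 4 * eps * C], so no blow-up occurs on any bounded time interval.

    The limit is only known to satisfy the vorticity equation against [C^1] test functions in space.
    Taking the stream function of the defect itself, frozen at one time, as the test function turns
    this weak information into the energy of the defect. *)

Ltac rdiag := rewrite Rminus_diag, Rabs_R0; auto.
Ltac rmin_bounds x y := pose proof (Rmin_l x y); pose proof (Rmin_r x y).

(** * Sequential compactness and extrema *)

Definition incr (s : nat -> nat) : Prop := forall n, (s n < s (S n))%nat.

Lemma incr_ge (s : nat -> nat) : incr s -> forall n, (n <= s n)%nat.
Proof. intros H n; induction n as [|n IH]; [lia|]. specialize (H n); lia. Qed.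

Lemma incr_lt (s : nat -> nat) : incr s -> forall n m, (n < m)%nat -> (s n < s m)%nat.
Proof. intros H n m L; induction L as [|m L IH]; [apply H|]. specialize (H m); lia. Qed.

Lemma incr_comp (s t : nat -> nat) : incr s -> incr t -> incr (fun n => s (t n)).
Proof. intros Hs Ht n; apply incr_lt; auto. Qed.

Lemma cv_sub (u : nat -> R) (l : R) (s : nat -> nat) : incr s -> Un_cv u l -> Un_cv (fun n => u (s n)) l.
Proof.
  intros Hs Hu eps He; destruct (Hu eps He) as [N HN]; exists N; intros n Hn.
  apply HN; pose proof (incr_ge s Hs n); lia.
Qed.

Lemma inv_small (eps : R) : 0 < eps -> exists N, forall n, (N <= n)%nat -> / (INR n + 1) < eps.
Proof.
  intros He; destruct (archimed_cor1 eps He) as [N [HN HN']]; exists N; intros n Hn.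
  apply le_INR in Hn; apply lt_INR in HN'; simpl in HN'.
  apply Rle_lt_trans with (/ INR N); [|lra]. apply Rinv_le_contravar; lra.
Qed.

Lemma bolzano_weierstrass (u : nat -> R) (M : R) : (forall n, Rabs (u n) <= M) ->
  exists l s, incr s /\ Un_cv (fun n => u (s n)) l.
Proof.
  intros HM.
  destruct (Bolzano_Weierstrass u (fun c => - M <= c <= M)) as [l Hl].
  { apply compact_P3. }
  { intros n; specialize (HM n); apply Rabs_le_between in HM; lra. }
  assert (Hc : forall N k : nat, exists p, (N <= p)%nat /\ Rabs (u p - l) < / (INR k + 1)).
  { intros N k. assert (Hk : 0 < / (INR k + 1)) by (apply Rinv_0_lt_compat; pose proof (pos_INR k); lra).
    destruct (Hl (fun y => Rabs (y - l) < / (INR k + 1)) N) as [p [Hp Hp']].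
    { exists (mkposreal _ Hk); intros y Hy; exact Hy. }
    exists p; split; auto. }
  set (c := fun N k => proj1_sig (constructive_indefinite_description _ (Hc N k))).
  assert (Hcs : forall N k, (N <= c N k)%nat /\ Rabs (u (c N k) - l) < / (INR k + 1)).
  { intros N k; unfold c; destruct (constructive_indefinite_description _ (Hc N k)); auto. }
  set (s := fix s n := match n with O => c O O | S n' => c (S (s n')) (S n') end).
  exists l, s; split.
  - intros n; simpl; destruct (Hcs (S (s n)) (S n)) as [H _]; lia.
  - intros eps He; destruct (inv_small eps He) as [N HN]; exists N; intros n Hn; unfold Rdist.
    apply Rlt_trans with (/ (INR n + 1)); [|apply HN; lia].
    destruct n; apply Hcs.
Qed.

(** Three variables cover all uses; planar problems take the last interval to be the single point
    [0]. *)
Definition closed3 (S : R -> R -> R -> Prop) : Prop :=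
  forall x y z, (forall eps, 0 < eps -> exists x' y' z', S x' y' z' /\
     Rabs (x' - x) < eps /\ Rabs (y' - y) < eps /\ Rabs (z' - z) < eps) -> S x y z.

Definition bounded3 (S : R -> R -> R -> Prop) : Prop :=
  exists M, forall x y z, S x y z -> Rabs x <= M /\ Rabs y <= M /\ Rabs z <= M.

Lemma compact3 (S : R -> R -> R -> Prop) (X Y Z : nat -> R) : closed3 S -> bounded3 S ->
  (forall n, S (X n) (Y n) (Z n)) -> exists x y z s, incr s /\ S x y z /\
    Un_cv (fun n => X (s n)) x /\ Un_cv (fun n => Y (s n)) y /\ Un_cv (fun n => Z (s n)) z.
Proof.
  intros Hc [M HM] HS.
  destruct (bolzano_weierstrass X M) as [x [s1 [I1 C1]]]; [intros n; apply (HM _ _ _ (HS n))|].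
  destruct (bolzano_weierstrass (fun n => Y (s1 n)) M) as [y [s2 [I2 C2]]]; [intros n; apply (HM _ _ _ (HS (s1 n)))|].
  destruct (bolzano_weierstrass (fun n => Z (s1 (s2 n))) M) as [z [s3 [I3 C3]]];
    [intros n; apply (HM _ _ _ (HS (s1 (s2 n))))|].
  assert (CX : Un_cv (fun n => X (s1 (s2 (s3 n)))) x).
  { apply (cv_sub (fun n => X (s1 n)) x (fun n => s2 (s3 n))); auto; apply incr_comp; auto. }
  assert (CY : Un_cv (fun n => Y (s1 (s2 (s3 n)))) y).
  { apply (cv_sub (fun n => Y (s1 (s2 n))) y s3); auto. }
  exists x, y, z, (fun n => s1 (s2 (s3 n))); repeat split; auto.
  { apply (incr_comp s1 (fun n => s2 (s3 n))); auto; apply incr_comp; auto. }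
  apply Hc; intros eps He.
  destruct (CX eps He) as [n1 H1]; destruct (CY eps He) as [n2 H2]; destruct (C3 eps He) as [n3 H3].
  set (n := (n1 + n2 + n3)%nat).
  exists (X (s1 (s2 (s3 n)))), (Y (s1 (s2 (s3 n)))), (Z (s1 (s2 (s3 n)))).
  split; [apply HS|]. split; [apply H1; unfold n; lia|]. split; [apply H2; unfold n; lia|apply H3; unfold n; lia].
Qed.

Lemma max_attained3 (S : R -> R -> R -> Prop) (g : field3) : closed3 S -> bounded3 S -> cont_on3 S g ->
  (exists x y z, S x y z) ->
  exists x y z, S x y z /\ forall x' y' z', S x' y' z' -> g x' y' z' <= g x y z.
Proof.
  intros Hc Hb Hg [x0 [y0 [z0 H0]]].
  (* [atan] is bounded and strictly increasing, so a supremum exists before [g] is known to be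
     bounded above, and maximising [atan g] maximises [g]. *)
  set (E := fun v => exists x y z, S x y z /\ v = atan (g x y z)).
  destruct (completeness E) as [M [HM1 HM2]].
  { exists (PI / 2); intros v [x [y [z [_ ->]]]]; pose proof (atan_bound (g x y z)); lra. }
  { exists (atan (g x0 y0 z0)); exists x0, y0, z0; auto. }
  assert (Hs : forall n : nat, exists p : R * R * R, S (fst (fst p)) (snd (fst p)) (snd p) /\
            M - / (INR n + 1) < atan (g (fst (fst p)) (snd (fst p)) (snd p))).
  { intros n. apply NNPP; intros Hn.
    assert (Hk : 0 < / (INR n + 1)) by (apply Rinv_0_lt_compat; pose proof (pos_INR n); lra).
    assert (HU : is_upper_bound E (M - / (INR n + 1))).
    { intros v [x [y [z [Hp ->]]]]. apply Rnot_lt_le; intros Hlt; apply Hn; exists (x, y, z); auto. }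
    specialize (HM2 _ HU); lra. }
  set (p := fun n => proj1_sig (constructive_indefinite_description _ (Hs n))).
  assert (Hp : forall n, S (fst (fst (p n))) (snd (fst (p n))) (snd (p n)) /\
            M - / (INR n + 1) < atan (g (fst (fst (p n))) (snd (fst (p n))) (snd (p n)))).
  { intros n; unfold p; destruct (constructive_indefinite_description _ (Hs n)); auto. }
  destruct (compact3 S (fun n => fst (fst (p n))) (fun n => snd (fst (p n))) (fun n => snd (p n)) Hc Hb)
    as [x [y [z [s [Is [HS [CX [CY CZ]]]]]]]]; [intros n; apply Hp|].
  exists x, y, z; split; auto.
  assert (HMx : M <= atan (g x y z)).
  { apply Rnot_lt_le; intros Hlt.
    assert (Hat : continuity_pt atan (g x y z)) by (apply derivable_continuous_pt, derivable_pt_atan).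
    set (e := (M - atan (g x y z)) / 2).
    assert (He : 0 < e) by (unfold e; lra).
    destruct (Hat e He) as [d1 [Hd1 Hd1']].
    destruct (Hg x y z HS d1 Hd1) as [d2 [Hd2 Hd2']].
    destruct (CX d2 Hd2) as [n1 H1]; destruct (CY d2 Hd2) as [n2 H2]; destruct (CZ d2 Hd2) as [n3 H3].
    destruct (inv_small e He) as [n4 H4].
    set (n := (n1 + n2 + n3 + n4)%nat).
    destruct (Hp (s n)) as [Hpn Hpn'].
    assert (Hc1 := Hd2' _ _ _ Hpn (H1 n ltac:(unfold n; lia)) (H2 n ltac:(unfold n; lia)) (H3 n ltac:(unfold n; lia))).
    assert (Hc2 : Rabs (atan (g (fst (fst (p (s n)))) (snd (fst (p (s n)))) (snd (p (s n)))) - atan (g x y z)) < e).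
    { destruct (Req_dec (g (fst (fst (p (s n)))) (snd (fst (p (s n)))) (snd (p (s n)))) (g x y z)) as [->|Hne].
      - rdiag.
      - apply Hd1'; split; [split; [exact I|auto]|exact Hc1]. }
    pose proof (H4 (s n) ltac:(pose proof (incr_ge s Is n); unfold n in *; lia)).
    apply Rabs_lt_between in Hc2. unfold e in *; lra. }
  intros x' y' z' H'. apply Rnot_lt_le; intros Hlt.
  apply atan_increasing in Hlt. assert (atan (g x' y' z') <= M) by (apply HM1; exists x', y', z'; auto). lra.
Qed.

(** * Mean value theorem, maxima, rules of differentiation *)

Lemma mean_value (f f' : R -> R) (a b : R) : a < b ->
  (forall x, a < x < b -> derivable_pt_lim f x (f' x)) -> (forall x, a <= x <= b -> continuity_pt f x) ->
  exists c, a < c < b /\ f b - f a = f' c * (b - a).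
Proof.
  intros Hab Hd Hc.
  destruct (MVT f id a b (fun c P => exist _ (f' c) (Hd c P)) (fun c _ => derivable_pt_id c) Hab Hc
     (fun c _ => derivable_continuous_pt _ _ (derivable_pt_id c))) as [c [P H]].
  exists c; split; auto. rewrite derive_pt_id in H.
  unfold derive_pt in H; simpl in H; unfold id in H. lra.
Qed.

Lemma derivable_lim_continuous (f : R -> R) (x l : R) : derivable_pt_lim f x l -> continuity_pt f x.
Proof. intros H; apply derivable_continuous_pt; exists l; exact H. Qed.

(** At the interior maximum [g1] vanishes; if [l] were positive, [g1] would be positive just to the
    right and [g] would increase there. This is the only form in which the maximum principle is
    used. *)
Lemma max_second_derivative (g g1 : R -> R) (x l r : R) : 0 < r ->
  (forall y, Rabs (y - x) < r -> g y <= g x /\ derivable_pt_lim g y (g1 y)) ->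
  derivable_pt_lim g1 x l -> l <= 0.
Proof.
  intros Hr H Hl. apply Rnot_lt_le; intros Hpos.
  assert (Hx : Rabs (x - x) < r) by (rdiag).
  assert (H0 : g1 x = 0).
  { destruct (H x Hx) as [_ D]. set (pr := exist (fun l => derivable_pt_abs g x l) (g1 x) D : derivable_pt g x).
    assert (E := deriv_maximum g (x - r / 2) (x + r / 2) x pr ltac:(lra) ltac:(lra)). apply E.
    intros y Hy1 Hy2; apply H; apply Rabs_lt_between; lra. }
  destruct (Hl (l / 2) ltac:(lra)) as [[d Hd] Hd']; simpl in Hd'.
  set (h := Rmin (d / 2) (r / 2)).
  assert (Hh : 0 < h /\ h < d /\ h < r).
  { unfold h; rmin_bounds (d / 2) (r / 2);
    repeat split; try lra; apply Rmin_pos; lra. }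
  destruct (mean_value g g1 x (x + h)) as [c [Hc Hc']]; try lra.
  { intros y Hy; apply H; apply Rabs_lt_between; lra. }
  { intros y Hy; apply (derivable_lim_continuous _ _ (g1 y)); apply H; apply Rabs_lt_between; lra. }
  specialize (Hd' (c - x) ltac:(lra) ltac:(apply Rabs_lt_between; lra)).
  replace (x + (c - x)) with c in Hd' by ring. rewrite H0 in Hd'. apply Rabs_lt_between in Hd'.
  assert (0 < g1 c).
  { replace (g1 c) with ((g1 c - 0) / (c - x) * (c - x)) by (field; lra). apply Rmult_lt_0_compat; lra. }
  destruct (H (x + h)) as [Hm _]; [apply Rabs_lt_between; lra|]. nra.
Qed.

Notation D := derivable_pt_lim.

Lemma D_plus (f g : R -> R) (x l m : R) : D f x l -> D g x m -> D (fun y => f y + g y) x (l + m).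
Proof. exact (derivable_pt_lim_plus f g x l m). Qed.

Lemma D_minus (f g : R -> R) (x l m : R) : D f x l -> D g x m -> D (fun y => f y - g y) x (l - m).
Proof. exact (derivable_pt_lim_minus f g x l m). Qed.

Lemma D_opp (f : R -> R) (x l : R) : D f x l -> D (fun y => - f y) x (- l).
Proof. exact (derivable_pt_lim_opp f x l). Qed.

Lemma D_mult (f g : R -> R) (x l m : R) : D f x l -> D g x m -> D (fun y => f y * g y) x (l * g x + f x * m).
Proof. exact (derivable_pt_lim_mult f g x l m). Qed.

Lemma D_scal (c : R) (f : R -> R) (x l : R) : D f x l -> D (fun y => c * f y) x (c * l).
Proof. exact (derivable_pt_lim_scal f c x l). Qed.

Lemma D_const (c x : R) : D (fun _ => c) x 0.
Proof. exact (derivable_pt_lim_const c x). Qed.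

Lemma D_id (x : R) : D (fun y => y) x 1.
Proof. exact (derivable_pt_lim_id x). Qed.

Lemma D_comp (f g : R -> R) (x l m : R) : D f x l -> D g (f x) m -> D (fun y => g (f y)) x (m * l).
Proof. exact (derivable_pt_lim_comp f g x l m). Qed.

Lemma D_eq (f : R -> R) (x l m : R) : l = m -> D f x l -> D f x m.
Proof. intros ->; auto. Qed.

Lemma D_ext (f g : R -> R) (x l : R) : (forall y, f y = g y) -> D f x l -> D g x l.
Proof.
  intros E H eps He; destruct (H eps He) as [d Hd]; exists d; intros; rewrite <- !E; auto.
Qed.

Lemma D_ext_loc (f g : R -> R) (x l r : R) : 0 < r -> (forall y, Rabs (y - x) < r -> f y = g y) -> D f x l -> D g x l.
Proof.
  intros Hr E H eps He; destruct (H eps He) as [d Hd].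
  assert (Hm : 0 < Rmin d r) by (apply Rmin_pos; auto; apply cond_pos).
  exists (mkposreal _ Hm); simpl; intros h H0 H1.
  rmin_bounds d r.
  rewrite <- !E; [apply Hd; auto; lra| |].
  - rdiag.
  - replace (x + h - x) with h by ring; lra.
Qed.

Lemma D_shift (f : R -> R) (c x l : R) : D f (x + c) l -> D (fun y => f (y + c)) x l.
Proof.
  intros H. apply D_eq with (l * (1 + 0)); [ring|]. apply (D_comp (fun y => y + c) f); auto.
  apply D_plus; [apply D_id|apply D_const].
Qed.

Lemma D_mirror (f : R -> R) (c x l : R) : D f (c - x) l -> D (fun y => f (c - y)) x (- l).
Proof.
  intros H. apply D_eq with (l * (0 - 1)); [ring|]. apply (D_comp (fun y => c - y) f); auto.
  apply D_minus; [apply D_const|apply D_id].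
Qed.

Lemma D_cont (f : R -> R) (x l : R) : D f x l -> continuity_pt f x.
Proof. apply derivable_lim_continuous. Qed.

Ltac dstep := match goal with
  | |- derivable_pt_lim (fun y => @?f y + @?g y) ?x _ => eapply (D_plus f g x)
  | |- derivable_pt_lim (fun y => @?f y - @?g y) ?x _ => eapply (D_minus f g x)
  | |- derivable_pt_lim (fun _ => ?c) ?x _ => apply (D_const c x)
  | |- derivable_pt_lim (fun y => y) ?x _ => apply (D_id x)
  | |- derivable_pt_lim (fun y => - @?f y) ?x _ => eapply (D_opp f x)
  | |- derivable_pt_lim (fun y => ?c * @?f y) ?x _ => eapply (D_scal c f x)
  | |- derivable_pt_lim (fun y => @?f y * @?g y) ?x _ => eapply (D_mult f g x)
  end.
Ltac dsplit := eapply D_eq; cycle 1; [repeat dstep | ].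
Lemma uniform_continuity3 (S : R -> R -> R -> Prop) (g : field3) :
  closed3 S -> bounded3 S -> cont_on3 S g -> forall eps, 0 < eps -> exists del, 0 < del /\
    forall x y z x' y' z', S x y z -> S x' y' z' ->
      Rabs (x' - x) < del -> Rabs (y' - y) < del -> Rabs (z' - z) < del ->
      Rabs (g x' y' z' - g x y z) < eps.
Proof.
  intros Hc Hb Hg eps He. apply NNPP; intros Hn.
  assert (Hs : forall n : nat, exists p : (R * R * R) * (R * R * R),
     S (fst (fst (fst p))) (snd (fst (fst p))) (snd (fst p)) /\
     S (fst (fst (snd p))) (snd (fst (snd p))) (snd (snd p)) /\
     Rabs (fst (fst (snd p)) - fst (fst (fst p))) < / (INR n + 1) /\
     Rabs (snd (fst (snd p)) - snd (fst (fst p))) < / (INR n + 1) /\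
     Rabs (snd (snd p) - snd (fst p)) < / (INR n + 1) /\
     eps <= Rabs (g (fst (fst (snd p))) (snd (fst (snd p))) (snd (snd p)) -
             g (fst (fst (fst p))) (snd (fst (fst p))) (snd (fst p)))).
  { intros n. apply NNPP; intros Hm. apply Hn. exists (/ (INR n + 1)); split.
    - apply Rinv_0_lt_compat; pose proof (pos_INR n); lra.
    - intros x y z x' y' z' H1 H2 H3 H4 H5. apply Rnot_le_lt; intros Hle. apply Hm.
      exists (((x, y), z), ((x', y'), z')); simpl; tauto. }
  set (p := fun n => proj1_sig (constructive_indefinite_description _ (Hs n))).
  assert (Hp : forall n, S (fst (fst (fst (p n)))) (snd (fst (fst (p n)))) (snd (fst (p n))) /\
     S (fst (fst (snd (p n)))) (snd (fst (snd (p n)))) (snd (snd (p n))) /\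
     Rabs (fst (fst (snd (p n))) - fst (fst (fst (p n)))) < / (INR n + 1) /\
     Rabs (snd (fst (snd (p n))) - snd (fst (fst (p n)))) < / (INR n + 1) /\
     Rabs (snd (snd (p n)) - snd (fst (p n))) < / (INR n + 1) /\
     eps <= Rabs (g (fst (fst (snd (p n)))) (snd (fst (snd (p n)))) (snd (snd (p n))) -
             g (fst (fst (fst (p n)))) (snd (fst (fst (p n)))) (snd (fst (p n))))).
  { intros n; unfold p; destruct (constructive_indefinite_description _ (Hs n)); auto. }
  destruct (compact3 S (fun n => fst (fst (fst (p n)))) (fun n => snd (fst (fst (p n)))) (fun n => snd (fst (p n))) Hc Hb)
    as [x [y [z [s [Is [HS [CX [CY CZ]]]]]]]]; [intros n; apply Hp|].
  destruct (Hg x y z HS (eps / 2) ltac:(lra)) as [d [Hd Hd']].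
  destruct (CX (d / 2) ltac:(lra)) as [n1 H1]; destruct (CY (d / 2) ltac:(lra)) as [n2 H2];
  destruct (CZ (d / 2) ltac:(lra)) as [n3 H3]; destruct (inv_small (d / 2) ltac:(lra)) as [n4 H4].
  set (n := (n1 + n2 + n3 + n4)%nat).
  specialize (H1 n ltac:(unfold n; lia)); specialize (H2 n ltac:(unfold n; lia)); specialize (H3 n ltac:(unfold n; lia)).
  specialize (H4 (s n) ltac:(pose proof (incr_ge s Is n); unfold n in *; lia)).
  unfold Rdist in *.
  destruct (Hp (s n)) as [Q1 [Q2 [Q3 [Q4 [Q5 Q6]]]]].
  assert (G1 := Hd' _ _ _ Q1 ltac:(lra) ltac:(lra) ltac:(lra)).
  assert (G2 : Rabs (g (fst (fst (snd (p (s n))))) (snd (fst (snd (p (s n))))) (snd (snd (p (s n)))) - g x y z) < eps / 2).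
  { apply Hd'; auto; apply Rabs_lt_between;
    apply Rabs_lt_between in H1, H2, H3, Q3, Q4, Q5; lra. }
  apply Rabs_lt_between in G1, G2.
  assert (Rabs (g (fst (fst (snd (p (s n))))) (snd (fst (snd (p (s n))))) (snd (snd (p (s n)))) -
             g (fst (fst (fst (p (s n))))) (snd (fst (fst (p (s n))))) (snd (fst (p (s n))))) < eps)
    by (apply Rabs_lt_between; lra). lra.
Qed.

(** * Uniformly continuous, clamped, periodic functions on the strip *)

Definition UC (f : field2) : Prop :=
  forall eps, 0 < eps -> exists del, 0 < del /\
    forall x y x' y', Rabs (x' - x) < del -> Rabs (y' - y) < del -> Rabs (f x' y' - f x y) < eps.

Definition UC1 (f : R -> R) : Prop :=
  forall eps, 0 < eps -> exists del, 0 < del /\ forall x x', Rabs (x' - x) < del -> Rabs (f x' - f x) < eps.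

Definition ctn (f : R -> R) : Prop := forall x, continuity_pt f x.

Definition clamp (L a : R) : R := Rmax 0 (Rmin L a).

(* Functions on the strip [0 <= a <= L] are extended to all [a] by clamping, so that continuity is
   unconditional and only derivatives in [a] are restricted to [0 < a < L]. *)
Definition CS (L : R) (f : field2) : Prop :=
  UC f /\ (forall a b, f (clamp L a) b = f a b) /\ (forall a b, f a (b + 2 * PI) = f a b).

Lemma clamp_range (L a : R) : 0 <= L -> 0 <= clamp L a <= L.
Proof. intros HL; unfold clamp, Rmax, Rmin; destruct (Rle_dec L a); destruct (Rle_dec _ _); lra. Qed.

Lemma clamp_id (L a : R) : 0 <= a <= L -> clamp L a = a.
Proof. intros HL; unfold clamp, Rmax, Rmin; destruct (Rle_dec L a); destruct (Rle_dec _ _); lra. Qed.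

Lemma clamp_lip (L a a' : R) : 0 <= L -> Rabs (clamp L a - clamp L a') <= Rabs (a - a').
Proof.
  intros HL; unfold clamp, Rmax, Rmin; repeat destruct (Rle_dec _ _); unfold Rabs; repeat destruct (Rcase_abs _); lra.
Qed.

Lemma clamp_clamp (L a : R) : 0 <= L -> clamp L (clamp L a) = clamp L a.
Proof. intros; apply clamp_id, clamp_range; auto. Qed.

Lemma continuity_pt_eps (f : R -> R) (x : R) :
  (forall eps, 0 < eps -> exists del, 0 < del /\ forall x', Rabs (x' - x) < del -> Rabs (f x' - f x) < eps) ->
  continuity_pt f x.
Proof.
  intros H eps He; destruct (H eps He) as [d [Hd Hd']]; exists d; split; auto.
  intros x' [_ Hx']; apply Hd'; exact Hx'.
Qed.

Lemma continuity_pt_eps_inv (f : R -> R) (x : R) : continuity_pt f x ->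
  (forall eps, 0 < eps -> exists del, 0 < del /\ forall x', Rabs (x' - x) < del -> Rabs (f x' - f x) < eps).
Proof.
  intros H eps He; destruct (H eps He) as [d [Hd Hd']]; exists d; split; auto.
  intros x' Hx'. destruct (Req_dec x' x) as [->|Hne]; [rdiag|].
  apply Hd'; split; auto; split; [exact I|auto].
Qed.

Lemma UC1_ctn (f : R -> R) : UC1 f -> ctn f.
Proof.
  intros H x; apply continuity_pt_eps; intros eps He; destruct (H eps He) as [d [Hd Hd']]; exists d; auto.
Qed.

Lemma UC_slice1 (f : field2) (b : R) : UC f -> UC1 (fun a => f a b).
Proof.
  intros H eps He; destruct (H eps He) as [d [Hd Hd']]; exists d; split; auto.
  intros; apply Hd'; auto; rdiag.
Qed.

Lemma UC_slice2 (f : field2) (a : R) : UC f -> UC1 (fun b => f a b).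
Proof.
  intros H eps He; destruct (H eps He) as [d [Hd Hd']]; exists d; split; auto.
  intros; apply Hd'; auto; rdiag.
Qed.

Lemma UC_ctn1 (f : field2) (b : R) : UC f -> ctn (fun a => f a b).
Proof. intros; apply UC1_ctn, UC_slice1; auto. Qed.

Lemma UC_ctn2 (f : field2) (a : R) : UC f -> ctn (fun b => f a b).
Proof. intros; apply UC1_ctn, (UC_slice2 f a); auto. Qed.

Lemma UC_plus (f g : field2) : UC f -> UC g -> UC (fun a b => f a b + g a b).
Proof.
  intros Hf Hg eps He.
  destruct (Hf (eps / 2) ltac:(lra)) as [d [Hd Hd']]; destruct (Hg (eps / 2) ltac:(lra)) as [e [He' He'']].
  exists (Rmin d e); split; [apply Rmin_pos; auto|]. intros x y x' y' H1 H2.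
  rmin_bounds d e.
  specialize (Hd' x y x' y' ltac:(lra) ltac:(lra)); specialize (He'' x y x' y' ltac:(lra) ltac:(lra)).
  apply Rabs_lt_between in Hd', He''; apply Rabs_lt_between; lra.
Qed.

Lemma UC_opp (f : field2) : UC f -> UC (fun a b => - f a b).
Proof.
  intros Hf eps He; destruct (Hf eps He) as [d [Hd Hd']]; exists d; split; auto.
  intros x y x' y' H1 H2; specialize (Hd' x y x' y' H1 H2).
  apply Rabs_lt_between in Hd'; apply Rabs_lt_between; lra.
Qed.

Lemma UC_const (c : R) : UC (fun _ _ => c).
Proof. intros eps He; exists 1; split; [lra|]; intros; rdiag. Qed.

Lemma UC_mult (f g : field2) (Mf Mg : R) : UC f -> UC g ->
  (forall a b, Rabs (f a b) <= Mf) -> (forall a b, Rabs (g a b) <= Mg) -> UC (fun a b => f a b * g a b).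
Proof.
  intros Hf Hg Bf Bg eps He.
  assert (0 <= Mf) by (apply Rle_trans with (2 := Bf 0 0), Rabs_pos).
  assert (0 <= Mg) by (apply Rle_trans with (2 := Bg 0 0), Rabs_pos).
  assert (Hk : 0 < eps / (2 * (Mf + Mg + 1))) by (apply Rdiv_lt_0_compat; lra).
  destruct (Hf _ Hk) as [d [Hd Hd']]; destruct (Hg _ Hk) as [e [He' He'']].
  exists (Rmin d e); split; [apply Rmin_pos; auto|]. intros x y x' y' H1 H2.
  rmin_bounds d e.
  specialize (Hd' x y x' y' ltac:(lra) ltac:(lra)); specialize (He'' x y x' y' ltac:(lra) ltac:(lra)).
  replace (f x' y' * g x' y' - f x y * g x y) with ((f x' y' - f x y) * g x' y' + f x y * (g x' y' - g x y)) by ring.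
  apply Rle_lt_trans with (1 := Rabs_triang _ _). rewrite !Rabs_mult.
  set (k := eps / (2 * (Mf + Mg + 1))) in *.
  assert (HE : eps = 2 * (Mf + Mg + 1) * k) by (unfold k; field; lra).
  specialize (Bf x y); specialize (Bg x' y').
  pose proof (Rabs_pos (f x' y' - f x y)). pose proof (Rabs_pos (g x' y' - g x y)).
  nra.
Qed.

Lemma UC_ext (f g : field2) : (forall a b, f a b = g a b) -> UC f -> UC g.
Proof.
  intros E Hf eps He; destruct (Hf eps He) as [d [Hd Hd']]; exists d; split; auto.
  intros; rewrite <- !E; auto.
Qed.

Lemma periodic_Z (f : R -> R) : (forall b, f (b + 2 * PI) = f b) -> forall (k : Z) b, f (b + 2 * PI * IZR k) = f b.
Proof.
  intros Hf.
  assert (Hn : forall (n : nat) b, f (b + 2 * PI * INR n) = f b).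
  { induction n as [|n IH]; intros b; [simpl; f_equal; ring|].
    rewrite S_INR. replace (b + 2 * PI * (INR n + 1)) with ((b + 2 * PI * INR n) + 2 * PI) by ring. rewrite Hf; apply IH. }
  intros k b. destruct (Z.le_gt_cases 0 k) as [H|H].
  - rewrite <- (Z2Nat.id k H), <- INR_IZR_INZ; apply Hn.
  - replace k with (- Z.of_nat (Z.to_nat (- k)))%Z by lia.
    rewrite opp_IZR, <- INR_IZR_INZ. rewrite <- (Hn (Z.to_nat (- k))). f_equal; ring.
Qed.

Lemma period_reduce (b : R) : exists k : Z, 0 <= b + 2 * PI * IZR k <= 2 * PI.
Proof.
  pose proof PI_RGT_0. exists (1 - up (b / (2 * PI)))%Z.
  destruct (archimed (b / (2 * PI))) as [H1 H2]. rewrite minus_IZR. set (u := IZR (up (b / (2 * PI)))) in *.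
  assert (E : b = (b / (2 * PI)) * (2 * PI)) by (field; lra).
  rewrite E; simpl; nra.
Qed.

Lemma closed3_box (x0 x1 y0 y1 z0 z1 : R) :
  closed3 (fun x y z => x0 <= x <= x1 /\ y0 <= y <= y1 /\ z0 <= z <= z1).
Proof.
  intros x y z H.
  assert (K : forall l h v, (forall eps, 0 < eps -> exists v', l <= v' <= h /\ Rabs (v' - v) < eps) -> l <= v <= h).
  { intros l h v Hv; split; apply Rnot_lt_le; intros Hlt.
    - destruct (Hv (l - v) ltac:(lra)) as [v' [H1 H2]]; apply Rabs_lt_between in H2; lra.
    - destruct (Hv (v - h) ltac:(lra)) as [v' [H1 H2]]; apply Rabs_lt_between in H2; lra. }
  split; [|split]; apply K; intros eps He; destruct (H eps He) as [x' [y' [z' [[Q1 [Q2 Q3]] [Q4 [Q5 Q6]]]]]]; eauto.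
Qed.

Lemma bounded3_box (x0 x1 y0 y1 z0 z1 : R) :
  bounded3 (fun x y z => x0 <= x <= x1 /\ y0 <= y <= y1 /\ z0 <= z <= z1).
Proof.
  exists (Rabs x0 + Rabs x1 + Rabs y0 + Rabs y1 + Rabs z0 + Rabs z1); intros x y z H.
  unfold Rabs; repeat destruct (Rcase_abs _); lra.
Qed.

Lemma CS_bounded (L : R) (f : field2) : 0 <= L -> CS L f -> exists M, 0 < M /\ forall a b, Rabs (f a b) <= M.
Proof.
  intros HL [Hf [Hc Hp]]. pose proof PI_RGT_0.
  destruct (max_attained3 (fun x y z => 0 <= x <= L /\ 0 <= y <= 2 * PI /\ 0 <= z <= 0) (fun x y _ => Rabs (f x y)))
    as [x [y [z [_ Hm]]]].
  - apply closed3_box.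
  - apply bounded3_box.
  - intros x y z _ eps He; destruct (Hf eps He) as [d [Hd Hd']]; exists d; split; auto.
    intros x' y' z' _ H1 H2 _. apply Rle_lt_trans with (1 := Rabs_triang_inv2 _ _); auto.
  - exists 0, 0, 0; lra.
  - exists (Rabs (f x y) + 1); split; [pose proof (Rabs_pos (f x y)); lra|].
    intros a b. destruct (period_reduce b) as [k Hk].
    rewrite <- Hc, <- (periodic_Z (fun b => f (clamp L a) b) (Hp _) k b).
    apply Rle_trans with (Rabs (f x y)); [|lra]. apply (Hm _ _ 0).
    repeat split; try lra; apply clamp_range; auto.
Qed.

Lemma CS_intro (L : R) (f : field2) : 0 <= L ->
  (forall a b, f a (b + 2 * PI) = f a b) ->
  (forall a b, 0 <= a <= L -> forall eps, 0 < eps -> exists del, 0 < del /\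
     forall a' b', 0 <= a' <= L -> Rabs (a' - a) < del -> Rabs (b' - b) < del -> Rabs (f a' b' - f a b) < eps) ->
  CS L (fun a b => f (clamp L a) b).
Proof.
  intros HL Hp Hf. split; [|split; [intros; rewrite clamp_clamp; auto|auto]].
  intros eps He.
  (* Only [y] is moved into [[0, 2 * PI]] by periodicity. The margin [1] at each end keeps the
     neighbouring point [y'], moved by the same period, inside the compact box. *)
  destruct (uniform_continuity3 (fun x y z => 0 <= x <= L /\ -1 <= y <= 2 * PI + 1 /\ 0 <= z <= 0) (fun x y _ => f x y))
    with (eps := eps) as [d [Hd Hd']]; auto.
  - apply closed3_box.
  - apply bounded3_box.
  - intros x y z [Hx _] e He'; destruct (Hf x y Hx e He') as [d [Hd Hd']]; exists d; split; auto.
    intros x' y' z' [Hx' _] ? ? _; apply Hd'; auto.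
  - exists (Rmin d 1); split; [apply Rmin_pos; lra|]. intros x y x' y' H1 H2.
    rmin_bounds d 1.
    destruct (period_reduce y) as [k Hk].
    rewrite <- (periodic_Z (fun b => f (clamp L x') b) (Hp _) k y'), <- (periodic_Z (fun b => f (clamp L x) b) (Hp _) k y).
    assert (Hy : Rabs (y' + 2 * PI * IZR k - (y + 2 * PI * IZR k)) < Rmin d 1).
    { replace (y' + 2 * PI * IZR k - (y + 2 * PI * IZR k)) with (y' - y) by ring; auto. }
    assert (-1 <= y' + 2 * PI * IZR k <= 2 * PI + 1) by (apply Rabs_lt_between in Hy; lra).
    pose proof (clamp_range L x HL). pose proof (clamp_range L x' HL).
    apply (Hd' _ _ 0 _ _ 0); try (repeat split; lra).
    + apply Rle_lt_trans with (1 := clamp_lip L x' x HL); lra.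
    + rdiag.
Qed.

Lemma CS_plus (L : R) (f g : field2) : CS L f -> CS L g -> CS L (fun a b => f a b + g a b).
Proof.
  intros [H1 [H2 H3]] [K1 [K2 K3]]; split; [apply UC_plus; auto|]; split; intros; [rewrite H2, K2|rewrite H3, K3]; auto.
Qed.

Lemma CS_opp (L : R) (f : field2) : CS L f -> CS L (fun a b => - f a b).
Proof.
  intros [H1 [H2 H3]]; split; [apply UC_opp; auto|]; split; intros; [rewrite H2|rewrite H3]; auto.
Qed.

Lemma CS_minus (L : R) (f g : field2) : CS L f -> CS L g -> CS L (fun a b => f a b - g a b).
Proof. intros Hf Hg; apply (CS_plus L f (fun a b => - g a b)); auto; apply CS_opp; auto. Qed.

Lemma CS_const (L c : R) : CS L (fun _ _ => c).
Proof. split; [apply UC_const|split; auto]. Qed.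

Lemma CS_mult (L : R) (f g : field2) : 0 <= L -> CS L f -> CS L g -> CS L (fun a b => f a b * g a b).
Proof.
  intros HL Hf Hg. destruct (CS_bounded L f HL Hf) as [Mf [_ Bf]]; destruct (CS_bounded L g HL Hg) as [Mg [_ Bg]].
  destruct Hf as [H1 [H2 H3]]; destruct Hg as [K1 [K2 K3]].
  split; [apply (UC_mult f g Mf Mg); auto|]; split; intros; [rewrite H2, K2|rewrite H3, K3]; auto.
Qed.

Lemma CS_scal (L c : R) (f : field2) : 0 <= L -> CS L f -> CS L (fun a b => c * f a b).
Proof. intros HL Hf; apply (CS_mult L (fun _ _ => c) f); auto; apply CS_const. Qed.

Lemma CS_ext (L : R) (f g : field2) : (forall a b, f a b = g a b) -> CS L f -> CS L g.
Proof.
  intros E [H1 [H2 H3]]; split; [apply UC_ext with f; auto|]; split; intros; rewrite <- !E; auto.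
Qed.

Lemma CS_of_a (L : R) (u : R -> R) : 0 <= L -> (forall a, 0 <= a <= L -> continuity_pt u a) -> CS L (fun a _ => u (clamp L a)).
Proof.
  intros HL Hu; apply (CS_intro L (fun a _ => u a)); auto.
  intros a b Ha eps He; destruct (continuity_pt_eps_inv _ _ (Hu a Ha) eps He) as [d [Hd Hd']]; exists d; split; auto.
Qed.

Lemma CS_of_b (L : R) (u : R -> R) : 0 <= L -> ctn u -> (forall b, u (b + 2 * PI) = u b) -> CS L (fun _ b => u b).
Proof.
  intros HL Hu Hp; apply (CS_intro L (fun _ b => u b)); auto.
  intros a b Ha eps He; destruct (continuity_pt_eps_inv _ _ (Hu b) eps He) as [d [Hd Hd']]; exists d; split; auto.
Qed.
(** * Integration *)

Lemma ctn_ex_RInt (f : R -> R) (a b : R) : ctn f -> ex_RInt f a b.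
Proof. intros H; apply (ex_RInt_continuous (V := R_CompleteNormedModule)); intros z _; apply continuity_pt_filterlim, H. Qed.

Lemma ctn_plus (f g : R -> R) : ctn f -> ctn g -> ctn (fun x => f x + g x).
Proof. intros Hf Hg x; apply (continuity_pt_plus f g); auto. Qed.

Lemma ctn_mult (f g : R -> R) : ctn f -> ctn g -> ctn (fun x => f x * g x).
Proof. intros Hf Hg x; apply (continuity_pt_mult f g); auto. Qed.

Lemma ctn_opp (f : R -> R) : ctn f -> ctn (fun x => - f x).
Proof. intros Hf x; apply (continuity_pt_opp f); auto. Qed.

Lemma ctn_const (c : R) : ctn (fun _ => c).
Proof. intros x; apply continuity_pt_const; intros ? ?; auto. Qed.

Lemma ctn_derivable (f f' : R -> R) : (forall x, derivable_pt_lim f x (f' x)) -> ctn f.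
Proof. intros H x; apply (derivable_lim_continuous f x (f' x)); auto. Qed.

Lemma ctn_ext (f g : R -> R) : (forall x, f x = g x) -> ctn f -> ctn g.
Proof. intros E H x; apply continuity_pt_ext with f; auto. Qed.

Lemma RI_plus (f g : R -> R) (a b : R) : ctn f -> ctn g ->
  RInt (fun x => f x + g x) a b = RInt f a b + RInt g a b.
Proof. intros; apply (RInt_plus f g); apply ctn_ex_RInt; auto. Qed.

Lemma RI_scal (f : R -> R) (k a b : R) : ctn f -> RInt (fun x => k * f x) a b = k * RInt f a b.
Proof. intros; apply (RInt_scal f); apply ctn_ex_RInt; auto. Qed.

Lemma RI_opp (f : R -> R) (a b : R) : ctn f -> RInt (fun x => - f x) a b = - RInt f a b.
Proof. intros; apply (RInt_opp f); apply ctn_ex_RInt; auto. Qed.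

Lemma RI_minus (f g : R -> R) (a b : R) : ctn f -> ctn g ->
  RInt (fun x => f x - g x) a b = RInt f a b - RInt g a b.
Proof. intros; apply (RInt_minus f g); apply ctn_ex_RInt; auto. Qed.

Lemma RI_const (c a b : R) : RInt (fun _ => c) a b = c * (b - a).
Proof. rewrite RInt_const; unfold scal; simpl; unfold mult; simpl; ring. Qed.

Lemma RI_ext (f g : R -> R) (a b : R) : (forall x, f x = g x) -> RInt f a b = RInt g a b.
Proof. intros H; apply RInt_ext; auto. Qed.

Lemma RI_le (f g : R -> R) (a b : R) : a <= b -> ctn f -> ctn g -> (forall x, a <= x <= b -> f x <= g x) ->
  RInt f a b <= RInt g a b.
Proof. intros Hab Hf Hg H; apply RInt_le; auto; try (apply ctn_ex_RInt; auto). intros; apply H; lra. Qed.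

Lemma RI_bound (f : R -> R) (a b M : R) : a <= b -> ctn f -> (forall x, a <= x <= b -> Rabs (f x) <= M) ->
  Rabs (RInt f a b) <= M * (b - a).
Proof.
  intros Hab Hf H. rewrite <- (RI_const M a b).
  assert (H1 : RInt f a b <= RInt (fun _ => M) a b).
  { apply RI_le; auto using ctn_const. intros x Hx; specialize (H x Hx); apply Rabs_le_between in H; lra. }
  assert (H2 : RInt (fun _ => - M) a b <= RInt f a b).
  { apply RI_le; auto using ctn_const. intros x Hx; specialize (H x Hx); apply Rabs_le_between in H; lra. }
  rewrite RI_const in H2; rewrite RI_const in *; apply Rabs_le_between; lra.
Qed.

Lemma RI_derive (f : R -> R) (a x : R) : ctn f -> derivable_pt_lim (fun y => RInt f a y) x (f x).
Proof.
  intros Hf; apply is_derive_Reals; apply (is_derive_RInt f (fun y => RInt f a y) a x).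
  - apply filter_forall; intros y; apply (RInt_correct f); apply ctn_ex_RInt; auto.
  - apply continuity_pt_filterlim, Hf.
Qed.

Lemma RI_point (f : R -> R) (a : R) : RInt f a a = 0.
Proof. apply (RInt_point a f). Qed.

Lemma RI_chasles (f : R -> R) (a b c : R) : ctn f -> RInt f a b + RInt f b c = RInt f a c.
Proof. intros H; apply (RInt_Chasles f a b c); apply ctn_ex_RInt; auto. Qed.

Lemma zero_derivative_const (g : R -> R) (a b : R) : a <= b -> (forall x, a <= x <= b -> continuity_pt g x) ->
  (forall x, a < x < b -> derivable_pt_lim g x 0) -> g b = g a.
Proof.
  intros Hab Hc Hd. destruct (Rle_lt_or_eq_dec a b Hab) as [H| ->]; auto.
  destruct (mean_value g (fun _ => 0) a b) as [c [_ Hcc]]; auto. lra.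
Qed.

Lemma RI_ftc (F f : R -> R) (a b : R) : a <= b -> (forall x, a <= x <= b -> continuity_pt F x) -> ctn f ->
  (forall x, a < x < b -> derivable_pt_lim F x (f x)) -> RInt f a b = F b - F a.
Proof.
  intros Hab HF Hf Hd.
  assert (H := zero_derivative_const (fun x => RInt f a x - F x) a b Hab).
  cbv beta in H. rewrite (RI_point f a) in H. cut (RInt f a b - F b = 0 - F a); [lra|]. apply H.
  - intros x Hx; apply (continuity_pt_minus (fun x => RInt f a x) F); auto.
    apply (derivable_lim_continuous _ _ (f x)), RI_derive; auto.
  - intros x Hx; replace 0 with (f x - f x) by ring.
    apply (derivable_pt_lim_minus (fun x => RInt f a x) F); auto using RI_derive.
Qed.

(** As a function of [c] the left side has derivative [f (c + 2 * PI) - f c], which is zero. *)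
Lemma RI_shift_period (f : R -> R) (c : R) : ctn f -> (forall x, f (x + 2 * PI) = f x) ->
  RInt f c (c + 2 * PI) = RInt f 0 (2 * PI).
Proof.
  intros Hf Hp.
  assert (K : forall x, derivable_pt_lim (fun c => RInt f 0 (c + 2 * PI) - RInt f 0 c) x 0).
  { intros x. apply D_eq with (f (x + 2 * PI) - f x); [rewrite Hp; ring|].
    apply (D_minus (fun c => RInt f 0 (c + 2 * PI)) (fun c => RInt f 0 c)).
    - apply (D_shift (fun y => RInt f 0 y)), RI_derive; auto.
    - apply RI_derive; auto. }
  assert (E : RInt f 0 (c + 2 * PI) - RInt f 0 c = RInt f 0 (0 + 2 * PI) - RInt f 0 0).
  { destruct (Rle_dec 0 c) as [H|H].
    - apply (zero_derivative_const (fun c => RInt f 0 (c + 2 * PI) - RInt f 0 c)); auto.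
      intros; apply (derivable_lim_continuous _ _ 0); auto.
    - symmetry; apply (zero_derivative_const (fun c => RInt f 0 (c + 2 * PI) - RInt f 0 c)); [lra| |auto].
      intros; apply (derivable_lim_continuous _ _ 0); auto. }
  rewrite RI_point, Rplus_0_l in E. rewrite <- (RI_chasles f 0 c (c + 2 * PI)) in E; auto. lra.
Qed.

(** * Integrals over circles and over the strip *)

Definition cint (g : field2) (a : R) : R := RInt (fun b => g a b) 0 (2 * PI).
Definition II (L : R) (g : field2) : R := RInt (fun a => cint g a) 0 L.

Lemma cint_UC (g : field2) : UC g -> UC1 (cint g).
Proof.
  intros Hg eps He. pose proof PI_RGT_0.
  destruct (Hg (eps / (4 * PI))) as [d [Hd Hd']]; [apply Rdiv_lt_0_compat; lra|].
  exists d; split; auto; intros x x' Hx. unfold cint. rewrite <- RI_minus by (apply UC_ctn2; auto).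
  apply Rle_lt_trans with (eps / (4 * PI) * (2 * PI - 0)).
  - apply RI_bound; [lra| |].
    + apply (ctn_plus (fun b => g x' b) (fun b => - g x b)); [|apply (ctn_opp (fun b => g x b))]; apply UC_ctn2; auto.
    + intros y _; left; apply Hd'; auto; rdiag.
  - replace (eps / (4 * PI) * (2 * PI - 0)) with (eps / 2) by (field; lra). lra.
Qed.

Lemma cint_ctn (g : field2) : UC g -> ctn (cint g).
Proof. intros; apply UC1_ctn, cint_UC; auto. Qed.

Lemma cint_clamp (L : R) (g : field2) (a : R) : CS L g -> cint g (clamp L a) = cint g a.
Proof. intros [_ [H _]]; unfold cint; apply RI_ext; auto. Qed.

Lemma cint_plus (f g : field2) (a : R) : UC f -> UC g -> cint (fun a b => f a b + g a b) a = cint f a + cint g a.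
Proof. intros; apply RI_plus; apply UC_ctn2; auto. Qed.

Lemma cint_minus (f g : field2) (a : R) : UC f -> UC g -> cint (fun a b => f a b - g a b) a = cint f a - cint g a.
Proof. intros; apply (RI_minus (fun b => f a b) (fun b => g a b)); apply UC_ctn2; auto. Qed.

Lemma cint_scal (k : R) (f : field2) (a : R) : UC f -> cint (fun a b => k * f a b) a = k * cint f a.
Proof. intros; apply (RI_scal (fun b => f a b)); apply UC_ctn2; auto. Qed.

Lemma cint_const (c a : R) : cint (fun _ _ => c) a = c * (2 * PI).
Proof. unfold cint; rewrite RI_const; ring. Qed.

Lemma cint_bound (f : field2) (a M : R) : UC f -> (forall b, Rabs (f a b) <= M) -> Rabs (cint f a) <= M * (2 * PI).
Proof.
  intros Hf HM; pose proof PI_RGT_0. apply Rle_trans with (M * (2 * PI - 0)); [|right; ring].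
  apply RI_bound; [lra|apply UC_ctn2; auto|auto].
Qed.

Lemma cint_le (f g : field2) (a : R) : UC f -> UC g -> (forall b, f a b <= g a b) -> cint f a <= cint g a.
Proof. intros; pose proof PI_RGT_0; apply RI_le; auto; try (apply UC_ctn2; auto); lra. Qed.

Lemma cint_db (u ub : field2) (a : R) : UC u -> UC ub -> (forall b, u a (b + 2 * PI) = u a b) ->
  (forall b, derivable_pt_lim (fun y => u a y) b (ub a b)) -> cint ub a = 0.
Proof.
  intros Hu Hub Hp Hd. pose proof PI_RGT_0. unfold cint. rewrite (RI_ftc (fun y => u a y)); auto; try lra.
  - rewrite <- (Hp 0), Rplus_0_l; ring.
  - intros; apply UC_ctn2; auto.
  - apply UC_ctn2; auto.
Qed.

(** The quotient is a value of [ux] within [d] of [x], so the modulus of continuity of [ux] alone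
    controls the error. This makes the estimate uniform in parameters and allows differentiation
    under integrals and of uniform limits. *)
Lemma derive_unif (u ux : R -> R) (lo hi x e d : R) :
  (forall y, lo < y < hi -> derivable_pt_lim u y (ux y)) -> lo < x < hi ->
  (forall y, Rabs (y - x) < d -> Rabs (ux y - ux x) < e) ->
  forall h, h <> 0 -> Rabs h < d -> lo < x + h < hi -> Rabs ((u (x + h) - u x) / h - ux x) <= e.
Proof.
  intros Hd Hx Hu h Hh Hhd Hxh.
  assert (K : exists c, Rabs (c - x) < d /\ u (x + h) - u x = ux c * h).
  { destruct (Rlt_dec 0 h) as [Hp|Hn].
    - destruct (mean_value u ux x (x + h)) as [c [Hc Hcc]]; try lra.
      + intros; apply Hd; lra.
      + intros y Hy; apply (derivable_lim_continuous _ _ (ux y)), Hd; lra.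
      + exists c; split; [|rewrite Hcc; ring]. apply Rabs_lt_between; apply Rabs_lt_between in Hhd; lra.
    - destruct (mean_value u ux (x + h) x) as [c [Hc Hcc]]; try lra.
      + intros; apply Hd; lra.
      + intros y Hy; apply (derivable_lim_continuous _ _ (ux y)), Hd; lra.
      + exists c; split; [|lra]. apply Rabs_lt_between; apply Rabs_lt_between in Hhd; lra. }
  destruct K as [c [Hc E]]. rewrite E. replace (ux c * h / h) with (ux c) by (field; auto).
  left; apply Hu; auto.
Qed.

Lemma RI_param_derive (u ux : field2) (lo hi c : R) : 0 <= c -> (forall x, lo < x < hi -> ctn (fun b => u x b)) -> UC ux ->
  (forall x b, lo < x < hi -> D (fun x => u x b) x (ux x b)) ->
  forall x, lo < x < hi -> D (fun x => RInt (fun b => u x b) 0 c) x (RInt (fun b => ux x b) 0 c).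
Proof.
  intros Hc Hu Hux Hd x Hx eps He.
  assert (Hk : 0 < eps / (2 * (c + 1))) by (apply Rdiv_lt_0_compat; lra). set (k := eps / (2 * (c + 1))) in *.
  destruct (Hux k Hk) as [d [Hd0 Hd']].
  assert (Hm : 0 < Rmin d (Rmin (x - lo) (hi - x))) by (repeat apply Rmin_pos; lra).
  exists (mkposreal _ Hm); simpl; intros h Hh Hhd.
  rmin_bounds d (Rmin (x - lo) (hi - x)).
  rmin_bounds (x - lo) (hi - x).
  assert (Hxh : lo < x + h < hi) by (apply Rabs_lt_between in Hhd; lra).
  assert (Cd : ctn (fun b => u (x + h) b - u x b)).
  { apply (ctn_plus (fun b => u (x + h) b) (fun b => - u x b)); [auto|apply (ctn_opp (fun b => u x b)); auto]. }
  assert (Cq : ctn (fun b => (u (x + h) b - u x b) / h)) by (apply (ctn_mult (fun b => u (x + h) b - u x b) (fun _ => / h)); auto; apply ctn_const).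
  replace ((RInt (fun b => u (x + h) b) 0 c - RInt (fun b => u x b) 0 c) / h - RInt (fun b => ux x b) 0 c) with
    (RInt (fun b => (u (x + h) b - u x b) / h - ux x b) 0 c).
  - apply Rle_lt_trans with (k * (c - 0)).
    + apply RI_bound; auto.
      * apply (ctn_plus (fun b => (u (x + h) b - u x b) / h) (fun b => - ux x b)); auto. apply (ctn_opp (fun b => ux x b)), UC_ctn2; auto.
      * intros b _. apply (derive_unif (fun x => u x b) (fun x => ux x b) lo hi x k d); auto; try lra.
        intros y Hy; apply Hd'; auto; rdiag.
    + assert (E : k * (2 * (c + 1)) = eps) by (unfold k; field; lra). clearbody k. nra.
  - rewrite (RI_minus (fun b => (u (x + h) b - u x b) / h) (fun b => ux x b)); auto; [|apply UC_ctn2; auto].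
    f_equal. rewrite (RI_ext _ (fun b => / h * (u (x + h) b - u x b))) by (intros; field; auto).
    rewrite RI_scal; auto. rewrite (RI_minus (fun b => u (x + h) b) (fun b => u x b)); auto. unfold Rdiv; apply Rmult_comm.
Qed.

Lemma cint_derive (u ux : field2) (lo hi : R) : (forall x, lo < x < hi -> ctn (fun b => u x b)) -> UC ux ->
  (forall x b, lo < x < hi -> D (fun x => u x b) x (ux x b)) ->
  forall x, lo < x < hi -> D (cint u) x (cint ux x).
Proof. intros; apply (RI_param_derive u ux lo hi (2 * PI)); auto. pose proof PI_RGT_0; lra. Qed.

Lemma II_plus (L : R) (f g : field2) : UC f -> UC g -> II L (fun a b => f a b + g a b) = II L f + II L g.
Proof.
  intros Hf Hg; unfold II. rewrite (RI_ext _ (fun a => cint f a + cint g a)) by (intros; apply cint_plus; auto).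
  apply RI_plus; apply cint_ctn; auto.
Qed.

Lemma II_minus (L : R) (f g : field2) : UC f -> UC g -> II L (fun a b => f a b - g a b) = II L f - II L g.
Proof.
  intros Hf Hg; unfold II. rewrite (RI_ext _ (fun a => cint f a - cint g a)) by (intros; apply cint_minus; auto).
  apply RI_minus; apply cint_ctn; auto.
Qed.

Lemma II_scal (L k : R) (f : field2) : UC f -> II L (fun a b => k * f a b) = k * II L f.
Proof.
  intros Hf; unfold II. rewrite (RI_ext _ (fun a => k * cint f a)) by (intros; apply cint_scal; auto).
  apply RI_scal; apply cint_ctn; auto.
Qed.

Lemma II_ext (L : R) (f g : field2) : (forall a b, f a b = g a b) -> II L f = II L g.
Proof. intros H; unfold II; apply RI_ext; intros a; unfold cint; apply RI_ext; auto. Qed.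

Lemma II_le (L : R) (f g : field2) : 0 <= L -> UC f -> UC g -> (forall a b, 0 <= a <= L -> f a b <= g a b) -> II L f <= II L g.
Proof. intros HL Hf Hg H; apply RI_le; auto; try (apply cint_ctn; auto). intros; apply cint_le; auto. Qed.

Lemma II_bound (L : R) (f : field2) (M : R) : 0 <= L -> UC f -> (forall a b, Rabs (f a b) <= M) -> Rabs (II L f) <= M * (2 * PI * L).
Proof.
  intros HL Hf HM. apply Rle_trans with (M * (2 * PI) * (L - 0)); [|right; ring].
  apply RI_bound; auto; [apply cint_ctn; auto|]. intros; apply cint_bound; auto.
Qed.

(** Differentiating the inner primitive under the integral in [b] gives [cint g]; the fundamental
    theorem then recovers the iterated integral in the other order. *)
Lemma II_fubini (L : R) (g : field2) : 0 < L -> UC g ->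
  II L g = RInt (fun b => RInt (fun a => g a b) 0 L) 0 (2 * PI).
Proof.
  intros HL Hg.
  (* The primitive starts at [-1] so that both [0] and [L] are interior to the interval on which it
     is differentiated in the parameter. *)
  set (u := fun x b => RInt (fun a => g a b) (-1) x).
  assert (Hub : forall x, -1 <= x -> UC1 (fun b => u x b)).
  { intros x Hx eps He.
    destruct (Hg (eps / (2 * (x + 2)))) as [d [Hd0 Hd']]; [apply Rdiv_lt_0_compat; lra|].
    exists d; split; auto; intros y y' Hy. unfold u. rewrite <- RI_minus by (apply (UC_ctn1 g); auto).
    apply Rle_lt_trans with (eps / (2 * (x + 2)) * (x - -1)).
    - apply RI_bound; [lra| |].
      + apply (ctn_plus (fun a => g a y') (fun a => - g a y)); [|apply (ctn_opp (fun a => g a y))]; apply UC_ctn1; auto.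
      + intros z _; left; apply Hd'; auto; rdiag.
    - assert (E : eps = eps / (2 * (x + 2)) * (2 * (x + 2))) by (field; lra).
      set (k := eps / (2 * (x + 2))) in *. clearbody k. nra. }
  assert (D : forall x, -1 < x < L + 1 -> derivable_pt_lim (cint u) x (cint g x)).
  { apply cint_derive; auto.
    - intros x Hx; apply UC1_ctn, Hub; lra.
    - intros x b _; apply (RI_derive (fun a => g a b)); apply UC_ctn1; auto. }
  unfold II. rewrite (RI_ftc (cint u) (cint g)); try lra; auto.
  - unfold cint. rewrite <- RI_minus by (apply UC1_ctn, Hub; lra).
    apply RI_ext; intros b; unfold u. rewrite <- (RI_chasles (fun a => g a b) (-1) 0 L) by (apply UC_ctn1; auto). ring.
  - intros x Hx. apply (derivable_lim_continuous _ _ (cint g x)), D; lra.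
  - apply cint_ctn; auto.
  - intros; apply D; lra.
Qed.

(** * Continuously differentiable functions on the strip *)

Definition C1s (L : R) (u ua ub : field2) : Prop :=
  CS L u /\ CS L ua /\ CS L ub /\
  (forall a b, 0 < a < L -> D (fun x => u x b) a (ua a b)) /\
  (forall a b, D (fun y => u a y) b (ub a b)).

Lemma C1s_plus (L : R) (u ua ub v va vb : field2) : C1s L u ua ub -> C1s L v va vb ->
  C1s L (fun a b => u a b + v a b) (fun a b => ua a b + va a b) (fun a b => ub a b + vb a b).
Proof.
  intros [H1 [H2 [H3 [H4 H5]]]] [K1 [K2 [K3 [K4 K5]]]].
  split; [|split; [|split; [|split]]]; try (apply CS_plus; auto).
  - intros a b Ha; apply (D_plus (fun x => u x b) (fun x => v x b)); auto.
  - intros a b; apply (D_plus (fun y => u a y) (fun y => v a y)); auto.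
Qed.

Lemma C1s_scal (L c : R) (u ua ub : field2) : 0 <= L -> C1s L u ua ub ->
  C1s L (fun a b => c * u a b) (fun a b => c * ua a b) (fun a b => c * ub a b).
Proof.
  intros HL [H1 [H2 [H3 [H4 H5]]]]. split; [|split; [|split; [|split]]]; try (apply CS_scal; auto).
  - intros a b Ha; apply (D_scal c (fun x => u x b)); auto.
  - intros a b; apply (D_scal c (fun y => u a y)); auto.
Qed.

Lemma C1s_ext (L : R) (u ua ub v va vb : field2) :
  (forall a b, u a b = v a b) -> (forall a b, ua a b = va a b) -> (forall a b, ub a b = vb a b) ->
  C1s L u ua ub -> C1s L v va vb.
Proof.
  intros E1 E2 E3 [H1 [H2 [H3 [H4 H5]]]].
  split; [apply CS_ext with u; auto|]. split; [apply CS_ext with ua; auto|]. split; [apply CS_ext with ub; auto|].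
  split; intros a b.
  - intros Ha; rewrite <- E2; apply D_ext with (fun x => u x b); auto.
  - rewrite <- E3; apply D_ext with (fun y => u a y); auto.
Qed.

Lemma C1s_minus (L : R) (u ua ub v va vb : field2) : 0 <= L -> C1s L u ua ub -> C1s L v va vb ->
  C1s L (fun a b => u a b - v a b) (fun a b => ua a b - va a b) (fun a b => ub a b - vb a b).
Proof.
  intros HL Hu Hv. assert (H := C1s_plus _ _ _ _ _ _ _ Hu (C1s_scal L (-1) _ _ _ HL Hv)).
  revert H; apply C1s_ext; intros; ring.
Qed.

Lemma C1s_mult (L : R) (u ua ub v va vb : field2) : 0 <= L -> C1s L u ua ub -> C1s L v va vb ->
  C1s L (fun a b => u a b * v a b) (fun a b => ua a b * v a b + u a b * va a b)
        (fun a b => ub a b * v a b + u a b * vb a b).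
Proof.
  intros HL [H1 [H2 [H3 [H4 H5]]]] [K1 [K2 [K3 [K4 K5]]]].
  split; [apply CS_mult; auto|]. split; [apply CS_plus; apply CS_mult; auto|].
  split; [apply CS_plus; apply CS_mult; auto|]. split.
  - intros a b Ha; apply (D_mult (fun x => u x b) (fun x => v x b)); auto.
  - intros a b; apply (D_mult (fun y => u a y) (fun y => v a y)); auto.
Qed.

Lemma C1s_of_a (L : R) (k k' : R -> R) : 0 <= L -> (forall x, 0 <= x <= L -> D k x (k' x)) ->
  (forall x, 0 <= x <= L -> continuity_pt k' x) ->
  C1s L (fun a _ => k (clamp L a)) (fun a _ => k' (clamp L a)) (fun _ _ => 0).
Proof.
  intros HL Hk Hk'.
  split; [apply CS_of_a; auto; intros x Hx; apply (D_cont _ _ (k' x)); auto|].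
  split; [apply CS_of_a; auto|]. split; [apply CS_const|]. split.
  - intros a b Ha. rewrite clamp_id by lra.
    apply D_ext_loc with k (Rmin a (L - a)); [apply Rmin_pos; lra| |apply Hk; lra].
    intros y Hy. rmin_bounds a (L - a). apply Rabs_lt_between in Hy.
    rewrite clamp_id; auto; lra.
  - intros a b; apply D_const.
Qed.

Lemma C1s_const (L c : R) : C1s L (fun _ _ => c) (fun _ _ => 0) (fun _ _ => 0).
Proof. split; [|split; [|split; [|split]]]; try apply CS_const; intros; apply D_const. Qed.

Lemma C1s_linear_a (L : R) : 0 <= L -> C1s L (fun a _ => clamp L a) (fun _ _ => 1) (fun _ _ => 0).
Proof.
  intros HL. apply (C1s_of_a L (fun a => a) (fun _ => 1)); auto; intros; [apply D_id|apply ctn_const].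
Qed.

Lemma II_da (L : R) (u ua ub : field2) : 0 < L -> C1s L u ua ub -> II L ua = cint u L - cint u 0.
Proof.
  intros HL [[H1 _] [[H2 _] [_ [H4 _]]]]. apply RI_ftc; try lra.
  - intros; apply cint_ctn; auto.
  - apply cint_ctn; auto.
  - apply cint_derive; auto. intros; apply UC_ctn2; auto.
Qed.

Lemma II_db (L : R) (u ua ub : field2) : 0 < L -> C1s L u ua ub -> II L ub = 0.
Proof.
  intros HL [[H1 [_ Hp]] [_ [[H3 _] [_ H5]]]]. unfold II.
  rewrite (RI_ext _ (fun _ => 0)); [rewrite RI_const; ring|].
  intros a; apply (cint_db u); auto.
Qed.

(** Every partial integral is squeezed between [0] and the whole integral, hence vanishes, and so
    does its derivative [f] inside the interval; continuity covers the end points. *)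
Lemma RI_pos_zero (f : R -> R) (a b : R) : a < b -> ctn f -> (forall x, a <= x <= b -> 0 <= f x) -> RInt f a b = 0 ->
  forall x, a <= x <= b -> f x = 0.
Proof.
  intros Hab Hf Hp H0.
  assert (G : forall x, a <= x <= b -> RInt f a x = 0).
  { intros x Hx. assert (0 <= RInt f a x).
    { replace 0 with (RInt (fun _ => 0) a x) by (rewrite RI_const; apply Rmult_0_l). apply RI_le; auto using ctn_const; try lra. intros; apply Hp; lra. }
    assert (0 <= RInt f x b).
    { replace 0 with (RInt (fun _ => 0) x b) by (rewrite RI_const; apply Rmult_0_l). apply RI_le; auto using ctn_const; try lra. intros; apply Hp; lra. }
    pose proof (RI_chasles f a x b Hf). lra. }
  assert (I : forall x, a < x < b -> f x = 0).
  { intros x Hx. apply (uniqueness_limite (fun x => RInt f a x) x); [apply RI_derive; auto|].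
    apply D_ext_loc with (fun _ => 0) (Rmin (x - a) (b - x)); [apply Rmin_pos; lra| |apply D_const].
    intros y Hy. rmin_bounds (x - a) (b - x). apply Rabs_lt_between in Hy.
    symmetry; apply G; lra. }
  intros x Hx. destruct (Rle_lt_or_eq_dec 0 (f x) (Hp x Hx)) as [Hlt|]; auto. exfalso.
  destruct (continuity_pt_eps_inv f x (Hf x) (f x) Hlt) as [d [Hd Hd']].
  assert (exists y, a < y < b /\ Rabs (y - x) < d) as [y [Hy Hy']].
  { set (m := Rmin d (b - a)). assert (0 < m) by (apply Rmin_pos; lra).
    rmin_bounds d (b - a). fold m in H1, H2.
    destruct (Rle_dec x ((a + b) / 2)).
    - exists (x + m / 3); split; [lra|apply Rabs_lt_between; lra].
    - exists (x - m / 3); split; [lra|apply Rabs_lt_between; lra]. }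
  specialize (Hd' y Hy'). rewrite (I y Hy) in Hd'. apply Rabs_lt_between in Hd'; lra.
Qed.

Lemma II_pos_zero (L : R) (g : field2) : 0 < L -> CS L g -> (forall a b, 0 <= g a b) -> II L g = 0 -> forall a b, g a b = 0.
Proof.
  intros HL [Hg [Hc Hp]] H0 HI a b. pose proof PI_RGT_0.
  assert (K : forall a, 0 <= a <= L -> cint g a = 0).
  { apply RI_pos_zero; auto; [apply cint_ctn; auto|]. intros x _. replace 0 with (cint (fun _ _ => 0) x) by (rewrite cint_const; ring).
    apply cint_le; auto using UC_const. }
  destruct (period_reduce b) as [k Hk].
  rewrite <- Hc, <- (periodic_Z (fun b => g (clamp L a) b) (Hp _) k b).
  apply (RI_pos_zero (fun b => g (clamp L a) b) 0 (2 * PI)); auto; try lra.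
  - apply UC_ctn2; auto.
  - apply K, clamp_range; lra.
Qed.

(** * Continuity in three variables *)

Lemma cont_on3_const (S : R -> R -> R -> Prop) (c : R) : cont_on3 S (fun _ _ _ => c).
Proof. intros x y z _ eps He; exists 1; split; [lra|]; intros; rdiag. Qed.

Lemma cont_on3_x (S : R -> R -> R -> Prop) : cont_on3 S (fun x _ _ => x).
Proof. intros x y z _ eps He; exists eps; split; auto. Qed.

Lemma cont_on3_y (S : R -> R -> R -> Prop) : cont_on3 S (fun _ y _ => y).
Proof. intros x y z _ eps He; exists eps; split; auto. Qed.

Lemma cont_on3_z (S : R -> R -> R -> Prop) : cont_on3 S (fun _ _ z => z).
Proof. intros x y z _ eps He; exists eps; split; auto. Qed.

Lemma cont_on3_comp1 (S : R -> R -> R -> Prop) (u : R -> R) (g : field3) :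
  (forall x y z, S x y z -> continuity_pt u (g x y z)) -> cont_on3 S g -> cont_on3 S (fun x y z => u (g x y z)).
Proof.
  intros Hu Hg x y z HS eps He.
  destruct (continuity_pt_eps_inv u _ (Hu x y z HS) eps He) as [d [Hd Hd']].
  destruct (Hg x y z HS d Hd) as [e [He' He'']]. exists e; split; auto.
Qed.

Lemma cont_on3_comp2 (S : R -> R -> R -> Prop) (f : field2) (g h : field3) :
  (forall p q, forall eps, 0 < eps -> exists del, 0 < del /\
    forall p' q', Rabs (p' - p) < del -> Rabs (q' - q) < del -> Rabs (f p' q' - f p q) < eps) ->
  cont_on3 S g -> cont_on3 S h -> cont_on3 S (fun x y z => f (g x y z) (h x y z)).
Proof.
  intros Hf Hg Hh x y z HS eps He.
  destruct (Hf (g x y z) (h x y z) eps He) as [d [Hd Hd']].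
  destruct (Hg x y z HS d Hd) as [e [He' He'']]. destruct (Hh x y z HS d Hd) as [i [Hi Hi']].
  exists (Rmin e i); split; [apply Rmin_pos; auto|].
  rmin_bounds e i.
  intros; apply Hd'; [apply He''|apply Hi']; auto; lra.
Qed.

Lemma UC_pointwise (f : field2) : UC f -> forall p q, forall eps, 0 < eps -> exists del, 0 < del /\
    forall p' q', Rabs (p' - p) < del -> Rabs (q' - q) < del -> Rabs (f p' q' - f p q) < eps.
Proof. intros Hf p q eps He; destruct (Hf eps He) as [d [Hd Hd']]; exists d; split; auto. Qed.

Lemma cont_on3_plus (S : R -> R -> R -> Prop) (g h : field3) :
  cont_on3 S g -> cont_on3 S h -> cont_on3 S (fun x y z => g x y z + h x y z).
Proof.
  apply (cont_on3_comp2 S Rplus). intros p q eps He; exists (eps / 2); split; [lra|]; intros p' q' H1 H2.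
  apply Rabs_lt_between in H1, H2; apply Rabs_lt_between; lra.
Qed.

Lemma cont_on3_opp (S : R -> R -> R -> Prop) (g : field3) :
  cont_on3 S g -> cont_on3 S (fun x y z => - g x y z).
Proof.
  apply (cont_on3_comp1 S Ropp). intros x y z _; apply (D_cont _ _ (- (1))). apply (D_opp (fun y => y)), D_id.
Qed.

Lemma cont_on3_minus (S : R -> R -> R -> Prop) (g h : field3) :
  cont_on3 S g -> cont_on3 S h -> cont_on3 S (fun x y z => g x y z - h x y z).
Proof. intros Hg Hh; apply (cont_on3_plus S g (fun x y z => - h x y z)); auto; apply cont_on3_opp; auto. Qed.

Lemma cont_on3_mult (S : R -> R -> R -> Prop) (g h : field3) :
  cont_on3 S g -> cont_on3 S h -> cont_on3 S (fun x y z => g x y z * h x y z).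
Proof.
  apply (cont_on3_comp2 S Rmult). intros p q eps He.
  set (m := Rmin 1 (eps / (Rabs p + Rabs q + 2))).
  assert (Pp := Rabs_pos p). assert (Pq := Rabs_pos q).
  assert (Hk : 0 < eps / (Rabs p + Rabs q + 2)) by (apply Rdiv_lt_0_compat; lra).
  assert (Hm : 0 < m) by (apply Rmin_pos; lra).
  assert (m <= 1) by apply Rmin_l. assert (Hm2 : m <= eps / (Rabs p + Rabs q + 2)) by apply Rmin_r.
  exists m; split; auto; intros p' q' H1 H2.
  replace (p' * q' - p * q) with ((p' - p) * (q' - q) + (p' - p) * q + p * (q' - q)) by ring.
  assert (E : eps = eps / (Rabs p + Rabs q + 2) * (Rabs p + Rabs q + 2)) by (field; lra).
  set (k := eps / (Rabs p + Rabs q + 2)) in *.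
  apply Rle_lt_trans with (Rabs (p' - p) * Rabs (q' - q) + Rabs (p' - p) * Rabs q + Rabs p * Rabs (q' - q)).
  - rewrite <- !Rabs_mult. eapply Rle_trans; [apply Rabs_triang|]. apply Rplus_le_compat_r, Rabs_triang.
  - pose proof (Rabs_pos (p' - p)).
    clearbody k. nra.
Qed.

(** * Powers on the half line *)

(* [Rpower x th] is [1] at [x = 0] in the standard library; [pw] has the value [0] there. *)
Definition pw (x th : R) : R := if Rle_dec x 0 then 0 else Rpower x th.

Lemma pw_pos_eq (x th : R) : 0 < x -> pw x th = Rpower x th.
Proof. intros H; unfold pw; destruct (Rle_dec x 0); auto; lra. Qed.

Lemma pw_npos (x th : R) : x <= 0 -> pw x th = 0.
Proof. intros H; unfold pw; destruct (Rle_dec x 0); auto; lra. Qed.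

Lemma pw_pos (x th : R) : 0 < x -> 0 < pw x th.
Proof. intros H; rewrite pw_pos_eq by auto; apply exp_pos. Qed.

Lemma pw_nonneg (x th : R) : 0 <= pw x th.
Proof. destruct (Rle_dec x 0); [rewrite pw_npos; lra|left; apply pw_pos; lra]. Qed.

Lemma pw_le (x y th : R) : 0 <= th -> x <= y -> pw x th <= pw y th.
Proof.
  intros Ht Hxy. destruct (Rle_dec x 0); [rewrite pw_npos by auto; apply pw_nonneg|].
  rewrite !pw_pos_eq by lra. apply Rle_Rpower_l; lra.
Qed.

Lemma pw_mult (x y th : R) : 0 <= x -> 0 <= y -> pw (x * y) th = pw x th * pw y th.
Proof.
  intros [Hx| <-] [Hy| <-]; try (rewrite ?Rmult_0_l, ?Rmult_0_r, (pw_npos 0) by lra; ring).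
  rewrite !pw_pos_eq by nra. symmetry; apply Rpower_mult_distr; auto.
Qed.

Lemma pw_1 (th : R) : pw 1 th = 1.
Proof. rewrite pw_pos_eq by lra. unfold Rpower; rewrite ln_1, Rmult_0_r; apply exp_0. Qed.

Lemma pw_le_one_plus (x th : R) : 0 <= th <= 1 -> 0 <= x -> pw x th <= 1 + x.
Proof.
  intros Ht Hx. destruct (Rle_dec x 1).
  - apply Rle_trans with (pw 1 th); [apply pw_le; lra|rewrite pw_1; lra].
  - rewrite pw_pos_eq by lra. apply Rle_trans with (Rpower x 1); [|rewrite Rpower_1; lra].
    apply Rle_Rpower; lra.
Qed.

Lemma pw_le_mult_one_plus (c x th : R) : 0 <= th <= 1 -> 1 <= c -> 0 <= x -> pw (c * x) th <= c * pw x th.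
Proof.
  intros Ht Hc Hx. rewrite pw_mult by lra. apply Rmult_le_compat_r; [apply pw_nonneg|].
  rewrite pw_pos_eq by lra. rewrite <- (Rpower_1 c) at 2 by lra. apply Rle_Rpower; lra.
Qed.

Lemma le_mult_pw (x th c : R) : 0 <= th <= 1 -> 0 <= x <= c -> 1 <= c -> x <= c * pw x th.
Proof.
  intros Ht [[Hx| <-] Hxc] Hc; [|rewrite pw_npos; lra].
  rewrite pw_pos_eq by auto. destruct (Rle_dec x 1).
  - assert (Rpower x 1 <= Rpower x th).
    { unfold Rpower. assert (ln x <= 0) by (rewrite <- ln_1; destruct (Req_dec x 1) as [->|]; [lra|left; apply ln_increasing; lra]).
      destruct (Req_dec (1 * ln x) (th * ln x)) as [->|]; [lra|]. left; apply exp_increasing; nra. }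
    rewrite Rpower_1 in H by auto. nra.
  - assert (1 <= Rpower x th). { rewrite <- (Rpower_O x) by auto. apply Rle_Rpower; lra. } nra.
Qed.

Lemma D_Rpower (x p : R) : 0 < x -> D (fun y => Rpower y p) x (p * Rpower x (p - 1)).
Proof. intros; apply derivable_pt_lim_power; auto. Qed.

Lemma D_pw (x p : R) : 0 < x -> D (fun y => pw y p) x (p * Rpower x (p - 1)).
Proof.
  intros Hx; apply D_ext_loc with (fun y => Rpower y p) x; auto; [|apply D_Rpower; auto].
  intros y Hy; apply Rabs_lt_between in Hy; rewrite pw_pos_eq; auto; lra.
Qed.

Lemma Rpower_pred (x p : R) : 0 < x -> x * Rpower x (p - 1) = Rpower x p.
Proof. intros Hx. rewrite <- (Rpower_1 x) at 1 by auto. rewrite <- Rpower_plus. f_equal; ring. Qed.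

Lemma D_id_pw (x p : R) : 0 < x -> D (fun y => y * pw y p) x ((1 + p) * pw x p).
Proof.
  intros Hx. apply D_eq with (1 * pw x p + x * (p * Rpower x (p - 1))).
  - rewrite pw_pos_eq by auto. rewrite <- (Rpower_pred x p) by auto; ring.
  - apply (D_mult (fun y => y) (fun y => pw y p)); [apply D_id|apply D_pw; auto].
Qed.

Lemma pw_ctn (th : R) : 0 < th -> ctn (fun x => pw x th).
Proof.
  intros Ht x. destruct (Rtotal_order x 0) as [H|[->|H]].
  - apply (D_cont _ _ 0). apply D_ext_loc with (fun _ => 0) (- x); [lra| |apply D_const].
    intros y Hy; apply Rabs_lt_between in Hy; rewrite pw_npos; lra.
  - apply continuity_pt_eps; intros eps He. exists (Rpower eps (/ th)); split; [apply exp_pos|].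
    intros y Hy. rewrite (pw_npos 0), Rminus_0_r by lra. rewrite Rminus_0_r in Hy.
    rewrite Rabs_right by apply Rle_ge, pw_nonneg.
    destruct (Rle_dec y 0); [rewrite pw_npos; lra|]. rewrite Rabs_right in Hy by lra.
    rewrite pw_pos_eq by lra.
    apply Rlt_le_trans with (Rpower (Rpower eps (/ th)) th); [apply Rlt_Rpower_l; lra|].
    rewrite Rpower_mult, Rinv_l, Rpower_1; lra.
  - apply (D_cont _ _ (th * Rpower x (th - 1))), D_pw; auto.
Qed.

Lemma Rpower_neg_le (y z p : R) : p <= 0 -> 0 < y <= z -> Rpower z p <= Rpower y p.
Proof.
  intros Hp Hy. unfold Rpower. destruct (Req_dec y z) as [->|]; [lra|].
  assert (ln y < ln z) by (apply ln_increasing; lra).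
  destruct (Req_dec p 0) as [->|]; [right; f_equal; ring|]. left; apply exp_increasing; nra.
Qed.

(** The right side is what the barriers produce through their second derivatives in the two
    variables. Since [th - 1 <= 0], the first term suffices when [y <= z], and the second when
    [z <= y]. *)
Lemma barrier_power (y z th : R) : 0 < th <= 1 -> 0 < y -> 0 < z ->
  pw y th <= z * Rpower y (th - 1) + y * Rpower z (th - 1).
Proof.
  intros Ht Hy Hz. rewrite pw_pos_eq by auto. rewrite <- (Rpower_pred y th) by auto.
  assert (0 < Rpower y (th - 1)) by apply exp_pos. assert (0 < Rpower z (th - 1)) by apply exp_pos.
  destruct (Rle_dec y z); [nra|]. pose proof (Rpower_neg_le z y (th - 1) ltac:(lra) ltac:(lra)). nra.
Qed.

(** * Schauder estimates on the strip by the maximum principle *)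

(** Regularity in [b] alone is enough: the maximum principle is applied to differences in [b], and
    the right-hand side is never compared at two values of [a]. *)
Definition holb (th H : R) (f : field2) : Prop :=
  forall a b b', Rabs (f a b' - f a b) <= H * pw (Rabs (b' - b)) th.

Definition C2s (L : R) (u ua ub uaa uab ubb : field2) : Prop :=
  C1s L u ua ub /\ C1s L ua uaa uab /\ C1s L ub uab ubb.

(** Excludes a maximum on a side with Neumann data. There the derivative of the compared function
    comes from the barrier alone, which is built to point inwards. *)
Lemma endpoint_left (G G1 : R -> R) (L : R) : 0 < L -> ctn G -> ctn G1 -> (forall x, 0 < x < L -> D G x (G1 x)) ->
  0 < G1 0 -> forall r, 0 < r -> exists x, 0 < x < r /\ x < L /\ G 0 < G x.
Proof.
  intros HL HG HG1 HD Hp r Hr.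
  destruct (continuity_pt_eps_inv G1 0 (HG1 0) (G1 0) Hp) as [d [Hd Hd']].
  set (x := Rmin (d / 2) (Rmin (L / 2) (r / 2))).
  assert (0 < x) by (repeat apply Rmin_pos; lra).
  assert (x <= d / 2) by apply Rmin_l. assert (x <= Rmin (L / 2) (r / 2)) by apply Rmin_r.
  rmin_bounds (L / 2) (r / 2).
  exists x; repeat split; try lra.
  destruct (mean_value G G1 0 x) as [c [Hc Hcc]]; auto; try lra.
  { intros; apply HD; lra. }
  specialize (Hd' c ltac:(apply Rabs_lt_between; lra)). apply Rabs_lt_between in Hd'. nra.
Qed.

Lemma endpoint_right (G G1 : R -> R) (L : R) : 0 < L -> ctn G -> ctn G1 -> (forall x, 0 < x < L -> D G x (G1 x)) ->
  G1 L < 0 -> forall r, 0 < r -> exists x, L - r < x < L /\ 0 < x /\ G L < G x.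
Proof.
  intros HL HG HG1 HD Hp r Hr.
  destruct (endpoint_left (fun x => G (L - x)) (fun x => - G1 (L - x)) L HL) with (r := r) as [x [H1 [H2 H3]]]; auto.
  - intros x. apply (continuity_pt_comp (fun x => L - x) G); auto.
    apply (D_cont _ _ (0 - 1)), D_minus; [apply D_const|apply D_id].
  - apply ctn_opp. intros x. apply (continuity_pt_comp (fun x => L - x) G1); auto.
    apply (D_cont _ _ (0 - 1)), D_minus; [apply D_const|apply D_id].
  - intros x Hx; apply D_mirror, HD; lra.
  - rewrite Rminus_0_r; lra.
  - exists (L - x). rewrite Rminus_0_r in H3. repeat split; auto; lra.
Qed.

(** Applied to [ua] the same predicate expresses Neumann data. *)
Definition dirichlet (L : R) (u : field2) : Prop := forall b, u 0 b = 0 /\ u L b = 0.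

Ltac hcont := repeat first [apply cont_on3_minus | apply cont_on3_plus | apply cont_on3_mult | apply cont_on3_opp | apply cont_on3_const
  | apply cont_on3_x | apply cont_on3_y | apply cont_on3_z ].

Lemma ctn_minus (f g : R -> R) : ctn f -> ctn g -> ctn (fun x => f x - g x).
Proof. intros Hf Hg; apply (ctn_plus f (fun x => - g x)); auto; apply ctn_opp; auto. Qed.

Lemma ctn_id : ctn (fun x => x).
Proof. intros x; apply (D_cont _ _ 1), D_id. Qed.

Lemma ctn_comp (f g : R -> R) : ctn f -> ctn g -> ctn (fun x => g (f x)).
Proof. intros Hf Hg x; apply (continuity_pt_comp f g); auto. Qed.

Ltac cstep := match goal with
  | |- ctn (fun _ => ?c) => apply (ctn_const c)
  | |- ctn (fun x => x) => apply ctn_id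
  | |- ctn (fun x => @?f x + @?g x) => apply (ctn_plus f g)
  | |- ctn (fun x => @?f x - @?g x) => apply (ctn_minus f g)
  | |- ctn (fun x => - @?f x) => apply (ctn_opp f)
  | |- ctn (fun x => @?f x * @?g x) => apply (ctn_mult f g)
  | |- ctn (fun x => pw (@?f x) ?th) => apply (ctn_comp f (fun t => pw t th)); [|apply pw_ctn; lra]
  end.
Lemma PI_le_4 : 3 < PI <= 4.
Proof. split; [pose proof PI2_3_2; lra|apply PI_4]. Qed.

Ltac dstepw := first [apply D_id_pw; lra | apply D_pw; lra | dstep].
Ltac dsplitw := eapply D_eq; cycle 1; [repeat dstepw | ].

(** Doubling the variable [b]: the second derivatives in [y] and in [z] are both [diff4] of [ubb],
    so the Laplace equation becomes an elliptic equation in [(a, y, z)] with right-hand side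
    [diff4 f]. The difference vanishes for [y] or [z] equal to [0] and, by periodicity, to [PI]. *)
Definition diff4 (u : field2) (b a y z : R) : R :=
  u a (b + y + z) - u a (b + y - z) - u a (b - y + z) + u a (b - y - z).

Lemma diff4_sym (u : field2) (b a y z : R) : diff4 u b a y z = diff4 u b a z y.
Proof. unfold diff4. replace (b + z + y) with (b + y + z) by ring. replace (b + z - y) with (b - y + z) by ring. replace (b - z + y) with (b + y - z) by ring. replace (b - z - y) with (b - y - z) by ring. ring. Qed.

Lemma diff4_mean (u ub ubb : field2) (b a y z : R) : 0 < y -> 0 < z ->
  (forall a b, D (fun t => u a t) b (ub a b)) -> (forall a b, D (fun t => ub a t) b (ubb a b)) ->
  exists c, Rabs (c - b) <= y + z /\ diff4 u b a y z = 4 * y * z * ubb a c.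
Proof.
  intros Hy Hz H1 H2.
  assert (HD : forall s, D (fun s => u a (s + z) - u a (s - z)) s (ub a (s + z) - ub a (s - z))).
  { intros s; apply (D_minus (fun s => u a (s + z)) (fun s => u a (s - z))).
    - apply (D_shift (fun t => u a t)); auto.
    - apply (D_shift (fun t => u a t) (- z)); auto. }
  destruct (mean_value (fun s => u a (s + z) - u a (s - z)) (fun s => ub a (s + z) - ub a (s - z)) (b - y) (b + y))
    as [c [Hc E]]; auto; try lra.
  { intros s _; eapply D_cont; apply HD. }
  destruct (mean_value (fun t => ub a t) (fun t => ubb a t) (c - z) (c + z)) as [d [Hd E']]; auto; try lra.
  { intros s _; eapply D_cont; apply H2. }
  exists d; split; [apply Rabs_le_between; lra|].
  unfold diff4. replace (u a (b + y + z) - u a (b + y - z) - u a (b - y + z) + u a (b - y - z)) with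
    (u a (b + y + z) - u a (b + y - z) - (u a (b - y + z) - u a (b - y - z))) by ring.
  rewrite E, E'. ring.
Qed.

(** A positive interior maximum of [diff4 u] minus the barrier is impossible: there the three second
    derivatives in [a], [y], [z] are nonpositive, and combined with the equation they force
    [diff4 f] below [- 4 * H * P], where [P] is the power [th] of the smaller of [y] and [z].
    Hoelder continuity forbids this. *)
Lemma diff4_upper (L th H : R) (u ua ub uaa uab ubb f : field2) (b : R) :
  0 < L -> 0 < th <= 1 -> 0 < H -> C2s L u ua ub uaa uab ubb ->
  (forall a b, 0 < a < L -> uaa a b + ubb a b = f a b) -> holb th H f ->
  dirichlet L u \/ dirichlet L ua ->
  forall a y z, 0 <= a <= L -> 0 <= y <= PI -> 0 <= z <= PI ->
    diff4 u b a y z <= y * z * ((800 + L ^ 2) * (H / th)).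
Proof.
  intros HL Ht HH [[U1 [U2 [U3 [U4 U5]]]] [[V1 [V2 [V3 [V4 V5]]]] [W1 [W2 [W3 [W4 W5]]]]]] Hf Hh Hbc.
  pose proof PI_le_4 as HPI.
  (* Averaging the inequalities in [y] and [z] gives [diff4 ubb <= - 40 * H * P] because
     [k * th = 80 * H]. This must beat [4 * H * P] from [f] and [2 * H * y * z <= 32 * H * P] from
     the quadratic part of the barrier, where [PI <= 4] is used. *)
  set (k := 80 * (H / th)). set (Kp := pw PI th).
  assert (Hth : 0 < H / th) by (apply Rdiv_lt_0_compat; lra).
  assert (Hk : 0 < k) by (unfold k; lra).
  (* The powers of [y] and [z] supply the negative second derivatives, and [2 * Kp] keeps the
     bracket nonnegative. The parabola centred at [L / 2] serves Neumann data: its slope at the two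
     sides makes the derivative of [diff4 u - bar] point inwards. *)
  set (bar := fun a y z => y * z * (k * (2 * Kp - pw y th - pw z th) + H * ((a - L / 2) * (a - L / 2)))).
  assert (Hbar0 : forall a y z, 0 <= y <= PI -> 0 <= z <= PI -> 0 <= bar a y z).
  { intros a y z Hy Hz; unfold bar. apply Rmult_le_pos; [nra|].
    assert (pw y th <= Kp) by (apply pw_le; lra). assert (pw z th <= Kp) by (apply pw_le; lra).
    assert (0 <= (a - L / 2) * (a - L / 2)) by apply Rle_0_sqr. nra. }
  assert (Hper : forall a t, u a (t + 2 * PI) = u a t) by apply U1.
  assert (HY0 : forall a z, diff4 u b a 0 z = 0) by (intros; unfold diff4; rewrite Rplus_0_r, Rminus_0_r; ring).
  assert (HYP : forall a z, diff4 u b a PI z = 0).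
  { intros; unfold diff4. rewrite <- (Hper a (b - PI + z)), <- (Hper a (b - PI - z)).
    replace (b - PI + z + 2 * PI) with (b + PI + z) by ring. replace (b - PI - z + 2 * PI) with (b + PI - z) by ring. ring. }
  set (S := fun x y z => 0 <= x <= L /\ 0 <= y <= PI /\ 0 <= z <= PI).
  set (g := fun a y z => diff4 u b a y z - bar a y z).
  assert (Main : forall a y z, S a y z -> g a y z <= 0).
  2:{ intros a y z Ha Hy Hz. specialize (Main a y z (conj Ha (conj Hy Hz))). unfold g in Main.
      apply Rle_trans with (bar a y z); [lra|]. unfold bar. apply Rmult_le_compat_l; [nra|].
      assert (Kp <= 5) by (unfold Kp; apply Rle_trans with (1 + PI); [apply pw_le_one_plus; lra|lra]).
      pose proof (pw_nonneg y th); pose proof (pw_nonneg z th).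
      assert ((a - L / 2) * (a - L / 2) <= L ^ 2) by nra.
      assert (H <= H / th). { apply Rmult_le_reg_r with th; [lra|]. replace (H / th * th) with H by (field; lra). nra. }
      assert (k * (2 * Kp - pw y th - pw z th) <= k * 10) by (apply Rmult_le_compat_l; lra).
      assert (H * ((a - L / 2) * (a - L / 2)) <= H / th * L ^ 2).
      { apply Rmult_le_compat; try lra. apply Rle_0_sqr. }
      unfold k in *. lra. }
  destruct (max_attained3 S g) as [a [y [z [[Ha [Hy Hz]] Hmax]]]].
  { apply closed3_box. } { apply bounded3_box. }
  { unfold g, diff4, bar. hcont; try (apply (cont_on3_comp2 S u)); hcont; try (apply UC_pointwise, U1);
    try (apply (cont_on3_comp1 S (fun x => pw x th)); hcont; intros; apply pw_ctn; lra). }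
  { exists 0, 0, 0; unfold S; lra. }
  destruct (Rle_lt_dec (g a y z) 0) as [Hg|Hg]; [intros a' y' z' HS; specialize (Hmax a' y' z' HS); lra|].
  exfalso.
  assert (Hb0 := Hbar0 a y z Hy Hz).
  assert (Hy' : 0 < y < PI).
  { split; apply Rnot_le_lt; intros Hc; unfold g in Hg.
    - replace y with 0 in * by lra. rewrite HY0 in Hg; lra.
    - replace y with PI in * by lra. rewrite HYP in Hg; lra. }
  assert (Hz' : 0 < z < PI).
  { split; apply Rnot_le_lt; intros Hc; unfold g in Hg.
    - replace z with 0 in * by lra. rewrite diff4_sym, HY0 in Hg; lra.
    - replace z with PI in * by lra. rewrite diff4_sym, HYP in Hg; lra. }
  assert (Hyz : 0 < y * z) by nra.
  set (G1 := fun x => diff4 ua b x y z - y * z * (H * (2 * (x - L / 2)))).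
  assert (DG : forall x, 0 < x < L -> D (fun x => g x y z) x (G1 x)).
  { intros x Hx. unfold g, G1, diff4, bar. dsplit; try (apply U4; auto). ring. }
  assert (CG : ctn (fun x => g x y z)).
  { unfold g, diff4, bar, Rminus. repeat apply ctn_plus; repeat apply ctn_opp; try (apply (UC_ctn1 u), U1).
    intros x; eapply D_cont; repeat dstep. }
  assert (CG1 : ctn G1).
  { unfold G1, diff4, Rminus. repeat apply ctn_plus; repeat apply ctn_opp; try (apply (UC_ctn1 ua), V1).
    intros x; eapply D_cont; repeat dstep. }
  assert (Ha' : 0 < a < L).
  { destruct Hbc as [Hd|Hn].
    - split; apply Rnot_le_lt; intros Hc; unfold g, diff4 in Hg.
      + replace a with 0 in * by lra. rewrite !(proj1 (Hd _)) in Hg; lra.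
      + replace a with L in * by lra. rewrite !(proj2 (Hd _)) in Hg; lra.
    - split; apply Rnot_le_lt; intros Hc.
      + replace a with 0 in * by lra.
        destruct (endpoint_left (fun x => g x y z) G1 L HL CG CG1 DG) with (r := L) as [x [Hx [Hx' Hx'']]]; auto.
        * unfold G1, diff4; rewrite !(proj1 (Hn _)). assert (0 < y * z * (H * L)) by (apply Rmult_lt_0_compat; nra). lra.
        * specialize (Hmax x y z ltac:(unfold S; lra)). lra.
      + replace a with L in * by lra.
        destruct (endpoint_right (fun x => g x y z) G1 L HL CG CG1 DG) with (r := L) as [x [Hx [Hx' Hx'']]]; auto.
        * unfold G1, diff4; rewrite !(proj2 (Hn _)). assert (0 < y * z * (H * L)) by (apply Rmult_lt_0_compat; nra). lra.
        * specialize (Hmax x y z ltac:(unfold S; lra)). lra. }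
  assert (Saa : diff4 uaa b a y z - y * z * (H * 2) <= 0).
  { apply (max_second_derivative (fun x => g x y z) G1 a _ (Rmin a (L - a))); [apply Rmin_pos; lra| |].
    - intros x Hx. rmin_bounds a (L - a). apply Rabs_lt_between in Hx.
      split; [apply Hmax; unfold S; lra|apply DG; lra].
    - unfold G1, diff4. dsplit; try (apply V4; auto). ring. }
  set (c0 := H * ((a - L / 2) * (a - L / 2))).
  assert (Sdir : forall y z, 0 < y < PI -> (forall t, 0 <= t <= PI -> g a t z <= g a y z) -> diff4 ubb b a y z + z * (k * ((1 + th) * (th * Rpower y (th - 1)))) <= 0).
  { clear y z Hy Hz Hmax Hg Hb0 Hy' Hz' Hyz G1 DG CG CG1 Saa. intros y z Hy Hmax. apply (max_second_derivative (fun t => g a t z)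
      (fun t => (ub a (b + t + z) - ub a (b + t - z) + ub a (b - t + z) - ub a (b - t - z))
          - z * (k * (2 * Kp - pw z th) + c0 - k * ((1 + th) * pw t th))) y _ (Rmin y (PI - y))); [apply Rmin_pos; lra| |].
    - intros t Hx. rmin_bounds y (PI - y). apply Rabs_lt_between in Hx.
      split; [apply Hmax; lra|].
      apply D_ext with (fun t => u a (t + (b + z)) - u a (t + (b - z)) - u a ((b + z) - t) + u a ((b - z) - t)
         - z * ((k * (2 * Kp - pw z th) + c0) * t - k * (t * pw t th))).
      { intros s; unfold g, diff4, bar, c0. replace (b + s + z) with (s + (b + z)) by ring. replace (b + s - z) with (s + (b - z)) by ring.
        replace (b - s + z) with (b + z - s) by ring. replace (b - s - z) with (b - z - s) by ring. ring. }
      dsplitw; try apply (D_shift (fun t => u a t)); try apply (D_mirror (fun t => u a t)); try apply U5.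
      replace (t + (b + z)) with (b + t + z) by ring. replace (t + (b - z)) with (b + t - z) by ring.
      replace (b + z - t) with (b - t + z) by ring. replace (b - z - t) with (b - t - z) by ring. ring.
    - apply D_ext with (fun t => ub a (t + (b + z)) - ub a (t + (b - z)) + ub a ((b + z) - t) - ub a ((b - z) - t)
         - z * (k * (2 * Kp - pw z th) + c0 - k * ((1 + th) * pw t th))).
      { intros s. replace (b + s + z) with (s + (b + z)) by ring. replace (b + s - z) with (s + (b - z)) by ring.
        replace (b - s + z) with (b + z - s) by ring. replace (b - s - z) with (b - z - s) by ring. ring. }
      dsplitw; try apply (D_shift (fun t => ub a t)); try apply (D_mirror (fun t => ub a t)); try apply W5.
      replace (y + (b + z)) with (b + y + z) by ring. replace (y + (b - z)) with (b + y - z) by ring.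
      replace (b + z - y) with (b - y + z) by ring. replace (b - z - y) with (b - y - z) by ring. unfold diff4. ring. }
  assert (Syy : diff4 ubb b a y z + z * (k * ((1 + th) * (th * Rpower y (th - 1)))) <= 0) by (apply Sdir; auto; intros; apply Hmax; unfold S; lra).
  assert (Szz : diff4 ubb b a y z + y * (k * ((1 + th) * (th * Rpower z (th - 1)))) <= 0).
  { rewrite diff4_sym. apply Sdir; auto. assert (Gs : forall y z, g a y z = g a z y) by (intros; unfold g, bar; rewrite diff4_sym; ring).
    intros. rewrite !(Gs _ y). apply Hmax; unfold S; lra. }
  set (m := Rmin y z). set (P := pw m th).
  assert (Hm : 0 < m) by (apply Rmin_pos; lra). assert (HP : 0 < P) by (apply pw_pos; auto).
  assert (m <= y) by apply Rmin_l. assert (m <= z) by apply Rmin_r.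
  assert (HF : - (4 * (H * P)) <= diff4 f b a y z).
  { assert (W : forall y z, 0 < y -> - (4 * (H * pw y th)) <= diff4 f b a y z).
    { clear - Hh Ht HH. intros y z Hy. unfold diff4.
      assert (K1 := Hh a (b - y + z) (b + y + z)). assert (K2 := Hh a (b - y - z) (b + y - z)).
      replace (b + y + z - (b - y + z)) with (2 * y) in K1 by ring. replace (b + y - z - (b - y - z)) with (2 * y) in K2 by ring.
      rewrite (Rabs_right (2 * y)) in K1, K2 by lra.
      assert (K3 := pw_le_mult_one_plus 2 y th ltac:(lra) ltac:(lra) ltac:(lra)).
      apply (Rmult_le_compat_l H) in K3; [|lra]. apply Rabs_le_between in K1, K2. lra. }
    unfold P, m, Rmin. destruct (Rle_dec y z); [|rewrite diff4_sym]; apply W; lra. }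
  assert (HF2 : diff4 f b a y z = diff4 uaa b a y z + diff4 ubb b a y z).
  { unfold diff4; rewrite <- !Hf by auto; ring. }
  assert (Hmb : P <= z * Rpower y (th - 1) + y * Rpower z (th - 1)).
  { unfold P, m, Rmin; destruct (Rle_dec y z); [apply barrier_power; lra|].
    rewrite Rplus_comm; apply barrier_power; lra. }
  assert (Hyz2 : y * z <= 16 * P).
  { assert (m <= 4 * P) by (apply le_mult_pw; lra). assert (y * z <= 4 * m); [|lra].
    unfold m, Rmin; destruct (Rle_dec y z); nra. }
  assert (Hkk : k * th = 80 * H) by (unfold k; field; lra).
  set (Q := z * Rpower y (th - 1) + y * Rpower z (th - 1)) in *.
  assert (k * ((1 + th) * (th * Q)) >= 80 * H * P).
  { replace (k * ((1 + th) * (th * Q))) with (k * th * ((1 + th) * Q)) by ring. rewrite Hkk.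
    apply Rle_ge. apply Rmult_le_compat_l; nra. }
  unfold Q in *. nra.
Qed.

(** With [y = z] small, [diff4 u] is [4 * y * y] times a value of [ubb] close to the given point, so
    the constant [800] of the barrier estimate becomes [200]. *)
Lemma Schauder_bb (L th H : R) (u ua ub uaa uab ubb f : field2) :
  0 < L -> 0 < th <= 1 -> 0 < H -> C2s L u ua ub uaa uab ubb ->
  (forall a b, 0 < a < L -> uaa a b + ubb a b = f a b) -> holb th H f ->
  dirichlet L u \/ dirichlet L ua ->
  forall a b, ubb a b <= (200 + L ^ 2) * (H / th).
Proof.
  intros HL Ht HH Hu Hf Hh Hbc a b. pose proof PI_le_4.
  destruct Hu as [[U1 [U2 [U3 [U4 U5]]]] [[V1 [V2 [V3 [V4 V5]]]] [W1 [W2 [W3 [W4 W5]]]]]] eqn:E.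
  clear E. apply Rnot_lt_le; intros Hlt. set (C := (200 + L ^ 2) * (H / th)) in *.
  destruct W3 as [W3a [W3b W3c]].
  destruct (W3a (ubb a b - C) ltac:(lra)) as [d [Hd Hd']].
  set (y := Rmin (d / 3) 1). assert (0 < y) by (apply Rmin_pos; lra).
  assert (y <= d / 3) by apply Rmin_l. assert (y <= 1) by apply Rmin_r.
  assert (K := diff4_upper L th H u ua ub uaa uab ubb f b HL Ht HH).
  specialize (K ltac:(auto) Hf Hh Hbc (clamp L a) y y (clamp_range L a ltac:(lra)) ltac:(lra) ltac:(lra)).
  destruct (diff4_mean u ub ubb b (clamp L a) y y) as [c [Hc Ec]]; auto.
  rewrite Ec, W3b in K.
  specialize (Hd' a b a c ltac:(rdiag) ltac:(lra)). apply Rabs_lt_between in Hd'.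
  assert (0 < H / th) by (apply Rdiv_lt_0_compat; lra).
  assert (0 <= L ^ 2) by nra.
  assert (y * y * ((800 + L ^ 2) * (H / th)) <= 4 * y * y * C).
  { unfold C. replace (4 * y * y * ((200 + L ^ 2) * (H / th))) with (y * y * ((800 + 4 * L ^ 2) * (H / th))) by ring.
    apply Rmult_le_compat_l; [nra|]. apply Rmult_le_compat_r; lra. }
  assert (4 * y * y * C < 4 * y * y * ubb a c) by (apply Rmult_lt_compat_l; nra). lra.
Qed.
(** In the variables [(a, y)] it solves the Poisson equation with right-hand side [diff2 f]. It
    vanishes at [y = 0] and, by periodicity, at [y = PI]. *)
Definition diff2 (u : field2) (b a y : R) : R := u a (b + y) - u a (b - y).

Lemma diff2_periodic (u : field2) (b a : R) : (forall a t, u a (t + 2 * PI) = u a t) -> diff2 u b a PI = 0.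
Proof.
  intros Hp; unfold diff2. rewrite <- (Hp a (b - PI)). replace (b - PI + 2 * PI) with (b + PI) by ring. ring.
Qed.

Lemma D_affine_pw (c s p x : R) : 0 < c + s * x ->
  D (fun x => (c + s * x) * pw (c + s * x) p) x (s * ((1 + p) * pw (c + s * x) p)).
Proof.
  intros H. apply D_eq with ((1 + p) * pw (c + s * x) p * s); [ring|].
  apply (D_comp (fun x => c + s * x) (fun y => y * pw y p)); [dsplit; ring|apply D_id_pw; auto].
Qed.

Lemma D_affine_pw1 (c s p x : R) : 0 < c + s * x ->
  D (fun x => pw (c + s * x) p) x (s * (p * Rpower (c + s * x) (p - 1))).
Proof.
  intros H. apply D_eq with (p * Rpower (c + s * x) (p - 1) * s); [ring|].
  apply (D_comp (fun x => c + s * x) (fun y => pw y p)); [dsplit; ring|apply D_pw; auto].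
Qed.

(* The affine function [c + s a] is the distance to one of the two sides of the strip. *)
Lemma diff2_upper (L th H c s : R) (u ua ub uaa uab ubb f : field2) (b : R) :
  0 < L -> 0 < th <= 1 -> 0 < H -> C2s L u ua ub uaa uab ubb ->
  (forall a b, 0 < a < L -> uaa a b + ubb a b = f a b) -> holb th H f ->
  dirichlet L u -> s * s = 1 -> (forall a, 0 < a < L -> 0 < c + s * a) -> (forall a, 0 <= a <= L -> 0 <= c + s * a <= L) ->
  forall a y, 0 <= a <= L -> 0 <= y <= PI ->
    diff2 u b a y <= (c + s * a) * y * (3 * (6 + L) * (H / th)).
Proof.
  intros HL Ht HH [[U1 [U2 [U3 [U4 U5]]]] [[V1 [V2 [V3 [V4 V5]]]] [W1 [W2 [W3 [W4 W5]]]]]] Hf Hh Hd Hs He He'.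
  pose proof PI_le_4 as HPI.
  (* Adding the second-order conditions in [a] and [y] gives [diff2 f <= - 3 * H * P], while Hoelder
     continuity gives [diff2 f >= - 2 * H * P]. *)
  set (k := 3 * (H / th)). set (K := pw L th + pw PI th).
  assert (Hth : 0 < H / th) by (apply Rdiv_lt_0_compat; lra).
  assert (Hk : 0 < k) by (unfold k; lra).
  (* The leading factor, distance to the side times [y], makes the barrier vanish at that side. The
     result is therefore a gradient bound at the boundary, which the mixed estimate needs for
     Dirichlet data. *)
  set (bar := fun a y => y * (k * (K * (c + s * a) - (c + s * a) * pw (c + s * a) th - pw y th * (c + s * a)))).
  assert (Ebar : forall a y, bar a y = (c + s * a) * y * (k * (K - pw (c + s * a) th - pw y th))) by (intros; unfold bar; ring).
  assert (Hbar0 : forall a y, 0 <= a <= L -> 0 <= y <= PI -> 0 <= bar a y).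
  { intros a y Ha Hy; rewrite Ebar. specialize (He' a Ha). apply Rmult_le_pos; [nra|].
    assert (pw y th <= pw PI th) by (apply pw_le; lra). assert (pw (c + s * a) th <= pw L th) by (apply pw_le; lra).
    unfold K; nra. }
  set (S := fun x y z => 0 <= x <= L /\ 0 <= y <= PI /\ 0 <= z <= 0).
  set (g := fun a y => diff2 u b a y - bar a y).
  assert (Main : forall a y z, S a y z -> g a y <= 0).
  2:{ intros a y Ha Hy. specialize (Main a y 0 (conj Ha (conj Hy (conj (Rle_refl 0) (Rle_refl 0))))). unfold g in Main.
      apply Rle_trans with (bar a y); [lra|]. rewrite Ebar. specialize (He' a Ha). apply Rmult_le_compat_l; [nra|].
      assert (K <= 6 + L) by (unfold K; pose proof (pw_le_one_plus L th ltac:(lra) ltac:(lra));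
         pose proof (pw_le_one_plus PI th ltac:(lra) ltac:(lra)); lra).
      pose proof (pw_nonneg y th). pose proof (pw_nonneg (c + s * a) th). unfold k. nra. }
  destruct (max_attained3 S (fun a y _ => g a y)) as [a [y [z [[Ha [Hy Hz]] Hmax]]]].
  { apply closed3_box. } { apply bounded3_box. }
  { hcont; try (apply (cont_on3_comp2 S u)); hcont; try (apply UC_pointwise, U1);
    try (apply (cont_on3_comp1 S (fun x => pw x th)); hcont; intros; apply pw_ctn; lra). }
  { exists 0, 0, 0; unfold S; lra. }
  destruct (Rle_lt_dec (g a y) 0) as [Hg|Hg]; [intros a' y' z' HS; specialize (Hmax a' y' z' HS); lra|].
  exfalso.
  assert (Hb0 := Hbar0 a y Ha Hy).
  assert (Hy' : 0 < y < PI).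
  { split; apply Rnot_le_lt; intros Hc; unfold g in Hg.
    - replace y with 0 in * by lra. unfold diff2 in Hg; rewrite Rplus_0_r, Rminus_0_r in Hg; lra.
    - replace y with PI in * by lra. rewrite diff2_periodic in Hg by apply U1; lra. }
  assert (Ha' : 0 < a < L).
  { split; apply Rnot_le_lt; intros Hc; unfold g, diff2 in Hg.
    - replace a with 0 in * by lra. rewrite !(proj1 (Hd _)) in Hg; lra.
    - replace a with L in * by lra. rewrite !(proj2 (Hd _)) in Hg; lra. }
  assert (Hea := He a Ha'). set (e := c + s * a) in *.
  assert (Saa : diff2 uaa b a y + y * (k * ((1 + th) * (th * Rpower e (th - 1)))) <= 0).
  { apply (max_second_derivative (fun x => g x y)
      (fun x => diff2 ua b x y - y * (k * (K * s - s * ((1 + th) * pw (c + s * x) th) - pw y th * s)))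
      a _ (Rmin a (L - a))); [apply Rmin_pos; lra| |].
    - intros x Hx. rmin_bounds a (L - a). apply Rabs_lt_between in Hx.
      split; [apply (Hmax x y 0); unfold S; lra|].
      unfold g, diff2, bar. eapply D_eq; cycle 1.
      { repeat first [apply D_affine_pw; apply He; lra | dstep]; apply U4; lra. } ring.
    - unfold diff2. eapply D_eq; cycle 1.
      { repeat first [apply D_affine_pw1; apply He; lra | dstep]; apply V4; lra. }
      fold e. replace (s * ((1 + th) * (s * (th * Rpower e (th - 1))))) with (s * s * ((1 + th) * (th * Rpower e (th - 1)))) by ring.
      rewrite Hs; ring. }
  assert (Syy : diff2 ubb b a y + e * (k * ((1 + th) * (th * Rpower y (th - 1)))) <= 0).
  { apply (max_second_derivative (fun t => g a t)
      (fun t => (ub a (t + b) + ub a (b - t)) - e * (k * (K - pw e th - (1 + th) * pw t th))) y _ (Rmin y (PI - y))); [apply Rmin_pos; lra| |].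
    - intros t Hx. rmin_bounds y (PI - y). apply Rabs_lt_between in Hx.
      split; [apply (Hmax a t 0); unfold S; lra|].
      apply D_ext with (fun t => u a (t + b) - u a (b - t) - e * (k * ((K - pw e th) * t - t * pw t th))).
      { intros x; unfold g, diff2, bar. fold e. rewrite (Rplus_comm b x). ring. }
      dsplitw; try apply (D_shift (fun t => u a t)); try apply (D_mirror (fun t => u a t)); try apply U5. ring.
    - dsplitw; try apply (D_shift (fun t => ub a t)); try apply (D_mirror (fun t => ub a t)); try apply W5.
      unfold diff2. rewrite (Rplus_comm b y). ring. }
  set (P := pw y th). assert (HP : 0 < P) by (apply pw_pos; lra).
  assert (HF : - (2 * (H * P)) <= diff2 f b a y).
  { unfold diff2. assert (K1 := Hh a (b - y) (b + y)). replace (b + y - (b - y)) with (2 * y) in K1 by ring.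
    rewrite (Rabs_right (2 * y)) in K1 by lra.
    assert (H1 := pw_le_mult_one_plus 2 y th ltac:(lra) ltac:(lra) ltac:(lra)). fold P in H1.
    apply Rabs_le_between in K1. nra. }
  assert (HF2 : diff2 f b a y = diff2 uaa b a y + diff2 ubb b a y).
  { unfold diff2; rewrite <- !Hf by auto; ring. }
  assert (Hmb : P <= e * Rpower y (th - 1) + y * Rpower e (th - 1)) by (apply barrier_power; lra).
  assert (Hkk : k * th = 3 * H) by (unfold k; field; lra).
  set (Q := e * Rpower y (th - 1) + y * Rpower e (th - 1)) in *.
  assert (k * ((1 + th) * (th * Q)) >= 3 * H * P).
  { replace (k * ((1 + th) * (th * Q))) with (k * th * ((1 + th) * Q)) by ring. rewrite Hkk.
    apply Rle_ge. apply Rmult_le_compat_l; nra. }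
  unfold Q in *. nra.
Qed.

Lemma closed3_triangle (L h : R) : closed3 (fun x x' y => 0 <= x' /\ x' <= x /\ x <= L /\ 0 <= y <= h).
Proof.
  intros x x' y H. repeat split; apply Rnot_lt_le; intros Hlt.
  - destruct (H (- x') ltac:(lra)) as [p [q [r [H1 [H2 [H3 H4]]]]]]; apply Rabs_lt_between in H2, H3, H4; lra.
  - destruct (H ((x' - x) / 2) ltac:(lra)) as [p [q [r [H1 [H2 [H3 H4]]]]]]; apply Rabs_lt_between in H2, H3, H4; lra.
  - destruct (H (x - L) ltac:(lra)) as [p [q [r [H1 [H2 [H3 H4]]]]]]; apply Rabs_lt_between in H2, H3, H4; lra.
  - destruct (H (- y) ltac:(lra)) as [p [q [r [H1 [H2 [H3 H4]]]]]]; apply Rabs_lt_between in H2, H3, H4; lra.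
  - destruct (H (y - h) ltac:(lra)) as [p [q [r [H1 [H2 [H3 H4]]]]]]; apply Rabs_lt_between in H2, H3, H4; lra.
Qed.

Lemma bounded3_triangle (L h : R) : bounded3 (fun x x' y => 0 <= x' /\ x' <= x /\ x <= L /\ 0 <= y <= h).
Proof. exists (Rmax L h); intros x y z H. pose proof (Rmax_l L h). pose proof (Rmax_r L h). rewrite !Rabs_right; lra. Qed.

(** The difference of [diff2 u] at [a] and [a'], divided by [(a - a') * y], approximates twice
    [uab]. It is maximised over the triangle [a' <= a] with [a] and [a'] as independent variables,
    so the Laplacian acts on both copies and [f] enters only through differences in [b] at each of
    them. On the sides a maximum is excluded by the barrier for Neumann data, and by the boundary
    gradient bound [C0] for Dirichlet data. *)
Lemma mixed_upper (L th H C0 : R) (u ua ub uaa uab ubb f : field2) (b : R) :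
  0 < L -> 0 < th <= 1 -> 0 < H -> 0 <= C0 -> C2s L u ua ub uaa uab ubb ->
  (forall a b, 0 < a < L -> uaa a b + ubb a b = f a b) -> holb th H f ->
  (dirichlet L ua) \/ (dirichlet L u /\ forall a y, 0 <= a <= L -> 0 <= y <= PI ->
     diff2 u b a y <= a * y * C0 /\ - diff2 u b a y <= (L - a) * y * C0) ->
  forall a a' y, 0 <= a' -> a' <= a -> a <= L -> 0 <= y <= PI ->
    diff2 u b a y - diff2 u b a' y <= (a - a') * y * (C0 + 5 * (8 + 2 * L) * (H / th)).
Proof.
  intros HL Ht HH HC0 [[U1 [U2 [U3 [U4 U5]]]] [[V1 [V2 [V3 [V4 V5]]]] [W1 [W2 [W3 [W4 W5]]]]]] Hf Hh Hbc.
  pose proof PI_le_4 as HPI.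
  (* The two copies of [diff2 f] contribute at most [4 * H * P], which [k * th = 5 * H] exceeds. [K]
     leaves room for twice the power of [a - a'], since differentiating that part of the barrier in
     [a] produces the factor [1 + th <= 2]. *)
  set (k := 5 * (H / th)). set (K := 8 + 2 * L).
  assert (Hth : 0 < H / th) by (apply Rdiv_lt_0_compat; lra).
  assert (Hk : 0 < k) by (unfold k; lra).
  set (bar := fun a a' y => y * ((C0 + k * (K - pw y th)) * (a - a') - k * ((a - a') * pw (a - a') th))).
  assert (Ebar : forall a a' y, bar a a' y = (a - a') * y * (C0 + k * (K - pw (a - a') th - pw y th))) by (intros; unfold bar; ring).
  assert (HK : forall a a' y, 0 <= a' -> a' <= a -> a <= L -> 0 <= y <= PI -> 0 < K - 2 * pw (a - a') th - pw y th).
  { intros a a' y H1 H2 H3 H4. pose proof (pw_le_one_plus (a - a') th ltac:(lra) ltac:(lra)). pose proof (pw_le_one_plus y th ltac:(lra) ltac:(lra)). unfold K; lra. }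
  assert (Hbar1 : forall a a' y, 0 <= a' -> a' <= a -> a <= L -> 0 <= y <= PI -> (a - a') * y * C0 <= bar a a' y).
  { intros a a' y H1 H2 H3 H4; rewrite Ebar. specialize (HK a a' y H1 H2 H3 H4). pose proof (pw_nonneg (a - a') th).
    apply Rmult_le_compat_l; [nra|]. nra. }
  set (S := fun x x' y => 0 <= x' /\ x' <= x /\ x <= L /\ 0 <= y <= PI).
  set (g := fun a a' y => diff2 u b a y - diff2 u b a' y - bar a a' y).
  assert (Main : forall a a' y, S a a' y -> g a a' y <= 0).
  2:{ intros a a' y H1 H2 H3 H4. specialize (Main a a' y (conj H1 (conj H2 (conj H3 H4)))). unfold g in Main.
      apply Rle_trans with (bar a a' y); [lra|]. rewrite Ebar. apply Rmult_le_compat_l; [nra|].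
      pose proof (pw_nonneg y th). pose proof (pw_nonneg (a - a') th). unfold k, K in *.
      assert (5 * (H / th) * (8 + 2 * L - pw (a - a') th - pw y th) <= 5 * (H / th) * (8 + 2 * L)) by (apply Rmult_le_compat_l; lra). lra. }
  destruct (max_attained3 S g) as [a [a' [y [[Ha1 [Ha2 [Ha3 Hy]]] Hmax]]]].
  { apply closed3_triangle. } { apply bounded3_triangle. }
  { hcont; try (apply (cont_on3_comp2 S u)); hcont; try (apply UC_pointwise, U1);
    try (apply (cont_on3_comp1 S (fun x => pw x th)); hcont; intros; apply pw_ctn; lra). }
  { exists 0, 0, 0; unfold S; lra. }
  destruct (Rle_lt_dec (g a a' y) 0) as [Hg|Hg]; [intros p q r HS; specialize (Hmax p q r HS); lra|].
  exfalso.
  assert (Hb1 := Hbar1 a a' y Ha1 Ha2 Ha3 Hy).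
  assert (Hb2 : 0 <= (a - a') * y * C0) by (apply Rmult_le_pos; nra).
  assert (Hy' : 0 < y < PI).
  { split; apply Rnot_le_lt; intros Hc; unfold g in Hg.
    - replace y with 0 in * by lra. unfold diff2 in Hg; rewrite !Rplus_0_r, !Rminus_0_r in Hg; lra.
    - replace y with PI in * by lra. rewrite !diff2_periodic in Hg by apply U1; lra. }
  assert (Haa : a' < a).
  { apply Rnot_le_lt; intros Hc. replace a with a' in * by lra. unfold g in Hg; lra. }
  set (G1 := fun x => diff2 ua b x y - y * (C0 + k * (K - pw y th) - k * ((1 + th) * pw (x - a') th))).
  set (G2 := fun x => - diff2 ua b x y + y * (C0 + k * (K - pw y th) - k * ((1 + th) * pw (a - x) th))).
  assert (DG1 : forall x, 0 < x < L -> a' < x -> D (fun x => g x a' y) x (G1 x)).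
  { intros x Hx Hx'. apply D_ext with (fun x => diff2 u b x y - diff2 u b a' y -
       y * ((C0 + k * (K - pw y th)) * (x - a') - k * ((- a' + 1 * x) * pw (- a' + 1 * x) th))).
    { intros t; unfold g, bar. replace (- a' + 1 * t) with (t - a') by ring. auto. }
    unfold diff2. eapply D_eq; cycle 1.
    { repeat first [apply D_affine_pw; lra | dstep]; apply U4; lra. }
    unfold G1, diff2. replace (- a' + 1 * x) with (x - a') by ring. ring. }
  assert (DG2 : forall x, 0 < x < L -> x < a -> D (fun x => g a x y) x (G2 x)).
  { intros x Hx Hx'. apply D_ext with (fun x => diff2 u b a y - diff2 u b x y -
       y * ((C0 + k * (K - pw y th)) * (a - x) - k * ((a + (-1) * x) * pw (a + (-1) * x) th))).
    { intros t; unfold g, bar. replace (a + -1 * t) with (a - t) by ring. auto. }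
    unfold diff2. eapply D_eq; cycle 1.
    { repeat first [apply D_affine_pw; lra | dstep]; apply U4; lra. }
    unfold G2, diff2. replace (a + -1 * x) with (a - x) by ring. ring. }
  assert (Hzp : 0 < y * (C0 + k * (K - pw y th) - k * ((1 + th) * pw (a - a') th))).
  { apply Rmult_lt_0_compat; [lra|]. specialize (HK a a' y Ha1 Ha2 Ha3 Hy). pose proof (pw_nonneg (a - a') th).
    assert (0 < k * (K - pw y th - (1 + th) * pw (a - a') th)) by (apply Rmult_lt_0_compat; nra). lra. }
  assert (Ha4 : 0 < a' /\ a < L).
  { destruct Hbc as [Hn|[Hd Hd']].
    - split; apply Rnot_le_lt; intros Hc.
      + replace a' with 0 in * by lra.
        destruct (endpoint_left (fun x => g a x y) G2 a) with (r := a) as [x [Hx [Hx' Hx'']]]; auto; try lra.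
        * unfold g, diff2, bar. repeat cstep; apply (UC_ctn1 u), U1.
        * unfold G2, diff2. repeat cstep; apply (UC_ctn1 ua), V1.
        * intros; apply DG2; lra.
        * unfold G2. unfold diff2; rewrite !(proj1 (Hn _)). lra.
        * specialize (Hmax a x y ltac:(unfold S; lra)). lra.
      + replace a with L in * by lra.
        destruct (endpoint_right (fun x => g (x + a') a' y) (fun x => G1 (x + a')) (L - a')) with (r := L - a') as [x [Hx [Hx' Hx'']]]; auto; try lra.
        * unfold g, diff2, bar. repeat cstep; apply (ctn_comp (fun x => x + a') (fun t => u t _)); repeat cstep; apply (UC_ctn1 u), U1.
        * unfold G1, diff2. repeat cstep; apply (ctn_comp (fun x => x + a') (fun t => ua t _)); repeat cstep; apply (UC_ctn1 ua), V1.
        * intros x Hx; apply (D_shift (fun x => g x a' y)), DG1; lra.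
        * replace (L - a' + a') with L by ring. unfold G1. unfold diff2; rewrite !(proj2 (Hn _)). lra.
        * replace (L - a' + a') with L in Hx'' by ring. specialize (Hmax (x + a') a' y ltac:(unfold S; lra)). lra.
    (* On a Dirichlet side one of the two copies of [diff2 u] vanishes and the other is bounded by
       [C0] times the distance to that side times [y], an amount already contained in the
       barrier. *)
    - split; apply Rnot_le_lt; intros Hc; unfold g in Hg.
      + replace a' with 0 in * by lra. destruct (Hd' a y ltac:(lra) Hy) as [Hq _].
        unfold diff2 at 2 in Hg; rewrite !(proj1 (Hd _)) in Hg. rewrite Rminus_0_r in Hb1. lra.
      + replace a with L in * by lra. destruct (Hd' a' y ltac:(lra) Hy) as [_ Hq].
        unfold diff2 at 1 in Hg; rewrite !(proj2 (Hd _)) in Hg. lra. }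
  set (z := a - a') in *. assert (Hz : 0 < z) by (unfold z; lra).
  set (E := k * ((1 + th) * (th * Rpower z (th - 1)))).
  assert (S1 : diff2 uaa b a y + y * E <= 0).
  { apply (max_second_derivative (fun x => g x a' y) G1 a _ (Rmin (a - a') (L - a))); [apply Rmin_pos; lra| |].
    - intros x Hx. rmin_bounds (a - a') (L - a). apply Rabs_lt_between in Hx.
      split; [apply (Hmax x a' y); unfold S; lra|apply DG1; lra].
    - apply D_ext with (fun x => diff2 ua b x y - y * (C0 + k * (K - pw y th) - k * ((1 + th) * pw (- a' + 1 * x) th))).
      { intros t; unfold G1. replace (- a' + 1 * t) with (t - a') by ring. auto. }
      unfold diff2. eapply D_eq; cycle 1.
      { repeat first [apply D_affine_pw1; lra | dstep]; apply V4; lra. }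
      unfold diff2, E. replace (- a' + 1 * a) with z by (unfold z; ring). ring. }
  assert (S2 : - diff2 uaa b a' y + y * E <= 0).
  { apply (max_second_derivative (fun x => g a x y) G2 a' _ (Rmin a' (a - a'))); [apply Rmin_pos; lra| |].
    - intros x Hx. rmin_bounds a' (a - a'). apply Rabs_lt_between in Hx.
      split; [apply (Hmax a x y); unfold S; lra|apply DG2; lra].
    - apply D_ext with (fun x => - diff2 ua b x y + y * (C0 + k * (K - pw y th) - k * ((1 + th) * pw (a + (-1) * x) th))).
      { intros t; unfold G2. replace (a + -1 * t) with (a - t) by ring. auto. }
      unfold diff2. eapply D_eq; cycle 1.
      { repeat first [apply D_affine_pw1; lra | dstep]; apply V4; lra. }
      unfold diff2, E. replace (a + -1 * a') with z by (unfold z; ring). ring. }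
  assert (S3 : diff2 ubb b a y - diff2 ubb b a' y + z * (k * ((1 + th) * (th * Rpower y (th - 1)))) <= 0).
  { apply (max_second_derivative (fun t => g a a' t)
      (fun t => (ub a (t + b) + ub a (b - t)) - (ub a' (t + b) + ub a' (b - t))
         - z * (C0 + k * (K - pw z th) - k * ((1 + th) * pw t th))) y _ (Rmin y (PI - y))); [apply Rmin_pos; lra| |].
    - intros t Hx. rmin_bounds y (PI - y). apply Rabs_lt_between in Hx.
      split; [apply (Hmax a a' t); unfold S; lra|].
      apply D_ext with (fun t => (u a (t + b) - u a (b - t)) - (u a' (t + b) - u a' (b - t))
          - z * ((C0 + k * (K - pw z th)) * t - k * (t * pw t th))).
      { intros x; unfold g, diff2, bar. fold z. rewrite (Rplus_comm b x). ring. }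
      dsplitw; try apply (D_shift (fun t => u a t)); try apply (D_mirror (fun t => u a t));
        try apply (D_shift (fun t => u a' t)); try apply (D_mirror (fun t => u a' t)); try apply U5. ring.
    - dsplitw; try apply (D_shift (fun t => ub a t)); try apply (D_mirror (fun t => ub a t));
        try apply (D_shift (fun t => ub a' t)); try apply (D_mirror (fun t => ub a' t)); try apply W5.
      unfold diff2. rewrite (Rplus_comm b y). ring. }
  set (P := pw y th). assert (HP : 0 < P) by (apply pw_pos; lra).
  assert (HF : forall x, Rabs (diff2 f b x y) <= 2 * (H * P)).
  { intros x; unfold diff2. assert (K1 := Hh x (b - y) (b + y)). replace (b + y - (b - y)) with (2 * y) in K1 by ring.
    rewrite (Rabs_right (2 * y)) in K1 by lra.
    assert (H1 := pw_le_mult_one_plus 2 y th ltac:(lra) ltac:(lra) ltac:(lra)). fold P in H1.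
    nra. }
  assert (F1 := HF a). assert (F2 := HF a'). apply Rabs_le_between in F1, F2.
  assert (HF2 : forall x, 0 < x < L -> diff2 f b x y = diff2 uaa b x y + diff2 ubb b x y).
  { intros; unfold diff2; rewrite <- !Hf by auto; ring. }
  rewrite HF2 in F1, F2 by lra.
  assert (Hmb : P <= z * Rpower y (th - 1) + y * Rpower z (th - 1)) by (apply barrier_power; lra).
  assert (Hkk : k * th = 5 * H) by (unfold k; field; lra).
  set (Q := z * Rpower y (th - 1) + y * Rpower z (th - 1)) in *.
  assert (k * ((1 + th) * (th * Q)) >= 5 * H * P).
  { replace (k * ((1 + th) * (th * Q))) with (k * th * ((1 + th) * Q)) by ring. rewrite Hkk.
    apply Rle_ge. apply Rmult_le_compat_l; nra. }
  assert (0 <= y * E).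
  { assert (0 < Rpower z (th - 1)) by apply exp_pos. apply Rmult_le_pos; [lra|]. apply Rmult_le_pos; [lra|].
    apply Rmult_le_pos; [lra|]. apply Rmult_le_pos; lra. }
  assert (EQ : y * E + z * (k * ((1 + th) * (th * Rpower y (th - 1)))) = k * ((1 + th) * (th * Q))) by (unfold E, Q; ring).
  assert (0 < H * P) by (apply Rmult_lt_0_compat; lra). lra.
Qed.

(** * Bounds for all derivatives up to second order *)

Lemma C2s_plus (L : R) (u ua ub uaa uab ubb v va vb vaa vab vbb : field2) :
  C2s L u ua ub uaa uab ubb -> C2s L v va vb vaa vab vbb ->
  C2s L (fun a b => u a b + v a b) (fun a b => ua a b + va a b) (fun a b => ub a b + vb a b)
    (fun a b => uaa a b + vaa a b) (fun a b => uab a b + vab a b) (fun a b => ubb a b + vbb a b).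
Proof. intros [H1 [H2 H3]] [K1 [K2 K3]]; split; [|split]; apply C1s_plus; auto. Qed.

Lemma C2s_scal (L c : R) (u ua ub uaa uab ubb : field2) : 0 <= L -> C2s L u ua ub uaa uab ubb ->
  C2s L (fun a b => c * u a b) (fun a b => c * ua a b) (fun a b => c * ub a b)
    (fun a b => c * uaa a b) (fun a b => c * uab a b) (fun a b => c * ubb a b).
Proof. intros HL [H1 [H2 H3]]; split; [|split]; apply C1s_scal; auto. Qed.

Lemma holb_scal (th H c : R) (f : field2) : holb th H f -> holb th (Rabs c * H) (fun a b => c * f a b).
Proof.
  intros Hf a b b'. rewrite <- Rmult_minus_distr_l, Rabs_mult, Rmult_assoc.
  apply Rmult_le_compat_l; [apply Rabs_pos|apply Hf].
Qed.

Lemma holb_opp (th H : R) (f : field2) : holb th H f -> holb th H (fun a b => -1 * f a b).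
Proof. intros Hf; apply (holb_scal th H (-1)) in Hf. replace (Rabs (-1) * H) with H in Hf by (rewrite Rabs_left; lra). auto. Qed.

Lemma lipschitz_a (L : R) (u ua ub : field2) (M : R) : 0 <= L -> C1s L u ua ub -> (forall a b, Rabs (ua a b) <= M) ->
  forall a a' b, Rabs (u a b - u a' b) <= M * Rabs (a - a').
Proof.
  intros HL [H1 [_ [_ [H4 _]]]] HM.
  assert (M0 : 0 <= M) by (apply Rle_trans with (2 := HM 0 0), Rabs_pos).
  assert (K : forall a a' b, 0 <= a' -> a' < a -> a <= L -> Rabs (u a b - u a' b) <= M * Rabs (a - a')).
  { intros a a' b Ha Ha' Ha''. destruct (mean_value (fun x => u x b) (fun x => ua x b) a' a) as [c [Hc E]]; auto.
    - intros; apply H4; lra.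
    - intros; apply UC_ctn1, H1.
    - rewrite E, Rabs_mult. apply Rmult_le_compat_r; auto; apply Rabs_pos. }
  intros a a' b. destruct H1 as [_ [Hc _]]. rewrite <- (Hc a), <- (Hc a').
  apply Rle_trans with (M * Rabs (clamp L a - clamp L a')); [|apply Rmult_le_compat_l; auto; apply clamp_lip; auto].
  pose proof (clamp_range L a HL). pose proof (clamp_range L a' HL).
  destruct (Rtotal_order (clamp L a) (clamp L a')) as [T|[->|T]].
  - rewrite Rabs_minus_sym, (Rabs_minus_sym (clamp L a)). apply K; lra.
  - rewrite !Rminus_diag, Rabs_R0; lra.
  - apply K; lra.
Qed.

Lemma lipschitz_b (u ub : field2) (M : R) : (forall a b, D (fun y => u a y) b (ub a b)) -> (forall a b, Rabs (ub a b) <= M) ->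
  forall a b b', Rabs (u a b - u a b') <= M * Rabs (b - b').
Proof.
  intros H5 HM.
  assert (K : forall a b b', b' < b -> Rabs (u a b - u a b') <= M * Rabs (b - b')).
  { intros a b b' Hb. destruct (mean_value (fun x => u a x) (fun x => ub a x) b' b) as [c [Hc E]]; auto.
    - intros; eapply D_cont; apply H5.
    - rewrite E, Rabs_mult. apply Rmult_le_compat_r; auto; apply Rabs_pos. }
  intros a b b'. destruct (Rtotal_order b b') as [H|[->|H]].
  - rewrite Rabs_minus_sym, (Rabs_minus_sym b). apply K; lra.
  - rewrite !Rminus_diag, Rabs_R0; lra.
  - apply K; lra.
Qed.

(** The constant is [3 * (6 + L)] from the boundary gradient bound plus [5 * (8 + 2 * L)] from the
    mixed barrier. At the side [a = L] the gradient bound is applied to [- u] with the distance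
    [L - a]. The final passage to the limit takes two nearby abscissae inside the strip. *)
Lemma Schauder_ab_upper (L th H : R) (u ua ub uaa uab ubb f : field2) :
  0 < L -> 0 < th <= 1 -> 0 < H -> C2s L u ua ub uaa uab ubb ->
  (forall a b, 0 < a < L -> uaa a b + ubb a b = f a b) -> holb th H f ->
  dirichlet L u \/ dirichlet L ua ->
  forall a b, uab a b <= (58 + 13 * L) * (H / th).
Proof.
  intros HL Ht HH Hu Hf Hh Hbc a b. pose proof PI_le_4.
  assert (Hth : 0 < H / th) by (apply Rdiv_lt_0_compat; lra).
  assert (K : forall a a' y, 0 <= a' -> a' <= a -> a <= L -> 0 <= y <= PI ->
    diff2 u b a y - diff2 u b a' y <= (a - a') * y * ((58 + 13 * L) * (H / th))).
  { intros p p' y H1 H2 H3 H4.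
    eapply Rle_trans; [apply (mixed_upper L th H (3 * (6 + L) * (H / th)) u ua ub uaa uab ubb f b HL Ht HH); auto; [nra|]|].
    - destruct Hbc as [Hd|Hn]; [right|left; auto]. split; auto. intros q z Hq Hz; split.
      + assert (Q := diff2_upper L th H 0 1 u ua ub uaa uab ubb f b HL Ht HH Hu Hf Hh Hd ltac:(lra)
           ltac:(intros; lra) ltac:(intros; lra) q z Hq Hz). rewrite Rplus_0_l, Rmult_1_l in Q; auto.
      + assert (Hf' : forall a b, 0 < a < L -> -1 * uaa a b + -1 * ubb a b = -1 * f a b) by (intros; rewrite <- Hf; [ring|auto]).
        assert (Q := diff2_upper L th H L (-1) _ _ _ _ _ _ _ b HL Ht HH (C2s_scal L (-1) _ _ _ _ _ _ ltac:(lra) Hu)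
           Hf' (holb_opp _ _ _ Hh)
           ltac:(intros x; destruct (Hd x) as [-> ->]; lra) ltac:(lra)
           ltac:(intros; lra) ltac:(intros; lra) q z Hq Hz). unfold diff2 in *.
        replace (L + -1 * q) with (L - q) in Q by ring. lra.
    - apply Rmult_le_compat_l; [nra|]. nra. }
  destruct Hu as [[U1 [U2 [U3 [U4 U5]]]] [[V1 [V2 [V3 [V4 V5]]]] [W1 [W2 [W3 [W4 W5]]]]]].
  apply Rnot_lt_le; intros Hlt. set (C := (58 + 13 * L) * (H / th)) in *.
  assert (HC : 0 < C) by (unfold C; apply Rmult_lt_0_compat; lra).
  destruct V3 as [V3a [V3b V3c]].
  destruct (V3a (uab a b - C) ltac:(lra)) as [d [Hd Hd']].
  rewrite <- V3b in Hlt.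
  set (p := clamp L a) in *. assert (Hp := clamp_range L a ltac:(lra)). fold p in Hp.
  set (y := Rmin (d / 2) 1). assert (0 < y) by (apply Rmin_pos; lra).
  assert (y <= d / 2) by apply Rmin_l. assert (y <= 1) by apply Rmin_r.
  set (m := Rmin (d / 2) (L / 2)). assert (0 < m) by (apply Rmin_pos; lra).
  assert (m <= d / 2) by apply Rmin_l. assert (m <= L / 2) by apply Rmin_r.
  assert (exists a1 a2, 0 <= a1 /\ a1 < a2 /\ a2 <= L /\ p - d < a1 /\ a2 < p + d) as [a1 [a2 [A1 [A2 [A3 [A4 A5]]]]]].
  { destruct (Rle_dec p (L / 2)); [exists p, (p + m)|exists (p - m), p]; repeat split; lra. }
  specialize (K a2 a1 y ltac:(lra) ltac:(lra) ltac:(lra) ltac:(lra)).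
  destruct (mean_value (fun x => diff2 u b x y) (fun x => diff2 ua b x y) a1 a2) as [c [Hc E]]; auto.
  { intros x Hx; unfold diff2; apply (D_minus (fun x => u x (b + y)) (fun x => u x (b - y))); apply U4; lra. }
  { intros x Hx; unfold diff2. apply (ctn_minus (fun x => u x (b + y)) (fun x => u x (b - y))); apply UC_ctn1, U1. }
  destruct (mean_value (fun t => ua c t) (fun t => uab c t) (b - y) (b + y)) as [e [He E']]; auto; try lra.
  { intros x Hx; eapply D_cont; apply V5. }
  unfold diff2 in E at 3. rewrite E' in E. rewrite E in K.
  specialize (Hd' p b c e ltac:(apply Rabs_lt_between; lra) ltac:(apply Rabs_lt_between; lra)). apply Rabs_lt_between in Hd'.
  assert (C < uab c e).
  { assert (uab p b = uab a b) by (unfold p; apply V3b). lra. }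
  assert ((a2 - a1) * y * C < uab c e * (b + y - (b - y)) * (a2 - a1)); [|lra].
  replace (uab c e * (b + y - (b - y)) * (a2 - a1)) with ((a2 - a1) * y * (2 * uab c e)) by ring.
  apply Rmult_lt_compat_l; [apply Rmult_lt_0_compat; lra|lra].
Qed.

Lemma le_of_eps_coef (x K H th : R) : 0 < th -> 0 <= K -> (forall eta, 0 < eta -> x <= K * ((H + eta) / th)) -> x <= K * (H / th).
Proof.
  intros Ht HK Hx. apply Rnot_lt_le; intros Hlt.
  set (e := x - K * (H / th)). specialize (Hx (e * th / (2 * (K + 1)))).
  assert (He : 0 < e) by (unfold e; lra).
  assert (0 < e * th / (2 * (K + 1))) by (apply Rdiv_lt_0_compat; nra). replace (K * ((H + e * th / (2 * (K + 1))) / th)) with (K * (H / th) + e * (K / (2 * (K + 1)))) in Hx by (field; lra).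
  assert (K / (2 * (K + 1)) < 1) by (apply Rmult_lt_reg_r with (2 * (K + 1)); [lra|]; unfold Rdiv; rewrite Rmult_assoc, Rinv_l; lra).
  unfold e in *. nra.
Qed.

Lemma Schauder_second (L th H : R) (u ua ub uaa uab ubb f : field2) :
  0 < L -> 0 < th <= 1 -> 0 <= H -> C2s L u ua ub uaa uab ubb ->
  (forall a b, uaa a b + ubb a b = f a b) -> holb th H f ->
  dirichlet L u \/ dirichlet L ua ->
  forall a b, Rabs (ubb a b) <= (200 + L ^ 2) * (H / th) /\ Rabs (uab a b) <= (58 + 13 * L) * (H / th).
Proof.
  intros HL Ht HH Hu Hf Hh Hbc a b.
  assert (Hu' := C2s_scal L (-1) _ _ _ _ _ _ ltac:(lra) Hu).
  (* The barriers need a positive Hoelder constant, so [H] is enlarged by [eta], which then tends to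
     zero. *)
  assert (Hh1 : forall eta, 0 < eta -> holb th (H + eta) f).
  { intros eta He x y y'. specialize (Hh x y y'). pose proof (pw_nonneg (Rabs (y' - y)) th). nra. }
  assert (Hf' : forall a b, 0 < a < L -> -1 * uaa a b + -1 * ubb a b = -1 * f a b) by (intros; rewrite <- Hf; ring).
  assert (Hbc' : dirichlet L (fun a b => -1 * u a b) \/ dirichlet L (fun a b => -1 * ua a b)).
  { destruct Hbc as [Hd|Hd]; [left|right]; intros x; destruct (Hd x) as [-> ->]; lra. }
  assert (B1 : ubb a b <= (200 + L ^ 2) * (H / th)).
  { apply le_of_eps_coef; [lra|nra|]; intros eta He.
    apply (Schauder_bb L th (H + eta) u ua ub uaa uab ubb f); auto; lra. }
  assert (B2 : -1 * ubb a b <= (200 + L ^ 2) * (H / th)).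
  { apply le_of_eps_coef; [lra|nra|]; intros eta He.
    apply (Schauder_bb L th (H + eta) _ _ _ _ _ _ (fun a b => -1 * f a b) HL Ht ltac:(lra) Hu'); auto. apply holb_opp; auto. }
  assert (B3 : uab a b <= (58 + 13 * L) * (H / th)).
  { apply le_of_eps_coef; [lra|nra|]; intros eta He.
    apply (Schauder_ab_upper L th (H + eta) u ua ub uaa uab ubb f); auto; lra. }
  assert (B4 : -1 * uab a b <= (58 + 13 * L) * (H / th)).
  { apply le_of_eps_coef; [lra|nra|]; intros eta He.
    apply (Schauder_ab_upper L th (H + eta) _ _ _ _ _ _ (fun a b => -1 * f a b) HL Ht ltac:(lra) Hu'); auto. apply holb_opp; auto. }
  split; apply Rabs_le_between; lra.
Qed.

(* [d = true] is the Dirichlet problem (with [kap = 0]), [d = false] the Neumann problem, which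
   is solvable only up to the mean [kap] of the right-hand side. *)
Definition bc (d : bool) (L kap : R) (u ua : field2) : Prop :=
  if d then dirichlet L u /\ kap = 0 else dirichlet L ua /\ u 0 0 = 0.

Definition Sol (d : bool) (L kap : R) (f u ua ub uaa uab ubb : field2) : Prop :=
  C2s L u ua ub uaa uab ubb /\ bc d L kap u ua /\ forall a b, uaa a b + ubb a b = f a b - kap.

Lemma Sol_plus (d : bool) (L k1 k2 : R) (f u ua ub uaa uab ubb g v va vb vaa vab vbb : field2) :
  Sol d L k1 f u ua ub uaa uab ubb -> Sol d L k2 g v va vb vaa vab vbb ->
  Sol d L (k1 + k2) (fun a b => f a b + g a b) (fun a b => u a b + v a b) (fun a b => ua a b + va a b)
    (fun a b => ub a b + vb a b) (fun a b => uaa a b + vaa a b) (fun a b => uab a b + vab a b) (fun a b => ubb a b + vbb a b).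
Proof.
  intros [H1 [H2 H3]] [K1 [K2 K3]]. split; [apply C2s_plus; auto|]. split.
  - destruct d; destruct H2 as [Hd Hk]; destruct K2 as [Kd Kk]; split; try lra;
      intros b; destruct (Hd b) as [-> ->]; destruct (Kd b) as [-> ->]; lra.
  - intros a b; specialize (H3 a b); specialize (K3 a b); lra.
Qed.

Lemma Sol_scal (d : bool) (L k c : R) (f u ua ub uaa uab ubb : field2) : 0 <= L ->
  Sol d L k f u ua ub uaa uab ubb ->
  Sol d L (c * k) (fun a b => c * f a b) (fun a b => c * u a b) (fun a b => c * ua a b)
    (fun a b => c * ub a b) (fun a b => c * uaa a b) (fun a b => c * uab a b) (fun a b => c * ubb a b).
Proof.
  intros HL [H1 [H2 H3]]. split; [apply C2s_scal; auto|]. split.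
  - destruct d; destruct H2 as [Hd Hk]; split; try (rewrite Hk; ring);
      intros b; destruct (Hd b) as [-> ->]; lra.
  - intros a b; rewrite <- !Rmult_plus_distr_l, H3; ring.
Qed.

Lemma Sol_minus (d : bool) (L k1 k2 : R) (f u ua ub uaa uab ubb g v va vb vaa vab vbb : field2) : 0 <= L ->
  Sol d L k1 f u ua ub uaa uab ubb -> Sol d L k2 g v va vb vaa vab vbb ->
  Sol d L (k1 + -1 * k2) (fun a b => f a b + -1 * g a b) (fun a b => u a b + -1 * v a b) (fun a b => ua a b + -1 * va a b)
    (fun a b => ub a b + -1 * vb a b) (fun a b => uaa a b + -1 * vaa a b) (fun a b => uab a b + -1 * vab a b) (fun a b => ubb a b + -1 * vbb a b).
Proof. intros HL H1 H2; apply (Sol_plus d L k1 (-1 * k2)); auto. apply Sol_scal; auto. Qed.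

(** Integrating the Neumann problem over the strip removes the Laplacian, by the side conditions and
    periodicity, and identifies [k] as the mean of [f]. *)
Lemma Sol_kap (d : bool) (L k M : R) (f u ua ub uaa uab ubb : field2) : 0 < L -> UC f ->
  Sol d L k f u ua ub uaa uab ubb -> (forall a b, Rabs (f a b) <= M) -> Rabs k <= M.
Proof.
  intros HL Uf [[H1 [H2 H3]] [Hb He]] HM. destruct d.
  { destruct Hb as [_ ->]. rewrite Rabs_R0. apply Rle_trans with (2 := HM 0 0), Rabs_pos. }
  destruct Hb as [Hn _]. pose proof PI_RGT_0.
  assert (E : II L f = k * (2 * PI * L)).
  { assert (E1 := II_da L ua uaa uab HL H2). assert (E2 := II_db L ub uab ubb HL H3).
    assert (Z : forall x, (forall b, ua x b = 0) -> cint ua x = 0).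
    { intros x Hx; unfold cint. rewrite (RI_ext _ (fun _ => 0)) by auto. rewrite RI_const; ring. }
    rewrite !Z in E1 by (intros b; apply Hn).
    assert (E3 : II L (fun a b => uaa a b + ubb a b) = 0) by (rewrite II_plus; [lra|apply H2|apply H3]).
    rewrite (II_ext L _ (fun a b => f a b - k)) in E3 by auto.
    rewrite II_minus in E3; auto using UC_const.
    assert (II L (fun _ _ => k) = k * (2 * PI * L)).
    { unfold II. rewrite (RI_ext _ (fun _ => k * (2 * PI))) by (intros; apply cint_const). rewrite RI_const; ring. }
    lra. }
  assert (B := II_bound L f M ltac:(lra) Uf HM). rewrite E, Rabs_mult, (Rabs_right (2 * PI * L)) in B by nra.
  apply Rmult_le_reg_r with (2 * PI * L); nra.
Qed.

(** One generous constant for all derivatives. Two integrations across the strip raise the quadratic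
    bounds for second derivatives to degree four in [L]; the numbers are compared coefficient by
    coefficient with the expansion of the fourth power. *)
Definition KS (L : R) : R := 20000 * (1 + L) ^ 4.

(** From the second derivatives downwards: [uaa] follows from the equation, [ub] vanishes somewhere
    in each period by Rolle's theorem, [ua] vanishes somewhere on each line across the strip by
    Rolle's theorem or the Neumann condition, and [u] is anchored at the side [a = 0] by the
    boundary value or by the normalisation [u 0 0 = 0]. *)
Lemma Schauder (d : bool) (L th H M k : R) (f u ua ub uaa uab ubb : field2) :
  0 < L -> 0 < th <= 1 -> 0 <= H -> UC f -> Sol d L k f u ua ub uaa uab ubb -> holb th H f ->
  (forall a b, Rabs (f a b) <= M) ->
  forall a b, Rabs (u a b) <= KS L * (M + H / th) /\ Rabs (ua a b) <= KS L * (M + H / th) /\ Rabs (ub a b) <= KS L * (M + H / th) /\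
    Rabs (uaa a b) <= KS L * (M + H / th) /\ Rabs (uab a b) <= KS L * (M + H / th) /\ Rabs (ubb a b) <= KS L * (M + H / th).
Proof.
  intros HL Ht HH Uf HS Hh HM.
  assert (Hk := Sol_kap d L k M f u ua ub uaa uab ubb HL Uf HS HM).
  destruct HS as [Hu [Hb He]].
  pose proof PI_le_4 as HPI.
  assert (M0 : 0 <= M) by (apply Rle_trans with (2 := HM 0 0), Rabs_pos).
  assert (Hth : 0 <= H / th) by (apply Rmult_le_pos; [lra|left; apply Rinv_0_lt_compat; lra]).
  set (X := H / th) in *.
  assert (B2 : forall a b, Rabs (ubb a b) <= (200 + L ^ 2) * X /\ Rabs (uab a b) <= (58 + 13 * L) * X).
  { apply (Schauder_second L th H u ua ub uaa uab ubb (fun a b => f a b - k)); auto; try lra.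
    - intros a b b'. replace (f a b' - k - (f a b - k)) with (f a b' - f a b) by ring. apply Hh.
    - destruct d; [left|right]; apply Hb. }
  assert (Baa : forall a b, Rabs (uaa a b) <= 2 * M + (200 + L ^ 2) * X).
  { intros a b. replace (uaa a b) with (f a b - k - ubb a b) by (rewrite <- He; ring).
    destruct (B2 a b) as [Q _]. specialize (HM a b). apply Rabs_le_between in Q, HM, Hk. apply Rabs_le_between; lra. }
  destruct Hu as [H1 [H2 H3]].
  assert (Bb : forall a b, Rabs (ub a b) <= 8 * ((200 + L ^ 2) * X)).
  { intros a b. destruct H1 as [[Uu [_ Hp]] [_ [_ [_ Db]]]]. destruct H3 as [_ [_ [_ [_ Dbb]]]].
    destruct (mean_value (fun y => u a y) (fun y => ub a y) b (b + 2 * PI)) as [c [Hc E]]; auto; try lra.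
    { intros; eapply D_cont; apply Db. }
    rewrite Hp in E. assert (Hz : ub a c = 0) by nra.
    assert (Q := lipschitz_b ub ubb ((200 + L ^ 2) * X) Dbb ltac:(intros; apply B2) a b c). rewrite Hz, Rminus_0_r in Q.
    assert (Rabs (b - c) <= 8) by (apply Rabs_le_between; lra).
    assert (0 <= (200 + L ^ 2) * X) by nra. nra. }
  set (A := 2 * M + (200 + L ^ 2) * X) in *. assert (HA : 0 <= A) by (unfold A; nra).
  assert (Ba : forall a b, Rabs (ua a b) <= A * L).
  { assert (Ba0 : forall a b, 0 <= a <= L -> Rabs (ua a b) <= A * L).
    { intros a b Ha.
      assert (exists c, 0 <= c <= L /\ ua c b = 0) as [c [Hc Hc']].
      { destruct d; destruct Hb as [Hd _].
        - destruct (mean_value (fun x => u x b) (fun x => ua x b) 0 L) as [c [Hc E]]; auto.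
          + intros; apply H1; auto.
          + intros; apply UC_ctn1, H1.
          + destruct (Hd b) as [E1 E2]. rewrite E1, E2 in E. exists c; split; [lra|nra].
        - exists 0; split; [lra|apply Hd]. }
      assert (Q := lipschitz_a L ua uaa uab A ltac:(lra) H2 Baa a c b). rewrite Hc', Rminus_0_r in Q.
      assert (Rabs (a - c) <= L) by (apply Rabs_le_between; lra). nra. }
    intros a b. destruct H2 as [[_ [Hc _]] _]. rewrite <- Hc. apply Ba0, clamp_range; lra. }
  assert (Bu : forall a b, Rabs (u a b) <= A * L * L + 8 * (8 * ((200 + L ^ 2) * X))).
  { intros a b. assert (P1 : 0 <= 8 * ((200 + L ^ 2) * X)) by nra.
    assert (Q : Rabs (u a b - u 0 b) <= A * L * L).
    { destruct H1 as [C1 C2]. assert (Q := lipschitz_a L u ua ub (A * L) ltac:(lra) (conj C1 C2) Ba (clamp L a) 0 b).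
      destruct C1 as [_ [Cc _]]. rewrite Cc in Q. pose proof (clamp_range L a ltac:(lra)).
      assert (Rabs (clamp L a - 0) <= L) by (apply Rabs_le_between; lra). assert (0 <= A * L) by nra. nra. }
    assert (Q2 : Rabs (u 0 b) <= 8 * (8 * ((200 + L ^ 2) * X))).
    { destruct d; destruct Hb as [Hd Hd'].
      - destruct (Hd b) as [-> _]. rewrite Rabs_R0; lra.
      - destruct H1 as [[_ [_ Hp]] [_ [_ [_ Db]]]]. destruct (period_reduce b) as [z Hz].
        rewrite <- (periodic_Z (fun b => u 0 b) (Hp 0) z b).
        assert (Q3 := lipschitz_b u ub _ Db Bb 0 (b + 2 * PI * IZR z) 0). rewrite Hd', Rminus_0_r in Q3.
        assert (Rabs (b + 2 * PI * IZR z - 0) <= 8) by (apply Rabs_le_between; lra). nra. }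
    apply Rabs_le_between in Q, Q2. apply Rabs_le_between; lra. }
  assert (HKS : KS L = 20000 * (1 + 4 * L + 6 * L ^ 2 + 4 * L ^ 3 + L ^ 4)) by (unfold KS; ring).
  assert (0 < L ^ 2 /\ 0 < L ^ 3 /\ 0 < L ^ 4) as [L2 [L3 L4]] by (repeat split; apply pow_lt; auto).
  assert (Pos : forall c0 c1 c2 c3 c4 e0 e1 e2 e3 e4, 0 <= c0 <= 20000 -> 0 <= c1 <= 80000 -> 0 <= c2 <= 120000 -> 0 <= c3 <= 80000 -> 0 <= c4 <= 20000 ->
     0 <= e0 <= 20000 -> 0 <= e1 <= 80000 -> 0 <= e2 <= 120000 -> 0 <= e3 <= 80000 -> 0 <= e4 <= 20000 ->
     (c0 + c1 * L + c2 * L ^ 2 + c3 * L ^ 3 + c4 * L ^ 4) * M + (e0 + e1 * L + e2 * L ^ 2 + e3 * L ^ 3 + e4 * L ^ 4) * X <= KS L * (M + X)).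
  { intros. rewrite HKS, Rmult_plus_distr_l. apply Rplus_le_compat; apply Rmult_le_compat_r; auto; nra. }
  intros a b. destruct (B2 a b) as [Q1 Q2].
  split; [|split; [|split; [|split; [|split]]]].
  - eapply Rle_trans; [apply Bu|]. eapply Rle_trans; [|apply (Pos 0 0 2 0 0 12800 0 264 0 1); lra]. unfold A; lra.
  - eapply Rle_trans; [apply Ba|]. eapply Rle_trans; [|apply (Pos 0 2 0 0 0 0 200 0 1 0); lra]. unfold A; lra.
  - eapply Rle_trans; [apply Bb|]. eapply Rle_trans; [|apply (Pos 0 0 0 0 0 1600 0 8 0 0); lra]. lra.
  - eapply Rle_trans; [apply Baa|]. eapply Rle_trans; [|apply (Pos 2 0 0 0 0 200 0 1 0 0); lra]. unfold A; lra.
  - eapply Rle_trans; [apply Q2|]. eapply Rle_trans; [|apply (Pos 0 0 0 0 0 58 13 0 0 0); lra]. lra.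
  - eapply Rle_trans; [apply Q1|]. eapply Rle_trans; [|apply (Pos 0 0 0 0 0 200 0 1 0 0); lra]. lra.
Qed.
(** * Solvability of the Poisson problem *)

Lemma D_exp_lin (w x : R) : D (fun x => exp (w * x)) x (w * exp (w * x)).
Proof.
  apply D_eq with (exp (w * x) * (w * 1)); [ring|].
  apply (D_comp (fun x => w * x) exp); [apply D_scal, D_id|apply derivable_pt_lim_exp].
Qed.

Lemma ctn_exp_lin (w : R) : ctn (fun x => exp (w * x)).
Proof. intros x; eapply D_cont; apply D_exp_lin. Qed.

(** Variation of constants: the solution is the integral of [sinh (w * (x - s)) * g s / w] over
    [[0, x]], with [sinh] split into exponentials so that each integrand depends on [s] alone. *)
Lemma ode_particular (w : R) (g : R -> R) : 0 < w -> ctn g -> exists v v1, v 0 = 0 /\ v1 0 = 0 /\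
  (forall x, D v x (v1 x)) /\ (forall x, D v1 x (w * w * v x + g x)).
Proof.
  intros Hw Hg.
  set (P := fun x => RInt (fun s => exp (- w * s) * g s) 0 x).
  set (Q := fun x => RInt (fun s => exp (w * s) * g s) 0 x).
  assert (DP : forall x, D P x (exp (- w * x) * g x)).
  { intros x; apply (RI_derive (fun s => exp (- w * s) * g s)). apply ctn_mult; auto. apply ctn_exp_lin. }
  assert (DQ : forall x, D Q x (exp (w * x) * g x)).
  { intros x; apply (RI_derive (fun s => exp (w * s) * g s)). apply ctn_mult; auto. apply ctn_exp_lin. }
  assert (E : forall x, exp (w * x) * exp (- w * x) = 1) by (intros; rewrite <- exp_plus; replace (w * x + - w * x) with 0 by ring; apply exp_0).
  assert (P0 : P 0 = 0) by (unfold P; apply RI_point). assert (Q0 : Q 0 = 0) by (unfold Q; apply RI_point).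
  exists (fun x => / (2 * w) * (exp (w * x) * P x - exp (- w * x) * Q x)),
         (fun x => / 2 * (exp (w * x) * P x + exp (- w * x) * Q x)).
  split; [rewrite P0, Q0; ring|]. split; [rewrite P0, Q0; ring|].
  split; intros x; (eapply D_eq; cycle 1; [repeat dstep; first [exact (D_exp_lin _ _) | exact (DP _) | exact (DQ _)]|]).
  - replace (exp (w * x) * (exp (- w * x) * g x)) with (g x) by (rewrite <- Rmult_assoc, E; ring).
    replace (exp (- w * x) * (exp (w * x) * g x)) with (g x) by (rewrite <- Rmult_assoc, (Rmult_comm (exp (- w * x))), E; ring).
    field; lra.
  - replace (exp (w * x) * (exp (- w * x) * g x)) with (g x) by (rewrite <- Rmult_assoc, E; ring).
    replace (exp (- w * x) * (exp (w * x) * g x)) with (g x) by (rewrite <- Rmult_assoc, (Rmult_comm (exp (- w * x))), E; ring).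
    field; lra.
Qed.

(** Homogeneous solutions adjust the condition at [L]. This fails only for the zero mode with
    Neumann data, where the integral of the right-hand side must vanish; there the mean of [g] is
    removed by [kap]. *)
Lemma ode_solve (d : bool) (L w : R) (g : R -> R) : 0 < L -> 0 <= w -> ctn g ->
  exists kap v v1, (forall x, D v x (v1 x)) /\ (forall x, D v1 x (w * w * v x + g x - kap)) /\
   (if d then v 0 = 0 /\ v L = 0 else v1 0 = 0 /\ v1 L = 0) /\ (d = true \/ 0 < w -> kap = 0).
Proof.
  intros HL Hw Hg. destruct Hw as [Hw|<-].
  - destruct (ode_particular w g Hw Hg) as [v [v1 [Z0 [Z1 [Dv Dv1]]]]].
    assert (HE : 0 < exp (w * L) - exp (- w * L)).
    { assert (exp (- w * L) < exp (w * L)) by (apply exp_increasing; nra). lra. }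
    assert (E0 : forall c, exp (c * 0) = 1) by (intros; rewrite Rmult_0_r; apply exp_0).
    destruct d.
    (* The correction is a multiple of [sinh (w * x)], which keeps the value at [0]; the Neumann
       case below uses [cosh (w * x)], which keeps the slope at [0]. *)
    + set (c := v L / (exp (w * L) - exp (- w * L))).
      exists 0, (fun x => v x - c * (exp (w * x) - exp (- w * x))), (fun x => v1 x - c * (w * exp (w * x) - (- w) * exp (- w * x))).
      split; [|split; [|split]]; auto.
      * intros x; eapply D_eq; cycle 1; [repeat dstep; first [exact (D_exp_lin _ _) | exact (Dv _)]|]; ring.
      * intros x. eapply D_eq; cycle 1; [repeat dstep; first [exact (D_exp_lin _ _) | exact (Dv1 _)]|]. ring.
      * split; [rewrite !E0, Z0; ring|]. unfold c; field; lra.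
    + set (c := v1 L / (w * (exp (w * L) - exp (- w * L)))).
      exists 0, (fun x => v x - c * (exp (w * x) + exp (- w * x))), (fun x => v1 x - c * (w * exp (w * x) + (- w) * exp (- w * x))).
      split; [|split; [|split]]; auto.
      * intros x; eapply D_eq; cycle 1; [repeat dstep; first [exact (D_exp_lin _ _) | exact (Dv _)]|]; ring.
      * intros x. eapply D_eq; cycle 1; [repeat dstep; first [exact (D_exp_lin _ _) | exact (Dv1 _)]|]. ring.
      * split; [rewrite !E0, Z1; ring|]. unfold c; field; lra.
  - set (kap := if d then 0 else RInt g 0 L / L).
    set (h := fun x => g x - kap).
    assert (Hh : ctn h) by (unfold h; repeat cstep; auto).
    set (G := fun x => RInt h 0 x). set (V := fun x => RInt G 0 x).
    assert (DG : forall x, D G x (h x)) by (intros; apply RI_derive; auto).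
    assert (DV : forall x, D V x (G x)) by (intros; apply RI_derive; intros y; eapply D_cont; apply DG).
    assert (G0 : G 0 = 0) by (unfold G; apply RI_point). assert (V0 : V 0 = 0) by (unfold V; apply RI_point).
    set (c := if d then V L / L else 0).
    exists kap, (fun x => V x - c * x), (fun x => G x - c).
    split; [|split; [|split]].
    + intros x; dsplit; [apply DV|ring].
    + intros x; dsplit; [apply DG|unfold h; ring].
    + unfold c; destruct d; split; try (rewrite ?V0, ?G0; ring); try (field; lra).
      rewrite Rminus_0_r. unfold G, h. rewrite RI_minus, RI_const by (auto using ctn_const). unfold kap. field; lra.
    + intros [-> |Hc]; [reflexivity|lra].
Qed.

Lemma C1s_of_b (L : R) (k k' : R -> R) : 0 <= L -> (forall x, D k x (k' x)) -> ctn k' ->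
  (forall b, k (b + 2 * PI) = k b) -> (forall b, k' (b + 2 * PI) = k' b) ->
  C1s L (fun _ b => k b) (fun _ _ => 0) (fun _ b => k' b).
Proof.
  intros HL Hk Hk' Hp Hp'. split; [|split; [|split; [|split]]].
  - apply CS_of_b; auto. eapply ctn_derivable; apply Hk.
  - apply CS_const.
  - apply CS_of_b; auto.
  - intros; apply D_const.
  - intros; apply Hk.
Qed.

Lemma C2s_product (L : R) (v v1 v2 k k1 k2 : R -> R) : 0 <= L ->
  (forall x, D v x (v1 x)) -> (forall x, D v1 x (v2 x)) -> ctn v2 ->
  (forall x, D k x (k1 x)) -> (forall x, D k1 x (k2 x)) -> ctn k2 ->
  (forall b, k (b + 2 * PI) = k b) -> (forall b, k1 (b + 2 * PI) = k1 b) -> (forall b, k2 (b + 2 * PI) = k2 b) ->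
  C2s L (fun a b => v (clamp L a) * k b) (fun a b => v1 (clamp L a) * k b) (fun a b => v (clamp L a) * k1 b)
    (fun a b => v2 (clamp L a) * k b) (fun a b => v1 (clamp L a) * k1 b) (fun a b => v (clamp L a) * k2 b).
Proof.
  intros HL Dv Dv1 Cv2 Dk Dk1 Ck2 P0 P1 P2.
  assert (Cv1 : ctn v1) by (eapply ctn_derivable; apply Dv1). assert (Ck1 : ctn k1) by (eapply ctn_derivable; apply Dk1).
  assert (A0 := C1s_of_a L v v1 HL ltac:(auto) ltac:(auto)). assert (A1 := C1s_of_a L v1 v2 HL ltac:(auto) ltac:(auto)).
  assert (B0 := C1s_of_b L k k1 HL Dk Ck1 P0 P1). assert (B1 := C1s_of_b L k1 k2 HL Dk1 Ck2 P1 P2).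
  split; [|split].
  - generalize (C1s_mult L _ _ _ _ _ _ HL A0 B0). apply C1s_ext; intros; ring.
  - generalize (C1s_mult L _ _ _ _ _ _ HL A1 B0). apply C1s_ext; intros; ring.
  - generalize (C1s_mult L _ _ _ _ _ _ HL A0 B1). apply C1s_ext; intros; ring.
Qed.

Definition Solvable (d : bool) (L : R) (f : field2) : Prop :=
  exists kap u ua ub uaa uab ubb, Sol d L kap f u ua ub uaa uab ubb.

Lemma Solvable_plus (d : bool) (L : R) (f g : field2) : Solvable d L f -> Solvable d L g -> Solvable d L (fun a b => f a b + g a b).
Proof.
  intros [k1 [u [ua [ub [uaa [uab [ubb H]]]]]]] [k2 [v [va [vb [vaa [vab [vbb K]]]]]]].
  do 7 eexists; eapply Sol_plus; eauto.
Qed.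

Lemma Solvable_scal (d : bool) (L c : R) (f : field2) : 0 <= L -> Solvable d L f -> Solvable d L (fun a b => c * f a b).
Proof.
  intros HL [k1 [u [ua [ub [uaa [uab [ubb H]]]]]]]. do 7 eexists; eapply Sol_scal; eauto.
Qed.

Lemma Solvable_ext (d : bool) (L : R) (f g : field2) : (forall a b, f a b = g a b) -> Solvable d L f -> Solvable d L g.
Proof.
  intros E [k [u [ua [ub [uaa [uab [ubb [H1 [H2 H3]]]]]]]]]. exists k, u, ua, ub, uaa, uab, ubb.
  split; [|split]; auto. intros; rewrite <- E; auto.
Qed.

Lemma Solvable_mode (d : bool) (L w : R) (g k k1 : R -> R) : 0 < L -> 0 <= w -> ctn g ->
  (forall x, D k x (k1 x)) -> (forall x, D k1 x (- (w * w) * k x)) ->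
  (forall b, k (b + 2 * PI) = k b) -> (forall b, k1 (b + 2 * PI) = k1 b) -> (w = 0 -> forall x, k x = k 0) ->
  Solvable d L (fun a b => g (clamp L a) * k b).
Proof.
  intros HL Hw Hg Dk Dk1 P0 P1 Hc.
  destruct (ode_solve d L w g HL Hw Hg) as [kap [v [v1 [Dv [Dv1 [Hbc Hkap]]]]]].
  (* Either the frequency is positive and [kap = 0], or [k] is constant; in both cases the
     correction is a constant, as the definition of a solution demands. *)
  assert (Hkk : forall b, kap * k b = kap * k 0).
  { intros b. destruct Hw as [Hw|Hw]; [rewrite Hkap by auto; ring|rewrite Hc; auto]. }
  assert (Ck : ctn k) by (eapply ctn_derivable; apply Dk).
  assert (Cv : ctn v) by (eapply ctn_derivable; apply Dv).
  assert (HC := C2s_product L v v1 (fun x => w * w * v x + g x - kap) k k1 (fun x => - (w * w) * k x) ltac:(lra) Dv Dv1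
     ltac:(repeat cstep; auto) Dk Dk1 ltac:(repeat cstep; auto) P0 P1 ltac:(intros; cbv beta; rewrite P0; auto)).
  assert (E0 := clamp_id L 0 ltac:(lra)). assert (EL := clamp_id L L ltac:(lra)).
  exists (kap * k 0).
  destruct d.
  - do 6 eexists. split; [exact HC|]. split.
    + destruct Hbc as [B0 BL]. split; [|rewrite Hkap by auto; ring].
      intros b; rewrite E0, EL, B0, BL; split; ring.
    + intros a b; cbv beta. rewrite <- (Hkk b). ring.
  (* Neumann solutions are fixed up to a constant; subtracting [c] achieves [u 0 0 = 0]. *)
  - set (c := v 0 * k 0).
    assert (HC' : C2s L (fun _ _ => - c) (fun _ _ => 0) (fun _ _ => 0) (fun _ _ => 0) (fun _ _ => 0) (fun _ _ => 0)).
    { split; [|split]; apply C1s_const. }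
    do 6 eexists. split; [exact (C2s_plus L _ _ _ _ _ _ _ _ _ _ _ _ HC HC')|]. split.
    + destruct Hbc as [B0 BL]. split.
      * intros b; cbv beta; rewrite E0, EL, B0, BL; split; ring.
      * rewrite E0. unfold c; ring.
    + intros a b; cbv beta. rewrite <- (Hkk b). ring.
Qed.

(** * Fourier modes and mollification by trigonometric polynomials *)

Lemma D_cos_lin (w x : R) : D (fun x => cos (w * x)) x (- w * sin (w * x)).
Proof.
  apply D_eq with (- sin (w * x) * (w * 1)); [ring|].
  apply (D_comp (fun x => w * x) cos); [apply D_scal, D_id|apply derivable_pt_lim_cos].
Qed.

Lemma D_sin_lin (w x : R) : D (fun x => sin (w * x)) x (w * cos (w * x)).
Proof.
  apply D_eq with (cos (w * x) * (w * 1)); [ring|].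
  apply (D_comp (fun x => w * x) sin); [apply D_scal, D_id|apply derivable_pt_lim_sin].
Qed.

Lemma cos_nat_period (n : nat) (b : R) : cos (INR n * (b + 2 * PI)) = cos (INR n * b).
Proof. replace (INR n * (b + 2 * PI)) with (INR n * b + 2 * INR n * PI) by ring. apply cos_period. Qed.

Lemma sin_nat_period (n : nat) (b : R) : sin (INR n * (b + 2 * PI)) = sin (INR n * b).
Proof. replace (INR n * (b + 2 * PI)) with (INR n * b + 2 * INR n * PI) by ring. apply sin_period. Qed.

Lemma Solvable_cos (d : bool) (L : R) (n : nat) (g : R -> R) : 0 < L -> ctn g -> Solvable d L (fun a b => g (clamp L a) * cos (INR n * b)).
Proof.
  intros HL Hg. apply (Solvable_mode d L (INR n) g (fun b => cos (INR n * b)) (fun b => - INR n * sin (INR n * b))); auto.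
  - apply pos_INR.
  - intros; apply D_cos_lin.
  - intros x. dsplit; [apply D_sin_lin|ring].
  - apply cos_nat_period.
  - intros; rewrite sin_nat_period; auto.
  - intros -> x; rewrite !Rmult_0_l; auto.
Qed.

Lemma Solvable_sin (d : bool) (L : R) (n : nat) (g : R -> R) : 0 < L -> ctn g -> Solvable d L (fun a b => g (clamp L a) * sin (INR n * b)).
Proof.
  intros HL Hg. apply (Solvable_mode d L (INR n) g (fun b => sin (INR n * b)) (fun b => INR n * cos (INR n * b))); auto.
  - apply pos_INR.
  - intros; apply D_sin_lin.
  - intros x. dsplit; [apply D_cos_lin|ring].
  - apply sin_nat_period.
  - intros; rewrite cos_nat_period; auto.
  - intros -> x; rewrite !Rmult_0_l; auto.
Qed.

(** Convolution in [b] with such a kernel makes every continuous right-hand side solvable. The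
    property is linear in the kernel, so it has to be checked only for [cos (n * x)], where the
    addition formula separates the variables. *)
Definition good_kernel (d : bool) (L : R) (Phi : R -> R) : Prop :=
  ctn Phi /\ forall f, CS L f -> Solvable d L (fun a b => RInt (fun y => Phi (b - y) * f a y) 0 (2 * PI)).

Lemma ctn_reflect (Phi : R -> R) (b : R) : ctn Phi -> ctn (fun y => Phi (b - y)).
Proof. intros H; apply (ctn_comp (fun y => b - y) Phi); auto; repeat cstep. Qed.

Lemma good_kernel_plus (d : bool) (L : R) (Phi Psi : R -> R) : good_kernel d L Phi -> good_kernel d L Psi -> good_kernel d L (fun x => Phi x + Psi x).
Proof.
  intros [C1 H1] [C2 H2]; split; [apply ctn_plus; auto|]. intros f Hf.
  apply Solvable_ext with (2 := Solvable_plus _ _ _ _ (H1 f Hf) (H2 f Hf)).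
  intros a b. rewrite <- RI_plus; [apply RI_ext; intros; ring| |]; apply ctn_mult; try apply ctn_reflect; auto; apply UC_ctn2, Hf.
Qed.

Lemma good_kernel_scal (d : bool) (L c : R) (Phi : R -> R) : 0 <= L -> good_kernel d L Phi -> good_kernel d L (fun x => c * Phi x).
Proof.
  intros HL [C1 H1]; split; [apply ctn_mult; auto; apply ctn_const|]. intros f Hf.
  apply Solvable_ext with (2 := Solvable_scal _ _ c _ HL (H1 f Hf)).
  intros a b. rewrite <- RI_scal; [apply RI_ext; intros; ring|]; apply ctn_mult; try apply ctn_reflect; auto; apply UC_ctn2, Hf.
Qed.

Lemma good_kernel_ext (d : bool) (L : R) (Phi Psi : R -> R) : (forall x, Phi x = Psi x) -> good_kernel d L Phi -> good_kernel d L Psi.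
Proof.
  intros E [C1 H1]; split; [apply ctn_ext with Phi; auto|]. intros f Hf.
  apply Solvable_ext with (2 := H1 f Hf). intros a b; apply RI_ext; intros; rewrite E; auto.
Qed.

Lemma good_kernel_cos (d : bool) (L : R) (n : nat) : 0 < L -> good_kernel d L (fun x => cos (INR n * x)).
Proof.
  intros HL; split; [intros x; eapply D_cont; apply D_cos_lin|]. intros f Hf.
  set (g1 := cint (fun a y => cos (INR n * y) * f a y)). set (g2 := cint (fun a y => sin (INR n * y) * f a y)).
  assert (CC : CS L (fun a y => cos (INR n * y) * f a y)).
  { apply (CS_mult L (fun _ y => cos (INR n * y)) f); auto; try lra. apply CS_of_b; try lra; [|apply cos_nat_period].
    intros x; eapply D_cont; apply D_cos_lin. }
  assert (CC2 : CS L (fun a y => sin (INR n * y) * f a y)).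
  { apply (CS_mult L (fun _ y => sin (INR n * y)) f); auto; try lra. apply CS_of_b; try lra; [|apply sin_nat_period].
    intros x; eapply D_cont; apply D_sin_lin. }
  assert (Hg1 : ctn g1) by (apply cint_ctn, CC). assert (Hg2 : ctn g2) by (apply cint_ctn, CC2).
  apply Solvable_ext with (2 := Solvable_plus _ _ _ _ (Solvable_cos d L n g1 HL Hg1) (Solvable_sin d L n g2 HL Hg2)).
  intros a b. unfold g1, g2. rewrite !(cint_clamp L) by auto. unfold cint.
  rewrite (Rmult_comm _ (cos (INR n * b))), (Rmult_comm _ (sin (INR n * b))).
  rewrite <- !RI_scal by (apply (UC_ctn2 (fun a y => _ * f a y)); first [apply CC | apply CC2]).
  rewrite <- RI_plus by (apply ctn_mult; [apply ctn_const|]; first [apply (UC_ctn2 (fun a y => cos (INR n * y) * f a y)), CC | apply (UC_ctn2 (fun a y => sin (INR n * y) * f a y)), CC2]).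
  apply RI_ext; intros y. replace (INR n * (b - y)) with (INR n * b - INR n * y) by ring. rewrite cos_minus. ring.
Qed.

(** Even trigonometric polynomials; closure under pointwise equality is a constructor because the
    algebra of cosines is only available pointwise. *)
Inductive trig : (R -> R) -> Prop :=
  | trig_cos : forall n, trig (fun x => cos (INR n * x))
  | trig_plus : forall f g, trig f -> trig g -> trig (fun x => f x + g x)
  | trig_scal : forall c f, trig f -> trig (fun x => c * f x)
  | trig_ext : forall f g, (forall x, f x = g x) -> trig f -> trig g.

Lemma trig_mult_cos (f : R -> R) : trig f -> trig (fun x => cos x * f x).
Proof.
  induction 1 as [n|f g Hf IHf Hg IHg|c f Hf IHf|f g E Hf IHf].
  - destruct n as [|n].
    + apply trig_ext with (2 := trig_cos 1). intros x; simpl; rewrite Rmult_0_l, cos_0, Rmult_1_l; ring.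
    + apply trig_ext with (2 := trig_plus _ _ (trig_scal (/ 2) _ (trig_cos (S (S n)))) (trig_scal (/ 2) _ (trig_cos n))).
      intros x. rewrite (S_INR (S n)), S_INR.
      replace ((INR n + 1 + 1) * x) with ((INR n + 1) * x + x) by ring. replace (INR n * x) with ((INR n + 1) * x - x) by ring.
      rewrite cos_plus, cos_minus. field.
  - apply trig_ext with (2 := trig_plus _ _ IHf IHg). intros; ring.
  - apply trig_ext with (2 := trig_scal c _ IHf). intros; ring.
  - apply trig_ext with (2 := IHf). intros; rewrite E; ring.
Qed.

(** The kernel of de la Vallee Poussin, that is [cos (y / 2)] to the power [2 * n], before
    normalisation: a nonnegative trigonometric polynomial concentrating at [0]. *)
Definition bump (n : nat) (y : R) : R := ((1 + cos y) / 2) ^ n.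

Lemma trig_bump (n : nat) : trig (bump n).
Proof.
  induction n as [|n IH].
  - apply trig_ext with (2 := trig_cos 0). intros x; unfold bump; simpl; rewrite Rmult_0_l, cos_0; auto.
  - apply trig_ext with (2 := trig_plus _ _ (trig_scal (/ 2) _ IH) (trig_scal (/ 2) _ (trig_mult_cos _ IH))).
    intros x; unfold bump; simpl; field.
Qed.

Lemma trig_good (d : bool) (L : R) (Phi : R -> R) : 0 < L -> trig Phi -> good_kernel d L Phi.
Proof.
  intros HL; induction 1; [apply good_kernel_cos; auto|apply good_kernel_plus; auto|apply good_kernel_scal; auto; lra|
    eapply good_kernel_ext; eauto].
Qed.
(** The left form separates variables and serves solvability; the right form averages translates of
    [h] and serves estimates. They agree by the substitution [y = b - z] and periodicity. *)
Lemma convolution_swap (Phi h : R -> R) (b : R) : ctn Phi -> ctn h ->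
  (forall x, Phi (x + 2 * PI) = Phi x) -> (forall x, h (x + 2 * PI) = h x) ->
  RInt (fun y => Phi (b - y) * h y) 0 (2 * PI) = RInt (fun z => Phi z * h (b - z)) 0 (2 * PI).
Proof.
  intros CP Ch PP Ph. pose proof PI_RGT_0.
  set (k := fun y => Phi (b - y) * h y).
  assert (Ck : ctn k) by (apply ctn_mult; auto; apply ctn_reflect; auto).
  assert (Pk : forall x, k (x + 2 * PI) = k x).
  { intros x; unfold k. rewrite Ph. rewrite <- (PP (b - (x + 2 * PI))). do 2 f_equal. ring. }
  set (F := fun x => RInt k 0 x).
  rewrite (RI_ftc (fun z => - F (b - z)) (fun z => Phi z * h (b - z))).
  - replace (b - 0) with ((b - 2 * PI) + 2 * PI) by ring.
    assert (E := RI_shift_period k (b - 2 * PI) Ck Pk).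
    assert (E2 := RI_chasles k 0 (b - 2 * PI) (b - 2 * PI + 2 * PI) Ck).
    unfold F. fold k. lra.
  - lra.
  - intros x _. eapply D_cont. apply (D_opp (fun z => F (b - z))). apply (D_mirror F), RI_derive; auto.
  - apply ctn_mult; auto; apply ctn_reflect; auto.
  - intros z _. apply D_eq with (- (- (k (b - z)))).
    + unfold k. replace (b - (b - z)) with z by ring. ring.
    + apply (D_opp (fun z => F (b - z))). apply (D_mirror F), RI_derive; auto.
Qed.

Lemma bump_nonneg (n : nat) (y : R) : 0 <= bump n y.
Proof. apply pow_le. pose proof (COS_bound y); lra. Qed.

(** Integrated over a period, this gives the recursion between the normalising constants [cN n] and
    [cN (S n)], the only quantitative fact needed about the kernel. *)
Lemma bump_D (n : nat) (y : R) : D (fun y => bump n y * sin y) y ((2 * INR n + 2) * bump (S n) y - (2 * INR n + 1) * bump n y).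
Proof.
  induction n as [|n IH].
  - apply D_ext with sin; [intros; unfold bump; simpl; ring|]. apply D_eq with (cos y); [|apply derivable_pt_lim_sin].
    unfold bump; simpl; field.
  - apply D_ext with (fun y => (/ 2 * (1 + cos y)) * (bump n y * sin y)); [intros; unfold bump; simpl; field|].
    eapply D_eq; cycle 1.
    { apply (D_mult (fun y => / 2 * (1 + cos y)) (fun y => bump n y * sin y)); [|apply IH].
      apply (D_scal (/ 2) (fun y => 1 + cos y)). apply (D_plus (fun _ => 1) cos); [apply D_const|apply derivable_pt_lim_cos]. }
    rewrite (S_INR n). assert (E := sin2_cos2 y); unfold Rsqr in E. unfold bump. simpl.
    set (X := ((1 + cos y) / 2) ^ n).
    replace (/ 2 * (0 + - sin y) * (X * sin y)) with (- / 2 * X * (sin y * sin y)) by ring.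
    replace (sin y * sin y) with (1 - cos y * cos y) by lra. field.
Qed.

Lemma bump_ctn (n : nat) : ctn (bump n).
Proof.
  induction n as [|n IH]; [apply ctn_ext with (fun _ => 1); [intros; auto|apply ctn_const]|].
  apply ctn_ext with (fun y => (/ 2 * (1 + cos y)) * bump n y); [intros; unfold bump; simpl; field|].
  repeat cstep; auto. intros x; apply continuity_cos.
Qed.

Lemma cos_2PI (b : R) : cos (b + 2 * PI) = cos b.
Proof. assert (H := cos_nat_period 1 b); simpl in H; rewrite !Rmult_1_l in H; auto. Qed.

Lemma sin_2PI (b : R) : sin (b + 2 * PI) = sin b.
Proof. assert (H := sin_nat_period 1 b); simpl in H; rewrite !Rmult_1_l in H; auto. Qed.

Lemma bump_period (n : nat) (b : R) : bump n (b + 2 * PI) = bump n b.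
Proof. unfold bump; rewrite cos_2PI; auto. Qed.

Definition cN (n : nat) : R := RInt (bump n) 0 (2 * PI).

Lemma cN_rec (n : nat) : (2 * INR n + 2) * cN (S n) = (2 * INR n + 1) * cN n.
Proof.
  pose proof PI_RGT_0. unfold cN. rewrite <- !RI_scal by apply bump_ctn.
  apply Rminus_diag_uniq. rewrite <- RI_minus by (apply ctn_mult; [apply ctn_const|apply bump_ctn]).
  rewrite (RI_ftc (fun y => bump n y * sin y)).
  - replace (2 * PI) with (0 + 2 * PI) by ring. rewrite sin_2PI, bump_period. ring.
  - lra.
  - intros; eapply D_cont; apply bump_D.
  - repeat cstep; apply bump_ctn.
  - intros; apply bump_D.
Qed.

Lemma cN_pos (n : nat) : 0 < cN n.
Proof.
  pose proof PI_RGT_0. induction n as [|n IH].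
  - unfold cN. rewrite (RI_ext _ (fun _ => 1)) by auto. rewrite RI_const; lra.
  - pose proof (cN_rec n). pose proof (pos_INR n). nra.
Qed.

Definition mollify (n : nat) (f : field2) (a b : R) : R :=
  / cN n * RInt (fun z => bump n z * f a (b - z)) 0 (2 * PI).

Lemma mollify_ctn (n : nat) (f : field2) (a b : R) : UC f -> ctn (fun z => bump n z * f a (b - z)).
Proof. intros Hf; apply ctn_mult; [apply bump_ctn|]. apply (ctn_reflect (fun y => f a y)), UC_ctn2; auto. Qed.

(** Averaging against a nonnegative kernel of total mass one does not enlarge a uniform difference.
    Uniform continuity and Hoelder bounds of the mollified function are instances. *)
Lemma mollify_diff (n : nat) (f g : field2) (a b a' b' e : R) : UC f -> UC g ->
  (forall z, Rabs (f a (b - z) - g a' (b' - z)) <= e) -> Rabs (mollify n f a b - mollify n g a' b') <= e.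
Proof.
  intros Hf Hg He. pose proof PI_RGT_0. assert (Hc := cN_pos n). unfold mollify.
  rewrite <- Rmult_minus_distr_l, <- RI_minus by (apply mollify_ctn; auto).
  rewrite Rabs_mult, Rabs_right by (apply Rle_ge; left; apply Rinv_0_lt_compat; auto).
  apply Rmult_le_reg_l with (cN n); auto. rewrite <- Rmult_assoc, Rinv_r, Rmult_1_l by lra.
  assert (E : cN n * e = RInt (fun z => e * bump n z) 0 (2 * PI)) by (rewrite RI_scal by apply bump_ctn; unfold cN; ring).
  assert (E' : - (cN n * e) = RInt (fun z => - e * bump n z) 0 (2 * PI)) by (rewrite RI_scal by apply bump_ctn; unfold cN; ring).
  apply Rabs_le_between. rewrite E', E.
  split; apply RI_le; try lra; try (repeat cstep; apply bump_ctn);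
    try (apply (ctn_minus (fun z => bump n z * f a (b - z)) (fun z => bump n z * g a' (b' - z))); apply mollify_ctn; auto);
    intros z _; specialize (He z); apply Rabs_le_between in He; pose proof (bump_nonneg n z); nra.
Qed.

Lemma mollify_const (n : nat) (c a b : R) : mollify n (fun _ _ => c) a b = c.
Proof.
  unfold mollify. rewrite (RI_ext _ (fun z => c * bump n z)) by (intros; ring).
  rewrite RI_scal by apply bump_ctn. fold (cN n). pose proof (cN_pos n). field; lra.
Qed.

Lemma mollify_CS (n : nat) (L : R) (f : field2) : CS L f -> CS L (mollify n f).
Proof.
  intros [Hf [Hc Hp]]. split; [|split].
  - intros eps He. destruct (Hf (eps / 2) ltac:(lra)) as [d [Hd Hd']]. exists d; split; auto.
    intros x y x' y' H1 H2. apply Rle_lt_trans with (eps / 2); [|lra]. apply mollify_diff; auto.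
    intros z; left; apply Hd'; auto. replace (y' - z - (y - z)) with (y' - y) by ring; auto.
  - intros a b; unfold mollify; f_equal; apply RI_ext; intros; rewrite Hc; auto.
  - intros a b; unfold mollify; f_equal; apply RI_ext; intros z.
    replace (b + 2 * PI - z) with (b - z + 2 * PI) by ring. rewrite Hp; auto.
Qed.

Lemma mollify_holb (n : nat) (th H : R) (f : field2) : UC f -> holb th H f -> holb th H (mollify n f).
Proof.
  intros Hf Hh a b b'. apply mollify_diff; auto. intros z. specialize (Hh a (b - z) (b' - z)).
  replace (b' - z - (b - z)) with (b' - b) in Hh by ring. auto.
Qed.

Lemma mollify_Solvable (d : bool) (n : nat) (L : R) (f : field2) : 0 < L -> CS L f -> Solvable d L (mollify n f).
Proof.
  intros HL Hf. destruct (trig_good d L (bump n) HL (trig_bump n)) as [_ Hg].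
  apply Solvable_ext with (2 := Solvable_scal d L (/ cN n) _ ltac:(lra) (Hg f Hf)).
  intros a b. unfold mollify. f_equal. apply (convolution_swap (bump n) (fun y => f a y)).
  - apply bump_ctn. - apply UC_ctn2, Hf. - apply bump_period. - apply Hf.
Qed.

(** * Uniform approximation and uniform limits *)

Definition uconv (U : nat -> field2) (V : field2) : Prop :=
  forall eps, 0 < eps -> exists N, forall n, (N <= n)%nat -> forall a b, Rabs (U n a b - V a b) <= eps.

Definition ucauchy (U : nat -> field2) : Prop :=
  forall eps, 0 < eps -> exists N, forall n m, (N <= n)%nat -> (N <= m)%nat -> forall a b, Rabs (U n a b - U m a b) <= eps.

(** A Korovkin argument: the oscillation of [f] at distance [z] is at most
    [eps / 2 + K * (1 - cos z) / 2], and [bump n z * (1 - cos z) / 2] equals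
    [bump n z - bump (S n) z]. By the recursion the weighted mean of the second term is
    [K / (2 * n + 2)]. *)
Lemma mollify_uconv (L : R) (f : field2) : 0 < L -> CS L f -> uconv (fun n => mollify n f) f.
Proof.
  intros HL Hf eps He. destruct (CS_bounded L f ltac:(lra) Hf) as [M [HM0 HM]].
  destruct Hf as [Uf [_ Hp]]. pose proof PI_le_4 as HPI.
  destruct (Uf (eps / 2) ltac:(lra)) as [d0 [Hd0 Hd0']].
  set (d := Rmin d0 1). assert (Hd : 0 < d) by (apply Rmin_pos; lra). assert (d <= d0) by apply Rmin_l. assert (d <= 1) by apply Rmin_r.
  assert (Hcd : 0 < 1 - cos d).
  { assert (cos d < cos 0) by (apply cos_decreasing_1; lra). rewrite cos_0 in *; lra. }
  (* For [z] at distance at least [d] from the multiples of [2 * PI] one has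
     [1 - cos z >= 1 - cos d], so the trivial bound [2 * M] is absorbed by the cosine term. *)
  set (K := 4 * M / (1 - cos d)). assert (HK : 0 < K) by (unfold K; apply Rdiv_lt_0_compat; lra).
  assert (Key : forall a b z, 0 <= z <= 2 * PI -> Rabs (f a (b - z) - f a b) <= eps / 2 + K * ((1 - cos z) / 2)).
  { intros a b z Hz. pose proof (COS_bound z).
    assert (P0 : 0 <= K * ((1 - cos z) / 2)) by (apply Rmult_le_pos; lra).
    assert (Far : cos z <= cos d -> Rabs (f a (b - z) - f a b) <= eps / 2 + K * ((1 - cos z) / 2)).
    { intros Hc. assert (M1 := HM a (b - z)). assert (M2 := HM a b). apply Rabs_le_between in M1, M2.
      assert (Rabs (f a (b - z) - f a b) <= 2 * M) by (apply Rabs_le_between; lra).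
      assert (2 * M = K * ((1 - cos d) / 2)) by (unfold K; field; lra).
      assert (K * ((1 - cos d) / 2) <= K * ((1 - cos z) / 2)) by (apply Rmult_le_compat_l; lra). lra. }
    destruct (Rlt_dec z d) as [Hz1|Hz1].
    - assert (Rabs (f a (b - z) - f a b) < eps / 2); [|lra]. apply Hd0'; [rdiag|].
      apply Rabs_lt_between; lra.
    - destruct (Rlt_dec (2 * PI - d) z) as [Hz2|Hz2].
      + assert (Rabs (f a (b - z) - f a b) < eps / 2); [|lra]. rewrite <- (Hp a (b - z)).
        apply Hd0'; [rdiag|]. apply Rabs_lt_between; lra.
      + apply Far. destruct (Rle_dec z PI).
        * destruct (Req_dec z d) as [->|]; [lra|]. left; apply cos_decreasing_1; lra.
        * replace (cos z) with (cos (2 * PI - z)).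
          { destruct (Req_dec (2 * PI - z) d) as [->|]; [lra|]. left; apply cos_decreasing_1; lra. }
          rewrite <- cos_neg. rewrite <- (cos_2PI (- (2 * PI - z))). f_equal; ring. }
  destruct (inv_small (eps / (2 * K))) as [N HN]; [apply Rdiv_lt_0_compat; lra|].
  exists N; intros n Hn a b. assert (Hc := cN_pos n).
  rewrite <- (mollify_const n (f a b) a b) at 1.
  assert (B : Rabs (mollify n f a b - mollify n (fun _ _ => f a b) a b) <= eps / 2 + K * (/ (2 * INR n + 2))).
  { unfold mollify. rewrite <- Rmult_minus_distr_l.
    rewrite <- (RI_minus (fun z => bump n z * f a (b - z)) (fun z => bump n z * f a b)); [|apply mollify_ctn; auto|repeat cstep; apply bump_ctn].
    rewrite Rabs_mult, Rabs_right by (apply Rle_ge; left; apply Rinv_0_lt_compat; auto).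
    apply Rmult_le_reg_l with (cN n); auto. rewrite <- Rmult_assoc, Rinv_r, Rmult_1_l by lra.
    set (hh := fun z => eps / 2 * bump n z + K * (bump n z - bump (S n) z)).
    assert (Ch : ctn hh) by (unfold hh; repeat cstep; apply bump_ctn).
    assert (E : cN n * (eps / 2 + K * (/ (2 * INR n + 2))) = RInt hh 0 (2 * PI)).
    { unfold hh. rewrite RI_plus by (repeat cstep; apply bump_ctn).
      rewrite (RI_scal (bump n)) by apply bump_ctn. rewrite (RI_scal (fun z => bump n z - bump (S n) z)) by (repeat cstep; apply bump_ctn).
      rewrite RI_minus by apply bump_ctn. fold (cN n) (cN (S n)). assert (Hrec := cN_rec n). pose proof (pos_INR n).
      replace (cN (S n)) with ((2 * INR n + 1) * cN n / (2 * INR n + 2)) by (rewrite <- Hrec; field; lra). field; lra. }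
    rewrite E.
    assert (Cd : ctn (fun z => bump n z * f a (b - z) - bump n z * f a b)).
    { apply (ctn_minus (fun z => bump n z * f a (b - z)) (fun z => bump n z * f a b)); [apply mollify_ctn; auto|repeat cstep; apply bump_ctn]. }
    assert (PW : forall z, 0 <= z <= 2 * PI -> Rabs (bump n z * f a (b - z) - bump n z * f a b) <= hh z).
    { intros z Hz. rewrite <- Rmult_minus_distr_l, Rabs_mult, Rabs_right by (apply Rle_ge, bump_nonneg).
      unfold hh. replace (eps / 2 * bump n z + K * (bump n z - bump (S n) z)) with (bump n z * (eps / 2 + K * ((1 - cos z) / 2)))
        by (unfold bump; simpl; field).
      apply Rmult_le_compat_l; [apply bump_nonneg|apply Key; auto]. }
    apply Rabs_le_between. rewrite <- RI_opp by auto.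
    split; apply RI_le; auto; try lra; try (apply ctn_opp; auto); intros z Hz; specialize (PW z Hz); apply Rabs_le_between in PW; lra. }
  assert (K * / (2 * INR n + 2) <= eps / 2).
  { specialize (HN n Hn). replace (2 * INR n + 2) with (2 * (INR n + 1)) by ring. rewrite Rinv_mult.
    assert (K * (eps / (2 * K)) = eps / 2) by (field; lra). nra. }
  apply Rle_trans with (1 := B); lra.
Qed.

Lemma ucauchy_limit (U : nat -> field2) : ucauchy U -> exists V, uconv U V.
Proof.
  intros HU.
  assert (HC : forall a b, Cauchy_crit (fun n => U n a b)).
  { intros a b eps He. destruct (HU (eps / 2) ltac:(lra)) as [N HN]. exists N; intros n m Hn Hm.
    apply Rle_lt_trans with (eps / 2); [|lra]. apply HN; auto. }
  exists (fun a b => proj1_sig (Rcomplete.R_complete _ (HC a b))). intros eps He.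
  destruct (HU (eps / 2) ltac:(lra)) as [N HN]. exists N; intros n Hn a b.
  destruct (Rcomplete.R_complete _ (HC a b)) as [l Hl]; simpl. destruct (Hl (eps / 2) ltac:(lra)) as [N' HN'].
  specialize (HN' (N + N')%nat ltac:(lia)). specialize (HN n (N + N')%nat Hn ltac:(lia) a b).
  apply Rabs_lt_between in HN'; apply Rabs_le_between in HN; apply Rabs_le_between; lra.
Qed.

Lemma uconv_pointwise_eq (U : nat -> field2) (V : field2) (a b c : R) : uconv U V -> (forall n, U n a b = c) -> V a b = c.
Proof.
  intros HU HE. apply cond_eq; intros eps He. destruct (HU (eps / 2) ltac:(lra)) as [N HN]. specialize (HN N (le_n N) a b).
  rewrite HE in HN. rewrite Rabs_minus_sym; lra.
Qed.

Lemma CS_limit (L : R) (U : nat -> field2) (V : field2) : (forall n, CS L (U n)) -> uconv U V -> CS L V.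
Proof.
  intros HU HV. split; [|split].
  - intros eps He. destruct (HV (eps / 4) ltac:(lra)) as [N HN]. destruct (proj1 (HU N) (eps / 4) ltac:(lra)) as [d [Hd Hd']].
    exists d; split; auto; intros x y x' y' H1 H2. specialize (Hd' x y x' y' H1 H2).
    assert (K1 := HN N (le_n N) x y). assert (K2 := HN N (le_n N) x' y').
    apply Rabs_lt_between in Hd'; apply Rabs_le_between in K1, K2; apply Rabs_lt_between; lra.
  - intros a b. apply cond_eq; intros eps He. destruct (HV (eps / 4) ltac:(lra)) as [N HN].
    assert (K1 := HN N (le_n N) a b). assert (K2 := HN N (le_n N) (clamp L a) b).
    rewrite (proj1 (proj2 (HU N))) in K2. apply Rabs_le_between in K1, K2; apply Rabs_lt_between; lra.
  - intros a b. apply cond_eq; intros eps He. destruct (HV (eps / 4) ltac:(lra)) as [N HN].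
    assert (K1 := HN N (le_n N) a b). assert (K2 := HN N (le_n N) a (b + 2 * PI)).
    rewrite (proj2 (proj2 (HU N))) in K2. apply Rabs_le_between in K1, K2; apply Rabs_lt_between; lra.
Qed.

Lemma D_limit (u v : nat -> R -> R) (U V : R -> R) (lo hi x : R) : lo < x < hi ->
  (forall n y, lo < y < hi -> D (u n) y (v n y)) ->
  (forall eps, 0 < eps -> exists N, forall n, (N <= n)%nat -> forall y, Rabs (u n y - U y) <= eps) ->
  (forall eps, 0 < eps -> exists N, forall n, (N <= n)%nat -> forall y, Rabs (v n y - V y) <= eps) ->
  continuity_pt V x -> D U x (V x).
Proof.
  intros Hx HD HU HV HC eps He.
  destruct (continuity_pt_eps_inv V x HC (eps / 4) ltac:(lra)) as [d [Hd Hd']].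
  assert (Hm : 0 < Rmin d (Rmin (x - lo) (hi - x))) by (repeat apply Rmin_pos; lra).
  exists (mkposreal _ Hm); simpl; intros h Hh Hhd.
  rmin_bounds d (Rmin (x - lo) (hi - x)).
  rmin_bounds (x - lo) (hi - x).
  assert (Hxh : lo < x + h < hi) by (apply Rabs_lt_between in Hhd; lra).
  assert (Hah : 0 < Rabs h) by (apply Rabs_pos_lt; auto).
  destruct (HV (eps / 16) ltac:(lra)) as [N1 HN1]. destruct (HU (eps * Rabs h / 16)) as [N2 HN2]; [nra|].
  set (n := (N1 + N2)%nat).
  assert (K : Rabs ((u n (x + h) - u n x) / h - v n x) <= eps / 2).
  { apply (derive_unif (u n) (v n) lo hi x (eps / 2) d); auto; try lra. intros y Hy. specialize (Hd' y Hy).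
    assert (K1 := HN1 n ltac:(unfold n; lia) y); assert (K2 := HN1 n ltac:(unfold n; lia) x).
    apply Rabs_lt_between in Hd'; apply Rabs_le_between in K1, K2; apply Rabs_lt_between; lra. }
  assert (K2 := HN1 n ltac:(unfold n; lia) x).
  assert (K3 := HN2 n ltac:(unfold n; lia) x). assert (K4 := HN2 n ltac:(unfold n; lia) (x + h)).
  assert (K5 : Rabs ((U (x + h) - U x) / h - (u n (x + h) - u n x) / h) <= eps / 8).
  { replace ((U (x + h) - U x) / h - (u n (x + h) - u n x) / h) with (((U (x + h) - u n (x + h)) - (U x - u n x)) / h) by lra.
    unfold Rdiv at 1. rewrite Rabs_mult, Rabs_inv. apply Rmult_le_reg_r with (Rabs h); auto.
    rewrite Rmult_assoc, Rinv_l, Rmult_1_r by lra.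
    apply Rabs_le_between in K3, K4. apply Rabs_le_between; lra. }
  apply Rabs_le_between in K, K2, K5. apply Rabs_lt_between; lra.
Qed.

Lemma C1s_limit (L : R) (U Ua Ub : nat -> field2) (V Va Vb : field2) : (forall n, C1s L (U n) (Ua n) (Ub n)) ->
  uconv U V -> uconv Ua Va -> uconv Ub Vb -> C1s L V Va Vb.
Proof.
  intros HU HV HVa HVb.
  assert (C0 : CS L V) by (apply CS_limit with U; auto; intros; apply HU).
  assert (C1 : CS L Va) by (apply CS_limit with Ua; auto; intros; apply HU).
  assert (C2 : CS L Vb) by (apply CS_limit with Ub; auto; intros; apply HU).
  split; [|split; [|split; [|split]]]; auto.
  - intros a b Ha. apply (D_limit (fun n x => U n x b) (fun n x => Ua n x b) (fun x => V x b) (fun x => Va x b) 0 L); auto.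
    + intros n y Hy; apply HU; auto.
    + intros eps He; destruct (HV eps He) as [N HN]; exists N; auto.
    + intros eps He; destruct (HVa eps He) as [N HN]; exists N; auto.
    + apply (UC_ctn1 Va), C1.
  - intros a b. apply (D_limit (fun n y => U n a y) (fun n y => Ub n a y) (fun y => V a y) (fun y => Vb a y) (b - 1) (b + 1)); auto; try lra.
    + intros n y Hy; apply HU; auto.
    + intros eps He; destruct (HV eps He) as [N HN]; exists N; auto.
    + intros eps He; destruct (HVb eps He) as [N HN]; exists N; auto.
    + apply (UC_ctn2 Vb), C2.
Qed.

(** * Interpolation of Hoelder constants and solution of the Poisson problem *)

Lemma pw_pw (x s t : R) : pw (pw x s) t = pw x (s * t).
Proof.
  destruct (Rle_dec x 0); [rewrite !(pw_npos x), pw_npos by lra; auto|].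
  rewrite !(pw_pos_eq x) by lra. rewrite pw_pos_eq by apply exp_pos. apply Rpower_mult.
Qed.

Lemma min_interpolation (v x y t : R) : 0 <= t <= 1 -> 0 <= v -> v <= x -> v <= y -> v <= pw x (1 - t) * pw y t.
Proof.
  intros Ht [Hv|<-] Hx Hy; [|apply Rmult_le_pos; apply pw_nonneg].
  apply Rle_trans with (pw v (1 - t) * pw v t).
  - rewrite !pw_pos_eq by auto. rewrite <- Rpower_plus. replace (1 - t + t) with 1 by ring. rewrite Rpower_1; lra.
  - apply Rmult_le_compat; try apply pw_nonneg; apply pw_le; lra.
Qed.

(** The oscillation is bounded both by [2 * M] and by the Hoelder modulus, hence by their geometric
    mean with weights [1 - t] and [t]. *)
Lemma holb_interpolation (th H M t : R) (f : field2) : 0 <= t <= 1 -> 0 <= H -> holb th H f -> (forall a b, Rabs (f a b) <= M) ->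
  holb (th * t) (pw (2 * M) (1 - t) * pw H t) f.
Proof.
  intros Ht HH Hf HM a b b'.
  replace (pw (2 * M) (1 - t) * pw H t * pw (Rabs (b' - b)) (th * t)) with (pw (2 * M) (1 - t) * pw (H * pw (Rabs (b' - b)) th) t).
  - apply min_interpolation; auto; [apply Rabs_pos|].
    assert (K1 := HM a b). assert (K2 := HM a b'). apply Rabs_le_between in K1, K2. apply Rabs_le_between; lra.
  - rewrite (pw_mult H (pw (Rabs (b' - b)) th) t), pw_pw by (auto; apply pw_nonneg). ring.
Qed.

Lemma holb_plus (th H K c : R) (f g : field2) : holb th H f -> holb th K g -> holb th (H + Rabs c * K) (fun a b => f a b + c * g a b).
Proof.
  intros Hf Hg a b b'. replace (f a b' + c * g a b' - (f a b + c * g a b)) with ((f a b' - f a b) + c * (g a b' - g a b)) by ring.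
  eapply Rle_trans; [apply Rabs_triang|]. rewrite Rabs_mult, Rmult_plus_distr_r. apply Rplus_le_compat; [apply Hf|].
  rewrite Rmult_assoc. apply Rmult_le_compat_l; [apply Rabs_pos|apply Hg].
Qed.

(** The Schauder bound after interpolation with [t = 1 / 2], at exponent [th / 2]. With [H] fixed it
    tends to zero with the sup norm [M], so solutions depend continuously, up to second derivatives,
    on the sup norm of data in a bounded Hoelder class. *)
Definition small_bound (L th H M : R) : R := KS L * (M + 2 * (pw (2 * M) (/ 2) * pw H (/ 2)) / th).

Lemma Schauder_small (d : bool) (L th H M k : R) (f u ua ub uaa uab ubb : field2) :
  0 < L -> 0 < th <= 1 -> 0 <= H -> UC f -> Sol d L k f u ua ub uaa uab ubb -> holb th H f ->
  (forall a b, Rabs (f a b) <= M) ->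
  forall a b, Rabs (u a b) <= small_bound L th H M /\ Rabs (ua a b) <= small_bound L th H M /\ Rabs (ub a b) <= small_bound L th H M /\
    Rabs (uaa a b) <= small_bound L th H M /\ Rabs (uab a b) <= small_bound L th H M /\ Rabs (ubb a b) <= small_bound L th H M.
Proof.
  intros HL Ht HH Uf HS Hh HM.
  assert (Hi := holb_interpolation th H M (/ 2) f ltac:(lra) HH Hh HM). replace (1 - / 2) with (/ 2) in Hi by field.
  assert (K := Schauder d L (th * / 2) (pw (2 * M) (/ 2) * pw H (/ 2)) M k f u ua ub uaa uab ubb HL ltac:(lra)
    ltac:(apply Rmult_le_pos; apply pw_nonneg) Uf HS Hi HM).
  replace (pw (2 * M) (/ 2) * pw H (/ 2) / (th * / 2)) with (2 * (pw (2 * M) (/ 2) * pw H (/ 2)) / th) in K by (field; lra).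
  exact K.
Qed.

Lemma KS_pos (L : R) : 0 < L -> 0 < KS L.
Proof. intros; unfold KS; apply Rmult_lt_0_compat; [lra|apply pow_lt; lra]. Qed.

Lemma small_bound_small (L th H : R) : 0 < L -> 0 < th <= 1 -> 0 <= H -> forall eps, 0 < eps -> exists del, 0 < del /\
  forall M, 0 <= M <= del -> small_bound L th H M <= eps.
Proof.
  intros HL Ht HH eps He. assert (HK := KS_pos L HL).
  set (P := pw H (/ 2)). assert (HP : 0 <= P) by apply pw_nonneg.
  set (e1 := eps / (2 * KS L)). assert (He1 : 0 < e1) by (apply Rdiv_lt_0_compat; lra).
  set (e2 := e1 * th / (2 * (P + 1))). assert (He2 : 0 < e2) by (apply Rdiv_lt_0_compat; nra).
  exists (Rmin e1 (e2 * e2 / 2)). split; [apply Rmin_pos; nra|].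
  intros M [HM0 HM]. rmin_bounds e1 (e2 * e2 / 2).
  unfold small_bound. fold P.
  assert (HQ : pw (2 * M) (/ 2) <= e2).
  { apply Rle_trans with (pw (e2 * e2) (/ 2)); [apply pw_le; lra|].
    rewrite pw_pos_eq by nra. replace (e2 * e2) with (Rpower e2 2).
    - rewrite Rpower_mult. replace (2 * / 2) with 1 by field. rewrite Rpower_1; lra.
    - replace 2 with (INR 2) by auto. rewrite Rpower_pow by auto. simpl; ring. }
  assert (HE : 2 * (pw (2 * M) (/ 2) * P) / th <= e1).
  { apply Rmult_le_reg_r with th; [lra|]. replace (2 * (pw (2 * M) (/ 2) * P) / th * th) with (2 * (pw (2 * M) (/ 2) * P)) by (field; lra).
    assert (e1 * th = 2 * (P + 1) * e2) by (unfold e2; field; lra). nra. }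
  assert (eps = KS L * (e1 + e1)) by (unfold e1; field; lra). rewrite H2. apply Rmult_le_compat_l; lra.
Qed.

Lemma seven_choice (P : nat -> R -> (field2) -> (field2) -> (field2) -> (field2) -> (field2) -> (field2) -> Prop) :
  (forall n, exists k u ua ub uaa uab ubb, P n k u ua ub uaa uab ubb) ->
  exists k u ua ub uaa uab ubb, forall n, P n (k n) (u n) (ua n) (ub n) (uaa n) (uab n) (ubb n).
Proof.
  intros H.
  set (T := (R * (field2) * (field2) * (field2) * (field2) * (field2) * (field2))%type).
  assert (H' : forall n, exists t : T, let '(k, u, ua, ub, uaa, uab, ubb) := t in P n k u ua ub uaa uab ubb).
  { intros n; destruct (H n) as [k [u [ua [ub [uaa [uab [ubb Hn]]]]]]]. exists (k, u, ua, ub, uaa, uab, ubb); auto. }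
  set (t := fun n => proj1_sig (constructive_indefinite_description _ (H' n))).
  assert (Ht : forall n, let '(k, u, ua, ub, uaa, uab, ubb) := t n in P n k u ua ub uaa uab ubb).
  { intros n; unfold t; destruct (constructive_indefinite_description _ (H' n)); auto. }
  exists (fun n => let '(k, u, ua, ub, uaa, uab, ubb) := t n in k), (fun n => let '(k, u, ua, ub, uaa, uab, ubb) := t n in u),
    (fun n => let '(k, u, ua, ub, uaa, uab, ubb) := t n in ua), (fun n => let '(k, u, ua, ub, uaa, uab, ubb) := t n in ub),
    (fun n => let '(k, u, ua, ub, uaa, uab, ubb) := t n in uaa), (fun n => let '(k, u, ua, ub, uaa, uab, ubb) := t n in uab),
    (fun n => let '(k, u, ua, ub, uaa, uab, ubb) := t n in ubb).
  intros n; specialize (Ht n); destruct (t n) as [[[[[[k u] ua] ub] uaa] uab] ubb]; auto.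
Qed.

(** The mollified right-hand sides are uniformly Cauchy with Hoelder constants below [H].
    Differences therefore stay in one Hoelder class while their sup norms vanish, and the solutions
    are Cauchy together with their derivatives up to second order. *)
Theorem Poisson_solvable (d : bool) (L th H : R) (f : field2) : 0 < L -> 0 < th <= 1 -> 0 <= H -> CS L f -> holb th H f -> Solvable d L f.
Proof.
  intros HL Ht HH Hf Hh.
  destruct (seven_choice (fun n k u ua ub uaa uab ubb => Sol d L k (mollify n f) u ua ub uaa uab ubb)) as [k [u [ua [ub [uaa [uab [ubb HS]]]]]]].
  { intros n; apply mollify_Solvable; auto. }
  assert (Hcau : ucauchy (fun n => mollify n f)).
  { intros eps He. destruct (mollify_uconv L f HL Hf (eps / 2) ltac:(lra)) as [N HN]. exists N; intros n m Hn Hm a b.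
    assert (K1 := HN n Hn a b). assert (K2 := HN m Hm a b). apply Rabs_le_between in K1, K2; apply Rabs_le_between; lra. }
  assert (Hall : forall eps, 0 < eps -> exists N, forall n m, (N <= n)%nat -> (N <= m)%nat ->
    Rabs (k n - k m) <= eps /\ forall a b,
     Rabs (u n a b - u m a b) <= eps /\ Rabs (ua n a b - ua m a b) <= eps /\ Rabs (ub n a b - ub m a b) <= eps /\
     Rabs (uaa n a b - uaa m a b) <= eps /\ Rabs (uab n a b - uab m a b) <= eps /\ Rabs (ubb n a b - ubb m a b) <= eps).
  { intros eps He.
    destruct (small_bound_small L th (2 * H) HL Ht ltac:(lra) eps He) as [del [Hdel Hsm]].
    set (e := Rmin del eps). assert (0 < e) by (apply Rmin_pos; auto). assert (e <= del) by apply Rmin_l. assert (e <= eps) by apply Rmin_r.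
    destruct (Hcau e H0) as [N HN]. exists N; intros n m Hn Hm.
    assert (HD := Sol_minus d L (k n) (k m) _ _ _ _ _ _ _ _ _ _ _ _ _ _ ltac:(lra) (HS n) (HS m)).
    assert (HB : forall a b, Rabs (mollify n f a b + -1 * mollify m f a b) <= e).
    { intros a b. replace (mollify n f a b + -1 * mollify m f a b) with (mollify n f a b - mollify m f a b) by ring. apply HN; auto. }
    assert (HH' : holb th (2 * H) (fun a b => mollify n f a b + -1 * mollify m f a b)).
    { replace (2 * H) with (H + Rabs (-1) * H) by (rewrite Rabs_left; lra). apply holb_plus; apply mollify_holb; auto; apply Hf. }
    assert (HU : UC (fun a b => mollify n f a b + -1 * mollify m f a b)).
    { apply (CS_plus L (mollify n f) (fun a b => -1 * mollify m f a b)); [|apply CS_scal; try lra]; apply mollify_CS; auto. }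
    split.
    - assert (Hk := Sol_kap d L _ e _ _ _ _ _ _ _ HL HU HD HB). replace (k n - k m) with (k n + -1 * k m) by ring. lra.
    - intros a b.
      destruct (Schauder_small d L th (2 * H) e _ _ _ _ _ _ _ _ HL Ht ltac:(lra) HU HD HH' HB a b) as [B1 [B2 [B3 [B4 [B5 B6]]]]].
      specialize (Hsm e ltac:(lra)).
      repeat split; match goal with |- Rabs (?p - ?q) <= _ => replace (p - q) with (p + -1 * q) by ring end; lra. }
  assert (Ck : exists kap, Un_cv k kap).
  { destruct (Rcomplete.R_complete k) as [l Hl]; [|exists l; auto].
    intros eps He. destruct (Hall (eps / 2) ltac:(lra)) as [N HN]. exists N; intros n m Hn Hm.
    destruct (HN n m Hn Hm) as [Q _]. unfold Rdist; lra. }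
  destruct Ck as [kap Hkap].
  assert (C1 : ucauchy u) by (intros eps He; destruct (Hall eps He) as [N HN]; exists N; intros n m Hn Hm a b; apply (HN n m Hn Hm)).
  assert (C2 : ucauchy ua) by (intros eps He; destruct (Hall eps He) as [N HN]; exists N; intros n m Hn Hm a b; apply (HN n m Hn Hm)).
  assert (C3 : ucauchy ub) by (intros eps He; destruct (Hall eps He) as [N HN]; exists N; intros n m Hn Hm a b; apply (HN n m Hn Hm)).
  assert (C4 : ucauchy uaa) by (intros eps He; destruct (Hall eps He) as [N HN]; exists N; intros n m Hn Hm a b; apply (HN n m Hn Hm)).
  assert (C5 : ucauchy uab) by (intros eps He; destruct (Hall eps He) as [N HN]; exists N; intros n m Hn Hm a b; apply (HN n m Hn Hm)).
  assert (C6 : ucauchy ubb) by (intros eps He; destruct (Hall eps He) as [N HN]; exists N; intros n m Hn Hm a b; apply (HN n m Hn Hm)).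
  destruct (ucauchy_limit _ C1) as [v V1]; destruct (ucauchy_limit _ C2) as [va V2]; destruct (ucauchy_limit _ C3) as [vb V3];
  destruct (ucauchy_limit _ C4) as [vaa V4]; destruct (ucauchy_limit _ C5) as [vab V5]; destruct (ucauchy_limit _ C6) as [vbb V6].
  exists kap, v, va, vb, vaa, vab, vbb. split; [|split].
  - split; [|split]; [apply C1s_limit with u ua ub|apply C1s_limit with ua uaa uab|apply C1s_limit with ub uab ubb]; auto;
      intros n; apply (HS n).
  - destruct d.
    + split.
      * intros b; split; [apply uconv_pointwise_eq with u|apply uconv_pointwise_eq with u]; auto; intros n;
          destruct (HS n) as [_ [[Hd _] _]]; apply Hd.
      * apply UL_sequence with k; auto. intros eps He; exists 0%nat; intros n _. destruct (HS n) as [_ [[_ ->] _]].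
        unfold Rdist; rdiag.
    + split.
      * intros b; split; [apply uconv_pointwise_eq with ua|apply uconv_pointwise_eq with ua]; auto; intros n;
          destruct (HS n) as [_ [[Hd _] _]]; apply Hd.
      * apply uconv_pointwise_eq with u; auto. intros n; destruct (HS n) as [_ [[_ Hd] _]]; apply Hd.
  - intros a b. apply cond_eq; intros eps He.
    destruct (V4 (eps / 8) ltac:(lra)) as [N4 H4]. destruct (V6 (eps / 8) ltac:(lra)) as [N6 H6].
    destruct (mollify_uconv L f HL Hf (eps / 8) ltac:(lra)) as [N0 H0]. destruct (Hkap (eps / 8) ltac:(lra)) as [N1 H1].
    set (n := (N4 + N6 + N0 + N1)%nat).
    specialize (H4 n ltac:(unfold n; lia) a b). specialize (H6 n ltac:(unfold n; lia) a b).
    specialize (H0 n ltac:(unfold n; lia) a b). specialize (H1 n ltac:(unfold n; lia)).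
    destruct (HS n) as [_ [_ E]]. specialize (E a b).
    apply Rabs_le_between in H4, H6, H0. apply Rabs_lt_between in H1. apply Rabs_lt_between; lra.
Qed.

(** Unlike the bound at a fixed exponent, this one grows so slowly in [H] that the transport of the
    Hoelder constant closes on every time interval. *)
Lemma Schauder_log (d : bool) (L th H M k : R) (f u ua ub uaa uab ubb : field2) :
  0 < L -> 0 < th <= 1 -> 0 <= H -> UC f -> Sol d L k f u ua ub uaa uab ubb -> holb th H f ->
  (forall a b, Rabs (f a b) <= M) ->
  let X := KS L * (4 * (1 + 2 * M) * (1 + ln (1 + H)) / th) in
  forall a b, Rabs (u a b) <= X /\ Rabs (ua a b) <= X /\ Rabs (ub a b) <= X /\
    Rabs (uaa a b) <= X /\ Rabs (uab a b) <= X /\ Rabs (ubb a b) <= X.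
Proof.
  intros HL Ht HH Uf HS Hh HM X.
  assert (M0 : 0 <= M) by (apply Rle_trans with (2 := HM 0 0), Rabs_pos).
  assert (Hln : 0 <= ln (1 + H)).
  { rewrite <- ln_1. destruct HH as [HH|<-]; [left; apply ln_increasing; lra|rewrite Rplus_0_r; lra]. }
  (* The power [t] of [1 + H] is [exp (t * l)], at most [exp 1 <= 3], while dividing by the new
     exponent [th * t] costs the factor [1 + l]. Rounding [3] up to [4] absorbs the summand [M]. *)
  set (l := ln (1 + H)) in *. set (t := / (1 + l)).
  assert (Ht1 : 0 < t <= 1).
  { unfold t; split; [apply Rinv_0_lt_compat; lra|]. rewrite <- Rinv_1 at 2. apply Rinv_le_contravar; lra. }
  assert (Hi := holb_interpolation th H M t f ltac:(lra) HH Hh HM).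
  assert (HB : pw (2 * M) (1 - t) * pw H t <= (1 + 2 * M) * 3).
  { apply Rmult_le_compat; try apply pw_nonneg; [apply pw_le_one_plus; lra|].
    apply Rle_trans with (pw (1 + H) t); [apply pw_le; lra|]. rewrite pw_pos_eq by lra. unfold Rpower. fold l.
    apply Rle_trans with (exp 1); [|apply exp_le_3]. destruct (Req_dec (t * l) 1) as [->|Hne]; [lra|left; apply exp_increasing].
    assert (t * (1 + l) = 1) by (unfold t; field; lra). nra. }
  set (Hi' := pw (2 * M) (1 - t) * pw H t) in *.
  assert (0 <= Hi') by (unfold Hi'; apply Rmult_le_pos; apply pw_nonneg).
  assert (K := Schauder d L (th * t) Hi' M k f u ua ub uaa uab ubb HL ltac:(nra) H0 Uf HS Hi HM).
  assert (HX : KS L * (M + Hi' / (th * t)) <= X).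
  { apply Rmult_le_compat_l; [left; apply KS_pos; auto|].
    assert (E : Hi' / (th * t) = Hi' * (1 + l) / th) by (unfold t; field; lra). rewrite E.
    apply Rmult_le_reg_r with th; [lra|].
    replace ((M + Hi' * (1 + l) / th) * th) with (M * th + Hi' * (1 + l)) by (field; lra).
    replace (4 * (1 + 2 * M) * (1 + l) / th * th) with (4 * (1 + 2 * M) * (1 + l)) by (field; lra). nra. }
  intros a b; destruct (K a b) as [B1 [B2 [B3 [B4 [B5 B6]]]]]. repeat split; lra.
Qed.
(** * Transport by shears *)

(** For [s = eps * Lam <= 1 / 2] the shear is a perturbation of the identity: the intermediate value
    theorem inverts it, and comparing two preimages costs the factor [1 / (1 - s)], which is at most
    [1 + 2 * s]. The second coordinate is kept in the estimate because [c] depends on it. *)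
Lemma shear_inverse (c : field2) (eps Lam V : R) : 0 < eps -> 0 <= Lam -> eps * Lam <= / 2 ->
  (forall x y x' y', Rabs (c x' y' - c x y) <= Lam * (Rabs (x' - x) + Rabs (y' - y))) ->
  (forall x y, Rabs (c x y) <= V) ->
  exists G, (forall x y, G x y + eps * c (G x y) y = x) /\
    (forall x y g, g + eps * c g y = x -> G x y = g) /\
    (forall x y, Rabs (G x y - x) <= eps * V) /\
    (forall x y x' y', Rabs (G x' y' - G x y) + Rabs (y' - y) <= (1 + 2 * (eps * Lam)) * (Rabs (x' - x) + Rabs (y' - y))).
Proof.
  intros He HL Hel Hlip HV.
  assert (V0 : 0 <= V) by (apply Rle_trans with (2 := HV 0 0), Rabs_pos).
  assert (Cc : forall y, ctn (fun g => c g y)).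
  { intros y x; apply continuity_pt_eps; intros e He'. exists (e / (Lam + 1)); split; [apply Rdiv_lt_0_compat; lra|].
    intros x' Hx'. specialize (Hlip x y x' y). rewrite Rminus_diag, Rabs_R0, Rplus_0_r in Hlip.
    assert (Lam * Rabs (x' - x) <= (Lam + 1) * Rabs (x' - x)) by (pose proof (Rabs_pos (x' - x)); nra).
    assert ((Lam + 1) * Rabs (x' - x) < (Lam + 1) * (e / (Lam + 1))) by (apply Rmult_lt_compat_l; lra).
    replace ((Lam + 1) * (e / (Lam + 1))) with e in H0 by (field; lra). lra. }
  assert (HI : forall x y, exists g, g + eps * c g y = x).
  { intros x y. destruct (IVT (fun g => g + eps * c g y - x) (x - eps * V - 1) (x + eps * V + 1)) as [z [Hz Ez]].
    - assert (ctn (fun g => g + eps * c g y - x)) by (repeat cstep; auto). exact H.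
    - nra.
    - specialize (HV (x - eps * V - 1) y). apply Rabs_le_between in HV. nra.
    - specialize (HV (x + eps * V + 1) y). apply Rabs_le_between in HV. nra.
    - exists z; lra. }
  set (G := fun x y => proj1_sig (constructive_indefinite_description _ (HI x y))).
  assert (HG : forall x y, G x y + eps * c (G x y) y = x) by (intros x y; unfold G; destruct (constructive_indefinite_description _ (HI x y)); auto).
  assert (Key : forall g y x g' y' x', g + eps * c g y = x -> g' + eps * c g' y' = x' ->
     Rabs (g' - g) + Rabs (y' - y) <= (1 + 2 * (eps * Lam)) * (Rabs (x' - x) + Rabs (y' - y))).
  { intros g y x g' y' x' E E'. specialize (Hlip g y g' y').
    assert (Q : Rabs (g' - g) <= Rabs (x' - x) + eps * (Lam * (Rabs (g' - g) + Rabs (y' - y)))).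
    { replace (g' - g) with ((x' - x) - eps * (c g' y' - c g y)) at 1 by lra.
      eapply Rle_trans; [apply Rabs_triang|]. rewrite Rabs_Ropp, Rabs_mult, (Rabs_right eps) by lra.
      apply Rplus_le_compat_l. apply Rmult_le_compat_l; lra. }
    set (s := eps * Lam) in *. pose proof (Rabs_pos (x' - x)). pose proof (Rabs_pos (y' - y)).
    replace (eps * (Lam * (Rabs (g' - g) + Rabs (y' - y)))) with (s * (Rabs (g' - g) + Rabs (y' - y))) in Q by (unfold s; ring).
    set (p := Rabs (g' - g)) in *; set (q := Rabs (x' - x)) in *; set (r := Rabs (y' - y)) in *.
    assert (0 <= s) by (unfold s; nra).
    assert (1 <= (1 - s) * (1 + 2 * s)) by nra.
    assert (q + r <= (1 - s) * ((1 + 2 * s) * (q + r))).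
    { rewrite <- Rmult_assoc. rewrite <- (Rmult_1_l (q + r)) at 1. apply Rmult_le_compat_r; lra. }
    apply Rmult_le_reg_l with (1 - s); lra. }
  exists G; split; [auto|split; [|split]].
  - intros x y g E. assert (Q := Key _ _ _ _ _ _ E (HG x y)). rewrite !Rminus_diag, !Rabs_R0 in Q.
    pose proof (Rabs_pos (G x y - g)). assert (Q0 : Rabs (G x y - g) = 0) by lra.
    apply Rminus_diag_uniq. destruct (Req_dec (G x y - g) 0); auto. apply Rabs_no_R0 in H0; contradiction.
  - intros x y. replace (G x y - x) with (- (eps * c (G x y) y)) by (specialize (HG x y); lra).
    rewrite Rabs_Ropp, Rabs_mult, (Rabs_right eps) by lra. apply Rmult_le_compat_l; auto; lra.
  - intros; eapply Key; eauto.
Qed.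

(* [fK a] is the factor [alpha / r^2], [fB a] the Coriolis parameter, [fgam] the circulation
   around the inner circle divided by [2 PI]. *)
Record flat := { fL : R; fK : R -> R; fK1 : R -> R; fB : R -> R; fth : R; fgam : R; fkm : R;
  fLpos : 0 < fL; fkmpos : 0 < fkm; fKm : forall a, fkm <= fK a;
  fKC1 : C1s fL (fun a _ => fK a) (fun a _ => fK1 a) (fun _ _ => 0);
  fBC : CS fL (fun a _ => fB a); fthr : 0 < fth <= 1 }.

Definition hol2 (th H : R) (q : field2) : Prop :=
  forall a b a' b', Rabs (q a' b' - q a b) <= H * pw (Rabs (a' - a) + Rabs (b' - b)) th.

Definition state (F : flat) (M H : R) (q : field2) : Prop :=
  CS (fL F) q /\ (forall a b, Rabs (q a b) <= M) /\ hol2 (fth F) H q.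

(** The relation [q = kappa * (B_a - A_b) + beta] solved for the curl, which is the right-hand side
    for the stream function. *)
Definition vort (F : flat) (q : field2) (a b : R) : R := (q a b - fB F a) / fK F a.

(** The Dirichlet stream function fixes the velocity up to one circulating flow. Adding this
    constant to [ua] makes the integral over the circle [a = 0] equal to [2 * PI * fgam F]. *)
Definition circ (F : flat) (ua : field2) : R := fgam F - cint ua 0 / (2 * PI).
Definition vB (F : flat) (ua : field2) (a b : R) : R := ua a b + circ F ua.

Lemma C1s_inv (L km : R) (K K1 : R -> R) : 0 < L -> 0 < km -> (forall a, km <= K a) ->
  C1s L (fun a _ => K a) (fun a _ => K1 a) (fun _ _ => 0) ->
  C1s L (fun a _ => / K a) (fun a _ => - K1 a / (K a * K a)) (fun _ _ => 0).
Proof.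
  intros HL Hk HK [[U1 [U2 U3]] [[V1 [V2 V3]] [_ [Da _]]]].
  assert (P : forall a, 0 < K a) by (intros a; specialize (HK a); lra).
  assert (CK : forall a, 0 <= a <= L -> continuity_pt K a) by (intros a _; apply (UC_ctn1 (fun a _ => K a) 0); auto).
  assert (CK1 : forall a, 0 <= a <= L -> continuity_pt K1 a) by (intros a _; apply (UC_ctn1 (fun a _ => K1 a) 0); auto).
  assert (Ci : forall a, 0 <= a <= L -> continuity_pt (fun a => / K a) a).
  { intros a Ha; apply (continuity_pt_inv K); auto. specialize (P a); lra. }
  split; [|split; [|split; [|split]]].
  - apply CS_ext with (fun a _ => / K (clamp L a)); [intros a b; rewrite (U2 a b); auto|].
    apply (CS_of_a L (fun a => / K a)); auto; lra.
  - apply CS_ext with (fun a _ => - K1 (clamp L a) * (/ K (clamp L a) * / K (clamp L a))).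
    { intros a b; rewrite (U2 a b), (V2 a b). specialize (P a). field; lra. }
    apply (CS_of_a L (fun a => - K1 a * (/ K a * / K a))); [lra|]. intros a Ha.
    apply (continuity_pt_mult (fun a => - K1 a)); [apply (continuity_pt_opp K1); auto|]. apply (continuity_pt_mult (fun a => / K a)); auto.
  - apply CS_const.
  - intros a b Ha. specialize (P a).
    apply D_eq with (- / (K a * K a) * K1 a); [field; lra|].
    apply (D_comp K Rinv); auto. apply D_eq with (- / Rsqr (K a)); [auto|].
    apply is_derive_Reals. eapply is_derive_ext; [intros; reflexivity|].
    auto_derive; [lra|unfold Rsqr; field; lra].
  - intros; apply D_const.
Qed.

Lemma vort_CS (F : flat) (q : field2) : CS (fL F) q -> CS (fL F) (vort F q).
Proof.
  intros Hq. assert (HL := fLpos F).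
  apply (CS_mult (fL F) (fun a b => q a b - fB F a) (fun a _ => / fK F a)); [lra| |].
  - apply (CS_minus (fL F) q (fun a _ => fB F a)); auto; apply (fBC F).
  - apply (C1s_inv (fL F) (fkm F) (fK F) (fK1 F)); auto; [apply (fkmpos F)|apply (fKm F)|apply (fKC1 F)].
Qed.

Lemma inv_K_bound (F : flat) (a : R) : 0 < / fK F a <= / fkm F.
Proof.
  pose proof (fkmpos F). pose proof (fKm F a). split; [apply Rinv_0_lt_compat; lra|apply Rinv_le_contravar; lra].
Qed.

Lemma hol2_holb (th H : R) (q : field2) : hol2 th H q -> holb th H q.
Proof. intros Hq a b b'. specialize (Hq a b a b'). rewrite Rminus_diag, Rabs_R0, Rplus_0_l in Hq. auto. Qed.

Lemma hol2_nonneg (th H : R) (q : field2) : hol2 th H q -> 0 <= H.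
Proof.
  intros Hq. specialize (Hq 0 0 0 1). replace (Rabs (0 - 0) + Rabs (1 - 0)) with 1 in Hq by (rewrite !Rminus_0_r, Rabs_R0, Rabs_R1; ring).
  rewrite pw_1, Rmult_1_r in Hq. apply Rle_trans with (2 := Hq), Rabs_pos.
Qed.

Lemma vort_holb (F : flat) (H : R) (q : field2) : holb (fth F) H q -> 0 <= H -> holb (fth F) (H * / fkm F) (vort F q).
Proof.
  intros Hq HH a b b'. unfold vort. pose proof (inv_K_bound F a) as [I1 I2].
  replace ((q a b' - fB F a) / fK F a - (q a b - fB F a) / fK F a) with (/ fK F a * (q a b' - q a b)) by lra.
  rewrite Rabs_mult, Rabs_right by lra. specialize (Hq a b b'). pose proof (Rabs_pos (q a b' - q a b)).
  apply Rle_trans with (/ fkm F * (H * pw (Rabs (b' - b)) (fth F))); [apply Rmult_le_compat; lra|right; ring].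
Qed.

Lemma vort_bound (F : flat) (M Mb : R) (q : field2) : (forall a b, Rabs (q a b) <= M) -> (forall a, Rabs (fB F a) <= Mb) ->
  forall a b, Rabs (vort F q a b) <= (M + Mb) * / fkm F.
Proof.
  intros HM HB a b. unfold vort, Rdiv. rewrite Rabs_mult. pose proof (inv_K_bound F a) as [I1 I2].
  rewrite (Rabs_right (/ fK F a)) by lra. specialize (HM a b); specialize (HB a).
  apply Rmult_le_compat; try lra; [apply Rabs_pos|]. apply Rabs_le_between in HM, HB; apply Rabs_le_between; lra.
Qed.

Lemma hol2_UC (th H : R) (q : field2) : 0 < th -> hol2 th H q -> UC q.
Proof.
  intros Ht Hq eps He. assert (HH := hol2_nonneg _ _ _ Hq).
  destruct (continuity_pt_eps_inv _ 0 (pw_ctn th Ht 0) (eps / (H + 1))) as [d [Hd Hd']]; [apply Rdiv_lt_0_compat; lra|].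
  exists (d / 2); split; [lra|]. intros x y x' y' H1 H2.
  assert (P1 := Rabs_pos (x' - x)). assert (P2 := Rabs_pos (y' - y)).
  set (t := Rabs (x' - x) + Rabs (y' - y)).
  assert (Q : Rabs (pw t th - pw 0 th) < eps / (H + 1)).
  { apply Hd'. rewrite Rminus_0_r, Rabs_right; unfold t; lra. }
  rewrite (pw_npos 0), Rminus_0_r in Q by lra. apply Rabs_lt_between in Q.
  specialize (Hq x y x' y'). fold t in Hq.
  assert (E : (H + 1) * (eps / (H + 1)) = eps) by (field; lra).
  assert (H * pw t th <= H * (eps / (H + 1))) by (apply Rmult_le_compat_l; lra). lra.
Qed.

(* One time step: the potential vorticity [q] is transported by two successive shears, along [a] and then along [b]. *)
Definition StepRel (F : flat) (eps : R) (q q' u ua ub uaa uab ubb : field2) : Prop :=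
  Sol true (fL F) 0 (vort F q) u ua ub uaa uab ubb /\
  exists q1, CS (fL F) q1 /\
   (forall a b, q1 (a + eps * (fK F a * - ub a b)) b = q a b) /\
   (forall a b, q' a (b + eps * (fK F a * vB F ua a b)) = q1 a b) /\
   (forall a b, exists a', Rabs (a' - a) <= eps * Rabs (fK F a' * - ub a' b) /\ q1 a b = q a' b).

Lemma CS_of_a_bounded (L : R) (k : R -> R) : 0 < L -> CS L (fun a _ => k a) -> exists M, 0 < M /\ forall a, Rabs (k a) <= M.
Proof. intros HL Hk; destruct (CS_bounded L _ ltac:(lra) Hk) as [M [M0 HM]]; exists M; split; auto; intros a; apply (HM a 0). Qed.

Lemma lipschitz_C1s (L M : R) (u ua ub : field2) : 0 <= L -> C1s L u ua ub -> (forall a b, Rabs (ua a b) <= M) -> (forall a b, Rabs (ub a b) <= M) ->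
  forall a b a' b', Rabs (u a' b' - u a b) <= M * (Rabs (a' - a) + Rabs (b' - b)).
Proof.
  intros HL Hu Ha Hb a b a' b'. assert (K1 := lipschitz_a L u ua ub M HL Hu Ha a' a b').
  assert (K2 := lipschitz_b u ub M ltac:(apply Hu) Hb a b' b).
  replace (u a' b' - u a b) with ((u a' b' - u a b') + (u a b' - u a b)) by ring.
  eapply Rle_trans; [apply Rabs_triang|lra].
Qed.

Lemma C1s_shift (L c : R) (u ua ub : field2) : C1s L u ua ub -> C1s L (fun a b => u a b + c) ua ub.
Proof.
  intros Hu. generalize (C1s_plus L _ _ _ _ _ _ Hu (C1s_const L c)). apply C1s_ext; intros; ring.
Qed.

Lemma C1s_opp (L : R) (u ua ub : field2) : 0 <= L -> C1s L u ua ub -> C1s L (fun a b => - u a b) (fun a b => - ua a b) (fun a b => - ub a b).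
Proof. intros HL Hu. generalize (C1s_scal L (-1) _ _ _ HL Hu). apply C1s_ext; intros; ring. Qed.

Lemma circ_bound (F : flat) (ua : field2) (X : R) : UC ua -> (forall a b, Rabs (ua a b) <= X) -> Rabs (circ F ua) <= Rabs (fgam F) + X.
Proof.
  intros Hu HX. pose proof PI_RGT_0. assert (B := cint_bound ua 0 X Hu (HX 0)).
  assert (Q : Rabs (cint ua 0 / (2 * PI)) <= X).
  { unfold Rdiv. rewrite Rabs_mult, (Rabs_right (/ (2 * PI))) by (apply Rle_ge; left; apply Rinv_0_lt_compat; lra).
    apply Rmult_le_reg_r with (2 * PI); [lra|]. rewrite Rmult_assoc, Rinv_l; lra. }
  eapply Rle_trans; [apply Rabs_triang|]. rewrite Rabs_Ropp. lra.
Qed.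

Lemma vel_C1s (F : flat) (u ua ub uaa uab ubb : field2) : C2s (fL F) u ua ub uaa uab ubb ->
  C1s (fL F) (fun a b => fK F a * - ub a b) (fun a b => fK1 F a * - ub a b + fK F a * - uab a b) (fun a b => fK F a * - ubb a b) /\
  C1s (fL F) (fun a b => fK F a * vB F ua a b) (fun a b => fK1 F a * vB F ua a b + fK F a * uaa a b) (fun a b => fK F a * uab a b).
Proof.
  intros [H1 [H2 H3]]. assert (HL := fLpos F). assert (HK := fKC1 F). split.
  - generalize (C1s_mult (fL F) _ _ _ _ _ _ ltac:(lra) HK (C1s_opp (fL F) _ _ _ ltac:(lra) H3)). apply C1s_ext; intros; ring.
  - generalize (C1s_mult (fL F) _ _ _ _ _ _ ltac:(lra) HK (C1s_shift (fL F) (circ F ua) _ _ _ H2)). unfold vB. apply C1s_ext; intros; ring.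
Qed.

Definition vel_ok (F : flat) (V : R) (ua ub uaa uab ubb : field2) : Prop :=
  (forall a b, Rabs (fK F a * - ub a b) <= V) /\ (forall a b, Rabs (fK F a * vB F ua a b) <= V) /\
  (forall a b, Rabs (fK1 F a * - ub a b + fK F a * - uab a b) <= V) /\ (forall a b, Rabs (fK F a * - ubb a b) <= V) /\
  (forall a b, Rabs (fK1 F a * vB F ua a b + fK F a * uaa a b) <= V) /\ (forall a b, Rabs (fK F a * uab a b) <= V) /\
  (forall a b, Rabs (ub a b) <= V) /\ (forall a b, Rabs (vB F ua a b) <= V).

Lemma ln_one_plus_nonneg (H : R) : 0 <= H -> 0 <= ln (1 + H).
Proof. intros [HH|<-]; [rewrite <- ln_1; left; apply ln_increasing; lra|rewrite Rplus_0_r, ln_1; lra]. Qed.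

(** [C] depends on [F] and [M] but not on the Hoelder constant, which enters only through the
    logarithm. This separation is what makes the growth estimate for the scheme linear. *)
Lemma vel_bound (F : flat) (M : R) : exists C, 0 < C /\ forall q H u ua ub uaa uab ubb, state F M H q ->
  Sol true (fL F) 0 (vort F q) u ua ub uaa uab ubb -> vel_ok F (C * (1 + ln (1 + H))) ua ub uaa uab ubb.
Proof.
  assert (HL := fLpos F). assert (Hkm := fkmpos F). assert (Hth := fthr F).
  destruct (CS_of_a_bounded _ _ HL (fBC F)) as [Mb [Mb0 HMb]].
  destruct (CS_of_a_bounded _ (fK F) HL ltac:(apply (fKC1 F))) as [k0 [k00 Hk0]].
  destruct (CS_of_a_bounded _ (fK1 F) HL ltac:(apply (fKC1 F))) as [k1 [k10 Hk1]].
  assert (Hik : 0 < / fkm F) by (apply Rinv_0_lt_compat; auto).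
  set (M' := Rmax M 0). assert (M <= M') by apply Rmax_l. assert (0 <= M') by apply Rmax_r.
  set (Mf := (M' + Mb) * / fkm F). assert (HMf : 0 < Mf) by (unfold Mf; nra).
  set (l0 := ln (1 + / fkm F)). assert (Hl0 : 0 <= l0) by (apply ln_one_plus_nonneg; lra).
  assert (HKS := KS_pos (fL F) HL).
  set (c0 := KS (fL F) * (4 * (1 + 2 * Mf) * (1 + l0) / fth F)).
  assert (Hc0 : 0 < c0) by (unfold c0; apply Rmult_lt_0_compat; auto; apply Rdiv_lt_0_compat; [nra|lra]).
  set (g := Rabs (fgam F)). assert (Hg : 0 <= g) by apply Rabs_pos.
  set (C := (1 + k0 + k1) * (g + 3 * c0)). exists C; split; [unfold C; nra|].
  intros q Hq u ua ub uaa uab ubb [S1 [S2 S3]] HS.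
  assert (HH := hol2_nonneg _ _ _ S3).
  set (l := ln (1 + Hq)). assert (Hl : 0 <= l) by (apply ln_one_plus_nonneg; lra).
  assert (Hbnd : forall a b, Rabs (vort F q a b) <= Mf).
  { intros a b; apply vort_bound; auto. intros x y; apply Rle_trans with M; auto. }
  assert (B := Schauder_log true (fL F) (fth F) (Hq * / fkm F) Mf 0 (vort F q) u ua ub uaa uab ubb HL Hth ltac:(nra)
     (proj1 (vort_CS F q S1)) HS (vort_holb F Hq q (hol2_holb _ _ _ S3) HH) Hbnd).
  set (X := KS (fL F) * (4 * (1 + 2 * Mf) * (1 + ln (1 + Hq * / fkm F)) / fth F)) in B.
  assert (HX : X <= c0 * (1 + l)).
  { unfold X, c0. rewrite (Rmult_assoc (KS (fL F)) _ (1 + l)). apply Rmult_le_compat_l; [lra|].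
    (* Dividing by [fK F] rescales the Hoelder constant by at most [1 / fkm F]; inside the logarithm
       this is an additive constant, absorbed into the factor [1 + l0]. *)
    assert (Hln : ln (1 + Hq * / fkm F) <= l + l0).
    { unfold l, l0. rewrite <- ln_mult by lra. destruct (Req_dec (1 + Hq * / fkm F) ((1 + Hq) * (1 + / fkm F))) as [->|]; [lra|].
      left; apply ln_increasing; nra. }
    unfold Rdiv. replace (4 * (1 + 2 * Mf) * (1 + l0) * / fth F * (1 + l)) with (4 * (1 + 2 * Mf) * ((1 + l0) * (1 + l)) * / fth F) by ring.
    apply Rmult_le_compat_r; [left; apply Rinv_0_lt_compat; lra|]. apply Rmult_le_compat_l; nra. }
  assert (X0 : 0 <= X) by (apply Rle_trans with (2 := proj1 (B 0 0)), Rabs_pos).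
  set (Y := g + 3 * X).
  assert (HY : (1 + k0 + k1) * Y <= C * (1 + l)).
  { unfold C, Y. rewrite Rmult_assoc. apply Rmult_le_compat_l; [lra|]. nra. }
  assert (HY0 : 0 <= Y) by (unfold Y; lra).
  assert (BvB : forall a b, Rabs (vB F ua a b) <= g + 2 * X).
  { intros a b. destruct (B a b) as [_ [Q _]].
    assert (Q2 := circ_bound F ua X ltac:(apply HS) ltac:(intros; apply B)). fold g in Q2.
    eapply Rle_trans; [apply Rabs_triang|lra]. }
  assert (P1 : forall (x y : R), Rabs x <= X -> Rabs y <= k0 -> Rabs (y * - x) <= k0 * Y).
  { intros x y Hx Hy. rewrite Rabs_mult, Rabs_Ropp. apply Rmult_le_compat; try apply Rabs_pos; auto. unfold Y; lra. }
  assert (P2 : forall (x y : R), Rabs x <= g + 2 * X -> Rabs y <= k0 -> Rabs (y * x) <= k0 * Y).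
  { intros x y Hx Hy. rewrite Rabs_mult. apply Rmult_le_compat; try apply Rabs_pos; auto. unfold Y; lra. }
  assert (P3 : forall (x y : R), Rabs x <= g + 2 * X -> Rabs y <= k1 -> Rabs (y * x) <= k1 * Y).
  { intros x y Hx Hy. rewrite Rabs_mult. apply Rmult_le_compat; try apply Rabs_pos; auto. unfold Y; lra. }
  assert (K0Y : 0 <= k0 * Y) by nra. assert (K1Y : 0 <= k1 * Y) by nra.
  split; [|split; [|split; [|split; [|split; [|split; [|split]]]]]]; intros a b; destruct (B a b) as [B1 [B2 [B3 [B4 [B5 B6]]]]].
  - eapply Rle_trans; [apply P1; auto|lra].
  - eapply Rle_trans; [apply P2; auto|lra].
  - eapply Rle_trans; [apply Rabs_triang|]. pose proof (P1 _ _ B5 (Hk0 a)).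
    pose proof (P3 (- ub a b) (fK1 F a) ltac:(rewrite Rabs_Ropp; lra) (Hk1 a)). lra.
  - eapply Rle_trans; [apply P1; auto|lra].
  - eapply Rle_trans; [apply Rabs_triang|]. pose proof (P2 (uaa a b) (fK F a) ltac:(lra) (Hk0 a)).
    pose proof (P3 (vB F ua a b) (fK1 F a) (BvB a b) (Hk1 a)). lra.
  - eapply Rle_trans; [apply P2; auto; lra|lra].
  - unfold Y in *; lra.
  - specialize (BvB a b). unfold Y in *; lra.
Qed.

Lemma Sol_exists (F : flat) (M H : R) (q : field2) : state F M H q ->
  exists u ua ub uaa uab ubb, Sol true (fL F) 0 (vort F q) u ua ub uaa uab ubb.
Proof.
  intros [S1 [S2 S3]]. assert (HL := fLpos F). assert (Hkm := fkmpos F).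
  assert (HH := hol2_nonneg _ _ _ S3). assert (Hik : 0 < / fkm F) by (apply Rinv_0_lt_compat; auto).
  destruct (Poisson_solvable true (fL F) (fth F) (H * / fkm F) (vort F q) HL (fthr F) ltac:(nra) (vort_CS F q S1)
    (vort_holb F H q (hol2_holb _ _ _ S3) HH)) as [k [u [ua [ub [uaa [uab [ubb HS]]]]]]].
  exists u, ua, ub, uaa, uab, ubb. destruct HS as [H1 [[H2 ->] H3]]. split; [|split]; auto. split; auto.
Qed.

(** Composition with the inverse shears preserves the bound [M]. Each inverse is Lipschitz with
    constant [s = 1 + 2 * (eps * V)], and since [s >= 1] its effect on the Hoelder constant is at
    most the factor [s] with the exponent unchanged; two shears give the square. *)
Lemma step_exists (F : flat) (M H V eps : R) (q u ua ub uaa uab ubb : field2) : state F M H q ->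
  Sol true (fL F) 0 (vort F q) u ua ub uaa uab ubb -> vel_ok F V ua ub uaa uab ubb -> 0 < eps -> eps * V <= / 2 ->
  exists q', StepRel F eps q q' u ua ub uaa uab ubb /\ state F M (H * ((1 + 2 * (eps * V)) * (1 + 2 * (eps * V)))) q' /\
    forall a b, exists a' b', Rabs (a' - a) + Rabs (b' - b) <= eps * (2 * V) /\ q' a b = q a' b'.
Proof.
  intros [S1 [S2 S3]] HS [V1 [V2 [V3 [V4 [V5 [V6 _]]]]]] He HeV. assert (HL := fLpos F). assert (Hth := fthr F).
  assert (V0 : 0 <= V) by (apply Rle_trans with (2 := V1 0 0), Rabs_pos).
  assert (HH := hol2_nonneg _ _ _ S3).
  destruct (vel_C1s F u ua ub uaa uab ubb (proj1 HS)) as [C1 C2].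
  destruct (shear_inverse (fun a b => fK F a * - ub a b) eps V V He V0 HeV) as [G1 [E1 [U1 [D1 L1]]]]; auto.
  { apply (lipschitz_C1s (fL F) V _ _ _ ltac:(lra) C1); auto. }
  destruct (shear_inverse (fun b a => fK F a * vB F ua a b) eps V V He V0 HeV) as [G2 [E2 [U2 [D2 L2]]]]; auto.
  { intros x y x' y'. rewrite Rplus_comm. apply (lipschitz_C1s (fL F) V _ _ _ ltac:(lra) C2); auto. }
  set (q1 := fun a b => q (G1 a b) b). set (q' := fun a b => q1 a (G2 b a)).
  set (s := 1 + 2 * (eps * V)). assert (Hs : 1 <= s) by (unfold s; nra).
  assert (Hpw : forall x p, 0 <= p -> 0 <= x <= s * p -> pw x (fth F) <= s * pw p (fth F)).
  { intros x p Hp Hx. apply Rle_trans with (pw (s * p) (fth F)); [apply pw_le; lra|]. apply pw_le_mult_one_plus; lra. }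
  assert (h1 : hol2 (fth F) (H * s) q1).
  { intros a b a' b'. eapply Rle_trans; [apply S3|]. rewrite Rmult_assoc. apply Rmult_le_compat_l; auto.
    apply Hpw; [pose proof (Rabs_pos (a' - a)); pose proof (Rabs_pos (b' - b)); lra|].
    split; [pose proof (Rabs_pos (G1 a' b' - G1 a b)); pose proof (Rabs_pos (b' - b)); lra|apply L1]. }
  assert (h2 : hol2 (fth F) (H * (s * s)) q').
  { intros a b a' b'. eapply Rle_trans; [apply h1|]. replace (H * (s * s)) with (H * s * s) by ring.
    rewrite (Rmult_assoc (H * s)). apply Rmult_le_compat_l; [nra|].
    assert (Q := L2 b a b' a'). fold s in Q.
    apply Hpw; [pose proof (Rabs_pos (a' - a)); pose proof (Rabs_pos (b' - b)); lra|].
    split; [pose proof (Rabs_pos (G2 b' a' - G2 b a)); pose proof (Rabs_pos (a' - a)); lra|lra]. }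
  destruct S1 as [Uq [Cq Pq]]. destruct C1 as [[_ [Cc1 Pc1]] _]. destruct C2 as [[_ [Cc2 Pc2]] _].
  (* The stream function is constant on each side, so its tangential derivative vanishes there. The
     shear along [a] thus fixes both sides, and also every point of the clamped exterior, so the
     transported function is again clamped. *)
  assert (Cub : dirichlet (fL F) (fun a b => fK F a * - ub a b)).
  { destruct HS as [[H1 [H2 H3]] [[Hd _] _]]. destruct H1 as [_ [_ [_ [_ Db]]]].
    assert (Z : forall x, (forall b, u x b = 0) -> forall b, ub x b = 0).
    { intros x Hx b. apply (uniqueness_limite (fun y => u x y) b); auto. apply D_ext with (fun _ => 0); [auto|apply D_const]. }
    intros b; rewrite !Z by (intros; apply Hd). split; ring. }
  assert (CS1 : CS (fL F) q1).
  { split; [apply hol2_UC with (fth F) (H * s); auto; lra|]. split.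
    - intros a b; unfold q1.
      destruct (Rlt_dec a 0) as [Ha|Ha]; [|destruct (Rlt_dec (fL F) a) as [Ha'|Ha']].
      + assert (Ec : clamp (fL F) a = 0).
        { unfold clamp, Rmax, Rmin; destruct (Rle_dec (fL F) a); destruct (Rle_dec _ _); lra. }
        rewrite Ec. rewrite (U1 0 b 0) by (rewrite (proj1 (Cub b)); ring).
        rewrite (U1 a b a) by (rewrite <- Cc1, Ec, (proj1 (Cub b)); ring). rewrite <- (Cq a), Ec; auto.
      + assert (Ec : clamp (fL F) a = fL F).
        { unfold clamp, Rmax, Rmin; destruct (Rle_dec (fL F) a); destruct (Rle_dec _ _); lra. }
        rewrite Ec. rewrite (U1 (fL F) b (fL F)) by (rewrite (proj2 (Cub b)); ring).
        rewrite (U1 a b a) by (rewrite <- Cc1, Ec, (proj2 (Cub b)); ring). rewrite <- (Cq a), Ec; auto.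
      + rewrite clamp_id by lra; auto.
    - intros a b; unfold q1. rewrite Pq. rewrite (U1 a (b + 2 * PI) (G1 a b)); auto. rewrite Pc1. apply E1. }
  assert (CS2 : CS (fL F) q').
  { split; [apply hol2_UC with (fth F) (H * (s * s)); auto; lra|]. split.
    - intros a b; unfold q'. rewrite (U2 b (clamp (fL F) a) (G2 b a)) by (rewrite Cc2; apply E2). apply CS1.
    - intros a b; unfold q'. rewrite (U2 (b + 2 * PI) a (G2 b a + 2 * PI)); [apply CS1|]. rewrite Pc2. specialize (E2 b a); lra. }
  exists q'; split; [|split].
  - split; auto. exists q1; split; [auto|split; [|split]].
    + intros a b; unfold q1. rewrite (U1 _ b a); auto.
    + intros a b; unfold q'. rewrite (U2 _ a b); auto.
    + intros a b. exists (G1 a b); split; auto. specialize (E1 a b).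
      replace (G1 a b - a) with (- (eps * (fK F (G1 a b) * - ub (G1 a b) b))) by lra.
      rewrite Rabs_Ropp, Rabs_mult, (Rabs_right eps); lra.
  - split; [auto|split; auto]. intros a b; unfold q', q1; auto.
  - intros a b. exists (G1 a (G2 b a)), (G2 b a). split; auto. specialize (D1 a (G2 b a)); specialize (D2 b a). lra.
Qed.

(** * Integrals after a time step, to first order in the step size *)

Lemma shear_taylor (w0 wF wx c cx eps V e : R) : 0 < eps -> Rabs c <= V -> Rabs cx <= V ->
  (exists xi, wF - w0 = xi * (eps * c) /\ Rabs (xi - wx) <= e) -> Rabs (wF - w0) <= e ->
  Rabs (wF * (1 + eps * cx) - w0 - eps * (wx * c + w0 * cx)) <= eps * (2 * V * e).
Proof.
  intros He Hc Hcx [xi [E Hxi]] Hw.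
  replace (wF * (1 + eps * cx) - w0 - eps * (wx * c + w0 * cx)) with (eps * ((xi - wx) * c + cx * (wF - w0))).
  2:{ replace (eps * ((xi - wx) * c + cx * (wF - w0))) with (xi * (eps * c) + eps * (cx * (wF - w0)) - eps * (wx * c)) by ring.
      rewrite <- E; ring. }
  rewrite Rabs_mult, (Rabs_right eps) by lra. apply Rmult_le_compat_l; [lra|].
  eapply Rle_trans; [apply Rabs_triang|]. rewrite !Rabs_mult.
  assert (Rabs (xi - wx) * Rabs c <= e * V) by (apply Rmult_le_compat; auto; apply Rabs_pos).
  assert (Rabs cx * Rabs (wF - w0) <= V * e) by (apply Rmult_le_compat; auto; apply Rabs_pos). lra.
Qed.

Lemma mean_value_segment (f f' : R -> R) (lo hi x y : R) : ctn f -> (forall z, lo < z < hi -> D f z (f' z)) ->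
  lo <= x <= hi -> lo <= y <= hi -> exists c, Rabs (c - x) <= Rabs (y - x) /\ f y - f x = f' c * (y - x).
Proof.
  intros Cf Hf Hx Hy. destruct (Rtotal_order x y) as [H|[<-|H]].
  - destruct (mean_value f f' x y H) as [c [Hc E]]; auto; [intros; apply Hf; lra|].
    exists c; split; auto. rewrite !Rabs_right; lra.
  - exists x; split; [lra|ring].
  - destruct (mean_value f f' y x H) as [c [Hc E]]; auto; [intros; apply Hf; lra|].
    exists c; split; [|lra]. rewrite !Rabs_left1; lra.
Qed.

(* Change of variables along the shear [x |-> x + eps * c x], expanded to first order in [eps]. *)
Lemma weak_shear (l eps V e M : R) (w wx c cx q q1 : R -> R) : 0 <= l -> 0 < eps ->
  ctn w -> ctn wx -> ctn c -> ctn cx -> ctn q -> ctn q1 -> (forall x, 0 < x < l -> D c x (cx x)) ->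
  (forall x, Rabs (c x) <= V) -> (forall x, Rabs (cx x) <= V) -> (forall x, Rabs (q x) <= M) -> (forall x, q1 (x + eps * c x) = q x) ->
  RInt (fun x => w x * q1 x) 0 (l + eps * c l) - RInt (fun x => w x * q1 x) 0 (0 + eps * c 0) = RInt (fun x => w x * q1 x) 0 l ->
  (forall x, 0 <= x <= l -> (exists xi, w (x + eps * c x) - w x = xi * (eps * c x) /\ Rabs (xi - wx x) <= e) /\ Rabs (w (x + eps * c x) - w x) <= e) ->
  Rabs (RInt (fun x => w x * q1 x - w x * q x - eps * (q x * (wx x * c x + w x * cx x))) 0 l) <= eps * (2 * V * e * M) * l.
Proof.
  intros Hl He Cw Cwx Cc Ccx Cq Cq1 Hc HV HVx HM Hrel Hsub Htay.
  set (FF := fun x => x + eps * c x). assert (CF : ctn FF) by (unfold FF; repeat cstep; auto).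
  set (h := fun x => w x * q1 x) in *. assert (Ch : ctn h) by (apply ctn_mult; auto).
  set (k := fun x => w (FF x) * q x * (1 + eps * cx x)).
  assert (CwF : ctn (fun x => w (FF x))) by (apply (ctn_comp FF w); auto).
  assert (Ck : ctn k) by (unfold k; repeat cstep; auto).
  (* Substitution through a primitive of [h] composed with the shear, without using the inverse map.
     The hypothesis on [q1] over the displaced limits says that the limits may be moved back to [0]
     and [l]. *)
  assert (E1 : RInt h 0 l = RInt k 0 l).
  { rewrite (RI_ftc (fun x => RInt h 0 (FF x)) k); auto.
    - intros x _. apply (ctn_comp FF (fun x => RInt h 0 x)); auto. intros y; eapply D_cont; apply RI_derive; auto.
    - intros x Hx. apply D_eq with (h (FF x) * (1 + eps * cx x)).
      + unfold h, k, FF. rewrite Hrel. ring.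
      + apply (D_comp FF (fun x => RInt h 0 x)); [|apply RI_derive; auto]. unfold FF. dsplit; [apply Hc; auto|ring]. }
  assert (Cp : ctn (fun x => w x * q x + eps * (q x * (wx x * c x + w x * cx x)))) by (repeat cstep; auto).
  assert (E2 : RInt (fun x => w x * q1 x - w x * q x - eps * (q x * (wx x * c x + w x * cx x))) 0 l =
    RInt (fun x => q x * (w (FF x) * (1 + eps * cx x) - w x - eps * (wx x * c x + w x * cx x))) 0 l).
  { rewrite (RI_ext _ (fun x => h x - (w x * q x + eps * (q x * (wx x * c x + w x * cx x))))) by (intros; unfold h; ring).
    rewrite RI_minus, E1, <- RI_minus by auto. apply RI_ext; intros; unfold k; ring. }
  rewrite E2. apply Rle_trans with (M * (eps * (2 * V * e)) * (l - 0)); [|right; ring].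
  apply RI_bound; [lra|repeat cstep; auto|].
  intros x Hx. rewrite Rabs_mult. destruct (Htay x Hx). apply Rmult_le_compat; auto; try apply Rabs_pos. apply shear_taylor; auto.
Qed.

Lemma II_expansion (L eps : R) (f g h : field2) : 0 < L -> CS L f -> CS L g -> CS L h ->
  CS L (fun a b => f a b - g a b - eps * h a b) /\ II L f - II L g - eps * II L h = II L (fun a b => f a b - g a b - eps * h a b).
Proof.
  intros HL Hf Hg Hh. assert (H1 := CS_minus L f g Hf Hg). assert (H2 := CS_scal L eps h (Rlt_le _ _ HL) Hh).
  split; [exact (CS_minus L _ _ H1 H2)|]. rewrite (II_minus L _ _ (proj1 H1) (proj1 H2)), (II_minus L f g (proj1 Hf) (proj1 Hg)), (II_scal L eps h (proj1 Hh)). auto.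
Qed.

Lemma shear_displacement (eps V c x : R) : 0 < eps -> Rabs c <= V -> Rabs (x + eps * c - x) <= eps * V.
Proof.
  intros He Hc. replace (x + eps * c - x) with (eps * c) by ring. rewrite Rabs_mult, (Rabs_right eps) by lra. apply Rmult_le_compat_l; lra.
Qed.

Lemma weak_shear_a (L eps V e M : R) (w wa wb c ca cb q q1 : field2) : 0 < L -> 0 < eps -> eps * V <= / 2 ->
  C1s L w wa wb -> C1s L c ca cb -> dirichlet L c -> (forall a b, Rabs (c a b) <= V) -> (forall a b, Rabs (ca a b) <= V) ->
  CS L q -> CS L q1 -> (forall a b, Rabs (q a b) <= M) -> (forall a b, q1 (a + eps * c a b) b = q a b) ->
  (forall x x' b, Rabs (x - x') <= eps * V -> Rabs (w x b - w x' b) <= e /\ Rabs (wa x b - wa x' b) <= e) ->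
  Rabs (II L (fun a b => w a b * q1 a b) - II L (fun a b => w a b * q a b) - eps * II L (fun a b => q a b * (wa a b * c a b + w a b * ca a b)))
    <= eps * (2 * V * e * M) * (2 * PI * L).
Proof.
  intros HL He HeV Hw Hc Hd HV HVa Hq Hq1 HM Hrel Hosc. assert (HL' := Rlt_le _ _ HL).
  assert (Hlip := lipschitz_a L c ca cb V HL' Hc HVa).
  destruct Hw as [W1 [W2 [W3 [W4 W5]]]]. destruct Hc as [C1 [C2 [C3 [C4 C5]]]].
  destruct (II_expansion L eps _ _ _ HL (CS_mult L _ _ HL' W1 Hq1) (CS_mult L _ _ HL' W1 Hq)
    (CS_mult L _ _ HL' Hq (CS_plus L _ _ (CS_mult L _ _ HL' W2 C1) (CS_mult L _ _ HL' W1 C2)))) as [CR ->].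
  rewrite II_fubini by (auto; apply CR). set (R1 := fun a b => w a b * q1 a b - _ - _) in *. pose proof PI_RGT_0.
  apply Rle_trans with (eps * (2 * V * e * M) * L * (2 * PI - 0)); [|right; ring].
  apply RI_bound; [lra| |].
  - apply UC1_ctn. intros eta Heta. destruct (proj1 CR (eta / (2 * (L + 1)))) as [d [Hd0 Hd']]; [apply Rdiv_lt_0_compat; lra|].
    exists d; split; auto. intros x x' Hx. rewrite <- RI_minus by (apply (UC_ctn1 R1), CR).
    apply Rle_lt_trans with (eta / (2 * (L + 1)) * (L - 0)).
    + apply RI_bound; [lra|apply ctn_minus; apply (UC_ctn1 R1), CR|]. intros y _; left; apply Hd'; auto; rdiag.
    + assert (E : eta / (2 * (L + 1)) * (2 * (L + 1)) = eta) by (field; lra).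
      assert (0 < eta / (2 * (L + 1))) by (apply Rdiv_lt_0_compat; lra). set (z := eta / (2 * (L + 1))) in *. nra.
  - intros b _. assert (HF : forall a, Rabs (a + eps * c a b - a) <= eps * V) by (intros; apply shear_displacement; auto).
    apply (weak_shear L eps V e M (fun a => w a b) (fun a => wa a b) (fun a => c a b) (fun a => ca a b) (fun a => q a b) (fun a => q1 a b));
      auto; try (apply (UC_ctn1 w), W1 || apply (UC_ctn1 wa), W2 || apply (UC_ctn1 c), C1 || apply (UC_ctn1 ca), C2 || apply (UC_ctn1 q), Hq || apply (UC_ctn1 q1), Hq1).
    + rewrite (proj1 (Hd b)), (proj2 (Hd b)), !Rmult_0_r, !Rplus_0_r, RI_point. ring.
    + intros a Ha. split; [|apply Hosc; auto].
      destruct (mean_value_segment (fun x => w x b) (fun x => wa x b) 0 L a (a + eps * c a b)) as [z [Hz Ez]]; auto.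
      { apply (UC_ctn1 w), W1. }
      (* The Lipschitz function [c] vanishes on both sides, so [eps * V <= 1 / 2] keeps the
         displacement below half the distance to either side. The segment stays in the strip, where
         [w] is differentiable. *)
      { assert (K1 := Hlip a 0 b); assert (K2 := Hlip a L b). rewrite (proj1 (Hd b)), !Rminus_0_r, (Rabs_right a) in K1 by lra.
        rewrite (proj2 (Hd b)), Rminus_0_r, (Rabs_left1 (a - L)) in K2 by lra. apply Rabs_le_between in K1, K2.
        assert (eps * (V * a) <= / 2 * a) by (rewrite <- Rmult_assoc; apply Rmult_le_compat_r; lra).
        assert (eps * (V * (L - a)) <= / 2 * (L - a)) by (rewrite <- Rmult_assoc; apply Rmult_le_compat_r; lra).
        split; nra. }
      exists (wa z b); split; [rewrite Ez; ring|]. apply Hosc. specialize (HF a); lra.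
Qed.

Lemma weak_shear_b (L eps V e M : R) (w wa wb c ca cb q q1 : field2) : 0 < L -> 0 < eps ->
  C1s L w wa wb -> C1s L c ca cb -> (forall a b, Rabs (c a b) <= V) -> (forall a b, Rabs (cb a b) <= V) ->
  CS L q -> CS L q1 -> (forall a b, Rabs (q a b) <= M) -> (forall a b, q1 a (b + eps * c a b) = q a b) ->
  (forall a y y', Rabs (y - y') <= eps * V -> Rabs (w a y - w a y') <= e /\ Rabs (wb a y - wb a y') <= e) ->
  Rabs (II L (fun a b => w a b * q1 a b) - II L (fun a b => w a b * q a b) - eps * II L (fun a b => q a b * (wb a b * c a b + w a b * cb a b)))
    <= eps * (2 * V * e * M) * (2 * PI * L).
Proof.
  intros HL He Hw Hc HV HVb Hq Hq1 HM Hrel Hosc. assert (HL' := Rlt_le _ _ HL).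
  destruct Hw as [W1 [W2 [W3 [W4 W5]]]]. destruct Hc as [C1 [C2 [C3 [C4 C5]]]].
  assert (Cwq1 := CS_mult L _ _ HL' W1 Hq1).
  destruct (II_expansion L eps _ _ _ HL Cwq1 (CS_mult L _ _ HL' W1 Hq)
    (CS_mult L _ _ HL' Hq (CS_plus L _ _ (CS_mult L _ _ HL' W3 C1) (CS_mult L _ _ HL' W1 C3)))) as [CR ->].
  unfold II. pose proof PI_RGT_0. apply Rle_trans with (eps * (2 * V * e * M) * (2 * PI) * (L - 0)); [|right; ring].
  apply RI_bound; [lra|apply cint_ctn, CR|]. intros a _. unfold cint.
  assert (HF : forall b, Rabs (b + eps * c a b - b) <= eps * V) by (intros; apply shear_displacement; auto).
  apply (weak_shear (2 * PI) eps V e M (fun b => w a b) (fun b => wb a b) (fun b => c a b) (fun b => cb a b) (fun b => q a b) (fun b => q1 a b));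
    auto; try lra; try (apply (UC_ctn2 w), W1 || apply (UC_ctn2 wb), W3 || apply (UC_ctn2 c), C1 || apply (UC_ctn2 cb), C3 || apply (UC_ctn2 q), Hq || apply (UC_ctn2 q1), Hq1).
  (* In the periodic direction both limits are displaced by the same amount, so the displaced
     interval is still a full period. *)
  - assert (Ch := UC_ctn2 _ a (proj1 Cwq1)). cbv beta in Ch.
    replace (c a (2 * PI)) with (c a 0) by (rewrite <- (proj2 (proj2 C1) a 0), Rplus_0_l; auto).
    replace (2 * PI + eps * c a 0) with (0 + eps * c a 0 + 2 * PI) by ring.
    rewrite <- (RI_chasles _ 0 (0 + eps * c a 0) (0 + eps * c a 0 + 2 * PI) Ch).
    rewrite (RI_shift_period _ (0 + eps * c a 0) Ch); [lra|]. intros x. rewrite (proj2 (proj2 W1)), (proj2 (proj2 Hq1)); auto.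
  - intros b Hb. split; [|apply Hosc; auto].
    destruct (mean_value_segment (fun x => w a x) (fun x => wb a x) (Rmin b (b + eps * c a b)) (Rmax b (b + eps * c a b)) b (b + eps * c a b)) as [z [Hz Ez]]; auto.
    { apply (UC_ctn2 w), W1. } { split; [apply Rmin_l|apply Rmax_l]. } { split; [apply Rmin_r|apply Rmax_r]. }
    exists (wb a z); split; [rewrite Ez; ring|]. apply Hosc. specialize (HF b); lra.
Qed.

(** One step satisfies the weak form of the vorticity equation up to [eps * eta]. The test function
    is divided by [fK F], so that the measure is the one preserved by the velocity
    [kappa * (A, B)]. *)
Lemma weak_step (F : flat) (M H V : R) (p pa pb : field2) : 0 <= V -> 0 <= H -> C1s (fL F) p pa pb ->
  forall eta, 0 < eta -> exists e0, 0 < e0 /\ forall eps q q' u ua ub uaa uab ubb, 0 < eps < e0 ->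
    state F M H q -> StepRel F eps q q' u ua ub uaa uab ubb -> CS (fL F) q' -> vel_ok F V ua ub uaa uab ubb ->
    Rabs (II (fL F) (fun a b => p a b * vort F q' a b) - II (fL F) (fun a b => p a b * vort F q a b)
      - eps * II (fL F) (fun a b => q a b * (- ub a b * pa a b + vB F ua a b * pb a b))) <= eps * eta.
Proof.
  intros HV0 HH Hp eta Heta. assert (HL := fLpos F). pose proof PI_RGT_0 as HPI. assert (Hth := fthr F).
  assert (Hinv := C1s_inv (fL F) (fkm F) (fK F) (fK1 F) HL (fkmpos F) (fKm F) (fKC1 F)).
  assert (Hw := C1s_mult (fL F) _ _ _ _ _ _ ltac:(lra) Hp Hinv).
  set (w := fun a b => p a b * / fK F a) in *.
  set (wa := fun a b => pa a b * / fK F a + p a b * (- fK1 F a / (fK F a * fK F a))) in *.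
  set (wb := fun a b => pb a b * / fK F a + p a b * 0) in *.
  destruct (CS_bounded (fL F) w ltac:(lra) ltac:(apply Hw)) as [Bw [Bw0 HBw]].
  destruct (CS_bounded (fL F) wb ltac:(lra) ltac:(apply Hw)) as [Bb [Bb0 HBb]].
  set (A := 2 * PI * fL F). assert (HA : 0 < A) by (unfold A; nra).
  set (M' := Rmax M 0). assert (M <= M') by apply Rmax_l. assert (M'0 : 0 <= M') by apply Rmax_r.
  set (e := eta / (8 * (V + 1) * (M' + 1) * A)). assert (He : 0 < e).
  { unfold e; apply Rdiv_lt_0_compat; auto. apply Rmult_lt_0_compat; auto. nra. }
  destruct (proj1 (proj1 Hw) e He) as [d1 [Hd1 Hd1']].
  destruct (proj1 (proj1 (proj2 Hw)) e He) as [d2 [Hd2 Hd2']].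
  destruct (proj1 (proj1 (proj2 (proj2 Hw))) e He) as [d3 [Hd3 Hd3']].
  set (B := H * ((Bb + Bw) * V) * A).
  assert (HB : 0 <= B) by (unfold B; apply Rmult_le_pos; [|lra]; apply Rmult_le_pos; auto; nra).
  destruct (continuity_pt_eps_inv _ 0 (pw_ctn (fth F) ltac:(lra) 0) (eta / (2 * (B + 1)))) as [d4 [Hd4 Hd4']]; [apply Rdiv_lt_0_compat; lra|].
  set (d := Rmin (Rmin d1 d2) (Rmin d3 d4)).
  assert (Hd : 0 < d) by (repeat apply Rmin_pos; auto).
  assert (Hdd : d <= d1 /\ d <= d2 /\ d <= d3 /\ d <= d4).
  { unfold d; rmin_bounds (Rmin d1 d2) (Rmin d3 d4);
    rmin_bounds d1 d2; rmin_bounds d3 d4. lra. }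
  set (e0 := Rmin (d / (V + 1)) (/ (2 * (V + 1)))).
  assert (He0 : 0 < e0) by (apply Rmin_pos; [apply Rdiv_lt_0_compat; lra|apply Rinv_0_lt_compat; lra]).
  exists e0; split; auto.
  intros eps q q' u ua ub uaa uab ubb Heps [S1 [S2 S3]] [HS [q1 [Cq1 [R1 [R2 R3]]]]] Cq' [V1 [V2 [V3 [V4 [V5 [V6 _]]]]]].
  assert (HeV : eps * V < d /\ eps * V <= / 2).
  { assert (K1 := Rmin_l (d / (V + 1)) (/ (2 * (V + 1)))). assert (K2 := Rmin_r (d / (V + 1)) (/ (2 * (V + 1)))). fold e0 in K1, K2.
    assert (E1 : d / (V + 1) * (V + 1) = d) by (field; lra). assert (E2 : / (2 * (V + 1)) * (V + 1) = / 2) by (field; lra).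
    assert (eps * (V + 1) < e0 * (V + 1)) by (apply Rmult_lt_compat_r; lra).
    assert (e0 * (V + 1) <= d / (V + 1) * (V + 1)) by (apply Rmult_le_compat_r; lra).
    assert (e0 * (V + 1) <= / (2 * (V + 1)) * (V + 1)) by (apply Rmult_le_compat_r; lra). lra. }
  destruct (vel_C1s F u ua ub uaa uab ubb (proj1 HS)) as [C1 C2].
  assert (Cub : dirichlet (fL F) (fun a b => fK F a * - ub a b)).
  { destruct HS as [[H1 [H2 H3]] [[Hd' _] _]]. destruct H1 as [_ [_ [_ [_ Db]]]].
    assert (Z : forall x, (forall b, u x b = 0) -> forall b, ub x b = 0).
    { intros x Hx b. apply (uniqueness_limite (fun y => u x y) b); auto. apply D_ext with (fun _ => 0); [auto|apply D_const]. }
    intros b; rewrite !Z by (intros; apply Hd'). split; ring. }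
  assert (HM' : forall a b, Rabs (q a b) <= M') by (intros a b; specialize (S2 a b); lra).
  assert (HM1 : forall a b, Rabs (q1 a b) <= M') by (intros a b; destruct (R3 a b) as [a' [_ ->]]; auto).
  assert (T1 := weak_shear_a (fL F) eps V e M' w wa wb _ _ _ q q1 HL ltac:(lra) (proj2 HeV) Hw C1 Cub V1 V3 S1 Cq1 HM' R1).
  assert (T2 := weak_shear_b (fL F) eps V e M' w wa wb _ _ _ q1 q' HL ltac:(lra) Hw C2 V2 V6 Cq1 Cq' HM1 R2).
  assert (Z : forall x, Rabs (x - x) < d) by (intros; rdiag).
  assert (O1 : forall x x' b, Rabs (x - x') <= eps * V -> Rabs (w x b - w x' b) <= e /\ Rabs (wa x b - wa x' b) <= e).
  { intros x x' b Hx; specialize (Z b); split; left; [apply Hd1'|apply Hd2']; lra. }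
  assert (O2 : forall a y y', Rabs (y - y') <= eps * V -> Rabs (w a y - w a y') <= e /\ Rabs (wb a y - wb a y') <= e).
  { intros a y y' Hy; specialize (Z a); split; left; [apply Hd1'|apply Hd3']; lra. }
  specialize (T1 O1); specialize (T2 O2).
  set (g1 := fun a b => wa a b * (fK F a * - ub a b) + w a b * (fK1 F a * - ub a b + fK F a * - uab a b)) in *.
  set (g2 := fun a b => wb a b * (fK F a * vB F ua a b) + w a b * (fK F a * uab a b)) in *.
  assert (Cg1 : CS (fL F) g1) by (unfold g1; apply CS_plus; apply CS_mult; try lra; first [apply Hw | apply C1]).
  assert (Cg2 : CS (fL F) g2) by (unfold g2; apply CS_plus; apply CS_mult; try lra; first [apply Hw | apply C2]).
  assert (Bg2 : forall a b, Rabs (g2 a b) <= (Bb + Bw) * V).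
  { intros a b; unfold g2. eapply Rle_trans; [apply Rabs_triang|]. rewrite !(Rabs_mult (wb a b)), !(Rabs_mult (w a b)), Rmult_plus_distr_r.
    apply Rplus_le_compat; apply Rmult_le_compat; auto; apply Rabs_pos. }
  (* The second shear starts from the intermediate [q1]. Replacing it by [q] costs the Hoelder
     modulus at distance [eps * V], which is small when [eps] is. *)
  assert (T3 : Rabs (II (fL F) (fun a b => q1 a b * g2 a b) - II (fL F) (fun a b => q a b * g2 a b)) <= eta / 2).
  { rewrite <- II_minus; [|apply (CS_mult (fL F) q1 g2); auto; lra|apply (CS_mult (fL F) q g2); auto; lra].
    assert (HP : pw (eps * V) (fth F) <= eta / (2 * (B + 1))).
    { specialize (Hd4' (eps * V)). rewrite (pw_npos 0), !Rminus_0_r in Hd4' by lra.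
      assert (0 <= eps * V) by nra. rewrite (Rabs_right (eps * V)) in Hd4' by lra. specialize (Hd4' ltac:(lra)). apply Rabs_lt_between in Hd4'. lra. }
    apply Rle_trans with (H * pw (eps * V) (fth F) * ((Bb + Bw) * V) * A).
    - apply II_bound; [lra| |].
      + apply (CS_minus (fL F) (fun a b => q1 a b * g2 a b) (fun a b => q a b * g2 a b)); apply CS_mult; auto; lra.
      + intros a b. rewrite <- Rmult_minus_distr_r, Rabs_mult. apply Rmult_le_compat; auto; try apply Rabs_pos.
        destruct (R3 a b) as [a' [Ha' ->]]. specialize (S3 a b a' b). rewrite Rminus_diag, Rabs_R0, Rplus_0_r in S3.
        eapply Rle_trans; [apply S3|]. apply Rmult_le_compat_l; auto. apply pw_le; [lra|].
        eapply Rle_trans; [apply Ha'|]. apply Rmult_le_compat_l; [lra|auto].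
    - replace (H * pw (eps * V) (fth F) * ((Bb + Bw) * V) * A) with (B * pw (eps * V) (fth F)) by (unfold B; ring).
      apply Rle_trans with (B * (eta / (2 * (B + 1)))); [apply Rmult_le_compat_l; auto|].
      assert (E : eta / (2 * (B + 1)) * (2 * (B + 1)) = eta) by (field; lra). nra. }
  assert (E0 : forall r, II (fL F) (fun a b => p a b * vort F r a b) = II (fL F) (fun a b => w a b * r a b - w a b * fB F a)).
  { intros r; apply II_ext; intros a b; unfold vort, w, Rdiv; ring. }
  assert (CwB : CS (fL F) (fun a b => w a b * fB F a)) by (apply (CS_mult (fL F) w (fun a _ => fB F a)); [lra|apply Hw|apply (fBC F)]).
  rewrite !E0. rewrite !II_minus; try apply CwB; try (apply (CS_mult (fL F) w q'); [lra|apply Hw|auto]);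
    try (apply (CS_mult (fL F) w q); [lra|apply Hw|auto]).
  (* Here the two compressions cancel: the terms with [fK1] drop out against the derivative of
     [1 / fK F], and the terms with [uab] have opposite signs in the two shears. *)
  assert (E1 : II (fL F) (fun a b => q a b * (- ub a b * pa a b + vB F ua a b * pb a b)) =
     II (fL F) (fun a b => q a b * g1 a b) + II (fL F) (fun a b => q a b * g2 a b)).
  { rewrite <- II_plus; [|apply (CS_mult (fL F) q g1); auto; lra|apply (CS_mult (fL F) q g2); auto; lra].
    apply II_ext; intros a b. unfold g1, g2, w, wa, wb.
    pose proof (fKm F a). pose proof (fkmpos F). field. lra. }
  rewrite E1.
  assert (HE : eps * (2 * V * e * M') * A <= eps * (eta / 4)).
  { rewrite Rmult_assoc. apply Rmult_le_compat_l; [lra|].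
    assert (E : e * (8 * (V + 1) * (M' + 1) * A) = eta) by (unfold e; field; repeat split; lra).
    assert (0 <= e * A) by nra.
    assert (V * M' <= (V + 1) * (M' + 1)) by nra.
    assert (e * A * (V * M') <= e * A * ((V + 1) * (M' + 1))) by (apply Rmult_le_compat_l; auto).
    lra. }
  change (Rabs (II (fL F) (fun a b => w a b * q1 a b) - II (fL F) (fun a b => w a b * q a b) - eps * II (fL F) (fun a b => q a b * g1 a b))
    <= eps * (2 * V * e * M') * A) in T1.
  change (Rabs (II (fL F) (fun a b => w a b * q' a b) - II (fL F) (fun a b => w a b * q1 a b) - eps * II (fL F) (fun a b => q1 a b * g2 a b))
    <= eps * (2 * V * e * M') * A) in T2.
  apply Rabs_le_between in T1, T2, T3. apply Rabs_le_between. set (I2 := II (fL F) (fun a b => q a b * g2 a b)) in *.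
  set (I3 := II (fL F) (fun a b => q1 a b * g2 a b)) in *.
  assert (Y : - (eps * (eta / 2)) <= eps * (I3 - I2) <= eps * (eta / 2)) by (split; nra).
  lra.
Qed.

(** * The scheme on the whole time interval *)

Lemma vel_ok_mono (F : flat) (V V' : R) (ua ub uaa uab ubb : field2) : V <= V' -> vel_ok F V ua ub uaa uab ubb -> vel_ok F V' ua ub uaa uab ubb.
Proof.
  intros HV [H1 [H2 [H3 [H4 [H5 [H6 [H7 H8]]]]]]].
  split; [|split; [|split; [|split; [|split; [|split; [|split]]]]]]; intros a b; eapply Rle_trans; eauto.
Qed.

Lemma state_mono (F : flat) (M H H' : R) (q : field2) : H <= H' -> state F M H q -> state F M H' q.
Proof.
  intros HH [S1 [S2 S3]]; split; [auto|split; auto]. intros a b a' b'. eapply Rle_trans; [apply S3|].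
  apply Rmult_le_compat_r; auto. apply pw_nonneg.
Qed.

(** The last clause is equicontinuity in time: each step displaces points by at most
    [eps * (2 * V)], and the values are carried along, so the Hoelder modulus in space becomes one
    in time. *)
Definition Scheme (F : flat) (M Hs V eps : R) (N : nat) (q0 : field2) (q : nat -> field2) : Prop :=
  q O = q0 /\ (forall k, (k <= N)%nat -> state F M Hs (q k)) /\
  (forall k, (k < N)%nat -> exists u ua ub uaa uab ubb, StepRel F eps (q k) (q (S k)) u ua ub uaa uab ubb /\ vel_ok F V ua ub uaa uab ubb) /\
  (forall j k, (j <= k)%nat -> (k <= N)%nat -> forall a b, Rabs (q k a b - q j a b) <= Hs * pw (INR (k - j) * (eps * (2 * V))) (fth F)).

Lemma exp_ge_pow (x : R) (n : nat) : 0 <= x -> (1 + x) ^ n <= exp (x * INR n).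
Proof.
  intros Hx; induction n as [|n IH]; [simpl; rewrite Rmult_0_r, exp_0; lra|].
  rewrite S_INR, Rmult_plus_distr_l, Rmult_1_r, exp_plus. rewrite Rmult_comm.
  assert (1 + x <= exp x) by (destruct Hx as [Hx|<-]; [left; apply exp_ineq1; lra|rewrite exp_0; lra]).
  apply Rmult_le_compat; auto; try lra. apply pow_le; lra.
Qed.

Lemma ln_one_plus_le (x : R) : 0 <= x -> ln (1 + x) <= x.
Proof.
  intros Hx. rewrite <- (ln_exp x) at 2. destruct Hx as [Hx|<-]; [|rewrite Rplus_0_r, exp_0; lra].
  left; apply ln_increasing; [lra|apply exp_ineq1; lra].
Qed.

Lemma indexed_choice (P : nat -> (field2) -> Prop) (Q : (field2) -> (field2) -> Prop) (q0 : field2) (N : nat) : P O q0 ->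
  (forall k q, (k < N)%nat -> P k q -> exists q', Q q q' /\ P (S k) q') ->
  exists s, s O = q0 /\ (forall k, (k <= N)%nat -> P k (s k)) /\ (forall k, (k < N)%nat -> Q (s k) (s (S k))).
Proof.
  intros H0 HS.
  set (s := fix s k := match k with O => q0 | S k' =>
     match excluded_middle_informative (exists q', Q (s k') q' /\ P (S k') q') with
     | left H => proj1_sig (constructive_indefinite_description _ H) | right _ => q0 end end).
  assert (K : forall k, (k <= N)%nat -> P k (s k)).
  { induction k as [|k IH]; intros Hk; auto. specialize (HS k (s k) ltac:(lia) (IH ltac:(lia))). simpl.
    destruct (excluded_middle_informative _) as [E|E]; [|contradiction].
    destruct (constructive_indefinite_description _ E) as [q' [Q1 Q2]]; auto. }
  exists s; split; [auto|split; auto]. intros k Hk. specialize (HS k (s k) ltac:(lia) (K k ltac:(lia))). simpl.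
  destruct (excluded_middle_informative _) as [E|E]; [|contradiction].
  destruct (constructive_indefinite_description _ E) as [q' [Q1 Q2]]; auto.
Qed.

(** The quantity [1 + ln (1 + h)] is propagated instead of [h]. A step multiplies [h] by [s * s]
    with [ln s <= 2 * (eps * V)], so it adds at most [4 * (eps * V)], which is [4 * eps * C] times
    the quantity itself: a linear discrete Gronwall inequality. *)
Lemma scheme_exists (F : flat) (M H0 T : R) (q0 : field2) : state F M H0 q0 -> 0 < T ->
  exists Hs V N0, 0 <= Hs /\ 0 <= V /\ forall N, (N0 <= N)%nat -> (0 < N)%nat -> exists q, Scheme F M Hs V (T / INR N) N q0 q.
Proof.
  intros HS0 HT. destruct (vel_bound F M) as [C [HC Hvb]].
  assert (HH0 := hol2_nonneg _ _ _ (proj2 (proj2 HS0))).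
  set (y0 := 1 + ln (1 + H0)). assert (Hy0 : 1 <= y0) by (unfold y0; pose proof (ln_one_plus_nonneg H0 HH0); lra).
  (* [Y] is the Gronwall bound for [1 + ln (1 + h)] after total time [T]. It is fixed before the
     scheme is built, so [V], [Hs] and the least number of steps, needed for [eps * V <= 1 / 2], do
     not depend on the run. *)
  set (Y := exp (4 * C * T) * y0). set (V := C * Y). set (Hs := exp Y).
  assert (HY : 0 < Y) by (unfold Y; pose proof (exp_pos (4 * C * T)); nra).
  assert (HV : 0 < V) by (unfold V; nra).
  destruct (inv_small (/ (2 * V * T))) as [N0 HN0]; [apply Rinv_0_lt_compat; nra|].
  exists Hs, V, (S N0). split; [unfold Hs; left; apply exp_pos|]. split; [lra|].
  intros N HN HN1. set (eps := T / INR N).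
  assert (HNR : 0 < INR N) by (apply lt_0_INR; auto).
  assert (Heps : 0 < eps) by (unfold eps; apply Rdiv_lt_0_compat; auto).
  assert (HeV : eps * V <= / 2).
  { specialize (HN0 (N - 1)%nat ltac:(lia)). rewrite minus_INR in HN0 by lia. simpl in HN0. replace (INR N - 1 + 1) with (INR N) in HN0 by ring.
    unfold eps, Rdiv. apply Rmult_le_reg_l with (/ (V * T)); [apply Rinv_0_lt_compat; nra|].
    replace (/ (V * T) * (T * / INR N * V)) with (/ INR N) by (field; repeat split; lra).
    replace (/ (V * T) * / 2) with (/ (2 * V * T)) by (field; split; lra). lra. }
  set (P := fun (k : nat) (q : field2) => exists h, state F M h q /\ 1 + ln (1 + h) <= (1 + 4 * (eps * C)) ^ k * y0).
  set (Q := fun q q' : field2 => (exists u ua ub uaa uab ubb, StepRel F eps q q' u ua ub uaa uab ubb /\ vel_ok F V ua ub uaa uab ubb) /\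
      forall a b, exists a' b', Rabs (a' - a) + Rabs (b' - b) <= eps * (2 * V) /\ q' a b = q a' b').
  assert (HP : forall k h, (k <= N)%nat -> 1 + ln (1 + h) <= (1 + 4 * (eps * C)) ^ k * y0 -> 1 + ln (1 + h) <= Y).
  { intros k h Hk Hh. eapply Rle_trans; [apply Hh|]. apply Rmult_le_compat_r; [lra|].
    eapply Rle_trans; [apply exp_ge_pow; nra|].
    assert (4 * (eps * C) * INR k <= 4 * C * T).
    { apply le_INR in Hk. replace (4 * C * T) with (4 * (eps * C) * INR N) by (unfold eps; field; lra).
      apply Rmult_le_compat_l; nra. }
    destruct (Req_dec (4 * (eps * C) * INR k) (4 * C * T)) as [->|]; [lra|]. left; apply exp_increasing; lra. }
  destruct (indexed_choice P Q q0 N) as [q [E0 [HPk HQk]]].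
  { exists H0; split; auto. fold y0. lra. }
  { intros k q Hk [h [Hh Hy]]. assert (Hh0 := hol2_nonneg _ _ _ (proj2 (proj2 Hh))).
    destruct (Sol_exists F M h q Hh) as [u [ua [ub [uaa [uab [ubb HSol]]]]]].
    assert (Hv := Hvb q h u ua ub uaa uab ubb Hh HSol). set (Vk := C * (1 + ln (1 + h))) in Hv.
    assert (Hl0 := ln_one_plus_nonneg h Hh0).
    assert (HVk : Vk <= V) by (unfold Vk, V; apply Rmult_le_compat_l; [lra|apply HP with k; auto; lia]).
    assert (HVk0 : 0 <= Vk) by (unfold Vk; nra).
    destruct (step_exists F M h Vk eps q u ua ub uaa uab ubb Hh HSol Hv Heps ltac:(nra)) as [q' [R1 [R2 R3]]].
    exists q'; split; [split|].
    - exists u, ua, ub, uaa, uab, ubb; split; auto. apply vel_ok_mono with Vk; auto.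
    - intros a b; destruct (R3 a b) as [a' [b' [B1 B2]]]; exists a', b'; split; auto. nra.
    - set (s := 1 + 2 * (eps * Vk)) in *. assert (Hs1 : 1 <= s) by (unfold s; nra).
      exists (h * (s * s)); split; auto.
      assert (L1 : ln (1 + h * (s * s)) <= ln (1 + h) + 4 * (eps * Vk)).
      { apply Rle_trans with (ln ((1 + h) * (s * s))).
        - destruct (Req_dec (1 + h * (s * s)) ((1 + h) * (s * s))) as [->|Hne]; [lra|]. left; apply ln_increasing; [|nra].
          assert (0 <= h * (s * s)) by (apply Rmult_le_pos; nra). lra.
        - rewrite ln_mult, ln_mult by nra. assert (ln s <= 2 * (eps * Vk)) by (unfold s; apply ln_one_plus_le; nra). lra. }
      simpl. replace (eps * Vk) with (eps * C * (1 + ln (1 + h))) in L1 by (unfold Vk; ring).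
      assert ((1 + ln (1 + h)) * (1 + 4 * (eps * C)) <= (1 + 4 * (eps * C)) ^ k * y0 * (1 + 4 * (eps * C))) by (apply Rmult_le_compat_r; nra).
      lra. }
  assert (HSt : forall k, (k <= N)%nat -> state F M Hs (q k)).
  { intros k Hk. destruct (HPk k Hk) as [h [Hh Hy]]. apply state_mono with h; auto.
    assert (Hh0 := hol2_nonneg _ _ _ (proj2 (proj2 Hh))).
    specialize (HP k h Hk Hy). apply Rle_trans with (exp (ln (1 + h))); [rewrite exp_ln; lra|].
    left; apply exp_increasing; lra. }
  exists q; split; [auto|split; [auto|split]].
  - intros k Hk; apply HQk; auto.
  - intros j k Hjk Hk a b.
    (* Values are traced back along the steps: a value at time [j + i] is a value at time [j], taken
       at a point reached by at most [i] displacements. *)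
    assert (Tr : forall i, (j + i <= N)%nat -> forall a b, exists a' b', Rabs (a' - a) + Rabs (b' - b) <= INR i * (eps * (2 * V)) /\ q (j + i)%nat a b = q j a' b').
    { induction i as [|i IH]; intros Hi x y.
      - exists x, y. rewrite Nat.add_0_r, !Rminus_diag, Rabs_R0. simpl. split; auto; lra.
      - rewrite Nat.add_succ_r. destruct (HQk (j + i)%nat ltac:(lia)) as [_ Hq].
        destruct (Hq x y) as [x1 [y1 [B1 E1]]]. destruct (IH ltac:(lia) x1 y1) as [x2 [y2 [B2 E2]]].
        exists x2, y2; split; [|rewrite E1; auto]. rewrite S_INR.
        assert (T1 := Rabs_triang (x2 - x1) (x1 - x)). assert (T2 := Rabs_triang (y2 - y1) (y1 - y)).
        replace (x2 - x1 + (x1 - x)) with (x2 - x) in T1 by ring. replace (y2 - y1 + (y1 - y)) with (y2 - y) in T2 by ring. lra. }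
    destruct (Tr (k - j)%nat ltac:(lia) a b) as [a' [b' [B E]]]. replace (j + (k - j))%nat with k in E by lia.
    rewrite E. destruct (HSt j ltac:(lia)) as [_ [_ Hh]]. eapply Rle_trans; [apply Hh|].
    apply Rmult_le_compat_l; [unfold Hs; left; apply exp_pos|]. apply pw_le; [pose proof (fthr F); lra|auto].
Qed.

(** * Compactness *)

Lemma diagonal_subsequence (x : nat -> nat -> R) (M : R) : (forall n j, Rabs (x n j) <= M) ->
  exists s, incr s /\ forall j, exists l, Un_cv (fun n => x (s n) j) l.
Proof.
  intros HM.
  assert (HB : forall (r : nat -> nat) (j : nat), exists t, incr t /\ exists l, Un_cv (fun n => x (r (t n)) j) l).
  { intros r j. destruct (bolzano_weierstrass (fun n => x (r n) j) M) as [l [t [I C]]]; [intros; apply HM|]. exists t; split; auto; exists l; auto. }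
  set (tau := fun r j => proj1_sig (constructive_indefinite_description _ (HB r j))).
  assert (Htau : forall r j, incr (tau r j) /\ exists l, Un_cv (fun n => x (r (tau r j n)) j) l).
  { intros r j; unfold tau; destruct (constructive_indefinite_description _ (HB r j)); auto. }
  (* Successive refinements: [sg j] makes the components up to [j] converge. The diagonal sequence
     is, from index [j] on, a subsequence of [sg j]. *)
  set (sg := fix sg j := match j with O => tau (fun n => n) O | S j' => fun n => sg j' (tau (sg j') (S j') n) end).
  assert (Isg : forall j, incr (sg j)).
  { induction j as [|j IH]; [apply Htau|]. apply (incr_comp (sg j)); auto. apply Htau. }
  assert (Csg : forall j, exists l, Un_cv (fun n => x (sg j n) j) l).
  { destruct j as [|j]; [apply (Htau (fun n => n))|apply (Htau (sg j))]. }
  assert (Sub : forall j k i, exists r, (i <= r)%nat /\ sg (j + k)%nat i = sg j r).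
  { intros j; induction k as [|k IH]; intros i; [exists i; rewrite Nat.add_0_r; auto|].
    rewrite Nat.add_succ_r. destruct (IH (tau (sg (j + k)%nat) (S (j + k)) i)) as [r [Hr E]]. exists r; split; auto.
    pose proof (incr_ge _ (proj1 (Htau (sg (j + k)%nat) (S (j + k)))) i). lia. }
  exists (fun n => sg n n); split.
  - intros n. simpl. apply Nat.lt_le_trans with (sg n (S n)); [apply Isg|].
    assert (Hge := incr_ge _ (proj1 (Htau (sg n) (S n))) (S n)).
    destruct (Nat.eq_dec (S n) (tau (sg n) (S n) (S n))) as [<-|Hne]; [lia|]. apply Nat.lt_le_incl, incr_lt; auto; lia.
  - intros j. destruct (Csg j) as [l Hl]; exists l. intros e He; destruct (Hl e He) as [N HN]. exists (N + j)%nat; intros n Hn.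
    destruct (Sub j (n - j)%nat n) as [r [Hr E]]. replace (j + (n - j))%nat with n in E by lia. rewrite E. apply HN. lia.
Qed.

Lemma finite_eventually (P : nat -> nat -> Prop) : (forall i, exists N, forall n, (N <= n)%nat -> P i n) ->
  forall m, exists N, forall n, (N <= n)%nat -> forall i, (i <= m)%nat -> P i n.
Proof.
  intros H; induction m as [|m [N HN]].
  - destruct (H O) as [N HN]; exists N; intros n Hn i Hi. replace i with O by lia; auto.
  - destruct (H (S m)) as [N' HN']. exists (N + N')%nat; intros n Hn i Hi.
    destruct (Nat.eq_dec i (S m)) as [->|]; [apply HN'; lia|apply HN; lia].
Qed.

Lemma grid_point (X x : R) (m : nat) : 0 < X -> 0 <= x <= X -> exists i, (i <= S m)%nat /\ Rabs (x - X * INR i / INR (S m)) <= X * / (INR m + 1) /\ 0 <= X * INR i / INR (S m) <= X.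
Proof.
  intros HX Hx. rewrite S_INR. assert (Hm := pos_INR m). set (h := INR m + 1) in *. assert (Hh : 0 < h) by (unfold h; lra).
  destruct (nfloor_ex (x * h / X)) as [i [H1 H2]].
  { apply Rmult_le_pos; [nra|]. left; apply Rinv_0_lt_compat; auto. }
  assert (E : x = X * (x * h / X) / h) by (field; split; lra).
  assert (Hi : INR i <= h).
  { eapply Rle_trans; [apply H1|]. apply Rmult_le_reg_r with X; auto. replace (x * h / X * X) with (x * h) by (field; lra). nra. }
  exists i. split; [|split].
  - apply INR_le. rewrite S_INR. auto.
  - rewrite E at 1. replace (X * (x * h / X) / h - X * INR i / h) with (X * / h * (x * h / X - INR i)) by lra.
    rewrite Rabs_mult, Rabs_right, Rabs_right by (try lra; apply Rle_ge; left; apply Rmult_lt_0_compat; auto; apply Rinv_0_lt_compat; auto).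
    rewrite <- (Rmult_1_r (X * / h)) at 2. apply Rmult_le_compat_l; [left; apply Rmult_lt_0_compat; auto; apply Rinv_0_lt_compat; auto|lra].
  - pose proof (pos_INR i). split.
    + apply Rmult_le_pos; [nra|left; apply Rinv_0_lt_compat; auto].
    + apply Rmult_le_reg_r with h; auto. replace (X * INR i / h * h) with (X * INR i) by (field; lra). nra.
Qed.

(** Equicontinuity is required only for large indices, because the approximations are piecewise
    constant in time and jump by an amount that vanishes with the step size. Coordinates in a period
    and in the closed strip suffice. *)
Lemma arzela_ascoli (X Y Z M : R) (Q : nat -> field3) : 0 < X -> 0 < Y -> 0 < Z ->
  (forall n x y z, Rabs (Q n x y z) <= M) ->
  (forall e, 0 < e -> exists d N, 0 < d /\ forall n, (N <= n)%nat -> forall x y z x' y' z',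
     0 <= x <= X -> 0 <= x' <= X -> 0 <= y <= Y -> 0 <= y' <= Y -> 0 <= z <= Z -> 0 <= z' <= Z ->
     Rabs (x - x') <= d -> Rabs (y - y') <= d -> Rabs (z - z') <= d -> Rabs (Q n x y z - Q n x' y' z') <= e) ->
  exists s, incr s /\ forall e, 0 < e -> exists N, forall n m, (N <= n)%nat -> (N <= m)%nat ->
    forall x y z, 0 <= x <= X -> 0 <= y <= Y -> 0 <= z <= Z -> Rabs (Q (s n) x y z - Q (s m) x y z) <= e.
Proof.
  intros HX HY HZ HM Heq.
  set (pt := fun (W : R) (m i : nat) => W * INR i / INR (S m)).
  set (code := fun m i k l => to_nat (m, to_nat (i, to_nat (k, l)))).
  (* Cantor pairing lists the points of all finite grids in one sequence, to which the diagonal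
     argument is applied. *)
  set (xx := fun n j => let '(m, r) := of_nat j in let '(i, r') := of_nat r in let '(k, l) := of_nat r' in
     Q n (pt X m i) (pt Y m k) (pt Z m l)).
  assert (Exx : forall n m i k l, xx n (code m i k l) = Q n (pt X m i) (pt Y m k) (pt Z m l)).
  { intros; unfold xx, code. rewrite !cancel_of_to; auto. }
  destruct (diagonal_subsequence xx M) as [s [Is Hs]].
  { intros n j; unfold xx. destruct (of_nat j) as [m r]; destruct (of_nat r) as [i r']; destruct (of_nat r') as [k l]; auto. }
  exists s; split; auto. intros e He.
  destruct (Heq (e / 4) ltac:(lra)) as [d [N0 [Hd Hd']]].
  destruct (inv_small (d / (X + Y + Z))) as [m Hm]; [apply Rdiv_lt_0_compat; lra|]. specialize (Hm m (le_n m)).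
  assert (Hmd : (X + Y + Z) * / (INR m + 1) < d).
  { apply (Rmult_lt_compat_l (X + Y + Z)) in Hm; [|lra]. replace ((X + Y + Z) * (d / (X + Y + Z))) with d in Hm by (field; lra). auto. }
  assert (Him : 0 < / (INR m + 1)) by (apply Rinv_0_lt_compat; pose proof (pos_INR m); lra).
  assert (HN1 : exists N, forall n, (N <= n)%nat -> forall i, (i <= S m)%nat -> forall k, (k <= S m)%nat -> forall l, (l <= S m)%nat ->
     exists lim, Rabs (xx (s n) (code m i k l) - lim) <= e / 8 /\ Un_cv (fun n => xx (s n) (code m i k l)) lim).
  { apply finite_eventually; intros i. apply finite_eventually; intros k. apply finite_eventually; intros l.
    destruct (Hs (code m i k l)) as [lim Hl]. destruct (Hl (e / 8) ltac:(lra)) as [N HN]. exists N; intros n Hn. exists lim; split; auto.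
    left; apply HN; auto. }
  destruct HN1 as [N1 HN1]. exists (N0 + N1)%nat; intros n n' Hn Hn' x y z Hx Hy Hz.
  destruct (grid_point X x m HX Hx) as [i [Hi [Gi Ri]]]. destruct (grid_point Y y m HY Hy) as [k [Hk [Gk Rk]]].
  destruct (grid_point Z z m HZ Hz) as [l [Hl [Gl Rl]]].
  destruct (HN1 n ltac:(lia) i Hi k Hk l Hl) as [l1 [A1 B1]]. destruct (HN1 n' ltac:(lia) i Hi k Hk l Hl) as [l2 [A2 B2]].
  assert (l1 = l2) by (eapply UL_sequence; eauto). subst l2. rewrite Exx in A1, A2.
  assert (K : forall n, (N0 <= n)%nat -> Rabs (Q n x y z - Q n (pt X m i) (pt Y m k) (pt Z m l)) <= e / 4).
  { intros j Hj. apply Hd'; auto; unfold pt; nra. }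
  assert (K1 := K (s n) ltac:(pose proof (incr_ge s Is n); lia)). assert (K2 := K (s n') ltac:(pose proof (incr_ge s Is n'); lia)).
  apply Rabs_le_between in A1, A2, K1, K2. apply Rabs_le_between; lra.
Qed.

(** * Convergence of the scheme *)

Lemma floor_exists (x : R) : exists i : nat, 0 <= x -> INR i <= x < INR i + 1.
Proof.
  destruct (Rle_dec 0 x) as [H|H]; [|exists O; intros; lra].
  destruct (nfloor_ex x H) as [i Hi]; exists i; auto.
Qed.

Definition nfl (x : R) : nat := proj1_sig (constructive_indefinite_description _ (floor_exists x)).

Lemma nfl_spec (x : R) : 0 <= x -> INR (nfl x) <= x < INR (nfl x) + 1.
Proof. unfold nfl; destruct (constructive_indefinite_description _ (floor_exists x)); auto. Qed.

Lemma nfl_INR (k : nat) : nfl (INR k) = k.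
Proof.
  destruct (nfl_spec (INR k) (pos_INR k)) as [H1 H2]. apply INR_le in H1. rewrite <- S_INR in H2. apply INR_lt in H2. lia.
Qed.

Lemma pw_ctn_add (th c x : R) : 0 < th -> forall e, 0 < e -> exists d, 0 < d /\ forall h, Rabs h < d -> pw (c * (x + h)) th <= pw (c * x) th + e.
Proof.
  intros Ht e He. assert (C : ctn (fun h => pw (c * (x + h)) th)) by (repeat cstep).
  destruct (continuity_pt_eps_inv _ 0 (C 0) e He) as [d [Hd Hd']]. exists d; split; auto. intros h Hh.
  specialize (Hd' h ltac:(rewrite Rminus_0_r; auto)). rewrite Rplus_0_r in Hd'. apply Rabs_lt_between in Hd'; lra.
Qed.

Lemma le_eps (x y : R) : (forall e, 0 < e -> x <= y + e) -> x <= y.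
Proof. intros H; apply Rnot_lt_le; intros Hlt. specialize (H ((x - y) / 2) ltac:(lra)); lra. Qed.

(** Besides the limit, the approximating runs are kept together with uniform convergence on all grid
    times, since the weak equation is derived by summing over their steps. *)
Lemma scheme_limit (F : flat) (M H0 T : R) (q0 : field2) : state F M H0 q0 -> 0 < T ->
  exists Hs V (N : nat -> nat) (qs : nat -> nat -> field2) (q : field3), 0 <= Hs /\ 0 <= V /\
    (forall n, (n < N n)%nat) /\ (forall n, Scheme F M Hs V (T / INR (N n)) (N n) q0 (qs n)) /\
    (forall e, 0 < e -> exists n1, forall n, (n1 <= n)%nat -> forall k, (k <= N n)%nat -> forall a b,
       Rabs (qs n k a b - q (INR k * (T / INR (N n))) a b) <= e) /\
    (forall t, 0 <= t <= T -> state F M Hs (q t)) /\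
    (forall t t', 0 <= t <= T -> 0 <= t' <= T -> forall a b, Rabs (q t a b - q t' a b) <= Hs * pw (2 * V * Rabs (t - t')) (fth F)) /\
    (forall a b, q 0 a b = q0 a b).
Proof.
  intros HS HT. destruct (scheme_exists F M H0 T q0 HS HT) as [Hs [V [N0 [HHs [HV Hex]]]]].
  assert (HL := fLpos F). assert (Hth := fthr F). pose proof PI_RGT_0 as HPI.
  set (NN := fun n => (N0 + n + 1)%nat).
  assert (Hex' : forall n, exists q, Scheme F M Hs V (T / INR (NN n)) (NN n) q0 q) by (intros n; apply Hex; unfold NN; lia).
  set (qs := fun n => proj1_sig (constructive_indefinite_description _ (Hex' n))).
  assert (Hqs : forall n, Scheme F M Hs V (T / INR (NN n)) (NN n) q0 (qs n)) by (intros n; unfold qs; destruct (constructive_indefinite_description _ (Hex' n)); auto).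
  assert (HNN : forall n, 0 < INR (NN n)) by (intros n; apply lt_0_INR; unfold NN; lia).
  (* The piecewise constant interpolation in time; the minimum guards the index outside [[0, T]],
     where no state is available. *)
  set (ix := fun n t => Nat.min (nfl (t * INR (NN n) / T)) (NN n)).
  set (Q := fun n t a b => qs n (ix n t) a b).
  assert (Hix : forall n t, (ix n t <= NN n)%nat) by (intros; apply Nat.le_min_r).
  assert (HQM : forall n t a b, Rabs (Q n t a b) <= M) by (intros n t; apply (proj1 (proj2 (Hqs n))); auto).
  assert (Hfl : forall n t, 0 <= t <= T -> INR (ix n t) * (T / INR (NN n)) <= t < (INR (ix n t) + 1) * (T / INR (NN n)) + 0).
  { intros n t Ht. specialize (HNN n).
    assert (P : 0 <= t * INR (NN n) / T) by (apply Rmult_le_pos; [nra|left; apply Rinv_0_lt_compat; auto]).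
    destruct (nfl_spec _ P) as [B1 B2].
    assert (E : t = t * INR (NN n) / T * (T / INR (NN n))) by (field; split; lra).
    assert (Hl : (nfl (t * INR (NN n) / T) <= NN n)%nat).
    { apply INR_le. eapply Rle_trans; [apply B1|]. apply Rmult_le_reg_r with T; auto.
      replace (t * INR (NN n) / T * T) with (t * INR (NN n)) by (field; lra). nra. }
    unfold ix. rewrite Nat.min_l by auto. assert (0 < T / INR (NN n)) by (apply Rdiv_lt_0_compat; auto).
    set (x := t * INR (NN n) / T) in *. rewrite E. split; [apply Rmult_le_compat_r; lra|].
    rewrite Rplus_0_r. apply Rmult_lt_compat_r; lra. }
  assert (Heps : forall d, 0 < d -> exists n0, forall n, (n0 <= n)%nat -> T / INR (NN n) <= d).
  { intros d Hd. destruct (inv_small (d / T)) as [n0 Hn0]; [apply Rdiv_lt_0_compat; auto|]. exists n0; intros n Hn.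
    specialize (Hn0 n Hn). apply Rle_trans with (T * / (INR n + 1)).
    - apply Rmult_le_compat_l; [lra|]. apply Rinv_le_contravar; [pose proof (pos_INR n); lra|]. unfold NN. rewrite !plus_INR. simpl. pose proof (pos_INR N0). lra.
    - apply (Rmult_lt_compat_l T) in Hn0; auto. replace (T * (d / T)) with d in Hn0 by (field; lra). lra. }
  assert (Htime : forall n t t' a b, 0 <= t <= T -> 0 <= t' <= T -> Rabs (Q n t a b - Q n t' a b) <= Hs * pw (2 * V * (Rabs (t - t') + T / INR (NN n))) (fth F)).
  { assert (W : forall n t t' a b, 0 <= t <= T -> 0 <= t' <= T -> (ix n t' <= ix n t)%nat ->
        Rabs (Q n t a b - Q n t' a b) <= Hs * pw (2 * V * (Rabs (t - t') + T / INR (NN n))) (fth F)).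
    { intros n t t' a b Ht Ht' Hi. destruct (Hqs n) as [_ [_ [_ Hd]]].
      eapply Rle_trans; [apply (Hd (ix n t') (ix n t)); auto|]. apply Rmult_le_compat_l; auto. apply pw_le; [lra|].
      rewrite minus_INR by auto. assert (F1 := Hfl n t Ht). assert (F2 := Hfl n t' Ht').
      set (ep := T / INR (NN n)) in *.
      assert ((INR (ix n t) - INR (ix n t')) * ep <= Rabs (t - t') + ep) by (pose proof (Rle_abs (t - t')); lra).
      replace ((INR (ix n t) - INR (ix n t')) * (ep * (2 * V))) with (2 * V * ((INR (ix n t) - INR (ix n t')) * ep)) by ring.
      apply Rmult_le_compat_l; lra. }
    intros n t t' a b Ht Ht'. destruct (Nat.le_gt_cases (ix n t') (ix n t)); [apply W; auto|].
    rewrite Rabs_minus_sym, (Rabs_minus_sym t). apply W; auto; lia. }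
  assert (HCS : forall n t, CS (fL F) (Q n t)) by (intros n t; apply (proj1 (proj2 (Hqs n))); auto).
  assert (Hhol : forall n t, hol2 (fth F) Hs (Q n t)) by (intros n t; apply (proj1 (proj2 (Hqs n))); auto).
  destruct (arzela_ascoli T (fL F) (2 * PI) M Q) as [s [Is Hcau]]; auto; try lra.
  { intros e He.
    destruct (pw_ctn_add (fth F) 1 0 ltac:(lra) (e / (2 * (Hs + 1)))) as [d1 [Hd1 Hd1']]; [apply Rdiv_lt_0_compat; lra|].
    destruct (pw_ctn_add (fth F) (2 * V) 0 ltac:(lra) (e / (2 * (Hs + 1)))) as [d2 [Hd2 Hd2']]; [apply Rdiv_lt_0_compat; lra|].
    destruct (Heps (d2 / 4) ltac:(lra)) as [n0 Hn0].
    exists (Rmin (d1 / 4) (d2 / 4)), n0. split; [apply Rmin_pos; lra|].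
    rmin_bounds (d1 / 4) (d2 / 4).
    intros n Hn x y z x' y' z' Hx Hx' Hy Hy' Hz Hz' D1 D2 D3. specialize (Hn0 n Hn).
    assert (K1 := Htime n x x' y z Hx Hx'). assert (K2 := Hhol n x' y' z' y z).
    pose proof (Rabs_pos (x - x')). pose proof (Rabs_pos (y - y')). pose proof (Rabs_pos (z - z')).
    assert (P1 : pw (Rabs (y - y') + Rabs (z - z')) (fth F) <= e / (2 * (Hs + 1))).
    { specialize (Hd1' (Rabs (y - y') + Rabs (z - z')) ltac:(rewrite Rabs_right; lra)).
      rewrite Rmult_0_r, (pw_npos 0), Rplus_0_l, Rmult_1_l, Rplus_0_l in Hd1' by lra. auto. }
    assert (0 < T / INR (NN n)) by (apply Rdiv_lt_0_compat; auto).
    assert (P2 : pw (2 * V * (Rabs (x - x') + T / INR (NN n))) (fth F) <= e / (2 * (Hs + 1))).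
    { specialize (Hd2' (Rabs (x - x') + T / INR (NN n)) ltac:(rewrite Rabs_right; lra)).
      rewrite Rmult_0_r, (pw_npos 0), Rplus_0_l, Rplus_0_l in Hd2' by lra. auto. }
    apply (Rmult_le_compat_l Hs) in P1; auto. apply (Rmult_le_compat_l Hs) in P2; auto.
    assert (E : e / (2 * (Hs + 1)) * (2 * (Hs + 1)) = e) by (field; lra).
    replace (Q n x y z - Q n x' y' z') with ((Q n x y z - Q n x' y z) + (Q n x' y z - Q n x' y' z')) by ring.
    eapply Rle_trans; [apply Rabs_triang|]. nra. }
  assert (Hcau' : forall e, 0 < e -> exists n1, forall n m, (n1 <= n)%nat -> (n1 <= m)%nat -> forall t a b, 0 <= t <= T -> Rabs (Q (s n) t a b - Q (s m) t a b) <= e).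
  { intros e He. destruct (Hcau e He) as [n1 Hn1]. exists n1; intros n m Hn Hm t a b Ht.
    destruct (period_reduce b) as [z Hz]. pose proof (clamp_range (fL F) a ltac:(lra)).
    assert (EQ : forall i, Q i t a b = Q i t (clamp (fL F) a) (b + 2 * PI * IZR z)).
    { intros i. destruct (HCS i t) as [_ [C P]]. rewrite (periodic_Z (fun b => Q i t (clamp (fL F) a) b) (P _) z b). symmetry; apply C. }
    rewrite !EQ. apply Hn1; auto. }
  assert (HC : forall t a b, Cauchy_crit (fun n => Q (s n) (clamp T t) a b)).
  { intros t a b e He. destruct (Hcau' (e / 2) ltac:(lra)) as [n1 Hn1]. exists n1; intros n m Hn Hm.
    apply Rle_lt_trans with (e / 2); [|lra]. apply Hn1; auto. apply clamp_range; lra. }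
  set (q := fun t a b => proj1_sig (Rcomplete.R_complete _ (HC t a b))).
  assert (Hconv : forall e, 0 < e -> exists n1, forall n, (n1 <= n)%nat -> forall t a b, 0 <= t <= T -> Rabs (Q (s n) t a b - q t a b) <= e).
  { intros e He. destruct (Hcau' (e / 2) ltac:(lra)) as [n1 Hn1]. exists n1; intros n Hn t a b Ht. unfold q.
    destruct (Rcomplete.R_complete _ (HC t a b)) as [l Hl]; simpl. destruct (Hl (e / 2) ltac:(lra)) as [n2 Hn2].
    specialize (Hn2 (n1 + n2)%nat ltac:(lia)). specialize (Hn1 n (n1 + n2)%nat Hn ltac:(lia) t a b Ht).
    rewrite clamp_id in Hn2 by auto. apply Rabs_lt_between in Hn2; apply Rabs_le_between in Hn1; apply Rabs_le_between; lra. }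
  exists Hs, V, (fun n => NN (s n)), (fun n => qs (s n)), q.
  split; [auto|]. split; [auto|]. split; [intros n; pose proof (incr_ge s Is n); unfold NN; lia|].
  split; [intros n; apply Hqs|]. split; [|split; [|split]].
  - intros e He. destruct (Hconv e He) as [n1 Hn1]. exists n1; intros n Hn k Hk a b.
    assert (Ht : 0 <= INR k * (T / INR (NN (s n))) <= T).
    { pose proof (HNN (s n)). apply le_INR in Hk. pose proof (pos_INR k).
      assert (0 < T / INR (NN (s n))) by (apply Rdiv_lt_0_compat; auto).
      replace T with (INR (NN (s n)) * (T / INR (NN (s n)))) at 3 by (field; lra). split; [nra|apply Rmult_le_compat_r; lra]. }
    specialize (Hn1 n Hn _ a b Ht). unfold Q, ix in Hn1.
    replace (INR k * (T / INR (NN (s n))) * INR (NN (s n)) / T) with (INR k) in Hn1 by (pose proof (HNN (s n)); field; lra).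
    rewrite nfl_INR, Nat.min_l in Hn1 by auto. auto.
  - intros t Ht. split; [|split].
    + apply CS_limit with (fun n => Q (s n) t); auto. intros e He; destruct (Hconv e He) as [n1 Hn1]; exists n1; auto.
    + intros a b. apply le_eps; intros e He. destruct (Hconv e He) as [n1 Hn1]. specialize (Hn1 n1 (le_n n1) t a b Ht).
      specialize (HQM (s n1) t a b). rewrite Rabs_minus_sym in Hn1. assert (Tr := Rabs_triang (q t a b - Q (s n1) t a b) (Q (s n1) t a b)).
      replace (q t a b - Q (s n1) t a b + Q (s n1) t a b) with (q t a b) in Tr by ring. lra.
    + intros a b a' b'. apply le_eps; intros e He. destruct (Hconv (e / 2) ltac:(lra)) as [n1 Hn1].
      assert (K1 := Hn1 n1 (le_n n1) t a b Ht). assert (K2 := Hn1 n1 (le_n n1) t a' b' Ht). assert (K3 := Hhol (s n1) t a b a' b').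
      apply Rabs_le_between in K1, K2, K3. apply Rabs_le_between; lra.
  - intros t t' Ht Ht' a b. apply le_eps; intros e He. destruct (Hconv (e / 4) ltac:(lra)) as [n1 Hn1].
    destruct (pw_ctn_add (fth F) (2 * V) (Rabs (t - t')) ltac:(lra) (e / (2 * (Hs + 1)))) as [d [Hd Hd']]; [apply Rdiv_lt_0_compat; lra|].
    destruct (Heps (d / 2) ltac:(lra)) as [n0 Hn0]. set (n := (n0 + n1)%nat).
    assert (K1 := Hn1 n ltac:(unfold n; lia) t a b Ht); assert (K2 := Hn1 n ltac:(unfold n; lia) t' a b Ht').
    assert (K3 := Htime (s n) t t' a b Ht Ht').
    specialize (Hn0 (s n) ltac:(pose proof (incr_ge s Is n); unfold n in *; lia)).
    assert (0 < T / INR (NN (s n))) by (apply Rdiv_lt_0_compat; auto).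
    specialize (Hd' (T / INR (NN (s n))) ltac:(rewrite Rabs_right; lra)).
    apply (Rmult_le_compat_l Hs) in Hd'; auto. rewrite (Rmult_plus_distr_l Hs) in Hd'.
    assert (E : e / (2 * (Hs + 1)) * (2 * (Hs + 1)) = e) by (field; lra).
    assert (0 < e / (2 * (Hs + 1))) by (apply Rdiv_lt_0_compat; lra).
    apply Rabs_le_between in K1, K2, K3. apply Rabs_le_between. split; lra.
  - intros a b. apply cond_eq; intros e He. destruct (Hconv (e / 2) ltac:(lra)) as [n1 Hn1]. specialize (Hn1 n1 (le_n n1) 0 a b ltac:(lra)).
    unfold Q, ix in Hn1. replace (0 * INR (NN (s n1)) / T) with (INR 0) in Hn1 by (simpl; field; lra). rewrite nfl_INR in Hn1. simpl in Hn1.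
    rewrite (proj1 (Hqs (s n1))) in Hn1. rewrite Rabs_minus_sym; lra.
Qed.
(** * Time dependent functions on the strip *)

Definition UC3 (G : field3) : Prop :=
  forall e, 0 < e -> exists d, 0 < d /\ forall t a b t' a' b', Rabs (t' - t) < d -> Rabs (a' - a) < d -> Rabs (b' - b) < d ->
    Rabs (G t' a' b' - G t a b) < e.

Definition CT (T L : R) (G : field3) : Prop :=
  UC3 G /\ (forall t a b, G (clamp T t) a b = G t a b) /\ (forall t a b, G t (clamp L a) b = G t a b) /\
  (forall t a b, G t a (b + 2 * PI) = G t a b).

Lemma CT_CS (T L : R) (G : field3) (t : R) : CT T L G -> CS L (G t).
Proof.
  intros [H1 [H2 [H3 H4]]]; split; [|split; auto]. intros e He; destruct (H1 e He) as [d [Hd Hd']]; exists d; split; auto.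
  intros; apply Hd'; auto. rdiag.
Qed.

Lemma CT_slice (T L : R) (G : field3) (b : R) : CT T L G -> UC (fun x s => G s x b).
Proof.
  intros [H1 _] e He; destruct (H1 e He) as [d [Hd Hd']]; exists d; split; auto.
  intros; apply Hd'; auto. rdiag.
Qed.

Lemma CT_slice_a (T L : R) (G : field3) (a : R) : CT T L G -> UC (fun y s => G s a y).
Proof.
  intros [H1 _] e He; destruct (H1 e He) as [d [Hd Hd']]; exists d; split; auto.
  intros; apply Hd'; auto. rdiag.
Qed.

Lemma CT_ctn (T L : R) (G : field3) (a b : R) : CT T L G -> ctn (fun t => G t a b).
Proof. intros H; apply (UC_ctn2 (fun x s => G s x b) a), (CT_slice T L); auto. Qed.

Lemma CT_intro3 (T L : R) (G : field3) : 0 <= T -> 0 <= L ->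
  (forall t a b, G t a (b + 2 * PI) = G t a b) ->
  cont_on3 (fun t a b => 0 <= t <= T /\ 0 <= a <= L) G -> CT T L (fun t a b => G (clamp T t) (clamp L a) b).
Proof.
  intros HT HL Hp HG. split; [|split; [intros; rewrite clamp_clamp; auto|split; [intros; rewrite clamp_clamp; auto|auto]]].
  intros e He.
  destruct (uniform_continuity3 (fun x y z => 0 <= x <= T /\ 0 <= y <= L /\ -1 <= z <= 2 * PI + 1) G) with (eps := e) as [d [Hd Hd']]; auto.
  - apply closed3_box.
  - apply bounded3_box.
  - intros x y z [Hx [Hy _]] e' He'. destruct (HG x y z (conj Hx Hy) e' He') as [d [Hd Hd']]; exists d; split; auto.
    intros x' y' z' [Hx' [Hy' _]]; apply Hd'; auto.
  - exists (Rmin d 1); split; [apply Rmin_pos; lra|]. intros t a b t' a' b' H1 H2 H3.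
    rmin_bounds d 1. destruct (period_reduce b) as [k Hk].
    rewrite <- (periodic_Z (fun b => G (clamp T t') (clamp L a') b) (Hp _ _) k b'), <- (periodic_Z (fun b => G (clamp T t) (clamp L a) b) (Hp _ _) k b).
    assert (Hy : Rabs (b' + 2 * PI * IZR k - (b + 2 * PI * IZR k)) < Rmin d 1).
    { replace (b' + 2 * PI * IZR k - (b + 2 * PI * IZR k)) with (b' - b) by ring; auto. }
    assert (-1 <= b' + 2 * PI * IZR k <= 2 * PI + 1) by (apply Rabs_lt_between in Hy; lra).
    pose proof (clamp_range L a HL). pose proof (clamp_range L a' HL). pose proof (clamp_range T t HT). pose proof (clamp_range T t' HT).
    apply Hd'; try (repeat split; lra).
    + apply Rle_lt_trans with (1 := clamp_lip T t' t HT); lra.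
    + apply Rle_lt_trans with (1 := clamp_lip L a' a HL); lra.
Qed.

(** Continuity in time for the sup norm in space, the form in which the Poisson estimates deliver
    it. With continuity in space at each time it gives joint continuity after clamping. *)
Definition TC (T : R) (G : field3) : Prop :=
  forall t, 0 <= t <= T -> forall e, 0 < e -> exists d, 0 < d /\ forall t', 0 <= t' <= T -> Rabs (t' - t) < d ->
    forall a b, Rabs (G t' a b - G t a b) <= e.

Lemma CT_ext (T L : R) (G K : field3) : (forall t a b, G t a b = K t a b) -> CT T L G -> CT T L K.
Proof.
  intros E [H1 [H2 [H3 H4]]]. split; [|split; [|split]]; try (intros; rewrite <- !E; auto).
  intros e He; destruct (H1 e He) as [d [Hd Hd']]; exists d; split; auto. intros; rewrite <- !E; auto.
Qed.

Lemma CT_intro (T L : R) (G : field3) : 0 <= T -> 0 <= L -> (forall t, 0 <= t <= T -> CS L (G t)) -> TC T G ->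
  CT T L (fun t => G (clamp T t)).
Proof.
  intros HT HL HC HG.
  apply CT_ext with (fun t a b => (fun t => G (clamp T t)) (clamp T t) (clamp L a) b).
  { intros t a b. rewrite clamp_clamp by auto. apply (HC (clamp T t)). apply clamp_range; auto. }
  apply (CT_intro3 T L (fun t => G (clamp T t))); auto.
  - intros t a b. apply (HC (clamp T t)). apply clamp_range; auto.
  - intros t a b [Ht Ha] e He. destruct (HG t Ht (e / 2) ltac:(lra)) as [d1 [Hd1 Hd1']].
    destruct (proj1 (HC t Ht) (e / 2) ltac:(lra)) as [d2 [Hd2 Hd2']]. exists (Rmin d1 d2); split; [apply Rmin_pos; auto|].
    rmin_bounds d1 d2. intros t' a' b' [Ht' Ha'] K1 K2 K3. rewrite !clamp_id by auto.
    specialize (Hd1' t' Ht' ltac:(lra) a' b'). specialize (Hd2' a b a' b' ltac:(lra) ltac:(lra)).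
    apply Rabs_le_between in Hd1'; apply Rabs_lt_between in Hd2'; apply Rabs_lt_between; lra.
Qed.

Lemma CT_bounded (T L : R) (G : field3) : 0 <= T -> 0 <= L -> CT T L G -> exists M, 0 < M /\ forall t a b, Rabs (G t a b) <= M.
Proof.
  intros HT HL [H1 [H2 [H3 H4]]]. pose proof PI_RGT_0.
  destruct (max_attained3 (fun x y z => 0 <= x <= T /\ 0 <= y <= L /\ 0 <= z <= 2 * PI) (fun x y z => Rabs (G x y z))) as [x [y [z [_ Hm]]]].
  - apply closed3_box. - apply bounded3_box.
  - intros x y z _ e He; destruct (H1 e He) as [d [Hd Hd']]; exists d; split; auto.
    intros x' y' z' _ K1 K2 K3. apply Rle_lt_trans with (1 := Rabs_triang_inv2 _ _); auto.
  - exists 0, 0, 0; lra.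
  - exists (Rabs (G x y z) + 1); split; [pose proof (Rabs_pos (G x y z)); lra|].
    intros t a b. destruct (period_reduce b) as [k Hk].
    rewrite <- H2, <- H3, <- (periodic_Z (fun b => G (clamp T t) (clamp L a) b) (H4 _ _) k b).
    apply Rle_trans with (Rabs (G x y z)); [|lra]. pose proof (clamp_range T t HT). pose proof (clamp_range L a HL). apply Hm. repeat split; lra.
Qed.

Lemma CT_plus (T L : R) (G K : field3) : CT T L G -> CT T L K -> CT T L (fun t a b => G t a b + K t a b).
Proof.
  intros [H1 [H2 [H3 H4]]] [K1 [K2 [K3 K4]]]. split; [|split; [|split]]; intros; rewrite ?H2, ?K2, ?H3, ?K3, ?H4, ?K4; auto.
  intros e He. destruct (H1 (e / 2) ltac:(lra)) as [d [Hd Hd']]; destruct (K1 (e / 2) ltac:(lra)) as [d2 [Hd2 Hd2']].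
  exists (Rmin d d2); split; [apply Rmin_pos; auto|]. rmin_bounds d d2. intros t a b t' a' b' Q1 Q2 Q3.
  specialize (Hd' t a b t' a' b' ltac:(lra) ltac:(lra) ltac:(lra)); specialize (Hd2' t a b t' a' b' ltac:(lra) ltac:(lra) ltac:(lra)).
  apply Rabs_lt_between in Hd', Hd2'; apply Rabs_lt_between; lra.
Qed.

Lemma CT_opp (T L : R) (G : field3) : CT T L G -> CT T L (fun t a b => - G t a b).
Proof.
  intros [H1 [H2 [H3 H4]]]. split; [|split; [|split]]; intros; rewrite ?H2, ?H3, ?H4; auto.
  intros e He. destruct (H1 e He) as [d [Hd Hd']]; exists d; split; auto; intros.
  replace (- G t' a' b' - - G t a b) with (- (G t' a' b' - G t a b)) by ring. rewrite Rabs_Ropp; auto.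
Qed.

Lemma CT_minus (T L : R) (G K : field3) : CT T L G -> CT T L K -> CT T L (fun t a b => G t a b - K t a b).
Proof. intros; apply (CT_plus T L G (fun t a b => - K t a b)); auto; apply CT_opp; auto. Qed.

Lemma CT_of_CS (T L : R) (g : field2) : CS L g -> CT T L (fun _ => g).
Proof.
  intros [H1 [H2 H3]]. split; [|split; [|split]]; auto. intros e He; destruct (H1 e He) as [d [Hd Hd']]; exists d; split; auto.
Qed.

Lemma CT_const (T L c : R) : CT T L (fun _ _ _ => c).
Proof. apply (CT_of_CS T L (fun _ _ => c)), CS_const. Qed.

Lemma CT_mult (T L : R) (G K : field3) : 0 <= T -> 0 <= L -> CT T L G -> CT T L K -> CT T L (fun t a b => G t a b * K t a b).
Proof.
  intros HT HL HG HK. destruct (CT_bounded T L G HT HL HG) as [Mg [Mg0 Bg]]; destruct (CT_bounded T L K HT HL HK) as [Mk [Mk0 Bk]].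
  destruct HG as [H1 [H2 [H3 H4]]]; destruct HK as [K1 [K2 [K3 K4]]].
  split; [|split; [|split]]; intros; rewrite ?H2, ?K2, ?H3, ?K3, ?H4, ?K4; auto.
  intros e He. assert (Hk : 0 < e / (2 * (Mg + Mk))) by (apply Rdiv_lt_0_compat; lra). set (k := e / (2 * (Mg + Mk))) in *.
  destruct (H1 k Hk) as [d [Hd Hd']]; destruct (K1 k Hk) as [d2 [Hd2 Hd2']].
  exists (Rmin d d2); split; [apply Rmin_pos; auto|]. rmin_bounds d d2. intros t a b t' a' b' Q1 Q2 Q3.
  specialize (Hd' t a b t' a' b' ltac:(lra) ltac:(lra) ltac:(lra)); specialize (Hd2' t a b t' a' b' ltac:(lra) ltac:(lra) ltac:(lra)).
  replace (G t' a' b' * K t' a' b' - G t a b * K t a b) with ((G t' a' b' - G t a b) * K t' a' b' + G t a b * (K t' a' b' - K t a b)) by ring.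
  eapply Rle_lt_trans; [apply Rabs_triang|]. rewrite !Rabs_mult.
  assert (Rabs (G t' a' b' - G t a b) * Rabs (K t' a' b') <= k * Mk) by (apply Rmult_le_compat; auto; try apply Rabs_pos; lra).
  assert (Rabs (G t a b) * Rabs (K t' a' b' - K t a b) <= Mg * k) by (apply Rmult_le_compat; auto; try apply Rabs_pos; lra).
  assert (E : k * (2 * (Mg + Mk)) = e) by (unfold k; field; lra). nra.
Qed.

Lemma CT_scal (T L c : R) (G : field3) : 0 <= T -> 0 <= L -> CT T L G -> CT T L (fun t a b => c * G t a b).
Proof. intros; apply (CT_mult T L (fun _ _ _ => c) G); auto; apply CT_const. Qed.

Lemma II_time_derive (T L : R) (w : field2) (J G : field3) (lo hi : R) : 0 < L -> CS L w -> CT T L G ->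
  (forall t, lo < t < hi -> CS L (J t)) -> (forall t a b, lo < t < hi -> D (fun s => J s a b) t (G t a b)) ->
  forall t, lo < t < hi -> D (fun s => II L (fun a b => w a b * J s a b)) t (II L (fun a b => w a b * G t a b)).
Proof.
  intros HL Hw HG HJ HD t Ht e He. pose proof PI_RGT_0.
  destruct (CS_bounded L w ltac:(lra) Hw) as [Mw [Mw0 Bw]].
  set (A := 2 * PI * L). assert (HA : 0 < A) by (unfold A; nra).
  assert (Hk : 0 < e / (2 * Mw * A)) by (apply Rdiv_lt_0_compat; auto; nra). set (k := e / (2 * Mw * A)) in *.
  destruct (proj1 HG k Hk) as [d [Hd Hd']].
  assert (Hm : 0 < Rmin d (Rmin (t - lo) (hi - t))) by (repeat apply Rmin_pos; lra).
  exists (mkposreal _ Hm); simpl; intros h Hh Hhd.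
  rmin_bounds d (Rmin (t - lo) (hi - t)).
  rmin_bounds (t - lo) (hi - t).
  assert (Hxh : lo < t + h < hi) by (apply Rabs_lt_between in Hhd; lra).
  assert (C1 : CS L (fun a b => w a b * J (t + h) a b)) by (apply CS_mult; auto; lra).
  assert (C2 : CS L (fun a b => w a b * J t a b)) by (apply CS_mult; auto; lra).
  assert (C3 : CS L (fun a b => w a b * G t a b)) by (apply CS_mult; auto; [lra|apply (CT_CS T L G t HG)]).
  assert (C4 : CS L (fun a b => / h * (w a b * J (t + h) a b - w a b * J t a b))) by (apply CS_scal; [lra|apply CS_minus; auto]).
  replace ((II L (fun a b => w a b * J (t + h) a b) - II L (fun a b => w a b * J t a b)) / h - II L (fun a b => w a b * G t a b))
    with (II L (fun a b => / h * (w a b * J (t + h) a b - w a b * J t a b) - w a b * G t a b)).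
  2:{ rewrite II_minus; [|apply C4|apply C3]. rewrite (II_scal L (/ h) (fun a b => w a b * J (t + h) a b - w a b * J t a b)).
      - rewrite II_minus; [unfold Rdiv; ring|apply C1|apply C2].
      - apply (CS_minus L (fun a b => w a b * J (t + h) a b) (fun a b => w a b * J t a b)); auto. }
  apply Rle_lt_trans with (Mw * k * A).
  - apply II_bound; [lra|apply (CS_minus L _ (fun a b => w a b * G t a b) C4 C3)|]. intros a b.
    replace (/ h * (w a b * J (t + h) a b - w a b * J t a b) - w a b * G t a b) with (w a b * ((J (t + h) a b - J t a b) / h - G t a b)) by lra.
    rewrite Rabs_mult. apply Rmult_le_compat; auto; try apply Rabs_pos.
    apply (derive_unif (fun s => J s a b) (fun s => G s a b) lo hi t k d); auto; try lra.
    intros y Hy. apply Hd'; auto; rdiag.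
  - assert (E : k * (2 * Mw * A) = e) by (unfold k; field; lra). nra.
Qed.

(** * Weak vorticity equation for the limit *)

Definition flux (F : flat) (q ua ub pa pb : field2) : R :=
  II (fL F) (fun a b => q a b * (- ub a b * pa a b + vB F ua a b * pb a b)).

Lemma vort_diff (F : flat) (q q' : field2) (r : R) : (forall a b, Rabs (q a b - q' a b) <= r) ->
  forall a b, Rabs (vort F q a b + -1 * vort F q' a b) <= r * / fkm F.
Proof.
  intros Hr a b. unfold vort. pose proof (inv_K_bound F a) as [I1 I2].
  replace ((q a b - fB F a) / fK F a + -1 * ((q' a b - fB F a) / fK F a)) with ((q a b - q' a b) * / fK F a) by lra.
  rewrite Rabs_mult, (Rabs_right (/ fK F a)) by lra. apply Rmult_le_compat; auto; try apply Rabs_pos; lra.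
Qed.

(** States with a common Hoelder constant that are close in the sup norm have stream functions close
    up to second derivatives, by interpolation. The velocities of the approximating runs therefore
    converge along with [q]. *)
Lemma Sol_stability (F : flat) (M Hs : R) : 0 <= Hs -> forall e, 0 < e -> exists r, 0 < r /\
  forall q q' u ua ub uaa uab ubb u' ua' ub' uaa' uab' ubb', state F M Hs q -> state F M Hs q' ->
    (forall a b, Rabs (q a b - q' a b) <= r) ->
    Sol true (fL F) 0 (vort F q) u ua ub uaa uab ubb -> Sol true (fL F) 0 (vort F q') u' ua' ub' uaa' uab' ubb' ->
    forall a b, Rabs (u a b - u' a b) <= e /\ Rabs (ua a b - ua' a b) <= e /\ Rabs (ub a b - ub' a b) <= e /\
      Rabs (uaa a b - uaa' a b) <= e /\ Rabs (uab a b - uab' a b) <= e /\ Rabs (ubb a b - ubb' a b) <= e.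
Proof.
  intros HHs e He. assert (HL := fLpos F). assert (Hkm := fkmpos F).
  assert (Hik : 0 < / fkm F) by (apply Rinv_0_lt_compat; auto).
  set (H2 := Hs * / fkm F + Rabs (-1) * (Hs * / fkm F)).
  assert (HH2 : 0 <= H2) by (unfold H2; pose proof (Rabs_pos (-1)); assert (0 <= Hs * / fkm F) by nra; nra).
  destruct (small_bound_small (fL F) (fth F) H2 HL (fthr F) HH2 e He) as [d [Hd Hd']].
  exists (d * fkm F); split; [nra|].
  intros q q' u ua ub uaa uab ubb u' ua' ub' uaa' uab' ubb' S S' Hr HS HS' a b.
  assert (HD := Sol_minus true (fL F) 0 0 _ _ _ _ _ _ _ _ _ _ _ _ _ _ ltac:(lra) HS HS').
  assert (HB : forall a b, Rabs (vort F q a b + -1 * vort F q' a b) <= d).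
  { intros x y. eapply Rle_trans; [apply vort_diff; apply Hr|]. right; field; lra. }
  assert (HH : holb (fth F) H2 (fun a b => vort F q a b + -1 * vort F q' a b)).
  { apply holb_plus; apply vort_holb; auto; apply hol2_holb; [apply S|apply S']. }
  assert (HU : UC (fun a b => vort F q a b + -1 * vort F q' a b)).
  { apply (CS_plus (fL F) (vort F q) (fun a b => -1 * vort F q' a b)); [|apply CS_scal; [lra|]]; apply vort_CS; [apply S|apply S']. }
  destruct (Schauder_small true (fL F) (fth F) H2 d _ _ _ _ _ _ _ _ HL (fthr F) HH2 HU HD HH HB a b) as [B1 [B2 [B3 [B4 [B5 B6]]]]].
  specialize (Hd' d ltac:(lra)).
  repeat split; match goal with |- Rabs (?p - ?q) <= _ => replace (p - q) with (p + -1 * q) by ring end; lra.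
Qed.

Lemma vB_diff (F : flat) (ua ua' : field2) (e : R) : UC ua -> UC ua' -> (forall a b, Rabs (ua a b - ua' a b) <= e) ->
  forall a b, Rabs (vB F ua a b - vB F ua' a b) <= 2 * e.
Proof.
  intros H H' He a b. pose proof PI_RGT_0. unfold vB, circ.
  assert (Q : Rabs (cint ua 0 - cint ua' 0) <= e * (2 * PI)).
  { rewrite <- cint_minus by auto. apply cint_bound; auto. apply UC_plus; auto. apply UC_opp; auto. }
  replace (ua a b + (fgam F - cint ua 0 / (2 * PI)) - (ua' a b + (fgam F - cint ua' 0 / (2 * PI)))) with
    ((ua a b - ua' a b) + - ((cint ua 0 - cint ua' 0) * / (2 * PI))) by lra.
  eapply Rle_trans; [apply Rabs_triang|]. rewrite Rabs_Ropp, Rabs_mult, (Rabs_right (/ (2 * PI))) by (apply Rle_ge; left; apply Rinv_0_lt_compat; lra).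
  assert (Rabs (cint ua 0 - cint ua' 0) * / (2 * PI) <= e).
  { apply Rmult_le_reg_r with (2 * PI); [lra|]. rewrite Rmult_assoc, Rinv_l; lra. }
  specialize (He a b). lra.
Qed.

Lemma flux_stability (F : flat) (M Hs V : R) (pa pb : field2) : 0 <= Hs -> 0 <= V -> CS (fL F) pa -> CS (fL F) pb ->
  forall e, 0 < e -> exists r, 0 < r /\
  forall q q' u ua ub uaa uab ubb u' ua' ub' uaa' uab' ubb', state F M Hs q -> state F M Hs q' ->
    (forall a b, Rabs (q a b - q' a b) <= r) ->
    Sol true (fL F) 0 (vort F q) u ua ub uaa uab ubb -> Sol true (fL F) 0 (vort F q') u' ua' ub' uaa' uab' ubb' ->
    vel_ok F V ua ub uaa uab ubb -> Rabs (flux F q ua ub pa pb - flux F q' ua' ub' pa pb) <= e.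
Proof.
  intros HHs HV Hpa Hpb e He. assert (HL := fLpos F). pose proof PI_RGT_0.
  destruct (CS_bounded (fL F) pa ltac:(lra) Hpa) as [Ma [Ma0 Ba]]. destruct (CS_bounded (fL F) pb ltac:(lra) Hpb) as [Mb [Mb0 Bb]].
  set (A := 2 * PI * fL F). assert (HA : 0 < A) by (unfold A; nra).
  set (M' := Rmax M 0). assert (M <= M') by apply Rmax_l. assert (M'0 : 0 <= M') by apply Rmax_r.
  set (Z := (V + 2 * M' + 1) * (Ma + Mb) * A). assert (HZ : 0 < Z) by (unfold Z; apply Rmult_lt_0_compat; auto; nra).
  set (k := e / Z). assert (Hk : 0 < k) by (apply Rdiv_lt_0_compat; auto).
  destruct (Sol_stability F M Hs HHs k Hk) as [r [Hr Hr']].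
  exists (Rmin r k); split; [apply Rmin_pos; auto|]. rmin_bounds r k.
  intros q q' u ua ub uaa uab ubb u' ua' ub' uaa' uab' ubb' S S' Hq HS HS' Hv.
  assert (B := Hr' q q' u ua ub uaa uab ubb u' ua' ub' uaa' uab' ubb' S S' ltac:(intros; eapply Rle_trans; [apply Hq|lra]) HS HS').
  assert (Uua : CS (fL F) ua) by apply HS. assert (Uub : CS (fL F) ub) by apply HS.
  assert (Uua' : CS (fL F) ua') by apply HS'. assert (Uub' : CS (fL F) ub') by apply HS'.
  assert (BvB := vB_diff F ua ua' k (proj1 Uua) (proj1 Uua') ltac:(intros; apply B)).
  assert (Cv : CS (fL F) (vB F ua)) by (apply (CS_plus (fL F) ua (fun _ _ => circ F ua)); auto; apply CS_const).
  assert (Cv' : CS (fL F) (vB F ua')) by (apply (CS_plus (fL F) ua' (fun _ _ => circ F ua')); auto; apply CS_const).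
  assert (C1 : CS (fL F) (fun a b => q a b * (- ub a b * pa a b + vB F ua a b * pb a b))).
  { apply CS_mult; [lra|apply S|]. apply CS_plus; apply CS_mult; auto; try lra. apply CS_opp; auto. }
  assert (C2 : CS (fL F) (fun a b => q' a b * (- ub' a b * pa a b + vB F ua' a b * pb a b))).
  { apply CS_mult; [lra|apply S'|]. apply CS_plus; apply CS_mult; auto; try lra. apply CS_opp; auto. }
  unfold flux. rewrite <- II_minus; [|apply C1|apply C2].
  apply Rle_trans with ((V + 2 * M' + 1) * (Ma + Mb) * k * A).
  2:{ right. unfold k, Z. field. repeat split; try lra. }
  destruct Hv as [_ [_ [_ [_ [_ [_ [V7 V8]]]]]]].
  apply II_bound; [lra|apply (CS_minus (fL F) _ _ C1 C2)|]. intros a b.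
  replace (q a b * (- ub a b * pa a b + vB F ua a b * pb a b) - q' a b * (- ub' a b * pa a b + vB F ua' a b * pb a b)) with
    (((q a b - q' a b) * - ub a b + q' a b * - (ub a b - ub' a b)) * pa a b + ((q a b - q' a b) * vB F ua a b + q' a b * (vB F ua a b - vB F ua' a b)) * pb a b) by ring.
  specialize (V7 a b); specialize (V8 a b); specialize (Ba a b); specialize (Bb a b); specialize (BvB a b); specialize (Hq a b).
  destruct (B a b) as [_ [_ [B3 _]]]. assert (Hq' : Rabs (q' a b) <= M') by (eapply Rle_trans; [apply S'|auto]).
  assert (X1 : Rabs ((q a b - q' a b) * - ub a b + q' a b * - (ub a b - ub' a b)) <= (V + 2 * M' + 1) * k).
  { eapply Rle_trans; [apply Rabs_triang|]. rewrite !Rabs_mult, !Rabs_Ropp.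
    assert (Rabs (q a b - q' a b) * Rabs (ub a b) <= k * V) by (apply Rmult_le_compat; auto; try apply Rabs_pos; lra).
    assert (Rabs (q' a b) * Rabs (ub a b - ub' a b) <= M' * k) by (apply Rmult_le_compat; auto; apply Rabs_pos). nra. }
  assert (X2 : Rabs ((q a b - q' a b) * vB F ua a b + q' a b * (vB F ua a b - vB F ua' a b)) <= (V + 2 * M' + 1) * k).
  { eapply Rle_trans; [apply Rabs_triang|]. rewrite !Rabs_mult.
    assert (Rabs (q a b - q' a b) * Rabs (vB F ua a b) <= k * V) by (apply Rmult_le_compat; auto; try apply Rabs_pos; lra).
    assert (Rabs (q' a b) * Rabs (vB F ua a b - vB F ua' a b) <= M' * (2 * k)) by (apply Rmult_le_compat; auto; apply Rabs_pos). nra. }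
  eapply Rle_trans; [apply Rabs_triang|]. rewrite !(Rabs_mult (_ + _)).
  set (W := (V + 2 * M' + 1) * k) in *.
  replace ((V + 2 * M' + 1) * (Ma + Mb) * k) with (W * Ma + W * Mb) by (unfold W; ring).
  apply Rplus_le_compat; apply Rmult_le_compat; auto; apply Rabs_pos.
Qed.
Lemma II_vort_lipschitz (F : flat) (p : field2) : CS (fL F) p -> exists C, 0 < C /\ forall q q' r, CS (fL F) q -> CS (fL F) q' ->
  (forall a b, Rabs (q a b - q' a b) <= r) ->
  Rabs (II (fL F) (fun a b => p a b * vort F q a b) - II (fL F) (fun a b => p a b * vort F q' a b)) <= C * r.
Proof.
  intros Hp. assert (HL := fLpos F). assert (Hkm := fkmpos F). pose proof PI_RGT_0.
  destruct (CS_bounded (fL F) p ltac:(lra) Hp) as [Mp [Mp0 Bp]].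
  assert (Hik : 0 < / fkm F) by (apply Rinv_0_lt_compat; auto).
  exists (Mp * / fkm F * (2 * PI * fL F)). split; [apply Rmult_lt_0_compat; nra|].
  intros q q' r Hq Hq' Hr.
  assert (C1 : CS (fL F) (fun a b => p a b * vort F q a b)) by (apply CS_mult; try lra; auto; apply vort_CS; auto).
  assert (C2 : CS (fL F) (fun a b => p a b * vort F q' a b)) by (apply CS_mult; try lra; auto; apply vort_CS; auto).
  rewrite <- II_minus; [|apply C1|apply C2].
  apply Rle_trans with (Mp * (r * / fkm F) * (2 * PI * fL F)); [|right; ring].
  apply II_bound; [lra|apply (CS_minus (fL F) _ _ C1 C2)|]. intros a b.
  rewrite <- Rmult_minus_distr_l, Rabs_mult. apply Rmult_le_compat; auto; try apply Rabs_pos.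
  assert (K := vort_diff F q q' r Hr a b). replace (vort F q a b - vort F q' a b) with (vort F q a b + -1 * vort F q' a b) by ring. auto.
Qed.

Lemma sum_steps (h : nat -> R) (c e : R) (I n : nat) : (forall j, (I <= j < I + n)%nat -> Rabs (h (S j) - h j - c) <= e) ->
  Rabs (h (I + n)%nat - h I - INR n * c) <= INR n * e.
Proof.
  induction n as [|n IH]; intros H.
  - rewrite Nat.add_0_r. rewrite !Rmult_0_l, !Rminus_0_r, Rminus_diag, Rabs_R0; lra.
  - rewrite Nat.add_succ_r, S_INR. specialize (IH ltac:(intros; apply H; lia)). specialize (H (I + n)%nat ltac:(lia)).
    apply Rabs_le_between in IH, H. apply Rabs_le_between. lra.
Qed.

(** An increment of the tested vorticity over [[x, y]] is compared with the telescoping sum of the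
    increments of a fine run, each equal to the step size times the flux up to a small error; near
    [t] the flux is almost constant. *)
Lemma weak_derivative (F : flat) (M T Hs V : R) (N : nat -> nat) (qs : nat -> nat -> field2) (q : field3) (q0 : field2)
  (u ua ub uaa uab ubb : field3) (p pa pb : field2) : 0 < T -> 0 <= Hs -> 0 <= V ->
  (forall n, (n < N n)%nat) -> (forall n, Scheme F M Hs V (T / INR (N n)) (N n) q0 (qs n)) ->
  (forall e, 0 < e -> exists n1, forall n, (n1 <= n)%nat -> forall k, (k <= N n)%nat -> forall a b,
       Rabs (qs n k a b - q (INR k * (T / INR (N n))) a b) <= e) ->
  (forall t, 0 <= t <= T -> state F M Hs (q t)) ->
  (forall t t', 0 <= t <= T -> 0 <= t' <= T -> forall a b, Rabs (q t a b - q t' a b) <= Hs * pw (2 * V * Rabs (t - t')) (fth F)) ->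
  (forall t, 0 <= t <= T -> Sol true (fL F) 0 (vort F (q t)) (u t) (ua t) (ub t) (uaa t) (uab t) (ubb t)) ->
  C1s (fL F) p pa pb ->
  forall t, 0 < t < T -> D (fun s => II (fL F) (fun a b => p a b * vort F (q s) a b)) t (flux F (q t) (ua t) (ub t) pa pb).
Proof.
  intros HT HHs HV HN Hsch Hconv Hst Htm Hsol Hp t Ht eta Heta.
  assert (Hth := fthr F). assert (HL := fLpos F).
  destruct (vel_bound F M) as [C [HC Hvb]].
  set (V' := Rmax V (C * (1 + ln (1 + Hs)))). assert (HV1 : V <= V') by apply Rmax_l. assert (HV2 : C * (1 + ln (1 + Hs)) <= V') by apply Rmax_r.
  set (h := fun s => II (fL F) (fun a b => p a b * vort F (q s) a b)).
  set (k := fun s => flux F (q s) (ua s) (ub s) pa pb).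
  (* Each step carries three errors of relative size [e]: the first-order expansion, the passage
     from the run to the limit, and the variation of the flux in time. Their sum [3 * e] stays below
     [eta]. *)
  set (e := eta / 8). assert (He : 0 < e) by (unfold e; lra).
  destruct (flux_stability F M Hs V' pa pb HHs ltac:(lra) ltac:(apply Hp) ltac:(apply Hp) e He) as [r [Hr Hfs]].
  destruct (weak_step F M Hs V' p pa pb ltac:(lra) HHs Hp e He) as [e0 [He0 Hws]].
  destruct (II_vort_lipschitz F p ltac:(apply Hp)) as [Ch [HCh Hlip]].
  assert (Hvq : forall s, 0 <= s <= T -> vel_ok F V' (ua s) (ub s) (uaa s) (uab s) (ubb s)).
  { intros s Hs'. apply vel_ok_mono with (C * (1 + ln (1 + Hs))); auto. apply (Hvb (q s) Hs (u s)); auto. }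
  assert (Hmod : forall rho, 0 < rho -> exists d, 0 < d /\ forall s s', 0 <= s <= T -> 0 <= s' <= T -> Rabs (s - s') < d -> forall a b, Rabs (q s a b - q s' a b) <= rho).
  { intros rho Hrho. destruct (pw_ctn_add (fth F) (2 * V) 0 ltac:(lra) (rho / (Hs + 1))) as [d [Hd Hd']]; [apply Rdiv_lt_0_compat; lra|].
    exists d; split; auto. intros s s' H1 H2 H3 a b. eapply Rle_trans; [apply Htm; auto|].
    specialize (Hd' (Rabs (s - s')) ltac:(rewrite Rabs_Rabsolu; auto)). rewrite Rmult_0_r, (pw_npos 0), Rplus_0_l, Rplus_0_l in Hd' by lra.
    apply (Rmult_le_compat_l Hs) in Hd'; auto. assert (E : rho / (Hs + 1) * (Hs + 1) = rho) by (field; lra).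
    assert (0 < rho / (Hs + 1)) by (apply Rdiv_lt_0_compat; lra). lra. }
  destruct (Hmod r Hr) as [d1 [Hd1 Hk1]].
  set (del := Rmin (d1 / 2) (Rmin t (T - t))). assert (Hdel : 0 < del) by (repeat apply Rmin_pos; lra).
  assert (Hdel1 : del <= d1 / 2) by apply Rmin_l. assert (Hdel2 : del <= Rmin t (T - t)) by apply Rmin_r.
  assert (Hdel3 : Rmin t (T - t) <= t) by apply Rmin_l. assert (Hdel4 : Rmin t (T - t) <= T - t) by apply Rmin_r.
  assert (Main : forall x y, 0 <= x -> x < y -> y <= T -> Rabs (x - t) < del -> Rabs (y - t) < del -> Rabs (h y - h x - (y - x) * k t) <= (y - x) * (3 * e)).
  { intros x y Hx Hxy Hy Hxt Hyt. apply le_eps; intros rho Hrho.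
    set (rr := rho / (4 * Ch)). assert (Hrr : 0 < rr) by (unfold rr; apply Rdiv_lt_0_compat; lra).
    destruct (Hmod (rr / 2) ltac:(lra)) as [d2 [Hd2 Hk2]].
    destruct (Hconv (Rmin r (rr / 2)) ltac:(apply Rmin_pos; lra)) as [n1 Hn1].
    (* The interval need not begin or end at grid times. The bound [z] on the step size makes the
       two incomplete cells contribute less than [rho]. *)
    assert (Hkt := Rabs_pos (k t)). set (z := rho / (8 * (Rabs (k t) + 3 * e + 1))).
    assert (Hz : 0 < z) by (unfold z; apply Rdiv_lt_0_compat; lra).
    set (m := Rmin (Rmin e0 d2) (Rmin (d1 / 2) z)).
    assert (Hm : 0 < m) by (repeat apply Rmin_pos; lra).
    assert (Hm' : m <= e0 /\ m <= d2 /\ m <= d1 / 2 /\ m <= z).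
    { unfold m. rmin_bounds (Rmin e0 d2) (Rmin (d1 / 2) z). rmin_bounds e0 d2. rmin_bounds (d1 / 2) z. lra. }
    destruct (inv_small (m / T)) as [n2 Hn2]; [apply Rdiv_lt_0_compat; auto|].
    set (n := (n1 + n2)%nat). set (ep := T / INR (N n)).
    assert (HNn : 0 < INR (N n)) by (apply lt_0_INR; specialize (HN n); lia).
    assert (Hep : 0 < ep) by (unfold ep; apply Rdiv_lt_0_compat; auto).
    assert (Hepm : ep < m).
    { specialize (Hn2 n ltac:(unfold n; lia)). apply Rle_lt_trans with (T * / (INR n + 1)).
      - apply Rmult_le_compat_l; [lra|]. apply Rinv_le_contravar; [pose proof (pos_INR n); lra|]. rewrite <- S_INR. apply le_INR. specialize (HN n); lia.
      - apply (Rmult_lt_compat_l T) in Hn2; auto. replace (T * (m / T)) with m in Hn2 by (field; lra). auto. }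
    specialize (Hn1 n ltac:(unfold n; lia)). fold ep in Hn1.
    destruct (Hsch n) as [_ [Sst [Sstep _]]]. fold ep in Sstep.
    set (I := nfl (x / ep)). set (J := nfl (y / ep)).
    assert (HI : INR I * ep <= x < INR I * ep + ep).
    { destruct (nfl_spec (x / ep)) as [B1 B2]; [apply Rmult_le_pos; [lra|left; apply Rinv_0_lt_compat; auto]|]. fold I in B1, B2.
      assert (E : x = x / ep * ep) by (field; lra). rewrite E. split; [apply Rmult_le_compat_r; lra|]. nra. }
    assert (HJ : INR J * ep <= y < INR J * ep + ep).
    { destruct (nfl_spec (y / ep)) as [B1 B2]; [apply Rmult_le_pos; [lra|left; apply Rinv_0_lt_compat; auto]|]. fold J in B1, B2.
      assert (E : y = y / ep * ep) by (field; lra). rewrite E. split; [apply Rmult_le_compat_r; lra|]. nra. }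
    assert (HTN : T = INR (N n) * ep) by (unfold ep; field; lra).
    assert (HIJ : (I <= J)%nat).
    { apply Nat.lt_succ_r, INR_lt. rewrite S_INR. apply Rmult_lt_reg_r with ep; auto. lra. }
    assert (HJN : (J <= N n)%nat) by (apply INR_le; apply Rmult_le_reg_r with ep; auto; lra).
    set (hn := fun j => II (fL F) (fun a b => p a b * vort F (qs n j) a b)).
    assert (Hgrid : forall j, (j <= N n)%nat -> 0 <= INR j * ep <= T).
    { intros j Hj. apply le_INR in Hj. pose proof (pos_INR j). rewrite HTN. split; nra. }
    assert (Hstep : forall j, (I <= j < I + (J - I))%nat -> Rabs (hn (S j) - hn j - ep * k t) <= ep * (3 * e)).
    { intros j Hj. assert (Hjn : (j < N n)%nat) by lia.
      destruct (Sstep j Hjn) as [v [va [vb [vaa [vab [vbb [R1 R2]]]]]]].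
      assert (R2' := vel_ok_mono F V V' _ _ _ _ _ HV1 R2).
      assert (W := Hws ep (qs n j) (qs n (S j)) v va vb vaa vab vbb ltac:(lra) (Sst j ltac:(lia)) R1 ltac:(apply (Sst (S j)); lia) R2').
      assert (Gj := Hgrid j ltac:(lia)).
      assert (Hjt : Rabs (INR j * ep - t) < d1).
      { assert (INR I <= INR j) by (apply le_INR; lia). assert (INR j <= INR J) by (apply le_INR; lia).
        apply Rabs_lt_between in Hxt, Hyt. apply Rabs_lt_between.
        assert (INR I * ep <= INR j * ep) by (apply Rmult_le_compat_r; lra). assert (INR j * ep <= INR J * ep) by (apply Rmult_le_compat_r; lra). lra. }
      assert (K1 := Hfs (qs n j) (q (INR j * ep)) v va vb vaa vab vbb _ _ _ _ _ _ (Sst j ltac:(lia)) (Hst _ Gj)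
         ltac:(intros a b; eapply Rle_trans; [apply Hn1; lia|apply Rmin_l]) (proj1 R1) (Hsol _ Gj) R2').
      assert (K2 := Hfs (q (INR j * ep)) (q t) _ _ _ _ _ _ _ _ _ _ _ _ (Hst _ Gj) (Hst t ltac:(lra))
         ltac:(apply Hk1; lra) (Hsol _ Gj) (Hsol t ltac:(lra)) (Hvq _ Gj)).
      fold (k (INR j * ep)) in K1, K2. fold (k t) in K2. fold (flux F (qs n j) va vb pa pb) in W. fold (hn (S j)) (hn j) in W.
      apply Rabs_le_between in W, K1, K2. apply Rabs_le_between.
      set (f := flux F (qs n j) va vb pa pb) in *. assert (- (2 * e) <= f - k t <= 2 * e) by lra. split; nra. }
    assert (Sm := sum_steps hn (ep * k t) (ep * (3 * e)) I (J - I) Hstep). replace (I + (J - I))%nat with J in Sm by lia.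
    rewrite minus_INR in Sm by auto.
    assert (Hend : forall w j, 0 <= w <= T -> (j <= N n)%nat -> INR j * ep <= w < INR j * ep + ep -> Rabs (h w - hn j) <= rho / 4).
    { intros w j Hw Hj Hwj. replace (rho / 4) with (Ch * rr) by (unfold rr; field; lra). apply Hlip; [apply Hst; auto|apply Sst; auto|].
      intros a b. assert (Gj := Hgrid j Hj).
      assert (K1 := Hk2 w (INR j * ep) Hw Gj ltac:(apply Rabs_lt_between; lra) a b).
      assert (K2 := Hn1 j Hj a b). pose proof (Rmin_r r (rr / 2)). apply Rabs_le_between in K1, K2. apply Rabs_le_between; lra. }
    assert (E1 := Hend x I ltac:(lra) ltac:(lia) HI). assert (E2 := Hend y J ltac:(lra) HJN HJ).
    set (g := (INR J - INR I) * ep).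
    assert (Hg : Rabs (g - (y - x)) <= ep) by (unfold g; apply Rabs_le_between; lra).
    replace ((INR J - INR I) * (ep * k t)) with (g * k t) in Sm by (unfold g; ring).
    replace ((INR J - INR I) * (ep * (3 * e))) with (g * (3 * e)) in Sm by (unfold g; ring).
    assert (Z1 : Rabs ((g - (y - x)) * k t) <= ep * Rabs (k t)) by (rewrite Rabs_mult; apply Rmult_le_compat_r; auto).
    assert (Ez : z * (8 * (Rabs (k t) + 3 * e + 1)) = rho) by (unfold z; field; lra).
    assert (Z2 : ep * (Rabs (k t) + 3 * e) <= rho / 8) by nra.
    assert (Z3 : g * (3 * e) <= (y - x) * (3 * e) + ep * (3 * e)) by (apply Rabs_le_between in Hg; nra).
    apply Rabs_le_between in Sm, E1, E2, Z1. apply Rabs_le_between. lra. }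
  exists (mkposreal _ Hdel); simpl. intros d Hd0 Hd. fold (h (t + d)) (h t) (k t).
  assert (Q : Rabs (h (t + d) - h t - d * k t) <= Rabs d * (3 * e)).
  { apply Rabs_lt_between in Hd as Hd'. destruct (Rlt_dec 0 d) as [Hp0|Hn0].
    - assert (K := Main t (t + d) ltac:(lra) ltac:(lra) ltac:(lra) ltac:(rdiag) ltac:(replace (t + d - t) with d by ring; auto)).
      replace (t + d - t) with d in K by ring. rewrite (Rabs_right d) by lra. auto.
    - assert (K := Main (t + d) t ltac:(lra) ltac:(lra) ltac:(lra) ltac:(replace (t + d - t) with d by ring; auto) ltac:(rdiag)).
      replace (t - (t + d)) with (- d) in K by ring. rewrite (Rabs_left d) by lra.
      replace (h (t + d) - h t - d * k t) with (- (h t - h (t + d) - - d * k t)) by ring. rewrite Rabs_Ropp; auto. }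
  replace ((h (t + d) - h t) / d - k t) with ((h (t + d) - h t - d * k t) / d) by (field; auto).
  unfold Rdiv. rewrite Rabs_mult, Rabs_inv. assert (0 < Rabs d) by (apply Rabs_pos_lt; auto).
  apply Rle_lt_trans with (3 * e); [|unfold e; lra]. apply Rmult_le_reg_r with (Rabs d); auto. rewrite Rmult_assoc, Rinv_l by lra. lra.
Qed.
(** * The momentum equation in logarithmic polar coordinates *)

Lemma holb_mult (th H K M N : R) (f g : field2) : holb th H f -> holb th K g -> (forall a b, Rabs (f a b) <= M) -> (forall a b, Rabs (g a b) <= N) ->
  holb th (N * H + M * K) (fun a b => f a b * g a b).
Proof.
  intros Hf Hg HM HN a b b'. replace (f a b' * g a b' - f a b * g a b) with (g a b' * (f a b' - f a b) + f a b * (g a b' - g a b)) by ring.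
  eapply Rle_trans; [apply Rabs_triang|]. rewrite !Rabs_mult, Rmult_plus_distr_r, !Rmult_assoc.
  apply Rplus_le_compat; apply Rmult_le_compat; auto; apply Rabs_pos.
Qed.

Lemma holb_lipschitz (th V : R) (g : field2) : 0 < th <= 1 -> (forall a b, Rabs (g a b) <= V) ->
  (forall a b b', Rabs (g a b - g a b') <= V * Rabs (b - b')) -> holb th (2 * V) g.
Proof.
  intros Ht HV Hl a b b'. assert (V0 : 0 <= V) by (apply Rle_trans with (2 := HV 0 0), Rabs_pos).
  assert (P := Rabs_pos (b' - b)). set (d := Rabs (b' - b)) in *.
  destruct (Rle_dec d 1).
  - eapply Rle_trans; [apply Hl|]. fold d. pose proof (le_mult_pw d th 1 ltac:(lra) ltac:(lra) ltac:(lra)). nra.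
  - assert (1 <= pw d th) by (rewrite <- (pw_1 th); apply pw_le; lra).
    assert (K1 := HV a b). assert (K2 := HV a b'). apply Rabs_le_between in K1, K2.
    apply Rle_trans with (2 * V); [apply Rabs_le_between; lra|nra].
Qed.

(** Differences of solutions at two times solve the problem for the difference of data, which is
    small in the sup norm within one Hoelder class; the interpolated Schauder bound applies. *)
Lemma Sol_TC (d : bool) (L T th H : R) (k : R -> R) (f u ua ub uaa uab ubb : field3) : 0 < L -> 0 < th <= 1 -> 0 <= H ->
  (forall t, 0 <= t <= T -> CS L (f t)) -> (forall t, 0 <= t <= T -> holb th H (f t)) -> TC T f ->
  (forall t, 0 <= t <= T -> Sol d L (k t) (f t) (u t) (ua t) (ub t) (uaa t) (uab t) (ubb t)) ->
  TC T u /\ TC T ua /\ TC T ub /\ TC T uaa /\ TC T uab /\ TC T ubb /\ TC T (fun t _ _ => k t).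
Proof.
  intros HL Ht HH Hc Hh Hf HS.
  assert (K : forall t, 0 <= t <= T -> forall e, 0 < e -> exists dl, 0 < dl /\ forall t', 0 <= t' <= T -> Rabs (t' - t) < dl -> forall a b,
    Rabs (u t' a b - u t a b) <= e /\ Rabs (ua t' a b - ua t a b) <= e /\ Rabs (ub t' a b - ub t a b) <= e /\
    Rabs (uaa t' a b - uaa t a b) <= e /\ Rabs (uab t' a b - uab t a b) <= e /\ Rabs (ubb t' a b - ubb t a b) <= e /\ Rabs (k t' - k t) <= e).
  { intros t Ht' e He.
    destruct (small_bound_small L th (2 * H) HL Ht ltac:(lra) e He) as [dl [Hdl Hsm]].
    set (r := Rmin dl e). assert (0 < r) by (apply Rmin_pos; auto). assert (r <= dl) by apply Rmin_l. assert (r <= e) by apply Rmin_r.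
    destruct (Hf t Ht' r H0) as [d0 [Hd0 Hd0']]. exists d0; split; auto. intros t' Ht'' Hd a b.
    assert (HD := Sol_minus d L (k t') (k t) _ _ _ _ _ _ _ _ _ _ _ _ _ _ ltac:(lra) (HS t' Ht'') (HS t Ht')).
    assert (HB : forall a b, Rabs (f t' a b + -1 * f t a b) <= r).
    { intros x y. replace (f t' x y + -1 * f t x y) with (f t' x y - f t x y) by ring. apply Hd0'; auto. }
    assert (HH' : holb th (2 * H) (fun a b => f t' a b + -1 * f t a b)).
    { replace (2 * H) with (H + Rabs (-1) * H) by (rewrite Rabs_left; lra). apply holb_plus; auto. }
    assert (HU : UC (fun a b => f t' a b + -1 * f t a b)).
    { apply (CS_plus L (f t') (fun a b => -1 * f t a b)); [|apply CS_scal; try lra]; auto. }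
    assert (Hk := Sol_kap d L _ r _ _ _ _ _ _ _ HL HU HD HB).
    destruct (Schauder_small d L th (2 * H) r _ _ _ _ _ _ _ _ HL Ht ltac:(lra) HU HD HH' HB a b) as [B1 [B2 [B3 [B4 [B5 B6]]]]].
    specialize (Hsm r ltac:(lra)).
    repeat split; match goal with |- Rabs (?p - ?q) <= _ => replace (p - q) with (p + -1 * q) by ring end; lra. }
  repeat split; intros t Ht' e He; destruct (K t Ht' e He) as [dl [Hdl Hd']]; exists dl; split; auto; intros t' H1 H2 a b; apply (Hd' t' H1 H2 a b).
Qed.

Lemma TC_of_modulus (T : R) (G : field3) (th H V : R) : 0 < th -> 0 <= H -> (forall t t', 0 <= t <= T -> 0 <= t' <= T -> forall a b,
   Rabs (G t a b - G t' a b) <= H * pw (2 * V * Rabs (t - t')) th) -> TC T G.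
Proof.
  intros Ht HH HG t Ht' e He. destruct (pw_ctn_add th (2 * V) 0 Ht (e / (H + 1))) as [d [Hd Hd']]; [apply Rdiv_lt_0_compat; lra|].
  exists d; split; auto. intros t' H1 H2 a b. eapply Rle_trans; [apply HG; auto|].
  specialize (Hd' (Rabs (t' - t)) ltac:(rewrite Rabs_Rabsolu; auto)). rewrite Rmult_0_r, (pw_npos 0), Rplus_0_l, Rplus_0_l in Hd' by lra.
  apply (Rmult_le_compat_l H) in Hd'; auto. assert (E : e / (H + 1) * (H + 1) = e) by (field; lra).
  assert (0 < e / (H + 1)) by (apply Rdiv_lt_0_compat; lra). lra.
Qed.

Definition Jt (G : field3) (t a b : R) : R := RInt (fun s => G s a b) 0 t.

Lemma Jt_CS (T L t : R) (G : field3) : 0 <= t -> CT T L G -> CS L (Jt G t).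
Proof.
  intros Ht HG. destruct HG as [H1 [H2 [H3 H4]]] eqn:E. split; [|split].
  - intros e He. destruct (H1 (e / (2 * (t + 1)))) as [d [Hd Hd']]; [apply Rdiv_lt_0_compat; lra|]. exists d; split; auto.
    intros x y x' y' K1 K2. unfold Jt. rewrite <- RI_minus by (apply (CT_ctn T L G _ _ HG)).
    apply Rle_lt_trans with (e / (2 * (t + 1)) * (t - 0)).
    + apply RI_bound; auto; [apply ctn_minus; apply (CT_ctn T L G _ _ HG)|]. intros s _; left; apply Hd'; auto; rdiag.
    + assert (E2 : e / (2 * (t + 1)) * (2 * (t + 1)) = e) by (field; lra). nra.
  - intros a b; apply RI_ext; auto.
  - intros a b; apply RI_ext; auto.
Qed.

Lemma Jt_C1s (T L t : R) (G Ga Gb : field3) : 0 <= t -> CT T L G -> CT T L Ga -> CT T L Gb -> (forall s, C1s L (G s) (Ga s) (Gb s)) ->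
  C1s L (Jt G t) (Jt Ga t) (Jt Gb t).
Proof.
  intros Ht HG HGa HGb HC. split; [|split; [|split; [|split]]]; try (eapply Jt_CS; eauto).
  - intros a b Ha. apply (RI_param_derive (fun x s => G s x b) (fun x s => Ga s x b) 0 L); auto.
    + intros x _; apply (CT_ctn T L G _ _ HG).
    + apply (CT_slice T L); auto.
    + intros x s Hx; apply (HC s); auto.
  - intros a b. apply (RI_param_derive (fun y s => G s a y) (fun y s => Gb s a y) (b - 1) (b + 1)); auto; try lra.
    + intros x _; apply (CT_ctn T L G _ _ HG).
    + apply (CT_slice_a T L); auto.
    + intros x s Hx; apply (HC s); auto.
Qed.

Lemma boundary_tangential (L x : R) (u ua ub : field2) (c : R) : C1s L u ua ub -> (forall b, u x b = c) -> forall b, ub x b = 0.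
Proof.
  intros Hu Hx b. apply (uniqueness_limite (fun y => u x y) b); [apply Hu|]. apply D_ext with (fun _ => c); [auto|apply D_const].
Qed.

Lemma cint_zero (g : field2) (a : R) : (forall b, g a b = 0) -> cint g a = 0.
Proof. intros H; unfold cint. rewrite (RI_ext _ (fun _ => 0)) by auto. rewrite RI_const; ring. Qed.

(* [d/dx int Q p_b db = int (Q_a p_b - Q_b p_a) db] needs only first derivatives, because the
   increment of [p_b] can be integrated by parts in [b]. *)
Lemma jacobian_derive (L : R) (Q Qa Qb p pa pb : field2) : 0 < L -> C1s L Q Qa Qb -> C1s L p pa pb ->
  forall x, 0 < x < L -> D (cint (fun a b => Q a b * pb a b)) x (cint (fun a b => Qa a b * pb a b - Qb a b * pa a b) x).
Proof.
  intros HL HQ Hp x Hx eps He. pose proof PI_RGT_0.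
  destruct HQ as [Q1 [Q2 [Q3 [Q4 Q5]]]]. destruct Hp as [p1 [p2 [p3 [p4 p5]]]].
  destruct (CS_bounded L Qa ltac:(lra) Q2) as [M1 [M10 B1]]. destruct (CS_bounded L Qb ltac:(lra) Q3) as [M2 [M20 B2]].
  destruct (CS_bounded L pb ltac:(lra) p3) as [M3 [M30 B3]].
  set (k := eps / (2 * (2 * PI) * (M1 + M2 + M3))).
  assert (Hk : 0 < k) by (unfold k; apply Rdiv_lt_0_compat; auto; nra).
  destruct (proj1 Q2 k Hk) as [d1 [Hd1 D1]]. destruct (proj1 p2 k Hk) as [d2 [Hd2 D2]]. destruct (proj1 p3 k Hk) as [d3 [Hd3 D3]].
  set (d := Rmin (Rmin d1 d2) (Rmin d3 (Rmin x (L - x)))).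
  assert (Hd : 0 < d) by (repeat apply Rmin_pos; lra).
  assert (Hd' : d <= d1 /\ d <= d2 /\ d <= d3 /\ d <= x /\ d <= L - x).
  { unfold d. pose proof (Rmin_l (Rmin d1 d2) (Rmin d3 (Rmin x (L - x)))). pose proof (Rmin_r (Rmin d1 d2) (Rmin d3 (Rmin x (L - x)))). rmin_bounds d1 d2. rmin_bounds d3 (Rmin x (L - x)). rmin_bounds x (L - x). lra. }
  exists (mkposreal _ Hd); simpl; intros h Hh Hhd. apply Rabs_lt_between in Hhd as Hhd'.
  set (dQ := fun b => (Q (x + h) b - Q x b) / h). set (dp := fun b => (p (x + h) b - p x b) / h).
  assert (CQ : ctn dQ) by (unfold dQ, Rdiv; repeat cstep; apply (UC_ctn2 Q), Q1).
  assert (Cp : ctn dp) by (unfold dp, Rdiv; repeat cstep; apply (UC_ctn2 p), p1).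
  assert (CC : forall (f : field2) y, CS L f -> ctn (fun b => f y b)) by (intros f y Hf; apply (UC_ctn2 f), Hf).
  assert (IBP : RInt (fun b => Q x b * (pb (x + h) b - pb x b)) 0 (2 * PI) = - RInt (fun b => Qb x b * (p (x + h) b - p x b)) 0 (2 * PI)).
  { assert (Z : RInt (fun b => Qb x b * (p (x + h) b - p x b) + Q x b * (pb (x + h) b - pb x b)) 0 (2 * PI) = 0).
    { rewrite (RI_ftc (fun b => Q x b * (p (x + h) b - p x b))); try lra.
      - rewrite <- (proj2 (proj2 Q1) x 0), <- (proj2 (proj2 p1) (x + h) 0), <- (proj2 (proj2 p1) x 0), Rplus_0_l. lra.
      - intros y _. assert (C : ctn (fun b => Q x b * (p (x + h) b - p x b))) by (repeat cstep; apply CC; auto). apply C.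
      - repeat cstep; apply CC; auto.
      - intros y _. apply (D_mult (fun b => Q x b) (fun b => p (x + h) b - p x b)); auto. apply (D_minus (fun b => p (x + h) b) (fun b => p x b)); auto. }
    rewrite RI_plus in Z by (repeat cstep; apply CC; auto). lra. }
  assert (E : (cint (fun a b => Q a b * pb a b) (x + h) - cint (fun a b => Q a b * pb a b) x) / h - cint (fun a b => Qa a b * pb a b - Qb a b * pa a b) x
     = RInt (fun b => (dQ b - Qa x b) * pb (x + h) b + Qa x b * (pb (x + h) b - pb x b) - Qb x b * (dp b - pa x b)) 0 (2 * PI)).
  { unfold cint. rewrite <- (RI_minus (fun b => Q (x + h) b * pb (x + h) b) (fun b => Q x b * pb x b)) by (repeat cstep; apply CC; auto).
    rewrite (RI_ext (fun b => Q (x + h) b * pb (x + h) b - Q x b * pb x b) (fun b => (Q (x + h) b - Q x b) * pb (x + h) b + Q x b * (pb (x + h) b - pb x b))) by (intros; ring).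
    rewrite RI_plus by (repeat cstep; apply CC; auto). rewrite IBP.
    rewrite <- RI_opp by (repeat cstep; apply CC; auto).
    rewrite <- RI_plus by (repeat cstep; apply CC; auto). unfold Rdiv at 1. rewrite Rmult_comm, <- RI_scal by (repeat cstep; apply CC; auto).
    rewrite <- RI_minus by (repeat cstep; apply CC; auto).
    apply RI_ext; intros b. unfold dQ, dp. field. auto. }
  rewrite E. apply Rle_lt_trans with ((k * (M1 + M2 + M3)) * (2 * PI - 0)).
  - apply RI_bound; [lra|repeat cstep; auto; apply CC; auto|]. intros b _.
    assert (A1 : Rabs (dQ b - Qa x b) <= k).
    { apply (derive_unif (fun x => Q x b) (fun x => Qa x b) 0 L x k d); auto; try lra. intros y Hy; apply D1; try lra. rewrite Rminus_diag, Rabs_R0; lra. }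
    assert (A2 : Rabs (dp b - pa x b) <= k).
    { apply (derive_unif (fun x => p x b) (fun x => pa x b) 0 L x k d); auto; try lra. intros y Hy; apply D2; try lra. rewrite Rminus_diag, Rabs_R0; lra. }
    assert (A3 : Rabs (pb (x + h) b - pb x b) <= k).
    { left; apply D3; [replace (x + h - x) with h by ring; lra|rewrite Rminus_diag, Rabs_R0; lra]. } eapply Rle_trans; [apply Rabs_triang|]. rewrite Rabs_Ropp.
    eapply Rle_trans; [apply Rplus_le_compat_r, Rabs_triang|]. rewrite !Rabs_mult.
    assert (Rabs (dQ b - Qa x b) * Rabs (pb (x + h) b) <= k * M3) by (apply Rmult_le_compat; auto; apply Rabs_pos).
    assert (Rabs (Qa x b) * Rabs (pb (x + h) b - pb x b) <= M1 * k) by (apply Rmult_le_compat; auto; apply Rabs_pos).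
    assert (Rabs (Qb x b) * Rabs (dp b - pa x b) <= M2 * k) by (apply Rmult_le_compat; auto; apply Rabs_pos). lra.
  - assert (E2 : k * (2 * (2 * PI) * (M1 + M2 + M3)) = eps) by (unfold k; field; split; lra). lra.
Qed.

(** A Jacobian is a null Lagrangian, and constancy of [p] on each side removes the boundary terms.
    It says that gradients are orthogonal to velocity fields with a stream function constant on each
    side, so the pressure drops out of the energy identity. *)
Lemma jacobian_zero (L c0 c1 : R) (Q Qa Qb p pa pb : field2) : 0 < L -> C1s L Q Qa Qb -> C1s L p pa pb ->
  (forall b, p 0 b = c0) -> (forall b, p L b = c1) -> II L (fun a b => Qa a b * pb a b - Qb a b * pa a b) = 0.
Proof.
  intros HL HQ Hp H0 H1. unfold II.
  assert (C1 : CS L (fun a b => Qa a b * pb a b - Qb a b * pa a b)) by (apply CS_minus; apply CS_mult; try lra; first [apply HQ|apply Hp]).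
  assert (C2 : CS L (fun a b => Q a b * pb a b)) by (apply CS_mult; try lra; first [apply HQ|apply Hp]).
  rewrite (RI_ftc (cint (fun a b => Q a b * pb a b))); try lra.
  - rewrite !cint_zero; [lra| |].
    + intros b; rewrite (boundary_tangential L 0 p pa pb c0); auto; ring.
    + intros b; rewrite (boundary_tangential L L p pa pb c1); auto; ring.
  - intros; apply cint_ctn, C2.
  - apply cint_ctn, C1.
  - intros x Hx; apply (jacobian_derive L Q Qa Qb p pa pb); auto.
Qed.

Lemma II_ctn_family (L : R) (w : field2) (K : field3) : 0 < L -> CS L w -> (forall t, CS L (K t)) ->
  (forall t e, 0 < e -> exists d, 0 < d /\ forall t', Rabs (t' - t) < d -> forall a b, Rabs (K t' a b - K t a b) <= e) ->
  ctn (fun t => II L (fun a b => w a b * K t a b)).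
Proof.
  intros HL Hw HK Hc t. apply continuity_pt_eps; intros e He. pose proof PI_RGT_0.
  destruct (CS_bounded L w ltac:(lra) Hw) as [Mw [Mw0 Bw]]. set (A := 2 * PI * L). assert (HA : 0 < A) by (unfold A; nra).
  assert (Hk : 0 < e / (2 * Mw * A)) by (apply Rdiv_lt_0_compat; auto; nra). set (k := e / (2 * Mw * A)) in *.
  destruct (Hc t k Hk) as [d [Hd Hd']]. exists d; split; auto; intros t' Ht'.
  assert (C1 : CS L (fun a b => w a b * K t' a b)) by (apply CS_mult; auto; lra).
  assert (C2 : CS L (fun a b => w a b * K t a b)) by (apply CS_mult; auto; lra).
  rewrite <- II_minus; [|apply C1|apply C2]. apply Rle_lt_trans with (Mw * k * A).
  - apply II_bound; [lra|apply (CS_minus L _ _ C1 C2)|]. intros a b. rewrite <- Rmult_minus_distr_l, Rabs_mult.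
    apply Rmult_le_compat; auto; apply Rabs_pos.
  - assert (E : k * (2 * Mw * A) = e) by (unfold k; field; lra). nra.
Qed.

(** Integration by parts moves the derivatives from [p] to the field. The boundary term is [c1]
    times the circulation at [a = L], which equals the inner circulation [gam2] plus the integral of
    the curl. *)
Lemma Green_stream (L gam2 c1 : R) (ua ub uaa uab ubb B f p pa pb : field2) : 0 < L ->
  C1s L B uaa uab -> C1s L ub uab ubb -> (forall a b, uaa a b + ubb a b = f a b) -> cint B 0 = gam2 ->
  C1s L p pa pb -> (forall b, p 0 b = 0) -> (forall b, p L b = c1) ->
  II L (fun a b => pa a b * B a b + pb a b * ub a b) = c1 * (gam2 + II L f) - II L (fun a b => p a b * f a b).
Proof.
  intros HL HB Hub Hf Hg Hp H0 H1.
  assert (P1 := C1s_mult L _ _ _ _ _ _ ltac:(lra) Hp HB). assert (P2 := C1s_mult L _ _ _ _ _ _ ltac:(lra) Hp Hub).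
  assert (E1 := II_da L _ _ _ HL P1). assert (E2 := II_db L _ _ _ HL P2).
  assert (E3 := II_da L _ _ _ HL HB). assert (E4 := II_db L _ _ _ HL Hub).
  rewrite (cint_zero _ 0) in E1 by (intros; rewrite H0; ring).
  assert (E5 : cint (fun a b => p a b * B a b) L = c1 * cint B L).
  { unfold cint. rewrite <- RI_scal by (apply (UC_ctn2 B), HB). apply RI_ext; intros; rewrite H1; auto. }
  assert (Ca : CS L (fun a b => pa a b * B a b)) by (apply CS_mult; try lra; first [apply HB|apply Hp]).
  assert (Cb : CS L (fun a b => pb a b * ub a b)) by (apply CS_mult; try lra; first [apply Hub|apply Hp]).
  assert (Cc : CS L (fun a b => p a b * uaa a b)) by (apply CS_mult; try lra; first [apply HB|apply Hp]).
  assert (Cd : CS L (fun a b => p a b * ubb a b)) by (apply CS_mult; try lra; first [apply Hub|apply Hp]).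
  rewrite II_plus in E1; [|apply Ca|apply Cc]. rewrite II_plus in E2; [|apply Cb|apply Cd].
  rewrite II_plus; [|apply Ca|apply Cb].
  rewrite (II_ext L f (fun a b => uaa a b + ubb a b)) by auto.
  rewrite (II_ext L (fun a b => p a b * f a b) (fun a b => p a b * uaa a b + p a b * ubb a b)) by (intros; rewrite <- Hf; ring).
  rewrite II_plus; [|apply HB|apply Hub]. rewrite II_plus; [|apply Cc|apply Cd].
  rewrite E5 in E1. rewrite E3, E4, Hg. replace (cint B L) with (II L uaa + gam2) in E1 by lra. rewrite E3, Hg in E1. lra.
Qed.

(** * Existence for the equations on the strip *)

Lemma time_choice (T : R) (P : R -> R -> (field2) -> (field2) -> (field2) -> (field2) -> (field2) -> (field2) -> Prop) :
  (forall t, 0 <= t <= T -> exists k u ua ub uaa uab ubb, P t k u ua ub uaa uab ubb) ->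
  exists k u ua ub uaa uab ubb, forall t, 0 <= t <= T -> P t (k t) (u t) (ua t) (ub t) (uaa t) (uab t) (ubb t).
Proof.
  intros H.
  set (TT := (R * (field2) * (field2) * (field2) * (field2) * (field2) * (field2))%type).
  assert (H' : forall t, exists x : TT, 0 <= t <= T -> let '(k, u, ua, ub, uaa, uab, ubb) := x in P t k u ua ub uaa uab ubb).
  { intros t. destruct (classic (0 <= t <= T)) as [Ht|Ht].
    - destruct (H t Ht) as [k [u [ua [ub [uaa [uab [ubb Hn]]]]]]]. exists (k, u, ua, ub, uaa, uab, ubb); auto.
    - exists (0, (fun _ _ => 0), (fun _ _ => 0), (fun _ _ => 0), (fun _ _ => 0), (fun _ _ => 0), (fun _ _ => 0)). intros; contradiction. }
  set (x := fun t => proj1_sig (constructive_indefinite_description _ (H' t))).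
  assert (Hx : forall t, 0 <= t <= T -> let '(k, u, ua, ub, uaa, uab, ubb) := x t in P t k u ua ub uaa uab ubb).
  { intros t; unfold x; destruct (constructive_indefinite_description _ (H' t)); auto. }
  exists (fun t => let '(k, u, ua, ub, uaa, uab, ubb) := x t in k), (fun t => let '(k, u, ua, ub, uaa, uab, ubb) := x t in u),
    (fun t => let '(k, u, ua, ub, uaa, uab, ubb) := x t in ua), (fun t => let '(k, u, ua, ub, uaa, uab, ubb) := x t in ub),
    (fun t => let '(k, u, ua, ub, uaa, uab, ubb) := x t in uaa), (fun t => let '(k, u, ua, ub, uaa, uab, ubb) := x t in uab),
    (fun t => let '(k, u, ua, ub, uaa, uab, ubb) := x t in ubb).
  intros t Ht; specialize (Hx t Ht); destruct (x t) as [[[[[[k u] ua] ub] uaa] uab] ubb]; auto.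
Qed.

Lemma CT_family_cont (T L : R) (G : field3) : CT T L G ->
  forall t e, 0 < e -> exists d, 0 < d /\ forall t', Rabs (t' - t) < d -> forall a b, Rabs (G t' a b - G t a b) <= e.
Proof.
  intros [H1 _] t e He; destruct (H1 e He) as [d [Hd Hd']]; exists d; split; auto. intros t' Ht' a b.
  left; apply Hd'; auto; rdiag.
Qed.

Lemma Jt_family_cont (T L : R) (G : field3) : 0 <= T -> 0 <= L -> CT T L G ->
  forall t e, 0 < e -> exists d, 0 < d /\ forall t', Rabs (t' - t) < d -> forall a b, Rabs (Jt G (clamp T t') a b - Jt G (clamp T t) a b) <= e.
Proof.
  intros HT HL HG t e He. destruct (CT_bounded T L G HT HL HG) as [M [M0 B]].
  exists (e / M); split; [apply Rdiv_lt_0_compat; auto|]. intros t' Ht' a b.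
  assert (K := lipschitz_b (fun _ s => Jt G s a b) (fun _ s => G s a b) M).
  eapply Rle_trans; [apply (K ltac:(intros; apply RI_derive, (CT_ctn T L G a b HG)) ltac:(intros; apply B) 0)|].
  apply Rle_trans with (M * Rabs (t' - t)); [apply Rmult_le_compat_l; [lra|apply clamp_lip; auto]|].
  apply Rle_trans with (M * (e / M)); [apply Rmult_le_compat_l; lra|right; field; lra].
Qed.

Theorem flat_existence (F : flat) (M H0 T : R) (q0 : field2) : state F M H0 q0 -> 0 < T ->
  exists q A Aa Ab At B Ba Bb Bt Q Qa Qb : field3,
   (CT T (fL F) q /\ CT T (fL F) A /\ CT T (fL F) Aa /\ CT T (fL F) Ab /\ CT T (fL F) At /\
    CT T (fL F) B /\ CT T (fL F) Ba /\ CT T (fL F) Bb /\ CT T (fL F) Bt /\ CT T (fL F) Q /\ CT T (fL F) Qa /\ CT T (fL F) Qb) /\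
   (forall t, C1s (fL F) (A t) (Aa t) (Ab t)) /\ (forall t, C1s (fL F) (B t) (Ba t) (Bb t)) /\ (forall t, C1s (fL F) (Q t) (Qa t) (Qb t)) /\
   (forall t a b, Aa t a b + Bb t a b = 0) /\ (forall t a b, Ba t a b - Ab t a b = vort F (q t) a b) /\
   (forall t, dirichlet (fL F) (A t)) /\
   (forall t a b, At t a b = q t a b * B t a b - Qa t a b) /\ (forall t a b, Bt t a b = - (q t a b * A t a b) - Qb t a b) /\
   (forall t a b, 0 < t < T -> D (fun s => A s a b) t (At t a b) /\ D (fun s => B s a b) t (Bt t a b)) /\
   (forall a b, q 0 a b = q0 a b) /\ cint (B 0) 0 = 2 * PI * fgam F.
Proof.
  intros HS HT. assert (HL := fLpos F). assert (Hth := fthr F). assert (Hkm := fkmpos F). pose proof PI_RGT_0 as HPI.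
  destruct (scheme_limit F M H0 T q0 HS HT) as [Hs [V [N [qs [q [HHs [HV [HN [Hsch [Hconv [Hst [Htm Hq0]]]]]]]]]]]].
  destruct (time_choice T (fun t k u ua ub uaa uab ubb => k = 0 /\ Sol true (fL F) 0 (vort F (q t)) u ua ub uaa uab ubb))
    as [kk [u [ua [ub [uaa [uab [ubb Hsol']]]]]]].
  { intros t Ht. destruct (Sol_exists F M Hs (q t) (Hst t Ht)) as [u [ua [ub [uaa [uab [ubb Hu]]]]]]. exists 0, u, ua, ub, uaa, uab, ubb; auto. }
  assert (Hsol : forall t, 0 <= t <= T -> Sol true (fL F) 0 (vort F (q t)) (u t) (ua t) (ub t) (uaa t) (uab t) (ubb t)) by (intros; apply Hsol'; auto).
  clear Hsol' kk.
  assert (TCq : TC T q) by (apply (TC_of_modulus T q (fth F) Hs V); auto; lra).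
  assert (Hik : 0 < / fkm F) by (apply Rinv_0_lt_compat; auto).
  assert (TCf : TC T (fun t => vort F (q t))).
  { intros t Ht e He. destruct (TCq t Ht (e * fkm F) ltac:(nra)) as [d [Hd Hd']]; exists d; split; auto. intros t' H1 H2 a b.
    assert (K := vort_diff F (q t') (q t) (e * fkm F) ltac:(auto) a b).
    replace (vort F (q t') a b - vort F (q t) a b) with (vort F (q t') a b + -1 * vort F (q t) a b) by ring.
    eapply Rle_trans; [apply K|]. right; field; lra. }
  destruct (Sol_TC true (fL F) T (fth F) (Hs * / fkm F) (fun _ => 0) (fun t => vort F (q t)) u ua ub uaa uab ubb HL Hth ltac:(nra)) as [Tu [Tua [Tub [Tuaa [Tuab [Tubb _]]]]]]; auto.
  { intros t Ht; apply vort_CS, Hst; auto. }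
  { intros t Ht; apply vort_holb; auto. apply hol2_holb, Hst; auto. }
  destruct (vel_bound F M) as [C [HC Hvb]]. set (W := C * (1 + ln (1 + Hs))).
  assert (Hv : forall t, 0 <= t <= T -> vel_ok F W (ua t) (ub t) (uaa t) (uab t) (ubb t)) by (intros t Ht; apply (Hvb (q t) Hs (u t)); auto).
  assert (W0 : 0 <= W) by (unfold W; pose proof (ln_one_plus_nonneg Hs HHs); nra).
  assert (TvB : TC T (fun t => vB F (ua t))).
  { intros t Ht e He. destruct (Tua t Ht (e / 2) ltac:(lra)) as [d [Hd Hd']]; exists d; split; auto. intros t' H1 H2 a b.
    replace e with (2 * (e / 2)) by field. apply vB_diff; [apply (Hsol t' H1)|apply (Hsol t Ht)|auto]. }
  assert (CvB : forall t, 0 <= t <= T -> C1s (fL F) (vB F (ua t)) (uaa t) (uab t)) by (intros t Ht; apply C1s_shift, (Hsol t Ht)).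
  set (M' := Rmax M 0). assert (HM1 : M <= M') by apply Rmax_l. assert (HM0 : 0 <= M') by apply Rmax_r.
  assert (Bq : forall t, 0 <= t <= T -> forall a b, Rabs (q t a b) <= M') by (intros t Ht a b; eapply Rle_trans; [apply Hst; auto|auto]).
  assert (HLb : exists X, 0 <= X /\ forall t, 0 <= t <= T -> (forall a b, Rabs (ub t a b) <= X) /\ (forall a b, Rabs (vB F (ua t) a b) <= X) /\
      (forall a b, Rabs (uab t a b) <= X) /\ (forall a b, Rabs (ubb t a b) <= X)).
  { exists (W + W * / fkm F). assert (0 <= W * / fkm F) by nra. split; [lra|]. intros t Ht.
    destruct (Hv t Ht) as [V1 [V2 [V3 [V4 [V5 [V6 [V7 V8]]]]]]].
    assert (K : forall x a, Rabs (fK F a * x) <= W -> Rabs x <= W * / fkm F).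
    { intros x a Hx. rewrite Rabs_mult in Hx. pose proof (fKm F a). rewrite (Rabs_right (fK F a)) in Hx by lra.
      apply Rmult_le_reg_r with (fkm F); auto. rewrite Rmult_assoc, Rinv_l, Rmult_1_r by lra. nra. }
    split; [intros a b; specialize (V7 a b); lra|]. split; [intros a b; specialize (V8 a b); lra|].
    split; [intros a b; specialize (K _ _ (V6 a b)); lra|intros a b; specialize (K _ _ (V4 a b)); rewrite Rabs_Ropp in K; lra]. }
  destruct HLb as [X [X0 HX]].
  set (Hy := X * Hs + M' * (2 * X)). assert (HHy : 0 <= Hy) by (unfold Hy; nra).
  set (Y1 := fun t a b => q t a b * vB F (ua t) a b). set (Y2 := fun t a b => q t a b * ub t a b).
  assert (HY1 : forall t, 0 <= t <= T -> holb (fth F) Hy (Y1 t)).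
  { intros t Ht. destruct (HX t Ht) as [X1 [X2 [X3 X4]]]. apply holb_mult; auto; [apply hol2_holb, Hst; auto|].
    apply holb_lipschitz; auto. apply (lipschitz_b (vB F (ua t)) (uab t)); auto. apply (CvB t Ht). }
  assert (HY2 : forall t, 0 <= t <= T -> holb (fth F) Hy (Y2 t)).
  { intros t Ht. destruct (HX t Ht) as [X1 [X2 [X3 X4]]]. apply holb_mult; auto; [apply hol2_holb, Hst; auto|].
    apply holb_lipschitz; auto. apply (lipschitz_b (ub t) (ubb t)); auto. apply (Hsol t Ht). }
  assert (Cq : CT T (fL F) (fun t => q (clamp T t))) by (apply CT_intro; try lra; auto; intros t Ht; apply Hst; auto).
  assert (CvBt : CT T (fL F) (fun t => vB F (ua (clamp T t)))) by (apply (CT_intro T (fL F) (fun t => vB F (ua t))); try lra; auto; intros t Ht; apply CvB; auto).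
  assert (Cub : CT T (fL F) (fun t => ub (clamp T t))) by (apply CT_intro; try lra; auto; intros t Ht; apply (Hsol t Ht)).
  assert (Cuaa : CT T (fL F) (fun t => uaa (clamp T t))) by (apply CT_intro; try lra; auto; intros t Ht; apply (Hsol t Ht)).
  assert (Cuab : CT T (fL F) (fun t => uab (clamp T t))) by (apply CT_intro; try lra; auto; intros t Ht; apply (Hsol t Ht)).
  assert (Cubb : CT T (fL F) (fun t => ubb (clamp T t))) by (apply CT_intro; try lra; auto; intros t Ht; apply (Hsol t Ht)).
  assert (CY1 : CT T (fL F) (fun t => Y1 (clamp T t))) by (apply (CT_mult T (fL F) (fun t => q (clamp T t)) (fun t => vB F (ua (clamp T t)))); auto; lra).
  assert (CY2 : CT T (fL F) (fun t => Y2 (clamp T t))) by (apply (CT_mult T (fL F) (fun t => q (clamp T t)) (fun t => ub (clamp T t))); auto; lra).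
  assert (TCY : forall Y, CT T (fL F) (fun t => Y (clamp T t)) -> TC T Y).
  { intros Y CY t Ht e He. destruct (CT_family_cont T (fL F) _ CY t e He) as [d [Hd Hd']]; exists d; split; auto. intros t' H1 H2 a b.
    specialize (Hd' t' H2 a b). rewrite !clamp_id in Hd' by auto. auto. }
  assert (CSY1 : forall t, 0 <= t <= T -> CS (fL F) (Y1 t)) by (intros t Ht; assert (K := CT_CS T (fL F) _ t CY1); cbv beta in K; rewrite clamp_id in K; auto).
  assert (CSY2 : forall t, 0 <= t <= T -> CS (fL F) (Y2 t)) by (intros t Ht; assert (K := CT_CS T (fL F) _ t CY2); cbv beta in K; rewrite clamp_id in K; auto).
  destruct (time_choice T (fun t k v va vb vaa vab vbb => Sol true (fL F) k (Y1 t) v va vb vaa vab vbb)) as [k1 [v [va [vb [vaa [vab [vbb Hv1]]]]]]].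
  { intros t Ht. apply (Poisson_solvable true (fL F) (fth F) Hy); auto. }
  destruct (time_choice T (fun t k v va vb vaa vab vbb => Sol false (fL F) k (Y2 t) v va vb vaa vab vbb)) as [k2 [x [xa [xb [xaa [xab [xbb Hx1]]]]]]].
  { intros t Ht. apply (Poisson_solvable false (fL F) (fth F) Hy); auto. }
  destruct (Sol_TC true (fL F) T (fth F) Hy k1 Y1 v va vb vaa vab vbb HL Hth HHy CSY1 HY1 (TCY Y1 CY1) Hv1) as [Tv [Tva [Tvb [Tvaa [Tvab [Tvbb _]]]]]].
  destruct (Sol_TC false (fL F) T (fth F) Hy k2 Y2 x xa xb xaa xab xbb HL Hth HHy CSY2 HY2 (TCY Y2 CY2) Hx1) as [Tx [Txa [Txb [Txaa [Txab [Txbb Tk]]]]]].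
  assert (CTi : forall G, (forall t, 0 <= t <= T -> CS (fL F) (G t)) -> TC T G -> CT T (fL F) (fun t => G (clamp T t))) by (intros; apply CT_intro; auto; lra).
  assert (Cva := CTi va ltac:(intros t Ht; apply (Hv1 t Ht)) Tva). assert (Cvb := CTi vb ltac:(intros t Ht; apply (Hv1 t Ht)) Tvb).
  assert (Cvaa := CTi vaa ltac:(intros t Ht; apply (Hv1 t Ht)) Tvaa). assert (Cvab := CTi vab ltac:(intros t Ht; apply (Hv1 t Ht)) Tvab).
  assert (Cvbb := CTi vbb ltac:(intros t Ht; apply (Hv1 t Ht)) Tvbb).
  assert (Cxa := CTi xa ltac:(intros t Ht; apply (Hx1 t Ht)) Txa). assert (Cxb := CTi xb ltac:(intros t Ht; apply (Hx1 t Ht)) Txb).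
  assert (Cxaa := CTi xaa ltac:(intros t Ht; apply (Hx1 t Ht)) Txaa). assert (Cxab := CTi xab ltac:(intros t Ht; apply (Hx1 t Ht)) Txab).
  assert (Cxbb := CTi xbb ltac:(intros t Ht; apply (Hx1 t Ht)) Txbb).
  assert (Ck2 : CT T (fL F) (fun t _ _ => k2 (clamp T t))) by (apply (CTi (fun t _ _ => k2 t)); auto; intros; apply CS_const).
  (* Each component is instead the right-hand side of its own Poisson problem, Dirichlet for [Y1]
     and Neumann for [Y2], and [Q] is built from first derivatives of the two solutions. Then [Q] is
     continuously differentiable although [Y1] and [Y2] are not differentiated. *)
  set (Q := fun t a b => xb (clamp T t) a b + va (clamp T t) a b).
  set (Qa := fun t a b => xab (clamp T t) a b + vaa (clamp T t) a b). set (Qb := fun t a b => xbb (clamp T t) a b + vab (clamp T t) a b).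
  (* [P] is the candidate for the time derivative of the stream function: the mixed derivatives
     cancel in [Qa - Pb = Y1] and [Pa + Qb = Y2]. The linear term restores the mean removed in the
     Neumann problem, and [P] is constant on each side for fixed time. *)
  set (P := fun t a b => xa (clamp T t) a b - vb (clamp T t) a b + k2 (clamp T t) * clamp (fL F) a).
  set (Pa := fun t a b => xaa (clamp T t) a b - vab (clamp T t) a b + k2 (clamp T t)). set (Pb := fun t a b => xab (clamp T t) a b - vbb (clamp T t) a b).
  assert (CQ : CT T (fL F) Q) by (apply CT_plus; auto). assert (CQa : CT T (fL F) Qa) by (apply CT_plus; auto). assert (CQb : CT T (fL F) Qb) by (apply CT_plus; auto).
  assert (CP : CT T (fL F) P).
  { apply (CT_plus T (fL F) (fun t a b => xa (clamp T t) a b - vb (clamp T t) a b)); [apply CT_minus; auto|].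
    apply (CT_mult T (fL F) (fun t _ _ => k2 (clamp T t)) (fun _ a _ => clamp (fL F) a)); auto; try lra.
    apply (CT_of_CS T (fL F) (fun a _ => clamp (fL F) a)). apply (C1s_linear_a (fL F)); lra. }
  assert (CPa : CT T (fL F) Pa) by (apply (CT_plus T (fL F) (fun t a b => xaa (clamp T t) a b - vab (clamp T t) a b)); auto; apply CT_minus; auto).
  assert (CPb : CT T (fL F) Pb) by (apply CT_minus; auto).
  assert (Hcl : forall t, 0 <= clamp T t <= T) by (intros; apply clamp_range; lra).
  assert (C1Q : forall t, C1s (fL F) (Q t) (Qa t) (Qb t)).
  { intros t. apply C1s_plus; [apply (Hx1 _ (Hcl t))|apply (Hv1 _ (Hcl t))]. }
  assert (C1P : forall t, C1s (fL F) (P t) (Pa t) (Pb t)).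
  { intros t. assert (K1 := C1s_minus (fL F) _ _ _ _ _ _ ltac:(lra) (proj1 (proj2 (proj1 (Hx1 _ (Hcl t))))) (proj2 (proj2 (proj1 (Hv1 _ (Hcl t)))))).
    assert (K2 := C1s_scal (fL F) (k2 (clamp T t)) _ _ _ ltac:(lra) (C1s_linear_a (fL F) ltac:(lra))).
    generalize (C1s_plus _ _ _ _ _ _ _ K1 K2). apply C1s_ext; intros; unfold P, Pa, Pb; ring. }
  assert (EY1 : forall t a b, Y1 (clamp T t) a b = Qa t a b - Pb t a b).
  { intros t a b. destruct (Hv1 _ (Hcl t)) as [_ [[_ Hk] E]]. specialize (E a b). unfold Qa, Pb. rewrite Hk in E. lra. }
  assert (EY2 : forall t a b, Y2 (clamp T t) a b = Pa t a b + Qb t a b).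
  { intros t a b. destruct (Hx1 _ (Hcl t)) as [_ [_ E]]. specialize (E a b). unfold Qb, Pa. lra. }
  assert (P0 : forall t b, P t 0 b = 0).
  { intros t b. unfold P. destruct (Hx1 _ (Hcl t)) as [_ [[Hn _] _]]. destruct (Hv1 _ (Hcl t)) as [K1 [[Hd _] _]].
    rewrite (proj1 (Hn b)), (boundary_tangential (fL F) 0 (v (clamp T t)) (va (clamp T t)) (vb (clamp T t)) 0 (proj1 K1)) by (intros; apply Hd).
    rewrite (clamp_id (fL F) 0) by lra. ring. }
  assert (PL : forall t b, P t (fL F) b = k2 (clamp T t) * fL F).
  { intros t b. unfold P. destruct (Hx1 _ (Hcl t)) as [_ [[Hn _] _]]. destruct (Hv1 _ (Hcl t)) as [K1 [[Hd _] _]].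
    rewrite (proj2 (Hn b)), (boundary_tangential (fL F) (fL F) (v (clamp T t)) (va (clamp T t)) (vb (clamp T t)) 0 (proj1 K1)) by (intros; apply Hd).
    rewrite (clamp_id (fL F) (fL F)) by lra. ring. }
  set (B := fun t => vB F (ua (clamp T t))). set (E := fun t => ub (clamp T t)).
  assert (C1B : forall t, C1s (fL F) (B t) (uaa (clamp T t)) (uab (clamp T t))) by (intros t; apply CvB; auto).
  assert (C1E : forall t, C1s (fL F) (E t) (uab (clamp T t)) (ubb (clamp T t))) by (intros t; apply (Hsol _ (Hcl t))).
  assert (cB0 : forall t, cint (B t) 0 = 2 * PI * fgam F).
  { intros t. rewrite (cint_plus (ua (clamp T t)) (fun _ _ => fgam F - cint (ua (clamp T t)) 0 / (2 * PI))); [|apply (Hsol _ (Hcl t))|apply UC_const].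
    rewrite cint_const. field. lra. }
  assert (Lap : forall t a b, uaa (clamp T t) a b + ubb (clamp T t) a b = vort F (q (clamp T t)) a b).
  { intros t a b. destruct (Hsol _ (Hcl t)) as [_ [_ K]]. rewrite K; ring. }
  (* the defect of the time-integrated equation *)
  set (Xa := fun t a b => B t a b - B 0 a b - Jt Pa (clamp T t) a b). set (Xb := fun t a b => E t a b - E 0 a b - Jt Pb (clamp T t) a b).
  (* The stream function of the defect. The linear term in [a] carries the circulation, so that the
     derivative in [a] involves [vB] and not [ua] alone. *)
  set (Xs := fun t a b => (u (clamp T t) a b + circ F (ua (clamp T t)) * clamp (fL F) a) - (u (clamp T 0) a b + circ F (ua (clamp T 0)) * clamp (fL F) a) - Jt P (clamp T t) a b).
  assert (C1X : forall t, C1s (fL F) (Xs t) (Xa t) (Xb t)).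
  { intros t.
    assert (K : forall s, C1s (fL F) (fun a b => u (clamp T s) a b + circ F (ua (clamp T s)) * clamp (fL F) a) (B s) (E s)).
    { intros s. assert (K2 := C1s_scal (fL F) (circ F (ua (clamp T s))) _ _ _ ltac:(lra) (C1s_linear_a (fL F) ltac:(lra))).
      generalize (C1s_plus _ _ _ _ _ _ _ (proj1 (proj1 (Hsol _ (Hcl s)))) K2). apply C1s_ext; intros; unfold B, E, vB; ring. }
    apply C1s_minus; [lra|apply C1s_minus; [lra|apply K|apply K]|]. apply (Jt_C1s T (fL F)); auto. apply Hcl. }
  (* For fixed [t1] the test function is the defect's own stream function [p] at time [t1]. The
     pairing [h] of its gradient with the defect at time [t] vanishes at [0], has derivative zero in
     between, and equals the squared norm of the defect at [t1]. *)
  assert (Energy : forall t1 a b, 0 <= t1 <= T -> Xa t1 a b = 0 /\ Xb t1 a b = 0).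
  { intros t1 a1 b1 Ht1. set (p := Xs t1). set (pa := Xa t1). set (pb := Xb t1). assert (Hp := C1X t1). fold p pa pb in Hp.
    assert (p0 : forall b, p 0 b = 0).
    { intros b. unfold p, Xs. rewrite (clamp_id (fL F) 0) by lra.
      destruct (Hsol _ (Hcl t1)) as [_ [[Hd1 _] _]]. destruct (Hsol _ (Hcl 0)) as [_ [[Hd2 _] _]]. rewrite (proj1 (Hd1 b)), (proj1 (Hd2 b)).
      unfold Jt. rewrite (RI_ext _ (fun _ => 0)) by auto. rewrite RI_const. ring. }
    assert (exists c1, forall b, p (fL F) b = c1) as [c1 p1].
    { exists (circ F (ua (clamp T t1)) * fL F - circ F (ua (clamp T 0)) * fL F - RInt (fun s => k2 (clamp T s) * fL F) 0 (clamp T t1)).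
      intros b. unfold p, Xs. rewrite (clamp_id (fL F) (fL F)) by lra.
      destruct (Hsol _ (Hcl t1)) as [_ [[Hd1 _] _]]. destruct (Hsol _ (Hcl 0)) as [_ [[Hd2 _] _]]. rewrite (proj2 (Hd1 b)), (proj2 (Hd2 b)).
      unfold Jt. rewrite (RI_ext _ (fun s => k2 (clamp T s) * fL F)) by auto. ring. }
    assert (Cpa : CS (fL F) pa) by apply Hp. assert (Cpb : CS (fL F) pb) by apply Hp.
    set (h := fun t => II (fL F) (fun a b => pa a b * Xa t a b) + II (fL F) (fun a b => pb a b * Xb t a b)).
    assert (CXa : forall t, CS (fL F) (Xa t)) by (intros; apply C1X). assert (CXb : forall t, CS (fL F) (Xb t)) by (intros; apply C1X).
    assert (Hcont : ctn h).
    { apply ctn_plus; apply II_ctn_family; auto; intros t e He.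
      - destruct (CT_family_cont T (fL F) B CvBt t (e / 2) ltac:(lra)) as [d1 [Hd1 D1]].
        destruct (Jt_family_cont T (fL F) Pa ltac:(lra) ltac:(lra) CPa t (e / 2) ltac:(lra)) as [d2 [Hd2 D2]].
        exists (Rmin d1 d2); split; [apply Rmin_pos; auto|]. rmin_bounds d1 d2. intros t' Ht' a b.
        specialize (D1 t' ltac:(lra) a b); specialize (D2 t' ltac:(lra) a b). unfold Xa. apply Rabs_le_between in D1, D2; apply Rabs_le_between; lra.
      - destruct (CT_family_cont T (fL F) E Cub t (e / 2) ltac:(lra)) as [d1 [Hd1 D1]].
        destruct (Jt_family_cont T (fL F) Pb ltac:(lra) ltac:(lra) CPb t (e / 2) ltac:(lra)) as [d2 [Hd2 D2]].
        exists (Rmin d1 d2); split; [apply Rmin_pos; auto|]. rmin_bounds d1 d2. intros t' Ht' a b.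
        specialize (D1 t' ltac:(lra) a b); specialize (D2 t' ltac:(lra) a b). unfold Xb. apply Rabs_le_between in D1, D2; apply Rabs_le_between; lra. }
    assert (Hder : forall t, 0 < t < T -> D h t 0).
    { intros t Ht.
      (* By Green's formula the pairing with the velocity is expressed through the vorticity alone,
         for which a time derivative is known. The total vorticity enters because [p] takes the
         value [c1] on the outer side. *)
      set (Wt := fun s => c1 * (2 * PI * fgam F + II (fL F) (vort F (q s))) - II (fL F) (fun a b => p a b * vort F (q s) a b)).
      set (Js := fun s => II (fL F) (fun a b => pa a b * Jt Pa s a b) + II (fL F) (fun a b => pb a b * Jt Pb s a b)).
      set (W0' := II (fL F) (fun a b => pa a b * B 0 a b + pb a b * E 0 a b)).
      assert (Eh : forall s, 0 <= s <= T -> h s = Wt s - W0' - Js s).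
      { intros s Hs'. assert (G := Green_stream (fL F) (2 * PI * fgam F) c1 (ua (clamp T s)) (E s) (uaa (clamp T s)) (uab (clamp T s)) (ubb (clamp T s)) (B s)
           (vort F (q (clamp T s))) p pa pb HL (C1B s) (C1E s) (Lap s) (cB0 s) Hp p0 p1). rewrite (clamp_id T s Hs') in G.
        fold (Wt s) in G. rewrite <- G. unfold h, W0', Js, Xa, Xb. rewrite (clamp_id T s Hs').
        assert (X1 : CS (fL F) (fun a b => pa a b * B s a b)) by (apply CS_mult; auto; [lra|apply C1B]).
        assert (X2 : CS (fL F) (fun a b => pb a b * E s a b)) by (apply CS_mult; auto; [lra|apply C1E]).
        assert (X3 : CS (fL F) (fun a b => pa a b * B 0 a b)) by (apply CS_mult; auto; [lra|apply C1B]).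
        assert (X4 : CS (fL F) (fun a b => pb a b * E 0 a b)) by (apply CS_mult; auto; [lra|apply C1E]).
        assert (X5 : CS (fL F) (fun a b => pa a b * Jt Pa s a b)) by (apply CS_mult; auto; [lra|apply (Jt_CS T); auto; lra]).
        assert (X6 : CS (fL F) (fun a b => pb a b * Jt Pb s a b)) by (apply CS_mult; auto; [lra|apply (Jt_CS T); auto; lra]).
        rewrite (II_ext (fL F) (fun a b => pa a b * (B s a b - B 0 a b - Jt Pa s a b)) (fun a b => (pa a b * B s a b - pa a b * B 0 a b) - pa a b * Jt Pa s a b)) by (intros; ring).
        rewrite (II_ext (fL F) (fun a b => pb a b * (E s a b - E 0 a b - Jt Pb s a b)) (fun a b => (pb a b * E s a b - pb a b * E 0 a b) - pb a b * Jt Pb s a b)) by (intros; ring).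
        rewrite (II_minus (fL F) (fun a b => pa a b * B s a b - pa a b * B 0 a b)); [|apply (CS_minus _ _ _ X1 X3)|apply X5].
        rewrite (II_minus (fL F) (fun a b => pb a b * E s a b - pb a b * E 0 a b)); [|apply (CS_minus _ _ _ X2 X4)|apply X6].
        rewrite (II_minus (fL F) (fun a b => pa a b * B s a b)); [|apply X1|apply X3].
        rewrite (II_minus (fL F) (fun a b => pb a b * E s a b)); [|apply X2|apply X4].
        rewrite !II_plus; [|apply X3|apply X4|apply X1|apply X2]. ring. }
      apply D_ext_loc with (fun s => Wt s - W0' - Js s) (Rmin t (T - t)); [apply Rmin_pos; lra| |].
      { intros s Hs'. rmin_bounds t (T - t). apply Rabs_lt_between in Hs'. symmetry; apply Eh; lra. }
      assert (D1 := weak_derivative F M T Hs V N qs q q0 u ua ub uaa uab ubb p pa pb HT HHs HV HN Hsch Hconv Hst Htm Hsol Hp t Ht).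
      (* The test function [1] shows that the total vorticity is conserved, so the outer circulation
         contributes nothing to the derivative. *)
      assert (D2 := weak_derivative F M T Hs V N qs q q0 u ua ub uaa uab ubb _ _ _ HT HHs HV HN Hsch Hconv Hst Htm Hsol (C1s_const (fL F) 1) t Ht).
      assert (D2' : D (fun s => II (fL F) (vort F (q s))) t 0).
      { apply D_ext with (fun s => II (fL F) (fun a b => 1 * vort F (q s) a b)); [intros; apply II_ext; intros; ring|].
        apply D_eq with (2 := D2). unfold flux. rewrite (II_ext _ _ (fun _ _ => 0)) by (intros; ring).
        unfold II. rewrite (RI_ext _ (fun _ => 0)) by (intros; rewrite cint_const; ring). rewrite RI_const; ring. }
      assert (D3 := II_time_derive T (fL F) pa (Jt Pa) Pa 0 T HL Cpa CPa ltac:(intros s Hs'; apply (Jt_CS T); auto; lra)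
         ltac:(intros s a b _; exact (RI_derive (fun s => Pa s a b) 0 s (CT_ctn T (fL F) Pa a b CPa))) t Ht).
      assert (D4 := II_time_derive T (fL F) pb (Jt Pb) Pb 0 T HL Cpb CPb ltac:(intros s Hs'; apply (Jt_CS T); auto; lra)
         ltac:(intros s a b _; exact (RI_derive (fun s => Pb s a b) 0 s (CT_ctn T (fL F) Pb a b CPb))) t Ht).
      assert (J0 := jacobian_zero (fL F) 0 c1 (Q t) (Qa t) (Qb t) p pa pb HL (C1Q t) Hp p0 p1).
      eapply D_eq; cycle 1.
      { unfold Wt, Js. repeat dstep; [exact D2'|exact D1|exact D3|exact D4]. }
      unfold flux.
      assert (Z1 : CS (fL F) (fun a b => pa a b * Pa t a b)) by (apply CS_mult; auto; [lra|apply C1P]).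
      assert (Z2 : CS (fL F) (fun a b => pb a b * Pb t a b)) by (apply CS_mult; auto; [lra|apply C1P]).
      assert (Z3 : CS (fL F) (fun a b => Qa t a b * pb a b - Qb t a b * pa a b)) by (apply CS_minus; apply CS_mult; auto; try lra; apply C1Q).
      rewrite (II_ext (fL F) (fun a b => q t a b * (- ub t a b * pa a b + vB F (ua t) a b * pb a b))
        (fun a b => (Qa t a b * pb a b - Qb t a b * pa a b) - (pa a b * Pa t a b + pb a b * Pb t a b))).
      - rewrite II_minus; [|apply Z3|apply (CS_plus _ _ _ Z1 Z2)]. rewrite II_plus; [|apply Z1|apply Z2]. rewrite J0. ring.
      - intros a b. specialize (EY1 t a b); specialize (EY2 t a b). rewrite clamp_id in EY1, EY2 by lra. unfold Y1, Y2 in EY1, EY2.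
        replace (q t a b * (- ub t a b * pa a b + vB F (ua t) a b * pb a b)) with (- (q t a b * ub t a b) * pa a b + q t a b * vB F (ua t) a b * pb a b) by ring.
        rewrite EY1, EY2. ring. }
    assert (h0 : h 0 = 0).
    { unfold h. rewrite (II_ext _ _ (fun _ _ => 0)), (II_ext _ (fun a b => pb a b * Xb 0 a b) (fun _ _ => 0)).
      - unfold II. rewrite (RI_ext _ (fun _ => 0)) by (intros; rewrite cint_const; ring). rewrite RI_const; ring.
      - intros a b. unfold Xb, Jt. rewrite (clamp_id T 0) by lra. rewrite RI_point. ring.
      - intros a b. unfold Xa, Jt. rewrite (clamp_id T 0) by lra. rewrite RI_point. ring. }
    assert (ht : h t1 = 0).
    { rewrite <- h0. apply zero_derivative_const; [lra|intros; apply Hcont|]. intros s Hs'; apply Hder; lra. }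
    assert (Zs : CS (fL F) (fun a b => pa a b * pa a b + pb a b * pb a b)) by (apply CS_plus; apply CS_mult; auto; lra).
    assert (Sq : pa a1 b1 * pa a1 b1 + pb a1 b1 * pb a1 b1 = 0).
    { apply (II_pos_zero (fL F) (fun a b => pa a b * pa a b + pb a b * pb a b)); auto.
      - intros a b. pose proof (Rle_0_sqr (pa a b)); pose proof (Rle_0_sqr (pb a b)); unfold Rsqr in *; lra.
      - rewrite II_plus; [exact ht|apply (CS_mult (fL F) pa pa); auto; lra|apply (CS_mult (fL F) pb pb); auto; lra]. }
    pose proof (Rle_0_sqr (pa a1 b1)); pose proof (Rle_0_sqr (pb a1 b1)); unfold Rsqr in *. split; apply Rsqr_0_uniq; unfold Rsqr; lra. }
  exists (fun t => q (clamp T t)), (fun t a b => - E t a b), (fun t a b => - uab (clamp T t) a b), (fun t a b => - ubb (clamp T t) a b), (fun t a b => - Pb t a b),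
    B, (fun t => uaa (clamp T t)), (fun t => uab (clamp T t)), Pa, Q, Qa, Qb.
  split; [|split; [|split; [|split; [|split; [|split; [|split; [|split; [|split; [|split; [|split]]]]]]]]]]; auto.
  - repeat (split; auto using CT_opp).
  - intros t. apply C1s_opp; [lra|auto].
  - intros t a b; ring.
  - intros t a b; rewrite <- Lap; ring.
  - intros t b. unfold E. destruct (Hsol _ (Hcl t)) as [K1 [[Hd _] _]].
    rewrite !(boundary_tangential (fL F) _ (u (clamp T t)) (ua (clamp T t)) (ub (clamp T t)) 0 (proj1 K1)) by (intros; apply Hd). split; ring.
  - intros t a b. specialize (EY1 t a b). unfold Y1 in EY1. unfold B. lra.
  - intros t a b. specialize (EY2 t a b). unfold Y2 in EY2. unfold E. lra.
  - intros t a b Ht.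
    assert (R1 : Rmin t (T - t) > 0) by (apply Rmin_pos; lra).
    assert (R2 := Rmin_l t (T - t)). assert (R3 := Rmin_r t (T - t)). split.
    + apply D_ext_loc with (fun s => - E 0 a b - Jt Pb s a b) (Rmin t (T - t)); [lra| |].
      * intros s Hs'. apply Rabs_lt_between in Hs'. destruct (Energy s a b ltac:(lra)) as [_ K]. unfold Xb in K. rewrite (clamp_id T s) in K by lra. lra.
      * dsplit; [exact (RI_derive (fun s => Pb s a b) 0 t (CT_ctn T (fL F) Pb a b CPb))|ring].
    + apply D_ext_loc with (fun s => B 0 a b + Jt Pa s a b) (Rmin t (T - t)); [lra| |].
      * intros s Hs'. apply Rabs_lt_between in Hs'. destruct (Energy s a b ltac:(lra)) as [K _]. unfold Xa in K. rewrite (clamp_id T s) in K by lra. lra.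
      * dsplit; [exact (RI_derive (fun s => Pa s a b) 0 t (CT_ctn T (fL F) Pa a b CPa))|ring].
  - intros a b; rewrite clamp_id by lra; auto.
Qed.

(** * Rigidity and uniqueness on the strip *)

Lemma linear_approx (g g' : R -> R) (x d l e : R) :
  (forall z, Rabs (z - x) < d -> D g z (g' z) /\ Rabs (g' z - l) <= e) ->
  forall u, Rabs (u - x) < d -> Rabs (g u - g x - l * (u - x)) <= e * Rabs (u - x).
Proof.
  intros H u Hu.
  assert (K : exists c, Rabs (c - x) < d /\ g u - g x = g' c * (u - x)).
  { apply Rabs_lt_between in Hu. destruct (Rtotal_order u x) as [Hl|[->|Hl]].
    - destruct (mean_value g g' u x Hl) as [c [Hc E]].
      + intros z Hz; apply H, Rabs_lt_between; lra.
      + intros z Hz; eapply D_cont; apply H, Rabs_lt_between; lra.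
      + exists c; split; [apply Rabs_lt_between; lra|]. lra.
    - exists x; split; [apply Rabs_lt_between; lra|ring].
    - destruct (mean_value g g' x u Hl) as [c [Hc E]].
      + intros z Hz; apply H, Rabs_lt_between; lra.
      + intros z Hz; eapply D_cont; apply H, Rabs_lt_between; lra.
      + exists c; split; [apply Rabs_lt_between; lra|]. lra. }
  destruct K as [c [Hc E]]. rewrite E. replace (g' c * (u - x) - l * (u - x)) with ((g' c - l) * (u - x)) by ring.
  rewrite Rabs_mult. apply Rmult_le_compat_r; [apply Rabs_pos|apply H; auto].
Qed.

Lemma interior_near (L a e : R) : 0 < L -> 0 <= a <= L -> 0 < e -> exists a', 0 < a' < L /\ Rabs (a' - a) < e.
Proof.
  intros HL Ha He. set (m := Rmin (e / 2) (L / 2)).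
  assert (m1 : m <= e / 2) by apply Rmin_l. assert (m2 : m <= L / 2) by apply Rmin_r. assert (0 < m) by (apply Rmin_pos; lra).
  destruct (Rle_dec a (L / 2)).
  - exists (a + m / 2); split; [lra|apply Rabs_lt_between; lra].
  - exists (a - m / 2); split; [lra|apply Rabs_lt_between; lra].
Qed.

(** Equations known only inside the strip are carried to the sides by continuity and to the clamped
    exterior by the clamping. *)
Lemma CS_zero_interior (L : R) (g : field2) : 0 < L -> CS L g -> (forall a b, 0 < a < L -> g a b = 0) -> forall a b, g a b = 0.
Proof.
  intros HL [H1 [H2 _]] H0 a b. rewrite <- H2. apply Rabs_eq_0, Rle_antisym; [|apply Rabs_pos].
  apply le_eps; intros e He. destruct (H1 e He) as [d [Hd Hd']].
  destruct (interior_near L (clamp L a) d) as [a' [Ha Ha']]; auto; [apply clamp_range; lra|].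
  specialize (Hd' (clamp L a) b a' b Ha' ltac:(rdiag)). rewrite (H0 a' b Ha) in Hd'.
  rewrite Rminus_0_l, Rabs_Ropp in Hd'. lra.
Qed.

(** The error of linear approximation is controlled by the modulus of continuity of [v], uniformly
    in [a], so the estimate survives the limit from interior points to a side. *)
Lemma D_closure (u v : field2) (L lo hi : R) : 0 < L -> UC u -> UC v ->
  (forall a s, 0 < a < L -> lo < s < hi -> D (fun y => u a y) s (v a s)) ->
  forall a s, 0 <= a <= L -> lo < s < hi -> D (fun y => u a y) s (v a s).
Proof.
  intros HL Hu Hv HD a s Ha Hs e He. destruct (Hv (e / 4) ltac:(lra)) as [d [Hd Hd']].
  set (m := Rmin d (Rmin (s - lo) (hi - s))).
  assert (Hm : 0 < m) by (repeat apply Rmin_pos; lra).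
  assert (m1 : m <= d) by apply Rmin_l. assert (m2 : m <= s - lo) by (eapply Rle_trans; [apply Rmin_r|apply Rmin_l]).
  assert (m3 : m <= hi - s) by (eapply Rle_trans; [apply Rmin_r|apply Rmin_r]).
  exists (mkposreal m Hm). intros h Hh0 Hh. assert (Ph : 0 < Rabs h) by (apply Rabs_pos_lt; auto).
  assert (K : Rabs (u a (s + h) - u a s - v a s * h) <= e / 2 * Rabs h).
  { apply le_eps; intros e1 He1. destruct (Hu (e1 / 2) ltac:(lra)) as [d1 [Hd1 Hd1']].
    destruct (interior_near L a (Rmin d d1)) as [a' [Ha' Ha'']]; auto; [apply Rmin_pos; auto|].
    rmin_bounds d d1.
    assert (Z : forall x, Rabs (x - x) < d1) by (intros; rdiag).
    assert (Z1 := Hd1' a (s + h) a' (s + h) ltac:(lra) (Z _)). assert (Z2 := Hd1' a s a' s ltac:(lra) (Z _)).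
    assert (Z3 := linear_approx (fun y => u a' y) (fun y => v a' y) s m (v a s) (e / 2)).
    assert (Z4 : Rabs (u a' (s + h) - u a' s - v a s * (s + h - s)) <= e / 2 * Rabs (s + h - s)).
    { apply Z3; [|replace (s + h - s) with h by ring; auto]. intros z Hz; split.
      - apply HD; auto. apply Rabs_lt_between in Hz; lra.
      - left; apply Rlt_trans with (e / 4); [|lra]. apply Hd'; lra. }
    replace (s + h - s) with h in Z4 by ring.
    apply Rabs_lt_between in Z1, Z2. apply Rabs_le_between in Z4. apply Rabs_le_between. lra. }
  replace ((u a (s + h) - u a s) / h - v a s) with ((u a (s + h) - u a s - v a s * h) / h) by (field; auto).
  unfold Rdiv at 1. rewrite Rabs_mult, Rabs_inv. apply Rmult_lt_reg_r with (Rabs h); auto. rewrite Rmult_assoc, Rinv_l by lra. nra.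
Qed.

Lemma II_parts_a (L : R) (p pa pb g ga gb : field2) : 0 < L -> C1s L p pa pb -> C1s L g ga gb ->
  (forall b, p 0 b * g 0 b = 0) -> (forall b, p L b * g L b = 0) ->
  II L (fun a b => p a b * ga a b) = - II L (fun a b => pa a b * g a b).
Proof.
  intros HL Hp Hg H0 H1. assert (Hm := C1s_mult L _ _ _ _ _ _ (Rlt_le _ _ HL) Hp Hg).
  assert (K := II_da L _ _ _ HL Hm). rewrite (cint_zero _ L H1), (cint_zero _ 0 H0) in K.
  destruct Hp as [p0 [p1 _]], Hg as [g0 [g1 _]]. rewrite II_plus in K; [lra|exact (proj1 (CS_mult L _ _ (Rlt_le _ _ HL) p1 g0))|exact (proj1 (CS_mult L _ _ (Rlt_le _ _ HL) p0 g1))].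
Qed.

Lemma II_parts_b (L : R) (p pa pb g ga gb : field2) : 0 < L -> C1s L p pa pb -> C1s L g ga gb ->
  II L (fun a b => p a b * gb a b) = - II L (fun a b => pb a b * g a b).
Proof.
  intros HL Hp Hg. assert (Hm := C1s_mult L _ _ _ _ _ _ (Rlt_le _ _ HL) Hp Hg).
  assert (K := II_db L _ _ _ HL Hm).
  destruct Hp as [p0 [_ [p1 _]]], Hg as [g0 [_ [g1 _]]]. rewrite II_plus in K; [lra|exact (proj1 (CS_mult L _ _ (Rlt_le _ _ HL) p1 g0))|exact (proj1 (CS_mult L _ _ (Rlt_le _ _ HL) p0 g1))].
Qed.

(** A stream function by integration across the strip: [Ea = Bb] is the condition of a closed form,
    and [E = 0] at [a = 0] removes the integration constant. No period in [b] can arise since the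
    path runs in the [a] direction only. *)
Lemma primitive_C1s (L : R) (B Ba Bb E Ea Eb : field2) : 0 < L -> C1s L B Ba Bb -> C1s L E Ea Eb ->
  (forall a b, Ea a b = Bb a b) -> (forall b, E 0 b = 0) ->
  C1s L (fun a b => RInt (fun x => B x b) 0 (clamp L a)) B E.
Proof.
  intros HL HB HE Hab H0. assert (HL' := Rlt_le _ _ HL).
  destruct (CS_bounded L B HL' (proj1 HB)) as [M [M0 BM]].
  assert (HBc := fun b => UC_ctn1 B b (proj1 (proj1 HB))).
  assert (Db : forall a b, D (fun y => RInt (fun x => B x y) 0 (clamp L a)) b (E a b)).
  { intros a b. assert (Hc := clamp_range L a HL').
    assert (K := RI_param_derive (fun y x => B x y) (fun y x => Bb x y) (b - 1) (b + 1) (clamp L a) (proj1 Hc)).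
    apply D_eq with (RInt (fun x => Bb x b) 0 (clamp L a)).
    - assert (E0 : RInt (fun x => Bb x b) 0 (clamp L a) = E (clamp L a) b - E 0 b).
      { apply (RI_ftc (fun x => E x b)); [lra|intros; apply UC_ctn1, HE|apply UC_ctn1, HB|].
        intros x Hx. rewrite <- Hab. apply HE; lra. }
      rewrite E0, H0, (proj1 (proj2 (proj1 HE))). ring.
    - apply K; [intros; apply HBc| | |lra].
      + intros e He. destruct (proj1 (proj1 (proj2 (proj2 HB))) e He) as [d [Hd Hd']]. exists d; split; auto.
      + intros; apply HB. }
  split; [|split; [apply HB|split; [apply HE|split; auto]]].
  - split; [|split].
    + destruct (CS_bounded L E HL' (proj1 HE)) as [N [N0 EN]].
      assert (Lb := lipschitz_b (fun a y => RInt (fun x => B x y) 0 (clamp L a)) E N Db EN).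
      assert (La : forall a a' b, Rabs (RInt (fun x => B x b) 0 (clamp L a) - RInt (fun x => B x b) 0 (clamp L a')) <= M * Rabs (clamp L a - clamp L a')).
      { intros a a' b. refine (lipschitz_b (fun _ y => RInt (fun x => B x b) 0 y) (fun _ y => B y b) M _ _ 0 _ _); auto.
        intros _ y; apply (RI_derive (fun x => B x b)); auto. }
      intros e He. exists (e / (M + N + 1)); split; [apply Rdiv_lt_0_compat; lra|]. intros a b a' b' Ha Hb.
      specialize (La a' a b'). specialize (Lb a b' b). pose proof (clamp_lip L a' a HL').
      apply Rle_lt_trans with (M * (e / (M + N + 1)) + N * (e / (M + N + 1))).
      * replace (RInt (fun x => B x b') 0 (clamp L a') - RInt (fun x => B x b) 0 (clamp L a)) with
          ((RInt (fun x => B x b') 0 (clamp L a') - RInt (fun x => B x b') 0 (clamp L a)) + (RInt (fun x => B x b') 0 (clamp L a) - RInt (fun x => B x b) 0 (clamp L a))) by ring.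
        eapply Rle_trans; [apply Rabs_triang|]. apply Rplus_le_compat; (eapply Rle_trans; [eassumption|]); apply Rmult_le_compat_l; lra.
      * rewrite <- Rmult_plus_distr_r. apply Rlt_le_trans with ((M + N + 1) * (e / (M + N + 1))); [|right; field; lra].
        apply Rmult_lt_compat_r; [apply Rdiv_lt_0_compat; lra|lra].
    + intros; rewrite clamp_clamp; auto.
    + intros a b. apply RI_ext; intros; apply (proj1 HB).
  - intros a b Ha. apply D_ext_loc with (fun x => RInt (fun x => B x b) 0 x) (Rmin a (L - a)); [apply Rmin_pos; lra| |apply (RI_derive (fun x => B x b)); auto].
    intros y Hy. rmin_bounds a (L - a). apply Rabs_lt_between in Hy. rewrite clamp_id; [auto|lra].
Qed.

Lemma II_zero (L : R) (g : field2) : (forall a b, g a b = 0) -> II L g = 0.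
Proof.
  intros H. unfold II. rewrite (RI_ext _ (fun _ => 0)); [rewrite RI_const; ring|]. intros; apply cint_zero; auto.
Qed.

(** The field has a stream function constant on each side; Green's formula tested with that stream
    function shows that its energy vanishes, since curl and circulation do. It serves to identify
    the reconstructed velocity at time zero with the initial data. *)
Lemma harmonic_rigidity (L : R) (A Aa Ab B Ba Bb : field2) : 0 < L -> C1s L A Aa Ab -> C1s L B Ba Bb ->
  (forall a b, Aa a b + Bb a b = 0) -> (forall a b, Ba a b - Ab a b = 0) -> dirichlet L A -> cint B 0 = 0 ->
  forall a b, A a b = 0 /\ B a b = 0.
Proof.
  intros HL HA HB Hd Hc Hb H0 a b. assert (HL' := Rlt_le _ _ HL).
  assert (HE := C1s_opp L _ _ _ HL' HA).
  assert (HE' : C1s L (fun a b => - A a b) Bb (fun a b => - Ab a b)).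
  { eapply C1s_ext; [| | |exact HE]; intros; simpl; auto. specialize (Hd a0 b0); lra. }
  assert (HX := primitive_C1s L B Ba Bb _ _ _ HL HB HE' ltac:(auto) ltac:(intros; cbv beta; rewrite (proj1 (Hb b0)); ring)).
  set (X := fun a b => RInt (fun x => B x b) 0 (clamp L a)) in *.
  assert (XL : forall b, X L b = X L 0).
  { intros b'. assert (K : Rabs (X L b' - X L 0) <= 0 * Rabs (b' - 0)).
    { apply (lipschitz_b (fun _ y => X L y) (fun _ _ => 0) 0); [|intros; rewrite Rabs_R0; lra|exact 0].
      intros _ y. assert (K := proj2 (proj2 (proj2 (proj2 HX))) L y). simpl in K. rewrite (proj2 (Hb y)), Ropp_0 in K. exact K. }
    rewrite Rmult_0_l in K. pose proof (Rabs_pos (X L b' - X L 0)). apply Rminus_diag_uniq, Rabs_eq_0; lra. }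
  assert (G := Green_stream L 0 (X L 0) B (fun a b => - A a b) Ba Bb (fun a b => - Ab a b) B (fun _ _ => 0) X B (fun a b => - A a b) HL HB HE'
    ltac:(auto) H0 HX ltac:(intros; unfold X; rewrite (clamp_id L 0) by lra; apply RI_point) XL).
  rewrite (II_zero L (fun _ _ => 0)) in G by auto. rewrite (II_zero L (fun a b => X a b * 0)) in G by (intros; ring).
  assert (S0 : B a b * B a b + - A a b * - A a b = 0).
  { apply (II_pos_zero L (fun a b => B a b * B a b + - A a b * - A a b)); auto.
    - apply CS_plus; apply CS_mult; auto; apply HB || apply HE.
    - intros x y. pose proof (Rle_0_sqr (B x y)); pose proof (Rle_0_sqr (- A x y)); unfold Rsqr in *; lra.
    - lra. }
  pose proof (Rle_0_sqr (B a b)); pose proof (Rle_0_sqr (- A a b)); unfold Rsqr in *. split; [|apply Rsqr_0_uniq; unfold Rsqr; lra].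
  rewrite <- (Ropp_involutive (A a b)). rewrite (Rsqr_0_uniq (- A a b)) by (unfold Rsqr; lra). ring.
Qed.

Lemma gronwall_zero (E E' : R -> R) (C T : R) : 0 <= T -> ctn E -> (forall t, 0 < t < T -> D E t (E' t) /\ E' t <= C * E t) ->
  (forall t, 0 <= E t) -> E 0 = 0 -> forall t, 0 <= t <= T -> E t = 0.
Proof.
  intros HT HE HD Hp H0 t Ht. destruct (Rle_lt_or_eq_dec 0 t (proj1 Ht)) as [Ht0|<-]; auto.
  assert (De : forall s, D (fun s => exp (- C * s)) s (exp (- C * s) * - C)).
  { intros s. apply (D_comp (fun s => - C * s) exp); [dsplit; ring|apply derivable_pt_lim_exp]. }
  destruct (mean_value (fun s => E s * exp (- C * s)) (fun s => E' s * exp (- C * s) + E s * (exp (- C * s) * - C)) 0 t Ht0) as [c [Hc K]].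
  - intros x Hx. apply (D_mult E (fun s => exp (- C * s))); auto. apply HD; lra.
  - intros x Hx. apply (ctn_mult E (fun s => exp (- C * s))); auto. eapply ctn_derivable; apply De.
  - rewrite H0 in K. destruct (HD c ltac:(lra)) as [_ K']. pose proof (exp_pos (- C * c)). pose proof (exp_pos (- C * t)).
    assert (E t * exp (- C * t) <= 0).
    { replace (E t * exp (- C * t)) with (E t * exp (- C * t) - 0 * exp (- C * 0)) by ring. rewrite K.
      replace ((E' c * exp (- C * c) + E c * (exp (- C * c) * - C)) * (t - 0)) with (- ((C * E c - E' c) * exp (- C * c) * t)) by ring.
      apply Rge_le, Ropp_0_le_ge_contravar. repeat apply Rmult_le_pos; lra. }
    specialize (Hp t). nra.
Qed.

Definition flat_solution (T L : R) (K Be : R -> R) (A Aa Ab At B Ba Bb Bt Q Qa Qb : field3) : Prop :=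
  (CT T L A /\ CT T L Aa /\ CT T L Ab /\ CT T L At /\ CT T L B /\ CT T L Ba /\ CT T L Bb /\ CT T L Bt) /\
  (forall t, C1s L (A t) (Aa t) (Ab t)) /\ (forall t, C1s L (B t) (Ba t) (Bb t)) /\ (forall t, C1s L (Q t) (Qa t) (Qb t)) /\
  (forall t a b, Aa t a b + Bb t a b = 0) /\ (forall t, dirichlet L (A t)) /\
  (forall t a b, At t a b = (K a * (Ba t a b - Ab t a b) + Be a) * B t a b - Qa t a b) /\
  (forall t a b, Bt t a b = - ((K a * (Ba t a b - Ab t a b) + Be a) * A t a b) - Qb t a b) /\
  (forall t a b, 0 < t < T -> D (fun s => A s a b) t (At t a b) /\ D (fun s => B s a b) t (Bt t a b)).

Lemma CT_eq_interior (T L : R) (G K : field3) : 0 < T -> CT T L G -> CT T L K ->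
  (forall t a b, 0 < t < T -> G t a b = K t a b) -> forall t a b, G t a b = K t a b.
Proof.
  intros HT HG HK H t a b. apply Rminus_diag_uniq.
  (* Time takes the place of the clamped variable, so the closure argument for the strip applies on
     [[0, T]]. *)
  assert (KS : CS T (fun s y => G s a y - K s a y)).
  { destruct (CT_minus T L G K HG HK) as [K1 [K2 [_ K4]]]. split; [|split; auto].
    intros e He; destruct (K1 e He) as [d [Hd Hd']]; exists d; split; auto. intros; apply Hd'; auto. rdiag. }
  apply (CS_zero_interior T _ HT KS). intros; rewrite H; auto; ring.
Qed.

(* With [w = (A, B)] the difference of two solutions and [S = (B^2 - A^2) / 2], the identities
   [(B_a - A_b) A = (A B)_a + S_b] and [(B_a - A_b) B = S_a - (A B)_b] move the derivatives in the
   energy balance off [w]. *)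
Lemma energy_transfer (L : R) (K K1 : R -> R) (A Aa Ab B Ba Bb A1 A1a A1b B1 B1a B1b : field2) : 0 < L ->
  C1s L (fun a _ => K a) (fun a _ => K1 a) (fun _ _ => 0) ->
  C1s L A Aa Ab -> C1s L B Ba Bb -> C1s L A1 A1a A1b -> C1s L B1 B1a B1b ->
  (forall a b, Aa a b + Bb a b = 0) -> dirichlet L A -> dirichlet L A1 ->
  II L (fun a b => K a * (Ba a b - Ab a b) * (A a b * B1 a b - B a b * A1 a b)) =
  II L (fun a b => (K1 a * A1 a b + K a * A1a a b - K a * B1b a b) * ((B a b * B a b - A a b * A a b) * / 2)
                 - (K1 a * B1 a b + K a * B1a a b + K a * A1b a b) * (A a b * B a b)).
Proof.
  intros HL HK HA HB HA1 HB1 Hd DA DA1. assert (HL' := Rlt_le _ _ HL).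
  assert (HP := C1s_mult L _ _ _ _ _ _ HL' HA HB).
  assert (HS := C1s_scal L (/ 2) _ _ _ HL' (C1s_minus L _ _ _ _ _ _ HL' (C1s_mult L _ _ _ _ _ _ HL' HB HB) (C1s_mult L _ _ _ _ _ _ HL' HA HA))).
  assert (HKA := C1s_mult L _ _ _ _ _ _ HL' HK HA1). assert (HKB := C1s_mult L _ _ _ _ _ _ HL' HK HB1).
  assert (P1 := II_parts_a L _ _ _ _ _ _ HL HKB HP ltac:(intros; cbv beta; rewrite (proj1 (DA b)); ring) ltac:(intros; cbv beta; rewrite (proj2 (DA b)); ring)).
  assert (P2 := II_parts_b L _ _ _ _ _ _ HL HKB HS).
  assert (P3 := II_parts_a L _ _ _ _ _ _ HL HKA HS ltac:(intros; cbv beta; rewrite (proj1 (DA1 b)); ring) ltac:(intros; cbv beta; rewrite (proj2 (DA1 b)); ring)).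
  assert (P4 := II_parts_b L _ _ _ _ _ _ HL HKA HP).
  destruct HP as [P0 [Pa [Pb _]]], HS as [S0 [Sa [Sb _]]], HKA as [KA0 [KAa [KAb _]]], HKB as [KB0 [KBa [KBb _]]].
  assert (M1 := CS_mult _ _ _ HL' KB0 Pa). assert (M2 := CS_mult _ _ _ HL' KB0 Sb). assert (M3 := CS_mult _ _ _ HL' KA0 Sa). assert (M4 := CS_mult _ _ _ HL' KA0 Pb).
  assert (N1 := CS_mult _ _ _ HL' KBa P0). assert (N2 := CS_mult _ _ _ HL' KBb S0). assert (N3 := CS_mult _ _ _ HL' KAa S0). assert (N4 := CS_mult _ _ _ HL' KAb P0).
  assert (Z1 := II_minus L _ _ (proj1 (CS_plus _ _ _ M1 M2)) (proj1 (CS_minus _ _ _ M3 M4))).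
  assert (Z2 := II_minus L _ _ (proj1 (CS_minus _ _ _ N3 N2)) (proj1 (CS_plus _ _ _ N1 N4))).
  cbv beta in *.
  rewrite (II_plus L _ _ (proj1 M1) (proj1 M2)), (II_minus L _ _ (proj1 M3) (proj1 M4)), P1, P2, P3, P4 in Z1.
  rewrite (II_minus L _ _ (proj1 N3) (proj1 N2)), (II_plus L _ _ (proj1 N1) (proj1 N4)) in Z2.
  etransitivity; [|etransitivity; [exact Z1|]].
  - apply II_ext. intros a b. assert (E : Bb a b = - Aa a b) by (specialize (Hd a b); lra). rewrite E. field.
  - etransitivity; [|etransitivity; [symmetry; exact Z2|]]; [ring|]. apply II_ext. intros a b. ring.
Qed.

Theorem flat_uniqueness (T L : R) (K K1 Be : R -> R) (A Aa Ab At B Ba Bb Bt Q Qa Qb A' Aa' Ab' At' B' Ba' Bb' Bt' Q' Qa' Qb' : field3) :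
  0 < L -> 0 < T -> C1s L (fun a _ => K a) (fun a _ => K1 a) (fun _ _ => 0) ->
  flat_solution T L K Be A Aa Ab At B Ba Bb Bt Q Qa Qb -> flat_solution T L K Be A' Aa' Ab' At' B' Ba' Bb' Bt' Q' Qa' Qb' ->
  (forall a b, A 0 a b = A' 0 a b /\ B 0 a b = B' 0 a b) ->
  (forall t a b, A t a b = A' t a b /\ B t a b = B' t a b) /\ forall t a b, Q' t a b - Q t a b = Q' t 0 0 - Q t 0 0.
Proof.
  intros HL HT HK [[C1 [C2 [C3 [C4 [C5 [C6 [C7 C8]]]]]]] [S1 [S2 [S3 [S4 [S5 [S6 [S7 S8]]]]]]]]
    [[C1' [C2' [C3' [C4' [C5' [C6' [C7' C8']]]]]]] [S1' [S2' [S3' [S4' [S5' [S6' [S7' S8']]]]]]]] H0.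
  assert (HL' := Rlt_le _ _ HL). assert (HT' := Rlt_le _ _ HT).
  set (dA := fun t a b => A t a b - A' t a b). set (dB := fun t a b => B t a b - B' t a b).
  assert (CA : CT T L dA) by (apply CT_minus; auto). assert (CB : CT T L dB) by (apply CT_minus; auto).
  set (G := fun t a b => 2 * (dA t a b * (At t a b - At' t a b) + dB t a b * (Bt t a b - Bt' t a b))).
  assert (CG : CT T L G) by (repeat first [assumption|apply CT_scal|apply CT_minus|apply CT_plus|apply CT_mult]).
  set (J := fun t a b => dA t a b * dA t a b + dB t a b * dB t a b).
  assert (CJ : CT T L J) by (apply CT_plus; apply CT_mult; auto).
  assert (CJ1 : forall t, CS L (fun a b => 1 * J t a b)) by (intros; apply CS_scal; auto; apply (CT_CS T); auto).
  set (E := fun t => II L (fun a b => 1 * J t a b)).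
  assert (DE : forall t, 0 < t < T -> D E t (II L (fun a b => 1 * G t a b))).
  { apply (II_time_derive T L (fun _ _ => 1) J G 0 T); auto; [apply CS_const|intros; apply (CT_CS T); auto|].
    intros t a b Ht. destruct (S8 t a b Ht) as [X1 X2], (S8' t a b Ht) as [X3 X4]. unfold J, G, dA, dB.
    dsplit; eauto. unfold G; simpl; ring. }

  destruct (CS_bounded L (fun a _ => K a) HL' (proj1 HK)) as [MK [MK0 BK]].
  destruct (CS_bounded L (fun a _ => K1 a) HL' (proj1 (proj2 HK))) as [MK1 [MK10 BK1]].
  (* These are the coefficients that the energy transfer leaves in front of quadratic expressions in
     the difference; they are bounded because the first derivatives of one solution are continuous
     up to the boundary. *)
  set (W1 := fun t a b => K1 a * A t a b + K a * Aa t a b - K a * Bb t a b).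
  set (W2 := fun t a b => K1 a * B t a b + K a * Ba t a b + K a * Ab t a b).
  assert (CK : CT T L (fun _ a _ => K a)) by (apply (CT_of_CS T L (fun a _ => K a)), HK).
  assert (CK1 : CT T L (fun _ a _ => K1 a)) by (apply (CT_of_CS T L (fun a _ => K1 a)), HK).
  assert (CW1 : CT T L W1) by (unfold W1; apply CT_minus; [apply CT_plus|]; apply CT_mult; auto).
  assert (CW2 : CT T L W2) by (unfold W2; apply CT_plus; [apply CT_plus|]; apply CT_mult; auto).
  destruct (CT_bounded T L W1 HT' HL' CW1) as [M1 [M10 BW1]]. destruct (CT_bounded T L W2 HT' HL' CW2) as [M2 [M20 BW2]].
  assert (GE : forall t, II L (fun a b => 1 * G t a b) <= (M1 + M2) * E t).
  { intros t. assert (HdA := C1s_minus L _ _ _ _ _ _ HL' (S1 t) (S1' t)). assert (HdB := C1s_minus L _ _ _ _ _ _ HL' (S2 t) (S2' t)).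
    assert (HdQ := C1s_minus L _ _ _ _ _ _ HL' (S3 t) (S3' t)).
    assert (Hdiv : forall a b, (Aa t a b - Aa' t a b) + (Bb t a b - Bb' t a b) = 0) by (intros a b; specialize (S4 t a b); specialize (S4' t a b); lra).
    assert (HdD : dirichlet L (dA t)) by (intros b; unfold dA; destruct (S5 t b) as [-> ->], (S5' t b) as [-> ->]; lra).
    assert (ET := energy_transfer L K K1 _ _ _ _ _ _ _ _ _ _ _ _ HL HK HdA HdB (S1 t) (S2 t) Hdiv HdD (S5 t)).
    assert (P1 := II_parts_a L _ _ _ _ _ _ HL HdA HdQ ltac:(intros b; change (dA t 0 b * (Q t 0 b - Q' t 0 b) = 0); rewrite (proj1 (HdD b)); ring) ltac:(intros b; change (dA t L b * (Q t L b - Q' t L b) = 0); rewrite (proj2 (HdD b)); ring)).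
    assert (P2 := II_parts_b L _ _ _ _ _ _ HL HdB HdQ).
    assert (X1 : CS L (fun a b => K a * ((Ba t a b - Ba' t a b) - (Ab t a b - Ab' t a b)) * (dA t a b * B t a b - dB t a b * A t a b))).
    { apply CS_mult; auto; [apply CS_mult; auto; [apply HK|apply CS_minus; [apply HdB|apply HdA]]|apply CS_minus; apply CS_mult; auto]; first [apply HdA|apply HdB|apply S1|apply S2]. }
    assert (X2 : CS L (fun a b => dA t a b * (Qa t a b - Qa' t a b))) by (apply CS_mult; auto; [apply HdA|apply HdQ]).
    assert (X3 : CS L (fun a b => dB t a b * (Qb t a b - Qb' t a b))) by (apply CS_mult; auto; [apply HdB|apply HdQ]).
    assert (X4 : CS L (fun a b => (Aa t a b - Aa' t a b) * (Q t a b - Q' t a b))) by (apply CS_mult; auto; [apply HdA|apply HdQ]).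
    assert (X5 : CS L (fun a b => (Bb t a b - Bb' t a b) * (Q t a b - Q' t a b))) by (apply CS_mult; auto; [apply HdB|apply HdQ]).
    assert (Z0 : II L (fun a b => dA t a b * (Qa t a b - Qa' t a b)) + II L (fun a b => dB t a b * (Qb t a b - Qb' t a b)) = 0).
    { unfold dA, dB. rewrite P1, P2. rewrite <- Ropp_plus_distr, <- II_plus; [|apply X4|apply X5].
      rewrite II_zero; [ring|]. intros a b. rewrite <- Rmult_plus_distr_r, Hdiv. ring. }
    (* In the difference of the two rotation terms, the part with a common factor [q] is orthogonal
       to the difference of the fields. Only the difference of the two [q], times the first
       solution, survives; the Coriolis terms cancel in it. *)
    rewrite (II_ext L _ (fun a b => 2 * (K a * ((Ba t a b - Ba' t a b) - (Ab t a b - Ab' t a b)) * (dA t a b * B t a b - dB t a b * A t a b)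
       - (dA t a b * (Qa t a b - Qa' t a b) + dB t a b * (Qb t a b - Qb' t a b))))).
    2: { intros a b. unfold G. rewrite S6, S6', S7, S7'. unfold dA, dB. ring. }
    rewrite II_scal by (apply (CS_minus _ _ _ X1 (CS_plus _ _ _ X2 X3))).
    rewrite (II_minus L _ _ (proj1 X1) (proj1 (CS_plus _ _ _ X2 X3))), (II_plus L _ _ (proj1 X2) (proj1 X3)), Z0.
    unfold dA, dB. rewrite ET. unfold E.
    rewrite <- II_scal by apply CJ1. rewrite Rminus_0_r.
    assert (X6 : CS L (fun a b => W1 t a b * ((dB t a b * dB t a b - dA t a b * dA t a b) * / 2) - W2 t a b * (dA t a b * dB t a b))).
    { apply CS_minus; (apply CS_mult; [auto|apply (CT_CS T); auto|]).
      - apply CS_ext with (fun a b => / 2 * (dB t a b * dB t a b - dA t a b * dA t a b)); [intros; ring|].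
        apply CS_scal; auto. apply CS_minus; apply CS_mult; auto; apply (CT_CS T); auto.
      - apply CS_mult; auto; apply (CT_CS T); auto. }
    fold W1 W2 dA dB. rewrite <- II_scal by apply X6.
    apply II_le; auto; [apply (CS_scal L 2 _ HL' X6)|apply (CS_scal L (M1 + M2) _ HL' (CJ1 t))|].
    intros a b _. unfold J. specialize (BW1 t a b); specialize (BW2 t a b). apply Rabs_le_between in BW1, BW2.
    fold (W1 t a b) (W2 t a b). set (x := dA t a b). set (y := dB t a b). change (A t a b - A' t a b) with x. change (B t a b - B' t a b) with y.
    assert (Q1 : W1 t a b * ((y * y - x * x) * / 2) <= M1 * ((x * x + y * y) * / 2)).
    { assert (0 <= (M1 - W1 t a b) * (y * y)) by (apply Rmult_le_pos; [lra|apply Rle_0_sqr]).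
      assert (0 <= (M1 + W1 t a b) * (x * x)) by (apply Rmult_le_pos; [lra|apply Rle_0_sqr]). lra. }
    assert (Q2 : - (W2 t a b * (x * y)) <= M2 * ((x * x + y * y) * / 2)).
    { assert (0 <= (M2 - W2 t a b) * ((x - y) * (x - y))) by (apply Rmult_le_pos; [lra|apply Rle_0_sqr]).
      assert (0 <= (M2 + W2 t a b) * ((x + y) * (x + y))) by (apply Rmult_le_pos; [lra|apply Rle_0_sqr]). lra. }
    lra. }
  assert (EC : ctn E).
  { exact (II_ctn_family L (fun _ _ => 1) J HL (CS_const L 1) (fun t => CT_CS T L J t CJ) (CT_family_cont T L J CJ)). }
  assert (JP : forall t a b, 0 <= J t a b) by (intros; unfold J; apply Rplus_le_le_0_compat; apply Rle_0_sqr).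
  assert (EZ : forall t, 0 <= t <= T -> E t = 0).
  { apply (gronwall_zero E (fun t => II L (fun a b => 1 * G t a b)) (M1 + M2)); auto.
    - intros t. rewrite <- (II_zero L (fun _ _ => 0)) by auto. apply II_le; auto; [apply UC_const|apply CJ1|].
      intros; rewrite Rmult_1_l; auto.
    - unfold E. apply II_zero. intros a b. unfold J, dA, dB. destruct (H0 a b) as [-> ->]. ring. }
  assert (EQ : forall t a b, A t a b = A' t a b /\ B t a b = B' t a b).
  { intros t a b. assert (Ht := clamp_range T t HT'). specialize (EZ (clamp T t) Ht).
    assert (JZ : J t a b = 0).
    { rewrite <- (proj1 (proj2 CJ)). apply (II_pos_zero L (J (clamp T t))); auto; [apply (CT_CS T); auto|].
      rewrite <- EZ. apply II_ext; intros; ring. }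
    unfold J in JZ. pose proof (Rle_0_sqr (dA t a b)); pose proof (Rle_0_sqr (dB t a b)); unfold Rsqr in *.
    assert (dA t a b = 0) by (apply Rsqr_0_uniq; unfold Rsqr; lra). assert (dB t a b = 0) by (apply Rsqr_0_uniq; unfold Rsqr; lra).
    unfold dA, dB in *; lra. }
  split; auto.
  assert (EA : forall t a b, Aa t a b = Aa' t a b /\ Ba t a b = Ba' t a b).
  { intros t. assert (Z : forall (u ua ub v va vb : field2), C1s L u ua ub -> C1s L v va vb -> (forall a b, u a b = v a b) -> forall a b, ua a b - va a b = 0).
    { intros u ua ub v va vb Hu Hv Huv. apply CS_zero_interior with L; auto; [apply CS_minus; [apply Hu|apply Hv]|].
      intros a b Ha. assert (ua a b = va a b); [|lra]. apply (uniqueness_limite (fun x => u x b) a); [apply Hu; auto|].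
      apply D_ext with (fun x => v x b); [intros; rewrite Huv; auto|apply Hv; auto]. }
    intros a b; split; apply Rminus_diag_uniq; [apply (Z _ _ _ _ _ _ (S1 t) (S1' t)); intros; apply EQ|apply (Z _ _ _ _ _ _ (S2 t) (S2' t)); intros; apply EQ]. }
  assert (EB : forall t a b, Ab t a b = Ab' t a b).
  { intros t a b. apply (uniqueness_limite (fun y => A t a y) b); [apply S1|]. apply D_ext with (fun y => A' t a y); [intros; symmetry; apply EQ|apply S1']. }
  assert (ET : forall t a b, At t a b = At' t a b).
  { apply (CT_eq_interior T L); auto. intros t a b Ht. apply (uniqueness_limite (fun y => A y a b) t); [apply S8; auto|].
    apply D_ext with (fun y => A' y a b); [intros; symmetry; apply EQ|apply S8'; auto]. }
  assert (EBt : forall t a b, Bt t a b = Bt' t a b).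
  { apply (CT_eq_interior T L); auto. intros t a b Ht. apply (uniqueness_limite (fun y => B y a b) t); [apply S8; auto|].
    apply D_ext with (fun y => B' y a b); [intros; symmetry; apply EQ|apply S8'; auto]. }
  intros t a b.
  assert (HdQ := C1s_minus L _ _ _ _ _ _ HL' (S3' t) (S3 t)).
  assert (K0 := lipschitz_C1s L 0 _ _ _ HL' HdQ).
  assert (K2 : Rabs ((Q' t a b - Q t a b) - (Q' t 0 0 - Q t 0 0)) <= 0 * (Rabs (a - 0) + Rabs (b - 0))).
  { apply K0; intros x y.
    - specialize (S6 t x y); specialize (S6' t x y). rewrite ET in S6. destruct (EQ t x y) as [E1 E2], (EA t x y) as [E3 E4]. rewrite E2, E4, EB in S6.
      right. replace (Qa' t x y - Qa t x y) with 0 by lra. apply Rabs_R0.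
    - specialize (S7 t x y); specialize (S7' t x y). rewrite EBt in S7. destruct (EQ t x y) as [E1 E2], (EA t x y) as [E3 E4]. rewrite E1, E4, EB in S7.
      right. replace (Qb' t x y - Qb t x y) with 0 by lra. apply Rabs_R0. }
  rewrite Rmult_0_l in K2. apply Rminus_diag_uniq, Rabs_eq_0. pose proof (Rabs_pos ((Q' t a b - Q t a b) - (Q' t 0 0 - Q t 0 0))). lra.
Qed.

(** * Chain rule in the plane *)

Lemma chain_rule2 (f fx fy : field2) (X Y : R -> R) (s X' Y' d : R) : 0 < d ->
  (forall x y, Rabs (x - X s) < d -> Rabs (y - Y s) < d -> D (fun z => f z y) x (fx x y) /\ D (fun z => f x z) y (fy x y)) ->
  (forall e, 0 < e -> exists d', 0 < d' /\ forall x y, Rabs (x - X s) < d' -> Rabs (y - Y s) < d' ->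
     Rabs (fx x y - fx (X s) (Y s)) <= e /\ Rabs (fy x y - fy (X s) (Y s)) <= e) ->
  D X s X' -> D Y s Y' -> D (fun u => f (X u) (Y u)) s (fx (X s) (Y s) * X' + fy (X s) (Y s) * Y').
Proof.
  intros Hd HD HC HX HY. apply derivable_pt_lim_comp_2d; auto.
  intros [e He]. destruct (HC (e / 2) ltac:(lra)) as [d' [Hd' HC']].
  assert (Hm : 0 < Rmin d d') by (apply Rmin_pos; auto). rmin_bounds d d'.
  exists (mkposreal _ Hm). simpl. intros u v Hu Hv.
  assert (Z : forall x, Rabs (x - x) < Rmin d d') by (intros; rdiag).
  assert (K1 := linear_approx (fun z => f z v) (fun z => fx z v) (X s) (Rmin d d') (fx (X s) (Y s)) (e / 2)
    ltac:(intros z Hz; split; [apply HD; lra|apply HC'; lra]) u Hu).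
  assert (K2 := linear_approx (fun z => f (X s) z) (fun z => fy (X s) z) (Y s) (Rmin d d') (fy (X s) (Y s)) (e / 2)
    ltac:(intros z Hz; specialize (Z (X s)); split; [apply HD; lra|apply HC'; lra]) v Hv). pose proof (Rmax_l (Rabs (u - X s)) (Rabs (v - Y s))). pose proof (Rmax_r (Rabs (u - X s)) (Rabs (v - Y s))).
  apply Rabs_le_between in K1, K2. apply Rabs_le_between. nra.
Qed.

Lemma D_sqr_sum (c x : R) : D (fun s => s ^ 2 + c) x (2 * x).
Proof. apply D_ext with (fun s => s * s + c); [intros; ring|]. dsplit. ring. Qed.

(** * Logarithmic polar coordinates *)

Definition logL (r1 r2 : R) : R := ln (r2 / r1).
Definition rho (r1 r2 a : R) : R := r1 * exp (clamp (logL r1 r2) a).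
Definition pull (r1 r2 T : R) (f : field3) (t a b : R) : R := f (rho r1 r2 a * cos b) (rho r1 r2 a * sin b) (clamp T t).
Definition lrad (r1 x y : R) : R := / 2 * ln (x ^ 2 + y ^ 2) - ln r1.
(** Some angle of the point, chosen without any continuity. Functions of period [2 * PI] do not see
    the choice, and near a given point it may be replaced by the smooth [branch]. *)
Definition arg (x y : R) : R := epsilon (inhabits 0) (fun s => sqrt (x ^ 2 + y ^ 2) * cos s = x /\ sqrt (x ^ 2 + y ^ 2) * sin s = y).
Definition hat (r1 : R) (G : field3) (x y t : R) : R := G t (lrad r1 x y) (arg x y).
(** The quotient of cross and scalar product is the tangent of the angle from [(x0, y0)] to
    [(x, y)]; the formula is a smooth angle wherever the scalar product is positive. *)
Definition branch (x0 y0 x y : R) : R := arg x0 y0 + atan ((x0 * y - y0 * x) * / (x0 * x + y0 * y)).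

Lemma logL_pos (r1 r2 : R) : 0 < r1 -> r1 < r2 -> 0 < logL r1 r2.
Proof.
  intros H1 H2. rewrite <- ln_1. apply ln_increasing; [lra|]. apply Rmult_lt_reg_r with r1; auto.
  unfold Rdiv. rewrite Rmult_assoc, Rinv_l; lra.
Qed.

Lemma rho_exp_L (r1 r2 : R) : 0 < r1 -> r1 < r2 -> r1 * exp (logL r1 r2) = r2.
Proof. intros H1 H2. unfold logL. rewrite exp_ln by (apply Rdiv_lt_0_compat; lra). field; lra. Qed.

Lemma rho_range (r1 r2 a : R) : 0 < r1 -> r1 < r2 -> 0 <= a <= logL r1 r2 -> r1 <= r1 * exp a <= r2.
Proof.
  intros H1 H2 [Ha Ha']. split.
  - rewrite <- (Rmult_1_r r1) at 1. apply Rmult_le_compat_l; [lra|]. rewrite <- exp_0. destruct Ha as [Ha| <-]; [left; apply exp_increasing; auto|right; auto].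
  - rewrite <- (rho_exp_L r1 r2) by auto. apply Rmult_le_compat_l; [lra|]. destruct Ha' as [Ha'| ->]; [left; apply exp_increasing; auto|right; auto].
Qed.

Lemma rho_range_strict (r1 r2 a : R) : 0 < r1 -> r1 < r2 -> 0 < a < logL r1 r2 -> r1 < r1 * exp a < r2.
Proof.
  intros H1 H2 [Ha Ha']. split.
  - rewrite <- (Rmult_1_r r1) at 1. apply Rmult_lt_compat_l; [lra|]. rewrite <- exp_0. apply exp_increasing; auto.
  - rewrite <- (rho_exp_L r1 r2) by auto. apply Rmult_lt_compat_l; [lra|]. apply exp_increasing; auto.
Qed.

Lemma polar_norm (r b : R) : (r * cos b) ^ 2 + (r * sin b) ^ 2 = r ^ 2.
Proof. assert (H := sin2_cos2 b); unfold Rsqr in H. replace ((r * cos b) ^ 2 + (r * sin b) ^ 2) with (r ^ 2 * (sin b * sin b + cos b * cos b)) by ring. rewrite H; ring. Qed.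

Lemma polar_inDbar (r1 r2 a b : R) : 0 < r1 -> r1 < r2 -> 0 <= a <= logL r1 r2 -> inDbar r1 r2 (r1 * exp a * cos b) (r1 * exp a * sin b).
Proof. intros H1 H2 Ha. unfold inDbar. rewrite polar_norm. pose proof (rho_range r1 r2 a H1 H2 Ha). split; apply pow_incr; lra. Qed.

Lemma polar_inD (r1 r2 a b : R) : 0 < r1 -> r1 < r2 -> 0 < a < logL r1 r2 -> inD r1 r2 (r1 * exp a * cos b) (r1 * exp a * sin b).
Proof. intros H1 H2 Ha. unfold inD. rewrite polar_norm. pose proof (rho_range_strict r1 r2 a H1 H2 Ha). nra. Qed.

Lemma polar_exists (x y : R) : 0 < x ^ 2 + y ^ 2 -> exists s, sqrt (x ^ 2 + y ^ 2) * cos s = x /\ sqrt (x ^ 2 + y ^ 2) * sin s = y.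
Proof.
  intros H. set (r := sqrt (x ^ 2 + y ^ 2)). assert (Hr : 0 < r) by (apply sqrt_lt_R0; auto).
  assert (Er : r * r = x ^ 2 + y ^ 2) by (apply sqrt_sqrt; lra).
  assert (Hx : -1 <= x / r <= 1).
  { assert (Rabs x <= r) by (apply Rsqr_incr_0_var; [rewrite <- Rsqr_abs; unfold Rsqr; nra|lra]). apply Rabs_le_between in H0.
    split; apply Rmult_le_reg_r with r; auto; unfold Rdiv; rewrite Rmult_assoc, Rinv_l; lra. }
  assert (E1 : 1 - Rsqr (x / r) = Rsqr (y / r)) by (unfold Rsqr; apply Rmult_eq_reg_r with (r * r); [field_simplify; nra|nra]).
  destruct (Rle_dec 0 y) as [Hy|Hy].
  - exists (acos (x / r)). rewrite cos_acos, sin_acos by auto. rewrite E1, sqrt_Rsqr by (apply Rdiv_le_0_compat; auto). split; field; lra.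
  - exists (- acos (x / r)). rewrite cos_neg, sin_neg, cos_acos, sin_acos by auto. rewrite E1.
    rewrite Rsqr_neg, sqrt_Rsqr; [split; field; lra|]. unfold Rdiv. rewrite <- Ropp_mult_distr_l_reverse. apply Rmult_le_pos; [lra|left; apply Rinv_0_lt_compat; auto].
Qed.

Lemma arg_spec (x y : R) : 0 < x ^ 2 + y ^ 2 -> sqrt (x ^ 2 + y ^ 2) * cos (arg x y) = x /\ sqrt (x ^ 2 + y ^ 2) * sin (arg x y) = y.
Proof. intros H. unfold arg. apply epsilon_spec, polar_exists; auto. Qed.

Lemma cos_one_period (s : R) : cos s = 1 -> 0 <= s <= 2 * PI -> s = 0 \/ s = 2 * PI.
Proof.
  intros H Hs. destruct (Rle_dec s PI) as [Hp|Hp].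
  - left. destruct (Req_dec s 0) as [|N]; auto. assert (K := cos_decreasing_1 0 s ltac:(lra) ltac:(lra) ltac:(lra) ltac:(lra) ltac:(lra)). rewrite cos_0 in K; lra.
  - right. destruct (Req_dec s (2 * PI)) as [|N]; auto. assert (K := cos_increasing_1 s (2 * PI) ltac:(lra) ltac:(lra) ltac:(lra) ltac:(lra) ltac:(lra)).
    rewrite cos_2PI0 in K || (replace (cos (2 * PI)) with 1 in K by (symmetry; rewrite <- (Rplus_0_l (2 * PI)), cos_2PI; apply cos_0)); lra.
Qed.

(** The difference of the angles, reduced to one period, has cosine one and is therefore [0] or
    [2 * PI]. *)
Lemma angle_unique (g : R -> R) (s u : R) : (forall b, g (b + 2 * PI) = g b) -> cos s = cos u -> sin s = sin u -> g s = g u.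
Proof.
  intros Hg Hc Hs. destruct (period_reduce (s - u)) as [k Hk].
  assert (E : cos (s - u + 2 * PI * IZR k) = 1).
  { rewrite (periodic_Z cos cos_2PI). rewrite cos_minus, Hc, Hs. pose proof (sin2_cos2 u); unfold Rsqr in *; lra. }
  rewrite <- (periodic_Z g Hg k s). destruct (cos_one_period _ E Hk) as [K|K].
  - f_equal; lra.
  - rewrite <- (Hg u). f_equal; lra.
Qed.

Lemma branch_spec (g : R -> R) (x0 y0 x y : R) : (forall b, g (b + 2 * PI) = g b) -> 0 < x0 ^ 2 + y0 ^ 2 -> 0 < x0 * x + y0 * y ->
  g (arg x y) = g (branch x0 y0 x y).
Proof.
  intros Hg H0 HM. assert (H : 0 < x ^ 2 + y ^ 2) by (assert (x <> 0 \/ y <> 0) by (destruct (Req_dec x 0) as [->|]; [right; intros ->; lra|auto]); nra).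
  destruct (arg_spec x0 y0 H0) as [C0 S0], (arg_spec x y H) as [C1 S1]. unfold branch.
  set (M := x0 * x + y0 * y) in *. set (N := x0 * y - y0 * x). set (z := N * / M).
  set (r0 := sqrt (x0 ^ 2 + y0 ^ 2)) in *. set (r := sqrt (x ^ 2 + y ^ 2)) in *.
  assert (Hr : 0 < r) by (apply sqrt_lt_R0; auto). assert (Hr0 : 0 < r0) by (apply sqrt_lt_R0; auto).
  assert (Er : r * r = x ^ 2 + y ^ 2) by (apply sqrt_sqrt; lra). assert (Er0 : r0 * r0 = x0 ^ 2 + y0 ^ 2) by (apply sqrt_sqrt; lra).
  set (c := cos (atan z)). assert (Es : sin (atan z) = z * c) by (unfold c; rewrite sin_atan, cos_atan; field; apply Rgt_not_eq, sqrt_lt_R0; pose proof (Rle_0_sqr z); lra).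
  assert (Hc : 0 < c) by (pose proof (atan_bound z); apply cos_gt_0; lra).
  assert (Ec : c * c * (1 + z * z) = 1) by (assert (K := sin2_cos2 (atan z)); unfold Rsqr in K; rewrite Es in K; fold c in K; lra).
  assert (Ez : z * M = N) by (unfold z; field; lra).
  assert (EM : c * r0 * r = M).
  { apply Rsqr_inj; [repeat apply Rmult_le_pos; lra|lra|]. unfold Rsqr.
    replace (c * r0 * r * (c * r0 * r)) with (c * c * ((r0 * r0) * (r * r))) by ring. rewrite Er, Er0.
    replace ((x0 ^ 2 + y0 ^ 2) * (x ^ 2 + y ^ 2)) with (M * M + N * N) by (unfold M, N; ring). rewrite <- Ez.
    replace (c * c * (M * M + z * M * (z * M))) with (c * c * (1 + z * z) * (M * M)) by ring. rewrite Ec; ring. }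
  apply angle_unique; auto.
  - rewrite cos_plus, Es. fold c. apply Rmult_eq_reg_l with (r * (r0 * M)); [|apply Rgt_not_eq; repeat apply Rmult_lt_0_compat; auto].
    replace (r * (r0 * M) * cos (arg x y)) with (r0 * M * x) by (rewrite <- C1 at 1; ring).
    replace (r * (r0 * M) * (cos (arg x0 y0) * c - sin (arg x0 y0) * (z * c))) with (c * r * ((r0 * cos (arg x0 y0)) * M - (r0 * sin (arg x0 y0)) * (z * M))) by ring.
    rewrite C0, S0, Ez. replace (x0 * M - y0 * N) with (x * (r0 * r0)) by (rewrite Er0; unfold M, N; ring). rewrite <- EM. ring.
  - rewrite sin_plus, Es. fold c. apply Rmult_eq_reg_l with (r * (r0 * M)); [|apply Rgt_not_eq; repeat apply Rmult_lt_0_compat; auto].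
    replace (r * (r0 * M) * sin (arg x y)) with (r0 * M * y) by (rewrite <- S1 at 1; ring).
    replace (r * (r0 * M) * (sin (arg x0 y0) * c + cos (arg x0 y0) * (z * c))) with (c * r * ((r0 * sin (arg x0 y0)) * M + (r0 * cos (arg x0 y0)) * (z * M))) by ring.
    rewrite C0, S0, Ez. replace (y0 * M + x0 * N) with (y * (r0 * r0)) by (rewrite Er0; unfold M, N; ring). rewrite <- EM. ring.
Qed.

Lemma branch_self (x y : R) : branch x y x y = arg x y.
Proof. unfold branch. replace (x * y - y * x) with 0 by ring. rewrite Rmult_0_l, atan_0. ring. Qed.

Lemma inDbar_pos (r1 r2 x y : R) : 0 < r1 -> inDbar r1 r2 x y -> 0 < x ^ 2 + y ^ 2.
Proof. intros H [H1 _]. pose proof (pow_lt r1 2 H). lra. Qed.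

Lemma inD_inDbar (r1 r2 x y : R) : inD r1 r2 x y -> inDbar r1 r2 x y.
Proof. unfold inD, inDbar; lra. Qed.

Lemma lrad_exp (r1 x y : R) : 0 < r1 -> 0 < x ^ 2 + y ^ 2 -> r1 * exp (lrad r1 x y) = sqrt (x ^ 2 + y ^ 2).
Proof.
  intros H1 H. unfold lrad, Rminus. rewrite exp_plus, exp_Ropp, exp_ln by auto. rewrite <- (Rpower_sqrt _ H). unfold Rpower. field; lra.
Qed.

Lemma ln_sqr (x : R) : 0 < x -> ln (x ^ 2) = 2 * ln x.
Proof. intros H. replace (x ^ 2) with (x * x) by ring. rewrite ln_mult by auto. ring. Qed.

Lemma logL_eq (r1 r2 : R) : 0 < r1 -> r1 < r2 -> logL r1 r2 = / 2 * ln (r2 ^ 2) - ln r1.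
Proof. intros H1 H2. unfold logL, Rdiv. rewrite ln_mult, ln_Rinv, ln_sqr by (auto; try lra; apply Rinv_0_lt_compat; auto). field. Qed.

Lemma lrad_range (r1 r2 x y : R) : 0 < r1 -> r1 < r2 -> inDbar r1 r2 x y -> 0 <= lrad r1 x y <= logL r1 r2.
Proof.
  intros H1 H2 [Ha Hb]. rewrite logL_eq by auto. assert (Hp := pow_lt r1 2 H1). unfold lrad.
  assert (K := ln_le (r1 ^ 2) (x ^ 2 + y ^ 2) Hp Ha). rewrite ln_sqr in K by auto.
  assert (K' := ln_le (x ^ 2 + y ^ 2) (r2 ^ 2) ltac:(lra) Hb). lra.
Qed.

Lemma lrad_range_strict (r1 r2 x y : R) : 0 < r1 -> r1 < r2 -> inD r1 r2 x y -> 0 < lrad r1 x y < logL r1 r2.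
Proof.
  intros H1 H2 [Ha Hb]. rewrite logL_eq by auto. assert (Hp := pow_lt r1 2 H1). unfold lrad.
  assert (K := ln_increasing (r1 ^ 2) (x ^ 2 + y ^ 2) Hp Ha). rewrite ln_sqr in K by auto.
  assert (K' := ln_increasing (x ^ 2 + y ^ 2) (r2 ^ 2) ltac:(lra) Hb). lra.
Qed.

Lemma lrad_boundary (r1 r2 x y : R) : 0 < r1 -> r1 < r2 -> onBdD r1 r2 x y -> lrad r1 x y = 0 \/ lrad r1 x y = logL r1 r2.
Proof.
  intros H1 H2 [H|H]; [left|right]; unfold lrad; rewrite H; [rewrite ln_sqr by auto; field|rewrite logL_eq by auto; auto].
Qed.

Lemma hat_pull (r1 r2 T : R) (f : field3) (x y t : R) : 0 < r1 -> r1 < r2 -> cylbar r1 r2 T x y t ->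
  hat r1 (pull r1 r2 T f) x y t = f x y t.
Proof.
  intros H1 H2 [HD Ht]. assert (Hp := inDbar_pos r1 r2 x y H1 HD). unfold hat, pull, rho.
  rewrite !clamp_id by (auto; apply lrad_range; auto). rewrite lrad_exp by auto. destruct (arg_spec x y Hp) as [-> ->]. auto.
Qed.

Lemma cont_on3_at (S : R -> R -> R -> Prop) (f : field3) (x y t e : R) : cont_on3 S f -> S x y t -> 0 < e -> exists d, 0 < d /\
  forall x' y', S x' y' t -> Rabs (x' - x) < d -> Rabs (y' - y) < d -> Rabs (f x' y' t - f x y t) < e.
Proof.
  intros H HS He. destruct (H x y t HS e He) as [d [Hd Hd']]; exists d; split; auto. intros; apply Hd'; auto. rdiag.
Qed.

Lemma cont_on3_lrad (r1 : R) (S : R -> R -> R -> Prop) : (forall x y t, S x y t -> 0 < x ^ 2 + y ^ 2) -> cont_on3 S (fun x y _ => lrad r1 x y).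
Proof.
  intros HS. apply cont_on3_minus; [apply cont_on3_mult; [apply cont_on3_const|]|apply cont_on3_const].
  apply (cont_on3_comp1 S ln (fun x y _ => x ^ 2 + y ^ 2)).
  - intros; apply (D_cont _ _ (/ (x ^ 2 + y ^ 2))), derivable_pt_lim_ln; eauto.
  - hcont.
Qed.

Lemma cont_on3_inv (S : R -> R -> R -> Prop) (g : field3) : (forall x y t, S x y t -> g x y t <> 0) -> cont_on3 S g -> cont_on3 S (fun x y t => / g x y t).
Proof. intros H. apply (cont_on3_comp1 S Rinv). intros x y t HS. apply (continuity_pt_inv (fun x => x)); [apply ctn_id|auto]. Qed.

Lemma cont_on3_branch (x0 y0 : R) (S : R -> R -> R -> Prop) : (forall x y t, S x y t -> 0 < x0 * x + y0 * y) -> cont_on3 S (fun x y _ => branch x0 y0 x y).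
Proof.
  intros HS. apply cont_on3_plus; [apply cont_on3_const|].
  apply (cont_on3_comp1 S atan (fun x y _ => (x0 * y - y0 * x) * / (x0 * x + y0 * y))).
  - intros; eapply D_cont, derivable_pt_lim_atan.
  - apply cont_on3_mult; [hcont|]. apply (cont_on3_inv S (fun x y _ => x0 * x + y0 * y)); [intros x y t K; apply Rgt_not_eq, (HS x y t K)|hcont].
Qed.

Lemma branch_domain (x0 y0 : R) : 0 < x0 ^ 2 + y0 ^ 2 -> exists d, 0 < d /\ forall x y, Rabs (x - x0) < d -> Rabs (y - y0) < d -> 0 < x0 * x + y0 * y /\ 0 < x ^ 2 + y ^ 2.
Proof.
  intros H. assert (K : cont_on3 (fun _ _ _ => True) (fun x y _ => x0 * x + y0 * y)) by hcont.
  destruct (cont_on3_at _ _ x0 y0 0 _ K I H) as [d [Hd Hd']]. exists d; split; auto. intros x y Hx Hy.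
  specialize (Hd' x y I Hx Hy). apply Rabs_lt_between in Hd'.
  assert (P : 0 < x0 * x + y0 * y) by lra. split; auto.
  assert (x <> 0 \/ y <> 0) by (destruct (Req_dec x 0) as [->|]; [right; intros ->; lra|auto]). nra.
Qed.

Lemma hat_cont (r1 r2 T : R) (G : field3) : 0 < r1 -> r1 < r2 -> CT T (logL r1 r2) G -> cont_on3 (cylbar r1 r2 T) (hat r1 G).
Proof.
  intros H1 H2 [HG [_ [_ Hp]]] x0 y0 t0 HS e He. assert (P0 := inDbar_pos _ _ _ _ H1 (proj1 HS)).
  destruct (HG e He) as [d [Hd Hd']]. destruct (branch_domain x0 y0 P0) as [d0 [Hd0 B0]].
  set (S := fun x y (t : R) => 0 < x0 * x + y0 * y /\ 0 < x ^ 2 + y ^ 2).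
  assert (S0 : S x0 y0 0) by (apply B0; rdiag).
  destruct (cont_on3_at S _ x0 y0 0 d (cont_on3_lrad r1 S ltac:(intros x y t [_ K]; exact K)) S0 Hd) as [d1 [Hd1 B1]].
  destruct (cont_on3_at S _ x0 y0 0 d (cont_on3_branch x0 y0 S ltac:(intros x y t [K _]; exact K)) S0 Hd) as [d2 [Hd2 B2]].
  exists (Rmin (Rmin d d0) (Rmin d1 d2)). split; [repeat apply Rmin_pos; auto|]. intros x y t HS' Hx Hy Ht.
  rmin_bounds (Rmin d d0) (Rmin d1 d2).
  rmin_bounds d d0. rmin_bounds d1 d2.
  assert (SS : S x y 0) by (apply B0; lra).
  unfold hat. rewrite (branch_spec (fun b => G t (lrad r1 x y) b) x0 y0 x y) by (auto; apply SS). rewrite <- (branch_self x0 y0).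
  apply Hd'; [lra|apply B1; auto; lra|apply B2; auto; lra].
Qed.

Lemma C1s_near (L : R) (u ua ub : field2) (a b : R) : C1s L u ua ub -> 0 < a < L ->
  (exists d, 0 < d /\ forall x y, Rabs (x - a) < d -> Rabs (y - b) < d -> D (fun z => u z y) x (ua x y) /\ D (fun z => u x z) y (ub x y)) /\
  (forall e, 0 < e -> exists d', 0 < d' /\ forall x y, Rabs (x - a) < d' -> Rabs (y - b) < d' -> Rabs (ua x y - ua a b) <= e /\ Rabs (ub x y - ub a b) <= e).
Proof.
  intros [_ [[Ha _] [[Hb _] [D1 D2]]]] HL. split.
  - exists (Rmin a (L - a)); split; [apply Rmin_pos; lra|]. intros x y Hx Hy. rmin_bounds a (L - a).
    apply Rabs_lt_between in Hx. split; [apply D1; lra|apply D2].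
  - intros e He. destruct (Ha e He) as [d1 [Hd1 K1]], (Hb e He) as [d2 [Hd2 K2]]. exists (Rmin d1 d2); split; [apply Rmin_pos; auto|].
    intros x y Hx Hy. rmin_bounds d1 d2. split; left; [apply K1|apply K2]; lra.
Qed.

Lemma D_lrad_x (r1 x y : R) : 0 < x ^ 2 + y ^ 2 -> D (fun s => lrad r1 s y) x (x / (x ^ 2 + y ^ 2)).
Proof.
  intros H. eapply D_eq; cycle 1.
  - apply D_minus; [apply D_scal, (D_comp (fun s => s ^ 2 + y ^ 2) ln); [apply D_sqr_sum|apply derivable_pt_lim_ln; auto]|apply D_const].
  - field. lra.
Qed.

Lemma D_lrad_y (r1 x y : R) : 0 < x ^ 2 + y ^ 2 -> D (fun s => lrad r1 x s) y (y / (x ^ 2 + y ^ 2)).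
Proof.
  intros H. apply D_ext with (fun s => lrad r1 s x); [intros; unfold lrad; rewrite Rplus_comm; auto|]. rewrite Rplus_comm. apply D_lrad_x. lra.
Qed.

Lemma D_branch (x y : R) (N M : R -> R) (s n m : R) : N s = 0 -> M s = x ^ 2 + y ^ 2 -> 0 < x ^ 2 + y ^ 2 -> D N s n -> D M s m ->
  D (fun u => arg x y + atan (N u * / M u)) s (n / (x ^ 2 + y ^ 2)).
Proof.
  intros HN HM H DN DM. eapply D_eq; cycle 1.
  - apply D_plus; [apply D_const|]. apply (D_comp (fun u => N u * / M u) atan); [|apply derivable_pt_lim_atan].
    apply D_mult; [exact DN|]. apply (D_comp M Rinv); [exact DM|]. apply is_derive_Reals. auto_derive; [|reflexivity]. rewrite HM; lra.
  - rewrite HN, HM. field_simplify; lra.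
Qed.

(** The chain rule with the gradients [(x, y) / r^2] of [lrad] and [(- y, x) / r^2] of the angle,
    after replacing [arg] by the branch based at the point itself. *)
Lemma hat_derivative (r1 r2 t : R) (G Ga Gb : field3) (x y : R) : 0 < r1 -> r1 < r2 -> inD r1 r2 x y ->
  C1s (logL r1 r2) (G t) (Ga t) (Gb t) ->
  D (fun s => hat r1 G s y t) x ((x * hat r1 Ga x y t - y * hat r1 Gb x y t) / (x ^ 2 + y ^ 2)) /\
  D (fun s => hat r1 G x s t) y ((y * hat r1 Ga x y t + x * hat r1 Gb x y t) / (x ^ 2 + y ^ 2)).
Proof.
  intros H1 H2 HD HG. assert (P0 := inDbar_pos _ _ _ _ H1 (inD_inDbar _ _ _ _ HD)).
  destruct (branch_domain x y P0) as [d0 [Hd0 B0]].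
  destruct (C1s_near _ _ _ _ (lrad r1 x y) (branch x y x y) HG (lrad_range_strict r1 r2 x y H1 H2 HD)) as [[d [Hd K1]] K2].
  assert (Per : forall a b, G t a (b + 2 * PI) = G t a b) by apply HG.
  assert (Z : forall z, Rabs (z - z) < d0) by (intros; rdiag).
  split.
  - apply D_ext_loc with (fun s => G t (lrad r1 s y) (branch x y s y)) d0; auto.
    + intros s Hs. symmetry; apply (branch_spec (fun b => G t (lrad r1 s y) b)); auto. apply B0; auto.
    + eapply D_eq; cycle 1.
      * eapply (chain_rule2 (G t) (Ga t) (Gb t) (fun s => lrad r1 s y) (fun s => branch x y s y)); eauto; [apply D_lrad_x; auto|].
        apply (D_branch x y (fun s => x * y - y * s) (fun s => x * s + y * y) x (- y) x); auto; try ring; dsplit; ring.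
      * rewrite branch_self. unfold hat. field. lra.
  - apply D_ext_loc with (fun s => G t (lrad r1 x s) (branch x y x s)) d0; auto.
    + intros s Hs. symmetry; apply (branch_spec (fun b => G t (lrad r1 x s) b)); auto. apply B0; auto.
    + eapply D_eq; cycle 1.
      * eapply (chain_rule2 (G t) (Ga t) (Gb t) (fun s => lrad r1 x s) (fun s => branch x y x s)); eauto; [apply D_lrad_y; auto|].
        apply (D_branch x y (fun s => x * s - y * x) (fun s => x * x + y * s) y x y); auto; try ring; dsplit; ring.
      * rewrite branch_self. unfold hat. field. lra.
Qed.

Lemma pull_CT (r1 r2 T : R) (f : field3) : 0 < r1 -> r1 < r2 -> 0 < T -> cont_on3 (cylbar r1 r2 T) f -> CT T (logL r1 r2) (pull r1 r2 T f).
Proof.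
  intros H1 H2 HT Hf. pose proof (logL_pos r1 r2 H1 H2).
  apply (CT_intro3 T (logL r1 r2) (fun t a b => f (r1 * exp a * cos b) (r1 * exp a * sin b) t)); try lra.
  - intros; rewrite cos_2PI, sin_2PI; auto.
  - set (S := fun t a b : R => 0 <= t <= T /\ 0 <= a <= logL r1 r2).
    assert (KX : cont_on3 S (fun t a b => r1 * exp a * cos b)).
    { apply cont_on3_mult; [apply cont_on3_mult; [apply cont_on3_const|]|].
      - apply (cont_on3_comp1 S exp (fun _ a _ => a)); [intros; eapply D_cont, derivable_pt_lim_exp|apply cont_on3_y].
      - apply (cont_on3_comp1 S cos (fun _ _ b => b)); [intros; eapply D_cont, derivable_pt_lim_cos|apply cont_on3_z]. }
    assert (KY : cont_on3 S (fun t a b => r1 * exp a * sin b)).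
    { apply cont_on3_mult; [apply cont_on3_mult; [apply cont_on3_const|]|].
      - apply (cont_on3_comp1 S exp (fun _ a _ => a)); [intros; eapply D_cont, derivable_pt_lim_exp|apply cont_on3_y].
      - apply (cont_on3_comp1 S sin (fun _ _ b => b)); [intros; eapply D_cont, derivable_pt_lim_sin|apply cont_on3_z]. }
    intros t a b HS e He.
    assert (CY : forall t a b, S t a b -> cylbar r1 r2 T (r1 * exp a * cos b) (r1 * exp a * sin b) t).
    { intros t' a' b' [K1 K2]; split; auto. apply polar_inDbar; auto. }
    destruct (Hf _ _ _ (CY t a b HS) e He) as [d [Hd K]].
    destruct (KX t a b HS d Hd) as [d1 [Hd1 K1]], (KY t a b HS d Hd) as [d2 [Hd2 K2]].
    exists (Rmin d (Rmin d1 d2)); split; [repeat apply Rmin_pos; auto|]. intros t' a' b' HS' Ht Ha Hb.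
    rmin_bounds d (Rmin d1 d2). rmin_bounds d1 d2.
    apply K; auto; [apply (K1 t' a' b'); auto; lra|apply (K2 t' a' b'); auto; lra|lra].
Qed.

Definition cartC1 (r1 r2 T : R) (f fx fy : field3) : Prop :=
  cont_on3 (cylbar r1 r2 T) f /\ cont_on3 (cylbar r1 r2 T) fx /\ cont_on3 (cylbar r1 r2 T) fy /\
  forall x y t, inD r1 r2 x y -> 0 <= t <= T -> D (fun s => f s y t) x (fx x y t) /\ D (fun s => f x s t) y (fy x y t).

Lemma inD_open (r1 r2 x y : R) : inD r1 r2 x y -> exists d, 0 < d /\ forall x' y', Rabs (x' - x) < d -> Rabs (y' - y) < d -> inD r1 r2 x' y'.
Proof.
  intros [Ha Hb]. assert (K : cont_on3 (fun _ _ _ => True) (fun x y _ => x ^ 2 + y ^ 2)) by (simpl; hcont).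
  destruct (cont_on3_at _ _ x y 0 (Rmin (x ^ 2 + y ^ 2 - r1 ^ 2) (r2 ^ 2 - (x ^ 2 + y ^ 2))) K I ltac:(apply Rmin_pos; lra)) as [d [Hd Hd']].
  exists d; split; auto. intros x' y' Hx Hy. specialize (Hd' x' y' I Hx Hy).
  rmin_bounds (x ^ 2 + y ^ 2 - r1 ^ 2) (r2 ^ 2 - (x ^ 2 + y ^ 2)).
  apply Rabs_lt_between in Hd'. unfold inD. lra.
Qed.

Lemma pull_C1s (r1 r2 T t : R) (f fx fy : field3) : 0 < r1 -> r1 < r2 -> 0 < T -> cartC1 r1 r2 T f fx fy ->
  C1s (logL r1 r2) (pull r1 r2 T f t) (pull r1 r2 T (fun x y t => x * fx x y t + y * fy x y t) t) (pull r1 r2 T (fun x y t => - y * fx x y t + x * fy x y t) t).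
Proof.
  intros H1 H2 HT [Hf [Hx [Hy HD]]]. assert (HL := logL_pos r1 r2 H1 H2). assert (Ht := clamp_range T t (Rlt_le _ _ HT)).
  assert (Ka : CT T (logL r1 r2) (pull r1 r2 T (fun x y t => x * fx x y t + y * fy x y t))) by (apply pull_CT; auto; hcont; auto).
  assert (Kb : CT T (logL r1 r2) (pull r1 r2 T (fun x y t => - y * fx x y t + x * fy x y t))) by (apply pull_CT; auto; hcont; auto).
  assert (K0 := pull_CT r1 r2 T f H1 H2 HT Hf).
  assert (Ch : forall (X Y : R -> R) s X' Y', inD r1 r2 (X s) (Y s) -> D X s X' -> D Y s Y' ->
     D (fun u => f (X u) (Y u) (clamp T t)) s (fx (X s) (Y s) (clamp T t) * X' + fy (X s) (Y s) (clamp T t) * Y')).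
  { intros X Y s X' Y' Hin DX DY. destruct (inD_open _ _ _ _ Hin) as [d [Hd Hop]].
    apply (chain_rule2 (fun x y => f x y (clamp T t)) (fun x y => fx x y (clamp T t)) (fun x y => fy x y (clamp T t)) X Y s X' Y' d); auto.
    intros e He. assert (CY : cylbar r1 r2 T (X s) (Y s) (clamp T t)) by (split; auto; apply inD_inDbar; auto).
    destruct (cont_on3_at _ _ _ _ _ e Hx CY He) as [d1 [Hd1 K1]], (cont_on3_at _ _ _ _ _ e Hy CY He) as [d2 [Hd2 K2]].
    exists (Rmin d (Rmin d1 d2)); split; [repeat apply Rmin_pos; auto|]. intros x y Hx' Hy'.
    rmin_bounds d (Rmin d1 d2). rmin_bounds d1 d2.
    assert (cylbar r1 r2 T x y (clamp T t)) by (split; auto; apply inD_inDbar, Hop; lra).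
    split; left; [apply K1|apply K2]; auto; lra. }
  split; [apply (CT_CS T); auto|]. split; [apply (CT_CS T); auto|]. split; [apply (CT_CS T); auto|]. split.
  - intros a b Ha. apply D_ext_loc with (fun a => f (r1 * exp a * cos b) (r1 * exp a * sin b) (clamp T t)) (Rmin a (logL r1 r2 - a)); [apply Rmin_pos; lra| |].
    + intros z Hz. rmin_bounds a (logL r1 r2 - a). apply Rabs_lt_between in Hz.
      unfold pull, rho. rewrite (clamp_id (logL r1 r2) z) by lra. auto.
    + eapply D_eq; cycle 1.
      * apply (Ch (fun a => r1 * exp a * cos b) (fun a => r1 * exp a * sin b)); [apply polar_inD; auto| |].
        -- apply D_ext with (fun a => (r1 * cos b) * exp a); [intros; ring|]. dsplit; [apply derivable_pt_lim_exp|reflexivity].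
        -- apply D_ext with (fun a => (r1 * sin b) * exp a); [intros; ring|]. dsplit; [apply derivable_pt_lim_exp|reflexivity].
      * unfold pull, rho. rewrite (clamp_id _ a) by lra. ring.
  - intros a b.
    assert (Kc : forall g, pull r1 r2 T g t (clamp (logL r1 r2) a) b = pull r1 r2 T g t a b) by (intros; unfold pull, rho; rewrite clamp_clamp by lra; auto).
    rewrite <- Kc. apply D_ext with (fun y => pull r1 r2 T f t (clamp (logL r1 r2) a) y); [intros; unfold pull, rho; rewrite clamp_clamp by lra; auto|].
    (* On the boundary circles no Cartesian derivative is given. The derivative along the circle is
       obtained as the limit from interior circles. *)
    apply (D_closure (pull r1 r2 T f t) (pull r1 r2 T (fun x y t => - y * fx x y t + x * fy x y t) t) (logL r1 r2) (b - 1) (b + 1)); auto; try lra.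
    + apply (CT_CS T _ _ t K0).
    + apply (CT_CS T _ _ t Kb).
    + intros x s Hxx _. unfold pull, rho. rewrite (clamp_id (logL r1 r2) x) by lra. eapply D_eq; cycle 1.
      * apply (Ch (fun s => r1 * exp x * cos s) (fun s => r1 * exp x * sin s)); [apply polar_inD; auto| |].
        -- dsplit; [apply derivable_pt_lim_cos|reflexivity].
        -- dsplit; [apply derivable_pt_lim_sin|reflexivity].
      * ring.
    + apply clamp_range; lra.
Qed.

(** * Transfer of the equations between annulus and strip; uniqueness on the annulus *)

Lemma cartC1_plus (r1 r2 T : R) (f fx fy g gx gy : field3) : cartC1 r1 r2 T f fx fy -> cartC1 r1 r2 T g gx gy ->
  cartC1 r1 r2 T (fun x y t => f x y t + g x y t) (fun x y t => fx x y t + gx x y t) (fun x y t => fy x y t + gy x y t).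
Proof.
  intros [F1 [F2 [F3 F4]]] [G1 [G2 [G3 G4]]]. repeat split; try (apply cont_on3_plus; auto);
  destruct (F4 x y t H H0), (G4 x y t H H0); dsplit; eauto.
Qed.
Arguments cartC1_plus {r1 r2 T f fx fy g gx gy}.

Lemma cartC1_minus (r1 r2 T : R) (f fx fy g gx gy : field3) : cartC1 r1 r2 T f fx fy -> cartC1 r1 r2 T g gx gy ->
  cartC1 r1 r2 T (fun x y t => f x y t - g x y t) (fun x y t => fx x y t - gx x y t) (fun x y t => fy x y t - gy x y t).
Proof.
  intros [F1 [F2 [F3 F4]]] [G1 [G2 [G3 G4]]]. repeat split; try (apply cont_on3_minus; auto);
  destruct (F4 x y t H H0), (G4 x y t H H0); dsplit; eauto.
Qed.
Arguments cartC1_minus {r1 r2 T f fx fy g gx gy}.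

Lemma cartC1_mult (r1 r2 T : R) (f fx fy g gx gy : field3) : cartC1 r1 r2 T f fx fy -> cartC1 r1 r2 T g gx gy ->
  cartC1 r1 r2 T (fun x y t => f x y t * g x y t) (fun x y t => fx x y t * g x y t + f x y t * gx x y t) (fun x y t => fy x y t * g x y t + f x y t * gy x y t).
Proof.
  intros [F1 [F2 [F3 F4]]] [G1 [G2 [G3 G4]]]. repeat split; try (try apply cont_on3_plus; apply cont_on3_mult; auto);
  destruct (F4 x y t H H0), (G4 x y t H H0).
  - apply (D_mult (fun s => f s y t) (fun s => g s y t)); auto.
  - apply (D_mult (fun s => f x s t) (fun s => g x s t)); auto.
Qed.
Arguments cartC1_mult {r1 r2 T f fx fy g gx gy}.

Lemma cartC1_const (r1 r2 T c : R) : cartC1 r1 r2 T (fun _ _ _ => c) (fun _ _ _ => 0) (fun _ _ _ => 0).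
Proof. repeat split; try apply cont_on3_const; apply D_const. Qed.

Lemma cartC1_x (r1 r2 T : R) : cartC1 r1 r2 T (fun x _ _ => x) (fun _ _ _ => 1) (fun _ _ _ => 0).
Proof. repeat split; try apply cont_on3_const; [apply cont_on3_x|apply D_id|apply D_const]. Qed.

Lemma cartC1_y (r1 r2 T : R) : cartC1 r1 r2 T (fun _ y _ => y) (fun _ _ _ => 0) (fun _ _ _ => 1).
Proof. repeat split; try apply cont_on3_const; [apply cont_on3_y|apply D_const|apply D_id]. Qed.

Lemma D_Rinv (x : R) : x <> 0 -> D Rinv x (- / (x * x)).
Proof. intros H. apply is_derive_Reals. auto_derive; auto. field; auto. Qed.

Lemma cartC1_inv (r1 r2 T : R) (g gx gy : field3) : (forall x y t, cylbar r1 r2 T x y t -> g x y t <> 0) -> cartC1 r1 r2 T g gx gy ->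
  cartC1 r1 r2 T (fun x y t => / g x y t) (fun x y t => - / (g x y t * g x y t) * gx x y t) (fun x y t => - / (g x y t * g x y t) * gy x y t).
Proof.
  intros H [G1 [G2 [G3 G4]]].
  assert (K : cont_on3 (cylbar r1 r2 T) (fun x y t => - / (g x y t * g x y t))).
  { apply cont_on3_opp. apply (cont_on3_inv (cylbar r1 r2 T) (fun x y t => g x y t * g x y t)); [|apply cont_on3_mult; auto]. intros x y t Hc; specialize (H x y t Hc). apply Rmult_integral_contrapositive; auto. }
  split; [apply (cont_on3_inv (cylbar r1 r2 T)); auto|]. split; [apply cont_on3_mult; auto|]. split; [apply cont_on3_mult; auto|].
  intros x y t Hin Ht. destruct (G4 x y t Hin Ht). assert (N : g x y t <> 0) by (apply H; split; auto; apply inD_inDbar; auto).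
  split; [apply (D_comp (fun s => g s y t) Rinv)|apply (D_comp (fun s => g x s t) Rinv)]; auto; apply D_Rinv; auto.
Qed.
Arguments cartC1_inv {r1 r2 T g gx gy}.

(** This is [alpha / r^2] at radius [rho]. It equals a quarter of [r^2 + 2 + r^(-2)], which explains
    the form of the derivative [kap'], as [rho] is its own derivative in [a] inside the strip. *)
Definition kap (r1 r2 a : R) : R := (1 + rho r1 r2 a ^ 2) ^ 2 / (4 * rho r1 r2 a ^ 2).
Definition kap' (r1 r2 a : R) : R := (rho r1 r2 a ^ 2 - / rho r1 r2 a ^ 2) / 2.
Definition bet (r1 r2 om a : R) : R := 2 * om * (1 - rho r1 r2 a ^ 2) / (1 + rho r1 r2 a ^ 2).

Lemma rho_pos (r1 r2 a : R) : 0 < r1 -> 0 < rho r1 r2 a.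
Proof. intros; apply Rmult_lt_0_compat; auto; apply exp_pos. Qed.

Lemma kap_C1s (r1 r2 : R) : 0 < r1 -> r1 < r2 -> C1s (logL r1 r2) (fun a _ => kap r1 r2 a) (fun a _ => kap' r1 r2 a) (fun _ _ => 0).
Proof.
  intros H1 H2. assert (HL := logL_pos r1 r2 H1 H2).
  assert (N : forall x, r1 * exp x <> 0) by (intros; apply Rgt_not_eq, Rmult_lt_0_compat; auto; apply exp_pos).
  apply (C1s_of_a (logL r1 r2) (fun a => (1 + (r1 * exp a) ^ 2) ^ 2 / (4 * (r1 * exp a) ^ 2)) (fun a => ((r1 * exp a) ^ 2 - / (r1 * exp a) ^ 2) / 2)); [lra| |].
  - intros x _. apply is_derive_Reals. auto_derive.
    + repeat split; auto. apply Rmult_integral_contrapositive; split; [lra|]. rewrite Rmult_1_r. apply Rmult_integral_contrapositive; auto.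
    + field. repeat split; try lra; apply Rgt_not_eq, exp_pos.
  - intros x _. eapply D_cont. apply is_derive_Reals. auto_derive; [|reflexivity].
    repeat split; auto.
Qed.

Lemma bet_CS (r1 r2 om : R) : 0 < r1 -> r1 < r2 -> CS (logL r1 r2) (fun a _ => bet r1 r2 om a).
Proof.
  intros H1 H2. assert (HL := logL_pos r1 r2 H1 H2).
  apply (CS_of_a (logL r1 r2) (fun a => 2 * om * (1 - (r1 * exp a) ^ 2) / (1 + (r1 * exp a) ^ 2))); [lra|].
  intros x _. eapply D_cont. apply is_derive_Reals. auto_derive; [|reflexivity]. repeat split. pose proof (pow2_ge_0 (r1 * exp x)). lra.
Qed.

(** The inequality [(1 + s)^2 >= 4 * s] with [s] the squared radius; it provides the lower bound
    [fkm = 1]. *)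
Lemma kap_lower (r1 r2 a : R) : 0 < r1 -> 1 <= kap r1 r2 a.
Proof.
  intros H. assert (K := rho_pos r1 r2 a H). unfold kap. assert (P : 0 < rho r1 r2 a ^ 2) by (apply pow_lt; auto).
  apply Rmult_le_reg_r with (4 * rho r1 r2 a ^ 2); [lra|]. unfold Rdiv. rewrite Rmult_assoc, Rinv_l by lra.
  pose proof (pow2_ge_0 (1 - rho r1 r2 a ^ 2)). nra.
Qed.

Lemma normal_radial (r1 r2 x y U V : R) : 0 < r1 -> r1 < r2 ->
  (U * normal_x r1 r2 x y + V * normal_y r1 r2 x y = 0 <-> x * U + y * V = 0).
Proof.
  intros H1 H2. unfold normal_x, normal_y. destruct Req_EM_T as [E|E].
  - replace (U * (x / r2) + V * (y / r2)) with ((x * U + y * V) / r2) by lra. split; intros H.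
    + apply Rmult_eq_reg_r with (/ r2); [unfold Rdiv in H; lra|apply Rinv_neq_0_compat; lra].
    + rewrite H; unfold Rdiv; ring.
  - replace (U * (- x / r1) + V * (- y / r1)) with (- (x * U + y * V) / r1) by lra. split; intros H.
    + apply Ropp_eq_reg. rewrite Ropp_0. apply Rmult_eq_reg_r with (/ r1); [unfold Rdiv in H; lra|apply Rinv_neq_0_compat; lra].
    + rewrite H; unfold Rdiv; ring.
Qed.

Lemma cont_of_cartC1 (r1 r2 T : R) (f fx fy : field3) : cartC1 r1 r2 T f fx fy ->
  cont_on3 (cylbar r1 r2 T) f /\ cont_on3 (cylbar r1 r2 T) fx /\ cont_on3 (cylbar r1 r2 T) fy.
Proof. intros [A [B [C _]]]; auto. Qed.

(* The covariant components [A = x U + y V], [B = x V - y U] and the Bernoulli function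
   [Q = P + alpha |U|^2 / 2] turn the equations into [A_t = q B - Q_a], [B_t = - q A - Q_b]. *)
Lemma solution_flat (r1 r2 om T : R) (U0 V0 : field2) (U V P : field3) : 0 < r1 -> r1 < r2 -> 0 < T ->
  is_solution r1 r2 om T U0 V0 U V P ->
  exists Aa Ab At Ba Bb Bt Qa Qb, flat_solution T (logL r1 r2) (kap r1 r2) (bet r1 r2 om)
    (pull r1 r2 T (fun x y t => x * U x y t + y * V x y t)) Aa Ab At (pull r1 r2 T (fun x y t => x * V x y t - y * U x y t)) Ba Bb Bt
    (pull r1 r2 T (fun x y t => P x y t + (1 + x * x + y * y) * (1 + x * x + y * y) * / 8 * (U x y t * U x y t + V x y t * V x y t))) Qa Qb.
Proof.
  intros H1 H2 HT [CU [CV [CP [Ux [Uy [Ut [Vx [Vy [Vt [Px [Py [CUx [CUy [CUt [CVx [CVy [CVt [CPx [CPy [HD [HDt [HE [HN HI]]]]]]]]]]]]]]]]]]]]]]].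
  assert (HL := logL_pos r1 r2 H1 H2).
  assert (KU : cartC1 r1 r2 T U Ux Uy) by (repeat split; auto; apply HD; auto).
  assert (KV : cartC1 r1 r2 T V Vx Vy) by (repeat split; auto; apply HD; auto).
  assert (KP : cartC1 r1 r2 T P Px Py) by (repeat split; auto; apply HD; auto).
  assert (KX := cartC1_x r1 r2 T). assert (KY := cartC1_y r1 r2 T).
  assert (KA := cartC1_plus (cartC1_mult KX KU) (cartC1_mult KY KV)).
  assert (KB := cartC1_minus (cartC1_mult KX KV) (cartC1_mult KY KU)).
  assert (K2 := cartC1_plus (cartC1_plus (cartC1_const r1 r2 T 1) (cartC1_mult KX KX)) (cartC1_mult KY KY)).
  (* The factor [1 / 8] is the [1 / 4] in [alpha] times the [1 / 2] of the Bernoulli term. *)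
  assert (KQ := cartC1_plus KP (cartC1_mult
    (cartC1_mult (cartC1_mult K2 K2) (cartC1_const r1 r2 T (/ 8)))
    (cartC1_plus (cartC1_mult KU KU) (cartC1_mult KV KV)))).
  assert (SA := fun t => pull_C1s r1 r2 T t _ _ _ H1 H2 HT KA). assert (SB := fun t => pull_C1s r1 r2 T t _ _ _ H1 H2 HT KB).
  assert (SQ := fun t => pull_C1s r1 r2 T t _ _ _ H1 H2 HT KQ).
  assert (PC : forall f, cont_on3 (cylbar r1 r2 T) f -> CT T (logL r1 r2) (pull r1 r2 T f)) by (intros; apply pull_CT; auto).
  destruct (cont_of_cartC1 _ _ _ _ _ _ KA) as [KA0 [KA1 KA2]], (cont_of_cartC1 _ _ _ _ _ _ KB) as [KB0 [KB1 KB2]], (cont_of_cartC1 _ _ _ _ _ _ KQ) as [KQ0 [KQ1 KQ2]].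
  assert (KAt : cont_on3 (cylbar r1 r2 T) (fun x y t => x * Ut x y t + y * Vt x y t)) by (hcont; auto).
  assert (KBt : cont_on3 (cylbar r1 r2 T) (fun x y t => x * Vt x y t - y * Ut x y t)) by (hcont; auto).
  assert (KAa : cont_on3 (cylbar r1 r2 T) (fun x y t => x * (1 * U x y t + x * Ux x y t + (0 * V x y t + y * Vx x y t)) + y * (0 * U x y t + x * Uy x y t + (1 * V x y t + y * Vy x y t)))) by (hcont; auto).
  assert (KAb : cont_on3 (cylbar r1 r2 T) (fun x y t => - y * (1 * U x y t + x * Ux x y t + (0 * V x y t + y * Vx x y t)) + x * (0 * U x y t + x * Uy x y t + (1 * V x y t + y * Vy x y t)))) by (hcont; auto).
  assert (KBa : cont_on3 (cylbar r1 r2 T) (fun x y t => x * (1 * V x y t + x * Vx x y t - (0 * U x y t + y * Ux x y t)) + y * (0 * V x y t + x * Vy x y t - (1 * U x y t + y * Uy x y t)))) by (hcont; auto).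
  assert (KBb : cont_on3 (cylbar r1 r2 T) (fun x y t => - y * (1 * V x y t + x * Vx x y t - (0 * U x y t + y * Ux x y t)) + x * (0 * V x y t + x * Vy x y t - (1 * U x y t + y * Uy x y t)))) by (hcont; auto).
  assert (CK := CT_of_CS T _ _ (proj1 (kap_C1s r1 r2 H1 H2))). assert (CB := CT_of_CS T _ _ (bet_CS r1 r2 om H1 H2)).
  match type of SQ with forall t, C1s _ _ (?qa t) (?qb t) => set (Qa := qa) in *; set (Qb := qb) in * end.
  apply PC in KA0, KAa, KAb, KAt, KB0, KBa, KBb, KBt.
  assert (SqA : forall t, CS (logL r1 r2) (Qa t)) by (intros; apply SQ). assert (SqB : forall t, CS (logL r1 r2) (Qb t)) by (intros; apply SQ).
  assert (Int : forall t a b, 0 < a < logL r1 r2 -> let x := rho r1 r2 a * cos b in let y := rho r1 r2 a * sin b in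
     inD r1 r2 x y /\ x ^ 2 + y ^ 2 = rho r1 r2 a ^ 2 /\ 0 <= clamp T t <= T).
  { intros t a b Ha x y. split; [|split; [apply polar_norm|apply clamp_range; lra]]. unfold x, y, rho. rewrite clamp_id by lra. apply polar_inD; auto. }
  eexists _, _, (pull r1 r2 T (fun x y t => x * Ut x y t + y * Vt x y t)), _, _, (pull r1 r2 T (fun x y t => x * Vt x y t - y * Ut x y t)), Qa, Qb.
  split; [exact (conj KA0 (conj KAa (conj KAb (conj KAt (conj KB0 (conj KBa (conj KBb KBt)))))))|].
  split; [exact SA|]. split; [exact SB|]. split; [exact SQ|].
  assert (HL' := Rlt_le _ _ HL). assert (HT' := Rlt_le _ _ HT).
  split; [|split; [|split; [|split]]].
  (* The Cartesian equations hold in the open annulus only, so this identity and the two momentum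
     equations are verified for interior [a] and extended by continuity. *)
  - intros t. apply CS_zero_interior with (logL r1 r2); auto; [exact (CT_CS T _ _ t (CT_plus T _ _ _ KAa KBb))|].
    intros a b Ha. destruct (Int t a b Ha) as [K1 [K3 K4]]. destruct (HE _ _ _ K1 K4) as [_ [_ E]]. unfold pull.
    set (x := rho r1 r2 a * cos b) in *. set (y := rho r1 r2 a * sin b) in *.
    replace (Vy x y (clamp T t)) with (- Ux x y (clamp T t)) by lra. ring.
  - intros t b. assert (Ht := clamp_range T t HT'). split; unfold pull; apply (normal_radial r1 r2); auto; apply HN; auto; [left|right]; rewrite polar_norm; unfold rho; rewrite clamp_id by lra.
    + rewrite exp_0; ring.
    + rewrite rho_exp_L by auto; auto.
  - intros t a b. apply Rminus_diag_uniq. revert a b. apply CS_zero_interior with (logL r1 r2); auto.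
    + apply CS_minus; [apply (CT_CS T); auto|apply CS_minus; auto]. exact (CT_CS T _ _ t (CT_mult T _ _ _ HT' HL' (CT_plus _ _ _ _ (CT_mult _ _ _ _ HT' HL' CK (CT_minus _ _ _ _ KBa KAb)) CB) KB0)).
    + intros a b Ha. destruct (Int t a b Ha) as [K1 [K3 K4]]. destruct (HE _ _ _ K1 K4) as [E1 [E2 E3]].
      assert (Hr := rho_pos r1 r2 a H1).
      unfold kap, bet, Qa, pull, alpha, alpha_x, alpha_y, beta, J_x, J_y in *. rewrite <- K3 in *.
      set (x := rho r1 r2 a * cos b) in *. set (y := rho r1 r2 a * sin b) in *. set (s := clamp T t) in *.
      replace (Px x y s) with (- (- Px x y s)) by ring. replace (Py x y s) with (- (- Py x y s)) by ring. rewrite <- E1, <- E2.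
      replace (Vy x y s) with (- Ux x y s) by lra. field. split; nra.
  - intros t a b. apply Rminus_diag_uniq. revert a b. apply CS_zero_interior with (logL r1 r2); auto.
    + apply CS_minus; [apply (CT_CS T); auto|apply CS_minus; auto]. exact (CT_CS T _ _ t (CT_opp T _ _ (CT_mult T _ _ _ HT' HL' (CT_plus _ _ _ _ (CT_mult _ _ _ _ HT' HL' CK (CT_minus _ _ _ _ KBa KAb)) CB) KA0))).
    + intros a b Ha. destruct (Int t a b Ha) as [K1 [K3 K4]]. destruct (HE _ _ _ K1 K4) as [E1 [E2 E3]].
      assert (Hr := rho_pos r1 r2 a H1).
      unfold kap, bet, Qb, pull, alpha, alpha_x, alpha_y, beta, J_x, J_y in *. rewrite <- K3 in *.
      set (x := rho r1 r2 a * cos b) in *. set (y := rho r1 r2 a * sin b) in *. set (s := clamp T t) in *.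
      replace (Px x y s) with (- (- Px x y s)) by ring. replace (Py x y s) with (- (- Py x y s)) by ring. rewrite <- E1, <- E2.
      replace (Vy x y s) with (- Ux x y s) by lra. field. split; nra.
  - assert (Kcl : forall g t a b, pull r1 r2 T g t a b = pull r1 r2 T g t (clamp (logL r1 r2) a) b) by (intros; unfold pull, rho; rewrite clamp_clamp by lra; auto).
    assert (Loc : forall f ft, (forall x y t, inD r1 r2 x y -> 0 < t < T -> D (fun s => f x y s) t (ft x y t)) ->
       CT T (logL r1 r2) (pull r1 r2 T f) -> CT T (logL r1 r2) (pull r1 r2 T ft) ->
       forall t a b, 0 < t < T -> D (fun s => pull r1 r2 T f s a b) t (pull r1 r2 T ft t a b)).
    { intros f ft Hf Cf Cft t a b Ht. rewrite Kcl. apply D_ext with (fun s => pull r1 r2 T f s (clamp (logL r1 r2) a) b); [intros; symmetry; apply Kcl|].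
      (* Time derivatives are given at interior points only and are extended to the boundary circles
         in the same way as derivatives along circles. *)
      apply (D_closure (fun a s => pull r1 r2 T f s a b) (fun a s => pull r1 r2 T ft s a b) (logL r1 r2) 0 T); auto; [apply (CT_slice T _ _ b Cf)|apply (CT_slice T _ _ b Cft)| |apply clamp_range; auto].
      intros a' s Ha Hs. apply D_ext_loc with (fun s => f (rho r1 r2 a' * cos b) (rho r1 r2 a' * sin b) s) (Rmin s (T - s)); [apply Rmin_pos; lra| |].
      - intros z Hz. rmin_bounds s (T - s). apply Rabs_lt_between in Hz. unfold pull. rewrite (clamp_id T z) by lra. auto.
      - unfold pull. rewrite (clamp_id T s) by lra. apply Hf; auto. apply (Int s a' b); auto. }
    intros t a b Ht. split; apply (Loc (fun x y t => _) (fun x y t => _)); auto; intros x y s Hin Hs; destruct (HDt x y s Hin Hs); dsplit; eauto.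
Qed.

Lemma cartesian_uniqueness (r1 r2 om T : R) (U0 V0 : field2) (U V P U' V' P' : field3) : 0 < r1 -> r1 < r2 -> 0 < T ->
  is_solution r1 r2 om T U0 V0 U V P -> is_solution r1 r2 om T U0 V0 U' V' P' ->
  (forall x y t, cylbar r1 r2 T x y t -> U' x y t = U x y t /\ V' x y t = V x y t) /\
  exists c : R -> R, forall x y t, cylbar r1 r2 T x y t -> P' x y t = P x y t + c t.
Proof.
  intros H1 H2 HT S S'. assert (HL := logL_pos r1 r2 H1 H2).
  destruct (solution_flat r1 r2 om T U0 V0 U V P H1 H2 HT S) as [Aa [Ab [At [Ba [Bb [Bt [Qa [Qb F]]]]]]]].
  destruct (solution_flat r1 r2 om T U0 V0 U' V' P' H1 H2 HT S') as [Aa' [Ab' [At' [Ba' [Bb' [Bt' [Qa' [Qb' F']]]]]]]].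
  assert (I0 : forall x y, inDbar r1 r2 x y -> U x y 0 = U' x y 0 /\ V x y 0 = V' x y 0).
  { intros x y Hin. destruct S as [_ [_ [_ [? [? [? [? [? [? [? [? [_ [_ [_ [_ [_ [_ [_ [_ [_ [_ [_ [_ HI]]]]]]]]]]]]]]]]]]]]]]].
    destruct S' as [_ [_ [_ [? [? [? [? [? [? [? [? [_ [_ [_ [_ [_ [_ [_ [_ [_ [_ [_ [_ HI']]]]]]]]]]]]]]]]]]]]]]].
    destruct (HI x y Hin) as [-> ->], (HI' x y Hin) as [-> ->]. auto. }
  destruct (flat_uniqueness T (logL r1 r2) _ _ _ _ _ _ _ _ _ _ _ _ _ _ _ _ _ _ _ _ _ _ _ _ _ HL HT (kap_C1s r1 r2 H1 H2) F F') as [EQ EP].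
  { intros a b. unfold pull. rewrite clamp_id by lra.
    destruct (I0 (rho r1 r2 a * cos b) (rho r1 r2 a * sin b)) as [-> ->]; auto. apply polar_inDbar; auto. apply clamp_range; lra. }
  assert (EU : forall x y t, cylbar r1 r2 T x y t -> U' x y t = U x y t /\ V' x y t = V x y t).
  { intros x y t HC. destruct (EQ t (lrad r1 x y) (arg x y)) as [EA EB].
    assert (HP := fun f => hat_pull r1 r2 T f x y t H1 H2 HC). unfold hat in HP. rewrite !HP in EA, EB.
    assert (Hp := inDbar_pos _ _ _ _ H1 (proj1 HC)).
    (* The velocity is recovered from its covariant components by [r^2 U = x A - y B] and
       [r^2 V = y A + x B]. *)
    split; apply Rmult_eq_reg_l with (x ^ 2 + y ^ 2); try lra.
    - replace ((x ^ 2 + y ^ 2) * U' x y t) with (x * (x * U' x y t + y * V' x y t) - y * (x * V' x y t - y * U' x y t)) by ring. rewrite <- EA, <- EB. ring.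
    - replace ((x ^ 2 + y ^ 2) * V' x y t) with (y * (x * U' x y t + y * V' x y t) + x * (x * V' x y t - y * U' x y t)) by ring. rewrite <- EA, <- EB. ring. }
  split; auto. match type of EP with forall t a b, ?q' t a b - ?q t a b = _ => exists (fun t => q' t 0 0 - q t 0 0) end.
  intros x y t HC. assert (E := EP t (lrad r1 x y) (arg x y)).
  assert (HP := fun f => hat_pull r1 r2 T f x y t H1 H2 HC). unfold hat in HP. rewrite !HP in E. destruct (EU x y t HC) as [E1 E2]. rewrite E1, E2 in E. lra.
Qed.

(** * Hoelder initial data and existence on the annulus *)

Lemma holder_pw (S : R -> R -> Prop) (th : R) (f : field2) : 0 < th -> holder_on2 S th f ->
  exists C, 0 <= C /\ forall x y x' y', S x y -> S x' y' -> Rabs (f x' y' - f x y) <= C * pw (Rabs (x' - x) + Rabs (y' - y)) th.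
Proof.
  intros Hth [C HC]. exists (Rabs C). split; [apply Rabs_pos|]. intros x y x' y' HS HS'.
  assert (P1 := Rabs_pos (x' - x)). assert (P2 := Rabs_pos (y' - y)).
  (* Coinciding points are treated apart: there [Rpower] gives the value [1] and the hypothesis no
     information, while the required bound with [pw] holds because the difference is zero. *)
  destruct (Req_dec (Rabs (x' - x) + Rabs (y' - y)) 0) as [E|E].
  - assert (E1 : x' = x) by (apply Rminus_diag_uniq, Rabs_eq_0; lra). assert (E2 : y' = y) by (apply Rminus_diag_uniq, Rabs_eq_0; lra).
    subst. rewrite !Rminus_diag, Rabs_R0. apply Rmult_le_pos; [apply Rabs_pos|apply pw_nonneg].
  - eapply Rle_trans; [apply HC; auto|].
    set (s := sqrt ((x' - x) ^ 2 + (y' - y) ^ 2)).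
    assert (Q : 0 < (x' - x) ^ 2 + (y' - y) ^ 2).
    { assert (Q1 := pow2_abs (x' - x)). assert (Q2 := pow2_abs (y' - y)). rewrite <- Q1, <- Q2. pose proof (pow_lt (Rabs (x' - x) + Rabs (y' - y)) 2 ltac:(lra)). nra. }
    assert (Hs : 0 < s) by (apply sqrt_lt_R0; auto).
    assert (Hle : s <= Rabs (x' - x) + Rabs (y' - y)).
    { apply Rsqr_incr_0_var; [|lra]. unfold s. rewrite Rsqr_sqrt by lra. unfold Rsqr. rewrite <- (pow2_abs (x' - x)), <- (pow2_abs (y' - y)). nra. }
    apply Rle_trans with (Rabs C * Rpower s th).
    + apply Rmult_le_compat_r; [left; apply exp_pos|apply Rle_abs].
    + rewrite <- pw_pos_eq by auto. apply Rmult_le_compat_l; [apply Rabs_pos|]. apply pw_le; lra.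
Qed.

Lemma holder_cont (r1 r2 T th : R) (f : field2) : 0 < th -> holder_on2 (inDbar r1 r2) th f -> cont_on3 (cylbar r1 r2 T) (fun x y _ => f x y).
Proof.
  intros Hth Hf. destruct (holder_pw _ _ _ Hth Hf) as [C [C0 HC]]. intros x y t [HS _] e He.
  assert (P : 0 < e / (C + 1)) by (apply Rdiv_lt_0_compat; lra).
  destruct (continuity_pt_eps_inv _ 0 (pw_ctn th Hth 0) _ P) as [d [Hd K]].
  exists (d / 2); split; [lra|]. intros x' y' t' [HS' _] Hx Hy _.
  eapply Rle_lt_trans; [apply HC; auto|]. pose proof (Rabs_pos (x' - x)). pose proof (Rabs_pos (y' - y)).
  specialize (K (Rabs (x' - x) + Rabs (y' - y)) ltac:(rewrite Rminus_0_r, Rabs_right; lra)).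
  rewrite (pw_npos 0), Rminus_0_r, Rabs_right in K by (try lra; apply Rle_ge, pw_nonneg).
  apply Rle_lt_trans with (C * (e / (C + 1))); [apply Rmult_le_compat_l; lra|].
  apply Rmult_lt_reg_r with (C + 1); [lra|]. unfold Rdiv. replace (C * (e * / (C + 1)) * (C + 1)) with (C * e) by (field; lra). nra.
Qed.

(** The pulled back coordinate functions have first derivatives bounded by the radius, which is at
    most one; each of them contributes the constant [1]. *)
Lemma polar_lipschitz (r1 r2 a b a' b' : R) : 0 < r1 -> r1 < r2 -> r2 < 1 ->
  Rabs (rho r1 r2 a' * cos b' - rho r1 r2 a * cos b) + Rabs (rho r1 r2 a' * sin b' - rho r1 r2 a * sin b) <= 2 * (Rabs (a' - a) + Rabs (b' - b)).
Proof.
  intros H1 H2 H3. assert (HL := logL_pos r1 r2 H1 H2).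
  assert (Br : forall a, 0 < rho r1 r2 a <= 1).
  { intros x. split; [apply rho_pos; auto|]. pose proof (rho_range r1 r2 (clamp (logL r1 r2) x) H1 H2 (clamp_range _ x (Rlt_le _ _ HL))). unfold rho. lra. }
  assert (Bc : forall a b, Rabs (rho r1 r2 a * cos b) <= 1 /\ Rabs (rho r1 r2 a * sin b) <= 1).
  { intros x z. specialize (Br x). pose proof (COS_bound z). pose proof (SIN_bound z). split; apply Rabs_le_between; nra. }
  assert (KX := lipschitz_C1s _ 1 _ _ _ (Rlt_le _ _ HL) (pull_C1s r1 r2 1 0 _ _ _ H1 H2 Rlt_0_1 (cartC1_x r1 r2 1))).
  assert (KY := lipschitz_C1s _ 1 _ _ _ (Rlt_le _ _ HL) (pull_C1s r1 r2 1 0 _ _ _ H1 H2 Rlt_0_1 (cartC1_y r1 r2 1))).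
  unfold pull in KX, KY.
  assert (K1 := KX ltac:(intros x z; rewrite Rmult_0_r, Rplus_0_r, Rmult_1_r; apply Bc) ltac:(intros x z; rewrite Rmult_0_r, Rplus_0_r, Rmult_1_r, Rabs_Ropp; apply Bc) a b a' b').
  assert (K2 := KY ltac:(intros x z; rewrite Rmult_0_r, Rplus_0_l, Rmult_1_r; apply Bc) ltac:(intros x z; rewrite Rmult_0_r, Rplus_0_l, Rmult_1_r; apply Bc) a b a' b').
  lra.
Qed.

Lemma pull_hol2 (r1 r2 T th : R) (f : field2) : 0 < r1 -> r1 < r2 -> r2 < 1 -> 0 < th <= 1 -> holder_on2 (inDbar r1 r2) th f ->
  exists H, hol2 th H (pull r1 r2 T (fun x y _ => f x y) 0).
Proof.
  intros H1 H2 H3 Hth Hf. destruct (holder_pw _ _ _ (proj1 Hth) Hf) as [C [C0 HC]]. exists (C * 2). intros a b a' b'.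
  assert (HL := logL_pos r1 r2 H1 H2). pose proof (Rabs_pos (a' - a)). pose proof (Rabs_pos (b' - b)).
  eapply Rle_trans; [apply HC; apply polar_inDbar; auto; apply clamp_range; lra|]. rewrite Rmult_assoc.
  apply Rmult_le_compat_l; auto. eapply Rle_trans; [|apply pw_le_mult_one_plus; lra]. apply pw_le; [lra|]. apply polar_lipschitz; auto.
Qed.

Lemma hol2_C1s (L th : R) (u ua ub : field2) : 0 <= L -> 0 < th <= 1 -> C1s L u ua ub -> exists H, hol2 th H u.
Proof.
  intros HL Hth Hu. destruct (CS_bounded L u HL (proj1 Hu)) as [M [M0 BM]].
  destruct (CS_bounded L ua HL (proj1 (proj2 Hu))) as [Ma [Ma0 BMa]]. destruct (CS_bounded L ub HL (proj1 (proj2 (proj2 Hu)))) as [Mb [Mb0 BMb]].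
  exists (2 * M + Ma + Mb). intros a b a' b'.
  assert (K := lipschitz_C1s L (Ma + Mb) _ _ _ HL Hu ltac:(intros x y; specialize (BMa x y); lra) ltac:(intros x y; specialize (BMb x y); lra) a b a' b').
  pose proof (Rabs_pos (a' - a)). pose proof (Rabs_pos (b' - b)). set (d := Rabs (a' - a) + Rabs (b' - b)) in *.
  destruct (Rle_dec d 1) as [Hd|Hd].
  - assert (Q := le_mult_pw d th 1 ltac:(lra) ltac:(unfold d in *; lra) ltac:(lra)). pose proof (pw_nonneg d th).
    apply Rle_trans with (1 := K). apply Rle_trans with ((Ma + Mb) * pw d th); nra.
  - assert (1 <= pw d th) by (rewrite <- (pw_1 th); apply pw_le; lra).
    assert (B1 := BM a b). assert (B2 := BM a' b'). apply Rabs_le_between in B1, B2.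
    apply Rle_trans with (2 * M); [apply Rabs_le_between; lra|nra].
Qed.

Lemma hol2_plus (th H K : R) (f g : field2) : hol2 th H f -> hol2 th K g -> hol2 th (H + K) (fun a b => f a b + g a b).
Proof.
  intros Hf Hg a b a' b'. specialize (Hf a b a' b'); specialize (Hg a b a' b').
  apply Rabs_le_between in Hf, Hg. apply Rabs_le_between. lra.
Qed.

Lemma hol2_mult (th H K M N : R) (f g : field2) : hol2 th H f -> hol2 th K g -> (forall a b, Rabs (f a b) <= M) -> (forall a b, Rabs (g a b) <= N) ->
  hol2 th (N * H + M * K) (fun a b => f a b * g a b).
Proof.
  intros Hf Hg HM HN a b a' b'.
  replace (f a' b' * g a' b' - f a b * g a b) with (g a' b' * (f a' b' - f a b) + f a b * (g a' b' - g a b)) by ring.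
  eapply Rle_trans; [apply Rabs_triang|]. rewrite !Rabs_mult, Rmult_plus_distr_r, !Rmult_assoc.
  apply Rplus_le_compat; apply Rmult_le_compat; auto; apply Rabs_pos.
Qed.

Lemma hat_cartC1 (r1 r2 T : R) (G Ga Gb : field3) : 0 < r1 -> r1 < r2 -> CT T (logL r1 r2) G -> CT T (logL r1 r2) Ga -> CT T (logL r1 r2) Gb ->
  (forall t, C1s (logL r1 r2) (G t) (Ga t) (Gb t)) ->
  cartC1 r1 r2 T (hat r1 G) (fun x y t => (x * hat r1 Ga x y t - y * hat r1 Gb x y t) * / (x ^ 2 + y ^ 2))
    (fun x y t => (y * hat r1 Ga x y t + x * hat r1 Gb x y t) * / (x ^ 2 + y ^ 2)).
Proof.
  intros H1 H2 HG HGa HGb HS. assert (K := hat_cont r1 r2 T G H1 H2 HG). assert (Ka := hat_cont r1 r2 T Ga H1 H2 HGa). assert (Kb := hat_cont r1 r2 T Gb H1 H2 HGb).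
  assert (Kw : cont_on3 (cylbar r1 r2 T) (fun x y _ => / (x ^ 2 + y ^ 2))).
  { apply (cont_on3_inv _ (fun x y _ => x ^ 2 + y ^ 2)); [|simpl; hcont]. intros x y t [Hin _]. apply Rgt_not_eq, (inDbar_pos r1 r2 x y H1 Hin). }
  split; [exact K|]. split; [apply cont_on3_mult; auto; hcont; auto|]. split; [apply cont_on3_mult; auto; hcont; auto|].
  intros x y t Hin _. apply (hat_derivative r1 r2 t G Ga Gb x y H1 H2 Hin (HS t)).
Qed.

Lemma C1theta_cartC1 (r1 r2 T th : R) (f : field2) : 0 < th -> C1theta r1 r2 th f ->
  exists fx fy : field2, holder_on2 (inDbar r1 r2) th fx /\ holder_on2 (inDbar r1 r2) th fy /\
    cartC1 r1 r2 T (fun x y _ => f x y) (fun x y _ => fx x y) (fun x y _ => fy x y).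
Proof.
  intros Hth [Hf [fx [fy [Hx [Hy HD]]]]]. exists fx, fy. split; [auto|]. split; [auto|]. split; [|split; [|split]].
  - intros x y t [HS _] e He. destruct (Hf x y HS e He) as [d [Hd K]]. exists d; split; auto. intros x' y' t' [HS' _] Hx' Hy' _; auto.
  - apply holder_cont with th; auto.
  - apply holder_cont with th; auto.
  - intros x y t Hin _. apply HD; auto.
Qed.

Lemma rho_lrad (r1 r2 x y : R) : 0 < r1 -> r1 < r2 -> inDbar r1 r2 x y -> rho r1 r2 (lrad r1 x y) ^ 2 = x ^ 2 + y ^ 2.
Proof.
  intros H1 H2 Hin. pose proof (inDbar_pos r1 r2 x y H1 Hin). unfold rho. rewrite clamp_id by (apply lrad_range; auto).
  rewrite lrad_exp by auto. apply pow2_sqrt. lra.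
Qed.

Definition annulus_flat (r1 r2 om th gam : R) (H1 : 0 < r1) (H2 : r1 < r2) (Hth : 0 < th <= 1) : flat :=
  {| fL := logL r1 r2; fK := kap r1 r2; fK1 := kap' r1 r2; fB := bet r1 r2 om; fth := th; fgam := gam; fkm := 1;
     fLpos := logL_pos r1 r2 H1 H2; fkmpos := Rlt_0_1; fKm := fun a => kap_lower r1 r2 a H1;
     fKC1 := kap_C1s r1 r2 H1 H2; fBC := bet_CS r1 r2 om H1 H2; fthr := Hth |}.

Lemma cartesian_existence (r1 r2 om th T : R) (U0 V0 : field2) : 0 < r1 -> r1 < r2 -> r2 < 1 -> 0 < th < 1 ->
  C1theta r1 r2 th U0 -> C1theta r1 r2 th V0 ->
  (forall x y, inD r1 r2 x y -> forall dUx dVy, D (fun s => U0 s y) x dUx -> D (fun s => V0 x s) y dVy -> dUx + dVy = 0) ->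
  (forall x y, onBdD r1 r2 x y -> U0 x y * normal_x r1 r2 x y + V0 x y * normal_y r1 r2 x y = 0) -> 0 < T ->
  exists U V P : field3, is_solution r1 r2 om T U0 V0 U V P.
Proof.
  intros H1 H2 H3 Hth HU HV Hdiv Hnor HT. assert (HL := logL_pos r1 r2 H1 H2). assert (HL' := Rlt_le _ _ HL).
  assert (Hth' : 0 < th <= 1) by lra. pose proof PI_RGT_0 as HPI.
  destruct (C1theta_cartC1 r1 r2 T th U0 (proj1 Hth) HU) as [Ux [Uy [HUx [HUy KU]]]].
  destruct (C1theta_cartC1 r1 r2 T th V0 (proj1 Hth) HV) as [Vx [Vy [HVx [HVy KV]]]].
  assert (KX := cartC1_x r1 r2 T). assert (KY := cartC1_y r1 r2 T).
  assert (KA := cartC1_plus (cartC1_mult KX KU) (cartC1_mult KY KV)).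
  assert (KB := cartC1_minus (cartC1_mult KX KV) (cartC1_mult KY KU)).
  assert (KR := cartC1_plus (cartC1_mult KX KX) (cartC1_mult KY KY)).
  assert (K2 := cartC1_plus (cartC1_const r1 r2 T 1) KR).
  assert (Kal := cartC1_mult (cartC1_mult K2 K2) (cartC1_const r1 r2 T (/ 4))).
  assert (N2 : forall x y t : R, cylbar r1 r2 T x y t -> 1 + (x * x + y * y) <> 0) by (intros x y _ _; apply Rgt_not_eq; pose proof (Rle_0_sqr x); pose proof (Rle_0_sqr y); unfold Rsqr in *; lra).
  assert (NR : forall x y t : R, cylbar r1 r2 T x y t -> x * x + y * y <> 0) by (intros x y t [Hin _]; pose proof (inDbar_pos _ _ _ _ H1 Hin); simpl in *; lra).
  assert (Kbe := cartC1_mult (cartC1_mult (cartC1_const r1 r2 T (2 * om)) (cartC1_minus (cartC1_const r1 r2 T 1) KR))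
     (cartC1_inv N2 K2)).
  assert (SA := pull_C1s r1 r2 T 0 _ _ _ H1 H2 HT KA). assert (SB := pull_C1s r1 r2 T 0 _ _ _ H1 H2 HT KB).
  assert (Sal := pull_C1s r1 r2 T 0 _ _ _ H1 H2 HT Kal). assert (Sbe := pull_C1s r1 r2 T 0 _ _ _ H1 H2 HT Kbe).
  set (A0 := pull r1 r2 T (fun x y t => x * U0 x y + y * V0 x y) 0) in *.
  set (B0 := pull r1 r2 T (fun x y t => x * V0 x y - y * U0 x y) 0) in *.
  set (vx := pull r1 r2 T (fun x y _ => Vx x y) 0). set (uy := pull r1 r2 T (fun x y _ => Uy x y) 0).
  set (al := pull r1 r2 T (fun x y _ => (1 + (x * x + y * y)) * (1 + (x * x + y * y)) * / 4) 0) in *.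
  set (be := pull r1 r2 T (fun x y _ => 2 * om * (1 - (x * x + y * y)) * / (1 + (x * x + y * y))) 0) in *.
  (* Written with the Cartesian curl, since the factor [r^2] in [B_a - A_b] cancels against that in
     [kap]. In this form Hoelder continuity follows from that of [Vx] and [Uy]. *)
  set (q0 := fun a b => al a b * (vx a b + -1 * uy a b) + be a b).
  assert (Cvx : CS (logL r1 r2) vx) by (apply (CT_CS T), pull_CT; auto; apply KV).
  assert (Cuy : CS (logL r1 r2) uy) by (apply (CT_CS T), pull_CT; auto; apply KU).
  assert (Cf : CS (logL r1 r2) (fun a b => vx a b + -1 * uy a b)) by (apply CS_plus; auto; apply CS_scal; auto).
  assert (Cq : CS (logL r1 r2) q0) by (apply CS_plus; [apply CS_mult; auto; apply Sal|apply Sbe]).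
  assert (Hq : exists H, hol2 th H q0).
  { destruct (pull_hol2 r1 r2 T th Vx H1 H2 H3 Hth' HVx) as [h1 Hh1]. destruct (pull_hol2 r1 r2 T th Uy H1 H2 H3 Hth' HUy) as [h2 Hh2].
    destruct (hol2_C1s _ th _ _ _ HL' Hth' Sal) as [h3 Hh3]. destruct (hol2_C1s _ th _ _ _ HL' Hth' Sbe) as [h4 Hh4].
    destruct (hol2_C1s _ th _ _ _ HL' Hth' (C1s_const (logL r1 r2) (-1))) as [h5 Hh5].
    destruct (CS_bounded _ _ HL' Cuy) as [m1 [_ B1]]. destruct (CS_bounded _ _ HL' (proj1 Sal)) as [m2 [_ B2]]. destruct (CS_bounded _ _ HL' Cf) as [m3 [_ B3]].
    eexists. apply hol2_plus; [|exact Hh4]. refine (hol2_mult th _ _ _ _ _ _ Hh3 _ B2 B3). apply hol2_plus; [exact Hh1|].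
    refine (hol2_mult th _ _ 1 _ (fun _ _ => -1) uy Hh5 Hh2 _ B1). intros; rewrite Rabs_left; lra. }
  destruct Hq as [Hq Hhol]. destruct (CS_bounded _ _ HL' Cq) as [M [_ BM]].
  (* The circulation of the data along the inner circle is the one quantity that the vorticity does
     not determine; it is prescribed here. *)
  set (F := annulus_flat r1 r2 om th (cint B0 0 / (2 * PI)) H1 H2 Hth').
  assert (HS : state F M Hq q0) by (split; [exact Cq|split; [exact BM|exact Hhol]]).
  destruct (flat_existence F M Hq T q0 HS HT) as [q [A [Aa [Ab [At [B [Ba [Bb [Bt [Q [Qa [Qb [[Cq' [CA [CAa [CAb [CAt [CB [CBa [CBb [CBt [CQ [CQa CQb]]]]]]]]]]] [SA' [SB' [SQ' [Ediv [Ecur [Edir [EA [EB [ED [E0 Ecirc]]]]]]]]]]]]]]]]]]]]]]].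
  change (fL F) with (logL r1 r2) in *.
  assert (Ekap : forall a b, kap r1 r2 a = al a b / (rho r1 r2 a ^ 2)).
  { intros a b. unfold kap, al, pull. rewrite <- (polar_norm (rho r1 r2 a) b). assert (K := pow_lt _ 2 (rho_pos r1 r2 a H1)). rewrite <- (polar_norm (rho r1 r2 a) b) in K. field. lra. }
  assert (Ebet : forall a b, bet r1 r2 om a = be a b).
  { intros a b. unfold bet, be, pull. rewrite <- (polar_norm (rho r1 r2 a) b). assert (K := pow_lt _ 2 (rho_pos r1 r2 a H1)). rewrite <- (polar_norm (rho r1 r2 a) b) in K. field. nra. }
  (* The solution was built from [q0] and the circulation, not from the velocity. Its initial field
     and the given one share divergence, curl, normal boundary values and circulation, so rigidity
     makes them equal. *)
  assert (Init : forall a b, A 0 a b = A0 a b /\ B 0 a b = B0 a b).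
  { assert (DA := C1s_minus _ _ _ _ _ _ _ HL' (SA' 0) SA). assert (DB := C1s_minus _ _ _ _ _ _ _ HL' (SB' 0) SB).
    intros a b. cut (A 0 a b - A0 a b = 0 /\ B 0 a b - B0 a b = 0); [lra|].
    refine (harmonic_rigidity _ _ _ _ _ _ _ HL DA DB _ _ _ _ a b).
    - apply CS_zero_interior with (logL r1 r2); auto; [apply CS_plus; [apply DA|apply DB]|].
      intros a' b' Ha. specialize (Ediv 0 a' b'). unfold pull.
      set (x := rho r1 r2 a' * cos b'). set (y := rho r1 r2 a' * sin b').
      assert (Hin : inD r1 r2 x y) by (unfold x, y, rho; rewrite clamp_id by lra; apply polar_inD; auto).
      destruct KU as [_ [_ [_ DU]]], KV as [_ [_ [_ DV]]].
      assert (E := Hdiv x y Hin _ _ (proj1 (DU x y 0 Hin ltac:(lra))) (proj2 (DV x y 0 Hin ltac:(lra)))).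
      replace (Vy x y) with (- Ux x y) by lra. replace (Bb 0 a' b') with (- Aa 0 a' b') by lra. ring.
    - intros a' b'. specialize (Ecur 0 a' b'). unfold vort in Ecur. rewrite E0 in Ecur. unfold F, annulus_flat, fB, fK in Ecur.
      rewrite (Ekap a' b'), (Ebet a' b') in Ecur.
      assert (Nal : al a' b' <> 0) by (unfold al, pull; nra).
      assert (E : (q0 a' b' - be a' b') / (al a' b' / rho r1 r2 a' ^ 2) = rho r1 r2 a' ^ 2 * (vx a' b' + -1 * uy a' b')) by (pose proof (rho_pos r1 r2 a' H1); unfold q0; field; split; auto; lra).
      rewrite E in Ecur. rewrite <- (polar_norm (rho r1 r2 a') b') in Ecur. unfold vx, uy, pull in *. lra.
    - intros b'. destruct (Edir 0 b') as [-> ->]. unfold A0, pull.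
      assert (K : forall x y, onBdD r1 r2 x y -> x * U0 x y + y * V0 x y = 0) by (intros x y Hb; apply (normal_radial r1 r2); auto).
      split; rewrite K; try ring; [left|right]; rewrite polar_norm; unfold rho; rewrite clamp_id by lra; [rewrite exp_0; ring|rewrite rho_exp_L by auto; auto].
    - rewrite cint_minus; [|apply SB'|apply SB]. rewrite Ecirc. unfold F, annulus_flat, fgam. field. lra. }
  assert (HA := hat_cartC1 r1 r2 T A Aa Ab H1 H2 CA CAa CAb SA'). assert (HB := hat_cartC1 r1 r2 T B Ba Bb H1 H2 CB CBa CBb SB').
  assert (HQ := hat_cartC1 r1 r2 T Q Qa Qb H1 H2 CQ CQa CQb SQ').
  assert (KW := cartC1_inv NR KR).
  (* The Cartesian velocity from its covariant components, [U = (x A - y B) / r^2], and next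
     [V = (y A + x B) / r^2]. *)
  assert (GU := cartC1_mult (cartC1_minus (cartC1_mult KX HA) (cartC1_mult KY HB)) KW).
  assert (GV := cartC1_mult (cartC1_plus (cartC1_mult KY HA) (cartC1_mult KX HB)) KW).
  (* The Bernoulli term is subtracted again; in covariant components the squared speed is
     [(A^2 + B^2) / r^2]. *)
  assert (GP := cartC1_minus HQ (cartC1_mult
    (cartC1_mult (cartC1_mult Kal (cartC1_const r1 r2 T (/ 2))) KW)
    (cartC1_plus (cartC1_mult HA HA) (cartC1_mult HB HB)))).
  assert (HAt := hat_cont r1 r2 T At H1 H2 CAt). assert (HBt := hat_cont r1 r2 T Bt H1 H2 CBt).
  destruct KW as [KW0 _].
  assert (GUt : cont_on3 (cylbar r1 r2 T) (fun x y t => (x * hat r1 At x y t - y * hat r1 Bt x y t) * / (x * x + y * y))).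
  { apply cont_on3_mult; auto. hcont; auto. }
  assert (GVt : cont_on3 (cylbar r1 r2 T) (fun x y t => (y * hat r1 At x y t + x * hat r1 Bt x y t) * / (x * x + y * y))).
  { apply cont_on3_mult; auto. hcont; auto. }
  match type of GU with cartC1 _ _ _ ?u ?ux ?uy => set (U := u) in *; set (Ux' := ux) in *; set (Uy' := uy) in * end.
  match type of GV with cartC1 _ _ _ ?u ?ux ?uy => set (V := u) in *; set (Vx' := ux) in *; set (Vy' := uy) in * end.
  match type of GP with cartC1 _ _ _ ?u ?ux ?uy => set (P := u) in *; set (Px' := ux) in *; set (Py' := uy) in * end.
  match type of GUt with cont_on3 _ ?u => set (Ut := u) in * end. match type of GVt with cont_on3 _ ?u => set (Vt := u) in * end.
  destruct GU as [GU0 [GU1 [GU2 GU3]]], GV as [GV0 [GV1 [GV2 GV3]]], GP as [GP0 [GP1 [GP2 GP3]]].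
  exists U, V, P. split; [exact GU0|]. split; [exact GV0|]. split; [exact GP0|].
  exists Ux', Uy', Ut, Vx', Vy', Vt, Px', Py'. repeat (split; [assumption|]).
  split; [|split; [|split; [|split]]].
  - intros x y t Hin Ht. destruct (GU3 x y t Hin Ht), (GV3 x y t Hin Ht), (GP3 x y t Hin Ht). repeat split; assumption.
  - intros x y t Hin Ht. destruct (ED t (lrad r1 x y) (arg x y) Ht) as [D1 D2].
    split; unfold U, V, Ut, Vt, hat.
    + eapply D_eq; cycle 1; [apply D_ext with (fun s => / (x * x + y * y) * (x * A s (lrad r1 x y) (arg x y) - y * B s (lrad r1 x y) (arg x y))); [intros; ring|]|].
      * repeat dstep; eassumption.
      * ring.
    + eapply D_eq; cycle 1; [apply D_ext with (fun s => / (x * x + y * y) * (y * A s (lrad r1 x y) (arg x y) + x * B s (lrad r1 x y) (arg x y))); [intros; ring|]|].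
      * repeat dstep; eassumption.
      * ring.
  - intros x y t Hin Ht. assert (Hin' := inD_inDbar _ _ _ _ Hin). assert (Hp := inDbar_pos _ _ _ _ H1 Hin').
    assert (Er := rho_lrad r1 r2 x y H1 H2 Hin').
    assert (Eq : q t (lrad r1 x y) (arg x y) = (1 + (x ^ 2 + y ^ 2)) ^ 2 / (4 * (x ^ 2 + y ^ 2)) * (hat r1 Ba x y t - hat r1 Ab x y t) + 2 * om * (1 - (x ^ 2 + y ^ 2)) / (1 + (x ^ 2 + y ^ 2))).
    { assert (E := Ecur t (lrad r1 x y) (arg x y)). unfold hat. rewrite E. unfold vort. unfold F, annulus_flat, fB, fK, kap, bet. rewrite Er. field. repeat split; nra. }
    assert (E1 := EA t (lrad r1 x y) (arg x y)). assert (E2 := EB t (lrad r1 x y) (arg x y)). rewrite Eq in E1, E2.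
    assert (E3 : hat r1 Bb x y t = - hat r1 Aa x y t) by (unfold hat; specialize (Ediv t (lrad r1 x y) (arg x y)); lra).
    fold (hat r1 At x y t) (hat r1 B x y t) (hat r1 Qa x y t) in E1. fold (hat r1 Bt x y t) (hat r1 A x y t) (hat r1 Qb x y t) in E2. unfold U, V, Ux', Uy', Vx', Vy', Px', Py', Ut, Vt, alpha, alpha_x, alpha_y, beta, J_x, J_y. rewrite E1, E2, E3.
    split; [|split]; field; repeat split; nra.
  - intros x y t Hb Ht. apply (normal_radial r1 r2); auto.
    assert (EA0 : hat r1 A x y t = 0) by (unfold hat; destruct (lrad_boundary r1 r2 x y H1 H2 Hb) as [-> | ->]; apply Edir).
    assert (Hp : 0 < x ^ 2 + y ^ 2) by (destruct Hb as [-> | ->]; apply pow_lt; lra).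
    unfold U, V. rewrite EA0. field. nra.
  - intros x y Hin. assert (Hp := inDbar_pos _ _ _ _ H1 Hin).
    assert (CY : cylbar r1 r2 T x y 0) by (split; [auto|lra]).
    assert (EA0 : hat r1 A x y 0 = x * U0 x y + y * V0 x y).
    { rewrite <- (hat_pull r1 r2 T (fun x y t => x * U0 x y + y * V0 x y) x y 0) by auto. apply Init. }
    assert (EB0 : hat r1 B x y 0 = x * V0 x y - y * U0 x y).
    { rewrite <- (hat_pull r1 r2 T (fun x y t => x * V0 x y - y * U0 x y) x y 0) by auto. apply Init. }
    unfold U, V. rewrite EA0, EB0. split; field; nra.
Qed.

Theorem theorem4p1 (r1 r2 omega th T : R) (U0 V0 : field2) :
  0 < r1 -> r1 < r2 -> r2 < 1 -> 0 < omega -> 0 < th < 1 ->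
  C1theta r1 r2 th U0 -> C1theta r1 r2 th V0 ->
  (* div U0 = 0 in D *)
  (forall x y, inD r1 r2 x y ->
     forall dUx dVy, derivable_pt_lim (fun s => U0 s y) x dUx ->
       derivable_pt_lim (fun s => V0 x s) y dVy -> dUx + dVy = 0) ->
  (* U0 . n = 0 on dD *)
  (forall x y, onBdD r1 r2 x y ->
     U0 x y * normal_x r1 r2 x y + V0 x y * normal_y r1 r2 x y = 0) ->
  0 < T ->
  (exists U V P : field3, is_solution r1 r2 omega T U0 V0 U V P) /\
  (forall U V P U' V' P' : field3,
     is_solution r1 r2 omega T U0 V0 U V P ->
     is_solution r1 r2 omega T U0 V0 U' V' P' ->
     (forall x y t, cylbar r1 r2 T x y t -> U' x y t = U x y t /\ V' x y t = V x y t) /\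
     exists c : R -> R, forall x y t, cylbar r1 r2 T x y t -> P' x y t = P x y t + c t).
Proof.
  intros H1 H2 H3 _ Hth HU HV Hdiv Hnor HT. split.
  - apply (cartesian_existence r1 r2 omega th T U0 V0); auto.
  - intros U V P U' V' P' S S'. apply (cartesian_uniqueness r1 r2 omega T U0 V0 U V P U' V' P'); auto.
Qed.
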